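(* Let $\varepsilon=-1$. For $q\in U$, let the zeros $\lambda_1(q),\lambda_2(q),\dots$ of $\breve\alpha(\,\cdot\,;q)$ in $\mathbb C^+$ be ordered by the size of their modulus and, for zeros with the same modulus, by increasing phase in $(0,\pi)$. Suppose that $q_0\in U$ with $N$ simple zeros $\lambda_1(q_0),\dots,\lambda_N(q_0)$ of $\breve\alpha(\,\cdot\,;q_0)$ in $\mathbb C^+$, listed in this ordering, and let $d_\Lambda=\inf\{|\lambda-\mu|:\lambda,\mu\in\Lambda,\ \lambda\ne\mu\}$ where $\Lambda=\{\lambda_j(q_0),\overline{\lambda_j(q_0)}\}_{j=1}^N$. There is a neighborhood $\mathcal N$ of $q_0$ in $H^{2,2}(\mathbb R)$ so that: (i) For any $q\in\mathcal N$, $\breve\alpha(\,\cdot\,;q)$ has exactly $N$ simple zeros in $\mathbb C^+$, no zeros on $\mathbb R$, and $|\lambda_j(q)-\lambda_j(q_0)|\le\frac14d_\Lambda$. (ii) The estimate $|\lambda_j(q)-\lambda_j(q_0)|\le C\|q-q_0\|_{H^{2,2}}$ holds for $C$ uniform in $q\in\mathcal N$. (iii) The estimate $|B_j(q)-B_j(q_0)|\le C\|q-q_0\|_{H^{2,2}}$ holds for $C$ uniform in $q\in\mathcal N$. (iv) The estimate $|C_j(q)-C_j(q_0)|\le C\|q-q_0\|_{H^{2,2}}$ holds for $C$ uniform in $q\in\mathcal N$.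
   Context: $H^{2,2}(\mathbb R)$ is the completion of $C_0^\infty(\mathbb R)$ in the norm $\|u\|_{H^{2,2}}=\left(\|(1+x^2)u\|_{L^2}^2+\|u''\|_{L^2}^2\right)^{1/2}$. $\mathbb C^\pm=\{\pm\operatorname{Im}\lambda>0\}$, $\sigma_3=\operatorname{diag}(1,-1)$. For $q\in H^{2,2}(\mathbb R)$, $\lambda\in\mathbb R$, let $\Psi^\pm(x;\lambda)$ be the unique matrix solutions of $$\Psi_x=\begin{pmatrix}-i\lambda+\frac i2|q|^2 & q\\ -\lambda\overline q & i\lambda-\frac i2|q|^2\end{pmatrix}\Psi ,\qquad \lim_{x\to\pm\infty}\Psi^\pm(x;\lambda)e^{i\lambda x\sigma_3}=I,$$ and $N^\pm(x,\lambda)=\Psi^\pm(x;\lambda)e^{i\lambda x\sigma_3}$. Write $\Psi^+=\Psi^-T(\lambda)$, $T=\begin{pmatrix}\alpha&\beta\\ \breve\beta&\breve\alpha\end{pmatrix}$; then $\breve\alpha=\overline\alpha$ on $\mathbb R$. For each $x$ the first column of $N^-$, the second column of $N^+$, and $\breve\alpha=\breve\alpha(\,\cdot\,;q)$ extend continuously to $\overline{\mathbb C^+}$ and analytically to $\mathbb C^+$. $U$ is the set of $q\in H^{2,2}(\mathbb R)$ for which $\breve\alpha$ has no zeros on $\mathbb R$ and at most finitely many zeros in $\mathbb C^+$, all simple. If $\lambda_k=\lambda_k(q)\in\mathbb C^+$ is a simple zero of $\breve\alpha(\,\cdot\,;q)$, the constant $B_k=B_k(q)$ is defined by $$\begin{pmatrix}N^-_{11}(x,\lambda_k)\\N^-_{21}(x,\lambda_k)\end{pmatrix}=B_k\lambda_k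 e^{2i\lambda_kx}\begin{pmatrix}N^+_{12}(x,\lambda_k)\\N^+_{22}(x,\lambda_k)\end{pmatrix},$$ and the norming constant is $C_k=C_k(q)=B_k/\breve\alpha'(\lambda_k)$.
   Formalization: For q near q₀ the zeros λ_j(q) follow the modulus/phase ordering only for pairs whose zeros at q₀ have different moduli; zeros tied in modulus at q₀ are labelled by closeness to λ_j(q₀), since small perturbations can swap their order and make (i), (ii) false as stated. *)

(* Defs.v *)
From Stdlib Require Import Reals Lra Lia ClassicalEpsilon.
From Coquelicot Require Import Coquelicot.

Open Scope R_scope.

(** * The space H^{2,2}(R) *)

Definition cpt_smooth (phi : R -> C) : Prop :=
  (forall (n : nat) (x : R),
      ex_derive_n (fun y => Re (phi y)) n x /\ ex_derive_n (fun y => Im (phi y)) n x)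
  /\ exists M : R, forall x, M < Rabs x -> phi x = RtoC 0.

Definition D2 (phi : R -> C) (x : R) : C :=
  (Derive_n (fun y => Re (phi y)) 2 x, Derive_n (fun y => Im (phi y)) 2 x).

(** The squared L^2 norm; used only for continuous compactly supported
    functions, so the Riemann integral suffices. *)
Definition L2sq (f : R -> C) : R :=
  RInt_gen (fun x => Cmod (f x) ^ 2) (Rbar_locally m_infty) (Rbar_locally p_infty).

Definition test_norm (phi : R -> C) : R :=
  sqrt (L2sq (fun x => (RtoC (1 + x ^ 2) * phi x)%C) + L2sq (D2 phi)).

Definition fsub (f g : R -> C) : R -> C := fun x => (f x - g x)%C.

(** The H^{2,2} norm dominates the sup norm on test functions, and a Cauchy
    sequence of test functions tending to 0 pointwise tends to 0 in norm.  Hence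
    an element of the completion is the same thing as the pointwise limit
    of a Cauchy sequence of test functions (its continuous representative), and
    its norm is the limit of the norms. *)
Definition approximates (phi : nat -> R -> C) (q : R -> C) : Prop :=
  (forall n, cpt_smooth (phi n))
  /\ (forall eps, 0 < eps -> exists n0, forall n m, (n0 <= n)%nat -> (n0 <= m)%nat ->
        test_norm (fsub (phi n) (phi m)) < eps)
  /\ (forall x, filterlim (fun n => phi n x) eventually (locally (q x))).

Definition H22 (q : R -> C) : Prop := exists phi, approximates phi q.

Definition is_H22norm (q : R -> C) (r : R) : Prop :=
  exists phi, approximates phi q /\ is_lim_seq (fun n => test_norm (phi n)) r.

Definition H22norm (q : R -> C) : R := epsilon (inhabits 0) (is_H22norm q).

Definition H22_neighborhood (q0 : R -> C) (V : (R -> C) -> Prop) : Prop :=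
  (forall q, V q -> H22 q)
  /\ exists delta, 0 < delta /\
       forall q, H22 q -> H22norm (fsub q q0) < delta -> V q.

(** * Jost solutions and scattering data *)

Definition Cexp (z : C) : C :=
  (RtoC (exp (Re z)) * (cos (Im z), sin (Im z)))%C.

Definition M2 : Type := @matrix C 2 2.

Definition mat2 (a b c d : C) : M2 :=
  mk_matrix 2 2 (fun i j =>
    match i, j with
    | O, O => a
    | O, _ => b
    | _, O => c
    | _, _ => d
    end).

(** Indices start at 0: the entry written [A_{12}] on paper is [ent A 0 1]. *)
Definition ent (A : M2) (i j : nat) : C := coeff_mat (RtoC 0) A i j.

Definition mul2 (A B : M2) : M2 := @Mmult C_Ring 2 2 2 A B.

Definition Lax (q : R -> C) (lam x : R) : M2 :=
  let d := (- Ci * RtoC lam + Ci / RtoC 2 * RtoC (Cmod (q x) ^ 2))%C in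
  mat2 d (q x) (- RtoC lam * Cconj (q x))%C (- d)%C.

(** [e^{i lam x sigma_3}] *)
Definition Esig (lam x : R) : M2 :=
  mat2 (Cexp (Ci * RtoC (lam * x))%C) (RtoC 0)
       (RtoC 0) (Cexp (- (Ci * RtoC (lam * x)))%C).

Definition is_jost (e : Rbar) (q : R -> C) (lam : R) (Psi : R -> M2) : Prop :=
  (forall x i j, (i < 2)%nat -> (j < 2)%nat ->
     @is_derive R_AbsRing C_R_NormedModule (fun y => ent (Psi y) i j) x
       (ent (mul2 (Lax q lam x) (Psi x)) i j))
  /\ (forall i j, (i < 2)%nat -> (j < 2)%nat ->
     filterlim (fun x => ent (mul2 (Psi x) (Esig lam x)) i j)
       (Rbar_locally e) (locally (ent (@Mone C_Ring 2) i j))).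

(** [e = p_infty] gives Psi^+, [e = m_infty] gives Psi^-. *)
Definition Psi (e : Rbar) (q : R -> C) (lam : R) : R -> M2 :=
  epsilon (inhabits (fun _ => @Mone C_Ring 2)) (is_jost e q lam).

Definition Njost (e : Rbar) (q : R -> C) (x lam : R) : M2 :=
  mul2 (Psi e q lam x) (Esig lam x).

Definition Tmat (q : R -> C) (lam : R) : M2 :=
  epsilon (inhabits (@Mone C_Ring 2))
    (fun T => forall x, Psi p_infty q lam x = mul2 (Psi m_infty q lam x) T).

(** [F] extends [f] from R continuously to [Im z >= 0] and analytically to
    [Im z > 0]; such an [F] is unique on [Im z >= 0]. *)
Definition is_upper_ext (f : R -> C) (F : C -> C) : Prop :=
  (forall lam : R, F (RtoC lam) = f lam)
  /\ @continuous_on C_UniformSpace C_UniformSpace (fun z => 0 <= Im z) F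
  /\ (forall z, 0 < Im z -> @ex_derive C_AbsRing C_NormedModule F z).

Definition upper_ext (f : R -> C) : C -> C :=
  epsilon (inhabits (fun _ => RtoC 0)) (is_upper_ext f).

Definition breve_alpha (q : R -> C) : C -> C :=
  upper_ext (fun lam => ent (Tmat q lam) 1 1).

Definition Nminus_col1 (q : R -> C) (x : R) (i : nat) : C -> C :=
  upper_ext (fun lam => ent (Njost m_infty q x lam) i 0).

Definition Nplus_col2 (q : R -> C) (x : R) (i : nat) : C -> C :=
  upper_ext (fun lam => ent (Njost p_infty q x lam) i 1).

Definition upper_zero (q : R -> C) (z : C) : Prop :=
  0 < Im z /\ breve_alpha q z = RtoC 0.

Definition simple_upper_zero (q : R -> C) (z : C) : Prop :=
  upper_zero q z /\ C_derive (breve_alpha q) z <> RtoC 0.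

Definition no_real_zero (q : R -> C) : Prop :=
  forall lam : R, breve_alpha q (RtoC lam) <> RtoC 0.

Definition Uset (q : R -> C) : Prop :=
  H22 q
  /\ no_real_zero q
  /\ (exists l : list C, forall z, upper_zero q z -> List.In z l)
  /\ (forall z, upper_zero q z -> simple_upper_zero q z).

Definition is_B (q : R -> C) (lamk B : C) : Prop :=
  forall x i, (i < 2)%nat ->
    Nminus_col1 q x i lamk
    = (B * lamk * Cexp (RtoC 2 * Ci * lamk * RtoC x) * Nplus_col2 q x i lamk)%C.

Definition Bconst (q : R -> C) (lamk : C) : C :=
  epsilon (inhabits (RtoC 0)) (is_B q lamk).

Definition Cconst (q : R -> C) (lamk : C) : C :=
  (Bconst q lamk / C_derive (breve_alpha q) lamk)%C.

(** * Labelling of the zeros *)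

(** [lam 0, ..., lam (N-1)] lists the zeros in the upper half-plane, without
    repetition. *)
Definition lists_zeros (q : R -> C) (N : nat) (lam : nat -> C) : Prop :=
  (forall j, (j < N)%nat -> upper_zero q (lam j))
  /\ (forall i j, (i < N)%nat -> (j < N)%nat -> lam i = lam j -> i = j)
  /\ (forall z, upper_zero q z -> exists j, (j < N)%nat /\ z = lam j).

Definition is_phase (z : C) (t : R) : Prop :=
  0 < t < PI /\ z = (RtoC (Cmod z) * Cexp (Ci * RtoC t))%C.

Definition precedes (z w : C) : Prop :=
  Cmod z < Cmod w
  \/ (Cmod z = Cmod w
      /\ exists s t, is_phase z s /\ is_phase w t /\ s < t).

Definition ordered (N : nat) (lam : nat -> C) : Prop :=
  forall i j, (i < j)%nat -> (j < N)%nat -> precedes (lam i) (lam j).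

(** The set Lambda, made of the [lam j] and their conjugates. *)
Definition in_Lambda (N : nat) (lam : nat -> C) (z : C) : Prop :=
  exists j, (j < N)%nat /\ (z = lam j \/ z = Cconj (lam j)).

(** For [N = 0] the infimum is over the empty set and [real] returns 0; this
    junk value is harmless, as [d_Lambda] only bounds quantities indexed by
    [j < N]. *)
Definition d_Lambda (N : nat) (lam : nat -> C) : R :=
  real (Glb_Rbar (fun r => exists z w,
    in_Lambda N lam z /\ in_Lambda N lam w /\ z <> w /\ r = Cmod (z - w)%C)).

(* Main.v *)
(* Idea.  The gauge transformation [Psi = [[1, 0], [- (i/2) conj q, 1]] Phi] turns the
   spectral problem into the Zakharov-Shabat system [Phi_x = [[-i z, q], [p, i z]] Phi] with
   [p = (i/2) conj q' - (1/4) |q|^2 conj q], whose coefficients are controlled in L^1 and in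
   the sup norm by [q] in H^{2,2}.  For [Im z >= 0] Gronwall's inequality bounds its
   normalized Jost solutions, and their dependence on [(q, p)] in L^1, uniformly in [z];
   hence [breve_alpha], a Wronskian of two of them, is Lipschitz in [q] uniformly on the closed
   upper half-plane, and it tends to 1 at infinity (by approximation with test functions).
   Cauchy's estimate transfers the Lipschitz bound to derivatives in [z].  Zeros of
   [breve_alpha] then persist by a contraction argument near the simple zeros of [q0] and by
   compactness elsewhere, and [B], [C] are quotients of Lipschitz quantities.

   As [upper_ext] is chosen among all functions that are merely differentiable in the upper
   half-plane and continuous up to the boundary, its identification with the Jost
   solutions needs Goursat's theorem and a uniqueness theorem for boundary values. *)

Require Import Defs.
From Stdlib Require Import Reals Lra Lia ClassicalEpsilon FunctionalExtensionality Classical.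
From Coquelicot Require Import Coquelicot.
Open Scope R_scope.

(** * Continuity and derivatives of complex-valued functions *)

(** In the Lax matrix the entry [- lam conj q] grows with [lam], so Gronwall applied to it directly
    gives no bound uniform in the spectral parameter; the gauge transformation confines [lam] to the
    diagonal at the price of one derivative of [q], which H^{2,2} affords. Existence of Jost
    solutions is split in two: for compactly supported C^1 potentials they start from exact data at
    a finite point, and the other potentials are reached by uniform limits, which keep continuity,
    holomorphy and the behaviour for large [z]. The matrices [Psi] are defined on the real line with
    both columns, but only one column of each extends upwards; the remaining two come from the same
    existence theorem with potentials exchanged and parameter [- lam]. The scattering data are
    finally read at [x = 0]: a zero of the Wronskian makes two vectors there parallel, and [Bconst]
    is their ratio divided by the zero. A zero of [q] takes the label of the nearest zero of [q0],
    so that labels are stable even between zeros of equal modulus. *)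

Definition cont {U : UniformSpace} (f : U -> C) (x : U) : Prop :=
  @continuous U C_UniformSpace f x.

Lemma C_ext (z w : C) : Re z = Re w -> Im z = Im w -> z = w.
Proof. destruct z, w; unfold Re, Im; simpl; intros; subst; reflexivity. Qed.

Lemma cont_parts {U : UniformSpace} (f : U -> C) x :
  cont f x <-> continuous (fun y => Re (f y)) x /\ continuous (fun y => Im (f y)) x.
Proof.
  split.
  - intros H; split.
    + apply (continuous_comp (V := C_UniformSpace) f (fun z => fst z)); [exact H|].
      apply continuous_fst.
    + apply (continuous_comp (V := C_UniformSpace) f (fun z => snd z)); [exact H|].
      apply continuous_snd.
  - intros [H1 H2]; apply filterlim_locally; intros e.
    generalize (proj1 (filterlim_locally _ _) H1 e) (proj1 (filterlim_locally _ _) H2 e).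
    intros A B; generalize (filter_and _ _ A B); apply filter_imp.
    intros y [P Q]; split; assumption.
Qed.

Lemma Cmod_le_parts (z : C) : Cmod z <= Rabs (Re z) + Rabs (Im z).
Proof.
  unfold Cmod. apply Rsqr_incr_0_var; [|generalize (Rabs_pos (Re z)) (Rabs_pos (Im z)); lra].
  rewrite Rsqr_sqrt by nra.
  unfold Rsqr; fold (Re z) (Im z).
  generalize (Rabs_pos (Re z)) (Rabs_pos (Im z)) (pow2_abs (Re z)) (pow2_abs (Im z)); nra.
Qed.

Lemma im_le_Cmod (z : C) : Rabs (Im z) <= Cmod z.
Proof. eapply Rle_trans; [apply Rmax_r|apply Rmax_Cmod]. Qed.

Lemma cont_eps {U : UniformSpace} (f : U -> C) x :
  cont f x <-> forall e, 0 < e -> locally x (fun y => Cmod (f y - f x) < e).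
Proof.
  split.
  - intros H e He. apply cont_parts in H; destruct H as [H1 H2].
    assert (He2 : 0 < e / 2) by lra.
    generalize (proj1 (filterlim_locally _ _) H1 (mkposreal _ He2))
               (proj1 (filterlim_locally _ _) H2 (mkposreal _ He2)).
    intros A B; generalize (filter_and _ _ A B); apply filter_imp.
    intros y [P Q].
    eapply Rle_lt_trans; [apply Cmod_le_parts|].
    change (Rabs (Re (f y) - Re (f x)) < e / 2) in P.
    change (Rabs (Im (f y) - Im (f x)) < e / 2) in Q.
    unfold Cminus, Cplus, Copp, Re, Im in *; simpl in *.
    unfold Rminus in *; lra.
  - intros H; apply cont_parts; split; apply filterlim_locally; intros e;
    generalize (H e (cond_pos e)); apply filter_imp; intros y P;
    (eapply Rle_lt_trans; [|exact P]).
    + change (Rabs (Re (f y) - Re (f x)) <= Cmod (f y - f x)).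
      eapply Rle_trans; [|apply re_le_Cmod]; right; reflexivity.
    + change (Rabs (Im (f y) - Im (f x)) <= Cmod (f y - f x)).
      eapply Rle_trans; [|apply im_le_Cmod]; right; reflexivity.
Qed.

(** Balls of [C_UniformSpace] are coordinate squares, so one direction costs nothing and the other
    halves the radius. *)
Lemma locally_C_eps (z : C) (P : C -> Prop) :
  @locally C_UniformSpace z P <-> exists d, 0 < d /\ forall w, Cmod (w - z) < d -> P w.
Proof.
  split.
  - intros [d Hd]; exists d; split; [apply cond_pos|]; intros w Hw; apply Hd.
    apply C_NormedModule_mixin_compat1; exact Hw.
  - intros [d [Hd H]].
    assert (Hd2 : 0 < d / 2) by lra.
    exists (mkposreal _ Hd2); intros w [A B]; apply H.
    change (Rabs (Re w - Re z) < d / 2) in A; change (Rabs (Im w - Im z) < d / 2) in B.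
    eapply Rle_lt_trans; [apply Cmod_le_parts|].
    unfold Cminus, Cplus, Copp, Re, Im in *; simpl in *; unfold Rminus in *; lra.
Qed.

Lemma locally_R_eps (x : R) (P : R -> Prop) :
  locally x P <-> exists d, 0 < d /\ forall y, Rabs (y - x) < d -> P y.
Proof.
  split.
  - intros [d Hd]; exists d; split; [apply cond_pos|]; exact Hd.
  - intros [d [Hd H]]; exists (mkposreal _ Hd); exact H.
Qed.

Lemma cont_C_eps (f : C -> C) (z : C) :
  @cont C_UniformSpace f z <->
  forall e, 0 < e -> exists d, 0 < d /\ forall w, Cmod (w - z) < d -> Cmod (f w - f z) < e.
Proof.
  rewrite cont_eps; split; intros H e He; apply locally_C_eps, H, He.
Qed.

Lemma cont_R_eps (f : R -> C) (x : R) :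
  @cont R_UniformSpace f x <->
  forall e, 0 < e -> exists d, 0 < d /\ forall y, Rabs (y - x) < d -> Cmod (f y - f x) < e.
Proof.
  rewrite cont_eps; split; intros H e He; apply locally_R_eps, H, He.
Qed.

Section Cont.
Context {U : UniformSpace}.
Implicit Types (f g : U -> C) (x : U).

Lemma cont_const (c : C) x : cont (fun _ => c) x.
Proof. apply continuous_const. Qed.

Lemma cont_plus f g x : cont f x -> cont g x -> cont (fun y => f y + g y)%C x.
Proof.
  rewrite !cont_parts; intros [A B] [A' B']; split.
  - apply (continuous_plus (V := R_NormedModule) _ _ x A A').
  - apply (continuous_plus (V := R_NormedModule) _ _ x B B').
Qed.

Lemma cont_opp f x : cont f x -> cont (fun y => - f y)%C x.
Proof.
  rewrite !cont_parts; intros [A B]; split.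
  - apply (continuous_opp (V := R_NormedModule) _ x A).
  - apply (continuous_opp (V := R_NormedModule) _ x B).
Qed.

Lemma cont_minus f g x : cont f x -> cont g x -> cont (fun y => f y - g y)%C x.
Proof. intros A B; apply cont_plus; [exact A|apply cont_opp, B]. Qed.

Lemma cont_conj f x : cont f x -> cont (fun y => Cconj (f y)) x.
Proof.
  rewrite !cont_parts; intros [A B]; split; [exact A|].
  apply (continuous_opp (V := R_NormedModule) _ x B).
Qed.

Lemma cont_mult f g x : cont f x -> cont g x -> cont (fun y => f y * g y)%C x.
Proof.
  rewrite !cont_parts; intros [A B] [A' B']; split.
  - apply (continuous_minus (V := R_NormedModule) (fun y => Re (f y) * Re (g y)) (fun y => Im (f y) * Im (g y)));
    apply (continuous_mult (K := R_AbsRing)); assumption.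
  - apply (continuous_plus (V := R_NormedModule) (fun y => Re (f y) * Im (g y)) (fun y => Im (f y) * Re (g y)));
    apply (continuous_mult (K := R_AbsRing)); assumption.
Qed.

Lemma cont_RtoC (r : U -> R) x : continuous r x -> cont (fun y => RtoC (r y)) x.
Proof. intros H; apply cont_parts; split; [exact H|apply continuous_const]. Qed.

Lemma cont_Cmod f x : cont f x -> continuous (fun y => Cmod (f y)) x.
Proof.
  rewrite cont_eps; intros H; apply filterlim_locally; intros e.
  generalize (H e (cond_pos e)); apply filter_imp; intros y P.
  change (Rabs (Cmod (f y) - Cmod (f x)) < e).
  eapply Rle_lt_trans; [|exact P].
  generalize (Cmod_triangle (f y - f x) (f x)) (Cmod_triangle (f x - f y) (f y)).
  replace (f y - f x + f x)%C with (f y) by ring.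
  replace (f x - f y + f y)%C with (f x) by ring.
  replace (Cmod (f x - f y)) with (Cmod (f y - f x)) by (rewrite <- Cmod_opp; f_equal; ring).
  intros; apply Rabs_le; lra.
Qed.

Lemma cont_comp_C f (h : C -> C) x :
  cont f x -> @cont C_UniformSpace h (f x) -> cont (fun y => h (f y)) x.
Proof. intros A B; apply (continuous_comp (V := C_UniformSpace) f h); assumption. Qed.

Lemma cont_ext f g x : (forall y, f y = g y) -> cont f x -> cont g x.
Proof. intros H; rewrite (functional_extensionality f g H); auto. Qed.

End Cont.

Ltac cont_tac :=
  lazymatch goal with
  | |- cont (fun _ => ?c) _ => apply cont_const
  | |- cont (fun y => Cplus _ _) _ => apply cont_plus; cont_tac
  | |- cont (fun y => Cminus _ _) _ => apply cont_minus; cont_tac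
  | |- cont (fun y => Copp _) _ => apply cont_opp; cont_tac
  | |- cont (fun y => Cmult _ _) _ => apply cont_mult; cont_tac
  | |- cont (fun y => Cconj _) _ => apply cont_conj; cont_tac
  | _ => first [assumption | idtac]
  end.

Lemma cont_id (z : C) : @cont C_UniformSpace (fun w => w) z.
Proof. apply continuous_id. Qed.

Lemma cont_comp_R {U : UniformSpace} (r : U -> R) (h : R -> C) x :
  continuous r x -> @cont R_UniformSpace h (r x) -> cont (fun y => h (r y)) x.
Proof. intros A B; apply (continuous_comp (V := R_UniformSpace) r h); assumption. Qed.

(* Caratheodory's form of the derivative: sums, products and chains become
   algebraic identities.  [e] is the embedding of the domain, [RtoC] or the identity. *)
Definition dv {U : UniformSpace} (e : U -> C) (f : U -> C) (x : U) (l : C) : Prop :=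
  exists phi : U -> C, cont phi x /\ phi x = l /\
    forall y, f y = (f x + phi y * (e y - e x))%C.

Definition rd (f : R -> C) (x : R) (l : C) := @dv R_UniformSpace RtoC f x l.
Definition cd (f : C -> C) (z : C) (l : C) := @dv C_UniformSpace (fun w => w) f z l.

Section Dv.
Context {U : UniformSpace} (e : U -> C) (x : U).
Implicit Types f g : U -> C.

Lemma dv_const c : dv e (fun _ => c) x 0.
Proof. exists (fun _ => RtoC 0); split; [apply cont_const|split; [reflexivity|intros; ring]]. Qed.

Lemma dv_plus f g l m : dv e f x l -> dv e g x m -> dv e (fun y => f y + g y)%C x (l + m).
Proof.
  intros [p [Hp [Ep Fp]]] [q [Hq [Eq Fq]]]; exists (fun y => p y + q y)%C.
  split; [apply cont_plus; assumption|split; [rewrite Ep, Eq; reflexivity|]].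
  intros y; rewrite (Fp y), (Fq y); ring.
Qed.

Lemma dv_opp f l : dv e f x l -> dv e (fun y => - f y)%C x (- l).
Proof.
  intros [p [Hp [Ep Fp]]]; exists (fun y => - p y)%C.
  split; [apply cont_opp; assumption|split; [rewrite Ep; reflexivity|]].
  intros y; rewrite (Fp y); ring.
Qed.

Lemma dv_minus f g l m : dv e f x l -> dv e g x m -> dv e (fun y => f y - g y)%C x (l - m).
Proof. intros A B; apply dv_plus; [exact A|apply dv_opp, B]. Qed.

Lemma dv_mult f g l m : cont e x -> dv e f x l -> dv e g x m ->
  dv e (fun y => f y * g y)%C x (l * g x + f x * m).
Proof.
  intros He [p [Hp [Ep Fp]]] [q [Hq [Eq Fq]]].
  exists (fun y => p y * g x + f x * q y + p y * q y * (e y - e x))%C.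
  split; [|split].
  - cont_tac.
  - rewrite Ep, Eq; ring.
  - intros y; rewrite (Fp y), (Fq y); ring.
Qed.

Lemma dv_comp f h l m : dv e f x l -> cont f x -> cd h (f x) m ->
  dv e (fun y => h (f y)) x (m * l).
Proof.
  intros [p [Hp [Ep Fp]]] Hf [q [Hq [Eq Fq]]].
  exists (fun y => q (f y) * p y)%C; split; [|split].
  - apply cont_mult; [apply (cont_comp_C f q); assumption|assumption].
  - rewrite Ep, Eq; reflexivity.
  - intros y; rewrite (Fq (f y)), (Fp y); ring.
Qed.

Lemma dv_cont f l : cont e x -> dv e f x l -> cont f x.
Proof.
  intros He [p [Hp [Ep Fp]]].
  apply (cont_ext (fun y => f x + p y * (e y - e x))%C); [intros; symmetry; apply Fp|].
  cont_tac.
Qed.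

End Dv.

Lemma cont_e_R x : @cont R_UniformSpace RtoC x.
Proof. apply (cont_RtoC (U := R_UniformSpace) (fun y => y)), continuous_id. Qed.

Lemma rd_eq f x l m : rd f x l -> l = m -> rd f x m.
Proof. intros H E; subst; exact H. Qed.
Lemma cd_eq f x l m : cd f x l -> l = m -> cd f x m.
Proof. intros H E; subst; exact H. Qed.
Lemma rd_mult f g x l m : rd f x l -> rd g x m -> rd (fun y => f y * g y)%C x (l * g x + f x * m).
Proof. apply dv_mult, cont_e_R. Qed.
Lemma cd_const c z : cd (fun _ => c) z 0.
Proof. apply (dv_const (U := C_UniformSpace)). Qed.
Lemma cd_plus f g z l m : cd f z l -> cd g z m -> cd (fun w => f w + g w)%C z (l + m).
Proof. apply (dv_plus (U := C_UniformSpace)). Qed.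
Lemma cd_minus f g z l m : cd f z l -> cd g z m -> cd (fun w => f w - g w)%C z (l - m).
Proof. apply (dv_minus (U := C_UniformSpace)). Qed.
Lemma cd_mult f g x l m : cd f x l -> cd g x m -> cd (fun y => f y * g y)%C x (l * g x + f x * m).
Proof. apply (dv_mult (U := C_UniformSpace)), cont_id. Qed.
Lemma rd_cont f x l : rd f x l -> @cont R_UniformSpace f x.
Proof. apply dv_cont, cont_e_R. Qed.
Lemma cd_cont f x l : cd f x l -> @cont C_UniformSpace f x.
Proof. apply (dv_cont (U := C_UniformSpace)), cont_id. Qed.
Lemma rd_comp f h x l m : rd f x l -> cd h (f x) m -> rd (fun y => h (f y)) x (m * l).
Proof. intros A B; apply dv_comp; [exact A|eapply rd_cont, A|exact B]. Qed.
Lemma cd_comp f h x l m : cd f x l -> cd h (f x) m -> cd (fun y => h (f y)) x (m * l).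
Proof. intros A B; apply (dv_comp (U := C_UniformSpace)); [exact A|eapply cd_cont, A|exact B]. Qed.
Lemma cd_id z : cd (fun w => w) z 1.
Proof.
  exists (fun _ => RtoC 1); split; [apply (cont_const (U := C_UniformSpace))|split; [reflexivity|refine (fun y : C => _); change (@eq C y (z + 1 * (y - z))%C); ring]].
Qed.
Lemma rd_RtoC x : rd RtoC x 1.
Proof.
  exists (fun _ => RtoC 1); split; [apply (cont_const (U := R_UniformSpace))|split; [reflexivity|intros y; change (@eq C (RtoC y) (RtoC x + 1 * (RtoC y - RtoC x))%C); ring]].
Qed.
Lemma rd_conj f x l : rd f x l -> rd (fun y => Cconj (f y)) x (Cconj l).
Proof.
  intros [p [Hp [Ep Fp]]]; exists (fun y => Cconj (p y)); split; [apply cont_conj, Hp|split].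
  - rewrite Ep; reflexivity.
  - intros y; rewrite (Fp y), Cplus_conj, Cmult_conj, Cminus_conj; f_equal; f_equal.
    apply C_ext; unfold Cconj, RtoC, Cminus, Cplus, Copp, Re, Im; simpl; ring.
Qed.

(** The quotient is undefined where [e y = e x]; there the factor is set to [l], which is harmless
    for its continuity, and the first premise makes the factorization hold. *)
Lemma dv_of_eps {U : UniformSpace} (e f : U -> C) (x : U) (l : C) :
  (forall y, e y = e x -> f y = f x) ->
  (forall eps, 0 < eps -> locally x (fun y =>
     Cmod (f y - f x - l * (e y - e x)) <= eps * Cmod (e y - e x))) -> dv e f x l.
Proof.
  intros Hinj H.
  pose (phi := fun y => if excluded_middle_informative (e y = e x) then l
                        else ((f y - f x) / (e y - e x))%C).
  assert (Ex : phi x = l).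
  { unfold phi; destruct (excluded_middle_informative (e x = e x)); tauto. }
  exists phi; split; [|split; [exact Ex|]].
  - apply cont_eps; intros eps He. assert (He2 : 0 < eps / 2) by lra.
    generalize (H _ He2); apply filter_imp; intros y P; rewrite Ex; unfold phi.
    destruct (excluded_middle_informative (e y = e x)) as [E|E].
    + replace (l - l)%C with (RtoC 0) by ring; rewrite Cmod_0; lra.
    + assert (N : (e y - e x)%C <> 0).
      { intros Q; apply E; replace (e y) with (e y - e x + e x)%C by ring; rewrite Q; ring. }
      replace ((f y - f x) / (e y - e x) - l)%C
        with ((f y - f x - l * (e y - e x)) / (e y - e x))%C by (field; exact N).
      rewrite Cmod_div by exact N.
      apply Cmod_gt_0 in N. apply Rle_lt_trans with (eps / 2); [|lra].
      apply Rmult_le_reg_r with (Cmod (e y - e x)); [exact N|].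
      unfold Rdiv at 1; rewrite Rmult_assoc, Rinv_l by lra; lra.
  - intros y; unfold phi; destruct (excluded_middle_informative (e y = e x)) as [E|E].
    + rewrite E, (Hinj y E); ring.
    + field. intros Q; apply E; replace (e y) with (e y - e x + e x)%C by ring; rewrite Q; ring.
Qed.

Lemma dv_to_eps {U : UniformSpace} (e f : U -> C) (x : U) (l : C) : dv e f x l ->
  forall eps, 0 < eps -> locally x (fun y =>
     Cmod (f y - f x - l * (e y - e x)) <= eps * Cmod (e y - e x)).
Proof.
  intros [p [Hp [Ep Fp]]] eps He.
  generalize (proj1 (cont_eps _ _) Hp eps He); apply filter_imp; intros y P.
  rewrite (Fp y), Ep in *.
  replace (f x + p y * (e y - e x) - f x - l * (e y - e x))%C with ((p y - l) * (e y - e x))%C by ring.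
  rewrite Cmod_mult; apply Rmult_le_compat_r; [apply Cmod_ge_0|lra].
Qed.

Lemma cd_eps f z l : cd f z l <-> forall eps, 0 < eps -> exists d, 0 < d /\
  forall w, Cmod (w - z) < d -> Cmod (f w - f z - l * (w - z)) <= eps * Cmod (w - z).
Proof.
  split.
  - intros H eps He; apply locally_C_eps; apply (dv_to_eps _ _ _ _ H _ He).
  - intros H; apply (dv_of_eps (U := C_UniformSpace)); [intros y E; rewrite E; reflexivity|].
    intros eps He; apply locally_C_eps, H, He.
Qed.

Lemma RtoC_minus' (x y : R) : (RtoC x - RtoC y)%C = RtoC (x - y).
Proof. apply C_ext; unfold RtoC, Cminus, Cplus, Copp, Re, Im; simpl; ring. Qed.

Lemma rd_eps f x l : rd f x l <-> forall eps, 0 < eps -> exists d, 0 < d /\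
  forall y, Rabs (y - x) < d -> Cmod (f y - f x - l * RtoC (y - x)) <= eps * Rabs (y - x).
Proof.
  split.
  - intros H eps He; apply locally_R_eps; generalize (dv_to_eps _ _ _ _ H _ He).
    apply filter_imp; intros y; rewrite RtoC_minus', Cmod_R; auto.
  - intros H; apply dv_of_eps.
    + intros y E; apply (f_equal Re) in E; unfold RtoC, Re in E; simpl in E; rewrite E; reflexivity.
    + intros eps He; generalize (proj2 (locally_R_eps x _) (H eps He)); apply filter_imp.
      intros y; rewrite RtoC_minus', Cmod_R; auto.
Qed.

Lemma cd_is_derive f z l : cd f z l <-> @is_derive C_AbsRing C_NormedModule f z l.
Proof.
  split.
  - intros H; split; [apply @is_linear_scal_l|].
    intros w Hw; assert (E : w = z) by (symmetry; apply is_filter_lim_locally_unique, Hw); subst w; clear Hw.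
    intros eps.
    destruct (proj1 (cd_eps f z l) H eps (cond_pos eps)) as [d [Hd P]].
    exists (mkposreal d Hd); intros w Hw.
    change (Cmod (w - z) < d) in Hw.
    specialize (P w Hw).
    change (norm (minus (minus (f w) (f z)) (scal (minus w z) l)))
      with (Cmod (f w - f z - (w - z) * l)).
    change (norm (minus w z)) with (Cmod (w - z)).
    rewrite (Cmult_comm (w - z) l); exact P.
  - intros [_ H]; apply cd_eps; intros eps He.
    destruct (H z (fun P Q => Q) (mkposreal eps He)) as [d Hd].
    exists d; split; [apply cond_pos|]; intros w Hw; rewrite (Cmult_comm l); apply Hd; exact Hw.
Qed.

Lemma rd_is_derive f x l : rd f x l <-> @is_derive R_AbsRing C_R_NormedModule f x l.
Proof.
  assert (Sc : forall (r : R) (m : C), @scal R_AbsRing C_R_NormedModule r m = (m * RtoC r)%C).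
  { intros r m; apply C_ext; unfold scal, Cmult, RtoC, Re, Im; simpl; unfold prod_scal; simpl;
    unfold scal; simpl; unfold mult; simpl; ring. }
  split.
  - intros H; split; [apply @is_linear_scal_l|].
    intros w Hw; assert (E : w = x) by (symmetry; apply is_filter_lim_locally_unique, Hw); subst w; clear Hw.
    intros eps.
    destruct (proj1 (rd_eps f x l) H eps (cond_pos eps)) as [d [Hd P]].
    exists (mkposreal d Hd); intros w Hw.
    change (Rabs (w - x) < d) in Hw; specialize (P w Hw).
    rewrite Sc; rewrite <- Cmod_norm; exact P.
  - intros [_ H]; apply rd_eps; intros eps He.
    destruct (H x (fun P Q => Q) (mkposreal eps He)) as [d Hd].
    exists d; split; [apply cond_pos|]; intros w Hw.
    specialize (Hd w Hw); rewrite Sc, <- Cmod_norm in Hd; exact Hd.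
Qed.

Lemma rd_parts f x l : rd f x l <->
  is_derive (fun y => Re (f y)) x (Re l) /\ is_derive (fun y => Im (f y)) x (Im l).
Proof.
  split.
  - intros H; split; (split; [apply @is_linear_scal_l|]);
    (intros w Hw; assert (E : w = x) by (symmetry; apply is_filter_lim_locally_unique, Hw); subst w; clear Hw);
    intros eps;
    destruct (proj1 (rd_eps f x l) H eps (cond_pos eps)) as [d [Hd P]];
    exists (mkposreal d Hd); intros w Hw; specialize (P w Hw);
    (eapply Rle_trans; [|exact P]).
    + eapply Rle_trans; [|apply re_le_Cmod]; right.
      unfold norm; simpl; unfold minus, plus, opp, scal, abs; simpl; unfold mult; simpl.
      f_equal; unfold Cminus, Cmult, Cplus, Copp, RtoC, Re, Im; simpl; ring.
    + eapply Rle_trans; [|apply im_le_Cmod]; right.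
      unfold norm; simpl; unfold minus, plus, opp, scal, abs; simpl; unfold mult; simpl.
      f_equal; unfold Cminus, Cmult, Cplus, Copp, RtoC, Re, Im; simpl; ring.
  - intros [[_ A] [_ B]]; apply rd_eps; intros eps He.
    assert (He2 : 0 < eps / 2) by lra.
    destruct (A x (fun P Q => Q) (mkposreal _ He2)) as [d Hd].
    destruct (B x (fun P Q => Q) (mkposreal _ He2)) as [d' Hd'].
    exists (Rmin d d'); split; [apply Rmin_pos; apply cond_pos|]; intros y Hy.
    specialize (Hd y (Rlt_le_trans _ _ _ Hy (Rmin_l _ _))).
    specialize (Hd' y (Rlt_le_trans _ _ _ Hy (Rmin_r _ _))).
    unfold norm in Hd, Hd'; simpl in Hd, Hd'; unfold minus, plus, opp, scal, abs in Hd, Hd'; simpl in Hd, Hd';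
    unfold mult in Hd, Hd'; simpl in Hd, Hd'.
    eapply Rle_trans; [apply Cmod_le_parts|].
    replace (Re (f y - f x - l * RtoC (y - x))) with (Re (f y) + - Re (f x) + - ((y + - x) * Re l))
      by (unfold Cminus, Cmult, Cplus, Copp, RtoC, Re, Im; simpl; ring).
    replace (Im (f y - f x - l * RtoC (y - x))) with (Im (f y) + - Im (f x) + - ((y + - x) * Im l))
      by (unfold Cminus, Cmult, Cplus, Copp, RtoC, Re, Im; simpl; ring).
    unfold Rminus in *; lra.
Qed.

Lemma rd_affine (a b : C) x : rd (fun t => a + RtoC t * b)%C x b.
Proof.
  eapply rd_eq; [apply dv_plus; [apply dv_const|apply rd_mult; [apply rd_RtoC|apply dv_const]]|cbv beta; ring].
Qed.

Lemma Cmod_minus_sym (z w : C) : Cmod (z - w) = Cmod (w - z).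
Proof. rewrite <- Cmod_opp; f_equal; ring. Qed.

Lemma Cmod_minus_triangle (z w : C) : Cmod (z - w) <= Cmod z + Cmod w.
Proof. unfold Cminus; eapply Rle_trans; [apply Cmod_triangle|]; rewrite Cmod_opp; lra. Qed.

Lemma Cmod_triangle_inv (z w : C) : Cmod z - Cmod w <= Cmod (z - w).
Proof. generalize (Cmod_triangle (z - w) w); replace (z - w + w)%C with z by ring; lra. Qed.

Lemma Cmod_le_via (z w v : C) : Cmod (z - v) <= Cmod (z - w) + Cmod (w - v).
Proof. replace (z - v)%C with ((z - w) + (w - v))%C by ring; apply Cmod_triangle. Qed.

(* Project the increment on its own direction to reduce to the real mean value theorem. *)
Lemma rd_mean_value (F : R -> C) (f : R -> C) a b K : a <= b ->
  (forall t, a <= t <= b -> rd F t (f t)) -> (forall t, a <= t <= b -> Cmod (f t) <= K) ->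
  Cmod (F b - F a) <= K * (b - a).
Proof.
  intros Hab HF HK.
  set (d := (F b - F a)%C).
  pose (g := fun t => Re (Cconj d * F t)%C).
  assert (Hg : forall t, a <= t <= b -> is_derive g t (Re (Cconj d * f t)%C)).
  { intros t Ht.
    assert (P : rd (fun y => Cconj d * F y)%C t (0 * F t + Cconj d * f t)%C).
    { apply rd_mult; [apply dv_const|apply HF, Ht]. }
    replace (0 * F t + Cconj d * f t)%C with (Cconj d * f t)%C in P by ring.
    apply rd_parts in P; apply P. }
  assert (E : g b - g a = Cmod d ^ 2).
  { rewrite Cmod2_alt; unfold g; replace (Re (Cconj d * F b) - Re (Cconj d * F a))%R with (Re (Cconj d * d)%C)
      by (unfold d, Cconj, Cmult, Cminus, Cplus, Copp, Re, Im; simpl; ring).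
    unfold Cconj, Cmult, Re, Im; simpl; ring. }
  destruct (MVT_gen g a b (fun t => Re (Cconj d * f t)%C)) as [c [Hc Ec]].
  - rewrite Rmin_left, Rmax_right by lra; intros t Ht; apply Hg; lra.
  - rewrite Rmin_left, Rmax_right by lra; intros t Ht.
    apply continuity_pt_filterlim; apply (ex_derive_continuous g); eexists; apply Hg; lra.
  - rewrite Rmin_left, Rmax_right in Hc by lra.
    rewrite E in Ec.
    assert (Q : Re (Cconj d * f c)%C <= Cmod d * K).
    { eapply Rle_trans; [apply Rle_abs|]; eapply Rle_trans; [apply re_le_Cmod|].
      rewrite Cmod_mult, Cmod_conj; apply Rmult_le_compat_l; [apply Cmod_ge_0|apply HK, Hc]. }
    destruct (Req_dec (Cmod d) 0) as [Z|Z].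
    + rewrite Z; apply Rmult_le_pos; [|lra]. eapply Rle_trans; [apply Cmod_ge_0|apply (HK a); lra].
    + assert (P : 0 < Cmod d) by (generalize (Cmod_ge_0 d); lra).
      apply Rmult_le_reg_l with (Cmod d); [exact P|].
      replace (Cmod d * Cmod d) with (Cmod d ^ 2) by ring; rewrite Ec.
      replace (Cmod d * (K * (b - a))) with (Cmod d * K * (b - a)) by ring.
      apply Rmult_le_compat_r; lra.
Qed.

Lemma cd_mean_value (F f : C -> C) (z w : C) K :
  (forall t, 0 <= t <= 1 -> cd F (z + RtoC t * (w - z)) (f (z + RtoC t * (w - z))))%C ->
  (forall t, 0 <= t <= 1 -> Cmod (f (z + RtoC t * (w - z))%C) <= K) ->
  Cmod (F w - F z) <= K * Cmod (w - z).
Proof.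
  intros HF HK.
  assert (H := rd_mean_value (fun t => F (z + RtoC t * (w - z)))%C
     (fun t => f (z + RtoC t * (w - z)) * (w - z))%C 0 1 (K * Cmod (w - z))).
  cbv beta in H.
  replace (z + RtoC 1 * (w - z))%C with w in H by ring.
  replace (z + RtoC 0 * (w - z))%C with z in H by ring.
  rewrite Rminus_0_r, Rmult_1_r in H; apply H; [lra| |].
  - intros t Ht; apply (rd_comp (fun t => z + RtoC t * (w - z))%C F); [apply rd_affine|apply HF, Ht].
  - intros t Ht; rewrite Cmod_mult; apply Rmult_le_compat_r; [apply Cmod_ge_0|apply HK, Ht].
Qed.

(** * Integrals of complex-valued functions of a real variable *)

Definition Cint (f : R -> C) (a b : R) : C :=
  (RInt (fun t => Re (f t)) a b, RInt (fun t => Im (f t)) a b).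

Definition exC (f : R -> C) (a b : R) : Prop :=
  ex_RInt (fun t => Re (f t)) a b /\ ex_RInt (fun t => Im (f t)) a b.

Lemma exC_cont f a b : (forall t, Rmin a b <= t <= Rmax a b -> @cont R_UniformSpace f t) -> exC f a b.
Proof.
  intros H; split; apply (ex_RInt_continuous (V := R_CompleteNormedModule));
    intros t Ht; apply (cont_parts f t), H, Ht.
Qed.

Lemma Cint_is_RInt f a b : exC f a b -> @is_RInt C_R_NormedModule f a b (Cint f a b).
Proof.
  intros [A B]; apply (is_RInt_fct_extend_pair (U := R_NormedModule) (V := R_NormedModule));
    apply (RInt_correct (V := R_CompleteNormedModule)); assumption.
Qed.

(** The bound goes through the vector-valued integral, since estimating the two components
    separately would lose a constant. *)
Lemma Cint_le f g a b : a <= b -> exC f a b -> ex_RInt g a b ->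
  (forall t, a <= t <= b -> Cmod (f t) <= g t) -> Cmod (Cint f a b) <= RInt g a b.
Proof.
  intros Hab Hf Hg H.
  rewrite Cmod_norm.
  apply (norm_RInt_le (V := C_R_NormedModule) f g a b (Cint f a b) (RInt g a b) Hab).
  - intros t Ht; rewrite <- Cmod_norm; apply H, Ht.
  - apply Cint_is_RInt, Hf.
  - apply (RInt_correct (V := R_CompleteNormedModule)), Hg.
Qed.

Lemma Cint_swap f a b : exC f a b -> Cint f b a = (- Cint f a b)%C.
Proof.
  intros [A B]; unfold Cint, Copp; simpl; f_equal.
  - rewrite <- (opp_RInt_swap (V := R_CompleteNormedModule) _ a b); [reflexivity|exact A].
  - rewrite <- (opp_RInt_swap (V := R_CompleteNormedModule) _ a b); [reflexivity|exact B].
Qed.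

Lemma exC_swap f a b : exC f a b -> exC f b a.
Proof. intros [A B]; split; apply ex_RInt_swap; assumption. Qed.

Lemma Cint_bound f a b K : exC f a b ->
  (forall t, Rmin a b <= t <= Rmax a b -> Cmod (f t) <= K) -> Cmod (Cint f a b) <= K * Rabs (b - a).
Proof.
  assert (W : forall a b, a <= b -> exC f a b ->
    (forall t, a <= t <= b -> Cmod (f t) <= K) -> Cmod (Cint f a b) <= K * (b - a)).
  { intros a' b' Hab Hf H; replace (K * (b' - a')) with (RInt (fun _ => K) a' b').
    - apply Cint_le; auto; apply ex_RInt_const.
    - rewrite (RInt_const (V := R_CompleteNormedModule)); unfold scal; simpl; unfold mult; simpl; ring. }
  intros Hf H; destruct (Rle_dec a b) as [L|L].
  - rewrite Rmin_left, Rmax_right in H by lra; rewrite Rabs_pos_eq by lra; apply W; auto.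
  - rewrite Rmin_right, Rmax_left in H by lra; rewrite Rabs_left by lra.
    rewrite Cint_swap by (apply exC_swap, Hf); rewrite Cmod_opp.
    replace (- (b - a)) with (a - b) by ring; apply W; auto; [lra|apply exC_swap, Hf].
Qed.

Lemma Cint_ext f g a b : (forall t, Rmin a b <= t <= Rmax a b -> f t = g t) -> Cint f a b = Cint g a b.
Proof.
  intros H; unfold Cint; f_equal; apply RInt_ext; intros t Ht; rewrite H by lra; reflexivity.
Qed.

Lemma exC_ext f g a b : (forall t, Rmin a b <= t <= Rmax a b -> f t = g t) -> exC f a b -> exC g a b.
Proof.
  intros H [A B]; split; [eapply ex_RInt_ext; [|exact A]|eapply ex_RInt_ext; [|exact B]];
  intros t Ht; cbv beta; rewrite H by lra; reflexivity.
Qed.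

Lemma exC_plus f g a b : exC f a b -> exC g a b -> exC (fun t => f t + g t)%C a b.
Proof.
  intros [A B] [A' B']; split; apply (ex_RInt_plus (V := R_NormedModule)); assumption.
Qed.

Lemma Cint_plus f g a b : exC f a b -> exC g a b ->
  Cint (fun t => f t + g t)%C a b = (Cint f a b + Cint g a b)%C.
Proof.
  intros [A B] [A' B']; unfold Cint, Cplus; simpl; f_equal;
  apply (RInt_plus (V := R_CompleteNormedModule)); assumption.
Qed.

Lemma exC_scal c f a b : exC f a b -> exC (fun t => c * f t)%C a b.
Proof.
  intros [A B]; split.
  - apply (ex_RInt_minus (V := R_NormedModule) (fun t => Re c * Re (f t)) (fun t => Im c * Im (f t)));
    apply (ex_RInt_scal (V := R_NormedModule)); assumption.
  - apply (ex_RInt_plus (V := R_NormedModule) (fun t => Re c * Im (f t)) (fun t => Im c * Re (f t)));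
    apply (ex_RInt_scal (V := R_NormedModule)); assumption.
Qed.

Lemma Cint_scal c f a b : exC f a b -> Cint (fun t => c * f t)%C a b = (c * Cint f a b)%C.
Proof.
  intros [A B]; unfold Cint, Cmult; simpl.
  assert (S : forall k g, ex_RInt g a b -> RInt (fun t => k * g t) a b = k * RInt g a b).
  { intros k g Hg; apply (RInt_scal (V := R_CompleteNormedModule) g a b k Hg). }
  assert (S' : forall k g, ex_RInt g a b -> ex_RInt (fun t => k * g t) a b).
  { intros k g Hg; apply (ex_RInt_scal (V := R_NormedModule) g a b k Hg). }
  f_equal.
  - transitivity (RInt (fun t => Re c * Re (f t)) a b - RInt (fun t => Im c * Im (f t)) a b).
    + apply (RInt_minus (V := R_CompleteNormedModule) (fun t => Re c * Re (f t)) (fun t => Im c * Im (f t)));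
      apply S'; assumption.
    + rewrite !S by assumption; reflexivity.
  - transitivity (RInt (fun t => Re c * Im (f t)) a b + RInt (fun t => Im c * Re (f t)) a b).
    + apply (RInt_plus (V := R_CompleteNormedModule) (fun t => Re c * Im (f t)) (fun t => Im c * Re (f t)));
      apply S'; assumption.
    + rewrite !S by assumption; reflexivity.
Qed.

Lemma exC_minus f g a b : exC f a b -> exC g a b -> exC (fun t => f t - g t)%C a b.
Proof.
  intros A B; apply (exC_ext (fun t => f t + (RtoC (-1)) * g t)%C).
  - intros; apply C_ext; unfold Cminus, Cplus, Cmult, Copp, RtoC, Re, Im; simpl; ring.
  - apply exC_plus; [exact A|apply exC_scal, B].
Qed.

Lemma Cint_minus f g a b : exC f a b -> exC g a b ->
  Cint (fun t => f t - g t)%C a b = (Cint f a b - Cint g a b)%C.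
Proof.
  intros A B; rewrite (Cint_ext _ (fun t => f t + (RtoC (-1)) * g t)%C).
  - rewrite Cint_plus by (auto; apply exC_scal, B); rewrite Cint_scal by exact B.
    apply C_ext; unfold Cminus, Cplus, Cmult, Copp, RtoC, Re, Im; simpl; ring.
  - intros; apply C_ext; unfold Cminus, Cplus, Cmult, Copp, RtoC, Re, Im; simpl; ring.
Qed.

Lemma exC_const c a b : exC (fun _ => c) a b.
Proof. split; apply ex_RInt_const. Qed.

Lemma Cint_const c a b : Cint (fun _ => c) a b = (RtoC (b - a) * c)%C.
Proof.
  unfold Cint; rewrite !(RInt_const (V := R_CompleteNormedModule)).
  apply C_ext; unfold Cmult, RtoC, Re, Im; simpl; unfold scal; simpl; unfold mult; simpl; ring.
Qed.

Lemma Cint_Chasles f a b c : exC f a b -> exC f b c -> (Cint f a b + Cint f b c)%C = Cint f a c.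
Proof.
  intros [A B] [A' B']; unfold Cint, Cplus; simpl; f_equal;
  apply (RInt_Chasles (V := R_CompleteNormedModule)); assumption.
Qed.

Lemma Cint_FTC F f a b : (forall t, Rmin a b <= t <= Rmax a b -> rd F t (f t)) ->
  (forall t, Rmin a b <= t <= Rmax a b -> @cont R_UniformSpace f t) -> Cint f a b = (F b - F a)%C.
Proof.
  intros HF Hf.
  apply C_ext.
  - change (RInt (fun t => Re (f t)) a b = minus (Re (F b)) (Re (F a))).
    apply is_RInt_unique, (is_RInt_derive (V := R_CompleteNormedModule) (fun t => Re (F t))).
    + intros t Ht; apply (rd_parts F t), HF, Ht.
    + intros t Ht; apply (cont_parts f t), Hf, Ht.
  - change (RInt (fun t => Im (f t)) a b = minus (Im (F b)) (Im (F a))).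
    apply is_RInt_unique, (is_RInt_derive (V := R_CompleteNormedModule) (fun t => Im (F t))).
    + intros t Ht; apply (rd_parts F t), HF, Ht.
    + intros t Ht; apply (cont_parts f t), Hf, Ht.
Qed.

(** * Goursat's theorem *)

(** The integral of [f] along the boundary of the rectangle [[a, b] x [c, d]], counterclockwise. *)
Definition J (f : C -> C) (a b c d : R) : C :=
  (Cint (fun x => f (x, c)) a b - Cint (fun x => f (x, d)) a b
   + Ci * (Cint (fun y => f (b, y)) c d - Cint (fun y => f (a, y)) c d))%C.

Definition rect (a b c d : R) (z : C) : Prop := a <= Re z <= b /\ c <= Im z <= d.

Lemma cont_hor (f : C -> C) x y : @cont C_UniformSpace f (x, y) -> @cont R_UniformSpace (fun s => f (s, y)) x.
Proof.
  intros H; apply (cont_comp_C (U := R_UniformSpace) (fun s => (s, y)) f); [|exact H].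
  apply cont_parts; split; [apply continuous_id|apply continuous_const].
Qed.

Lemma cont_ver (f : C -> C) x y : @cont C_UniformSpace f (x, y) -> @cont R_UniformSpace (fun t => f (x, t)) y.
Proof.
  intros H; apply (cont_comp_C (U := R_UniformSpace) (fun t => (x, t)) f); [|exact H].
  apply cont_parts; split; [apply continuous_const|apply continuous_id].
Qed.

Lemma exC_hor f a b c : (forall x, Rmin a b <= x <= Rmax a b -> @cont C_UniformSpace f (x, c)) ->
  exC (fun x => f (x, c)) a b.
Proof. intros H; apply exC_cont; intros; apply cont_hor, H; auto. Qed.

Lemma exC_ver f a c d : (forall y, Rmin c d <= y <= Rmax c d -> @cont C_UniformSpace f (a, y)) ->
  exC (fun y => f (a, y)) c d.
Proof. intros H; apply exC_cont; intros; apply cont_ver, H; auto. Qed.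

Lemma rd_hor (F : C -> C) x y l : cd F (x, y) l -> rd (fun s => F (s, y)) x l.
Proof.
  intros H; eapply rd_eq; [apply (rd_comp (fun s => (s, y)) F); [|exact H]|].
  - replace (fun s : R => (s, y)) with (fun s : R => ((0, y) + RtoC s * RtoC 1)%C); [apply rd_affine|].
    apply functional_extensionality; intros s.
    apply C_ext; unfold Cplus, Cmult, RtoC, Re, Im; simpl; ring.
  - ring.
Qed.

Lemma rd_ver (F : C -> C) x y l : cd F (x, y) l -> rd (fun t => F (x, t)) y (l * Ci).
Proof.
  intros H; apply (rd_comp (fun s => (x, s)) F); [|exact H].
  replace (fun s : R => (x, s)) with (fun s : R => ((x, 0) + RtoC s * Ci)%C); [apply rd_affine|].
  apply functional_extensionality; intros s.
  apply C_ext; unfold Cplus, Cmult, Ci, RtoC, Re, Im; simpl; ring.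
Qed.

(** On each edge the integral is an increment of [F], and the corner values cancel. *)
Lemma J_primitive (F f : C -> C) a b c d :
  (forall z, cd F z (f z)) -> (forall z, @cont C_UniformSpace f z) -> J f a b c d = 0.
Proof.
  intros HF Hf; unfold J.
  assert (V : forall x, (Ci * Cint (fun y => f (x, y)) c d = F (x, d) - F (x, c))%C).
  { intros x; rewrite <- Cint_scal by (apply (exC_ver f); intros; apply Hf).
    apply (Cint_FTC (fun y => F (x, y))).
    - intros y _; eapply rd_eq; [apply rd_ver, HF|ring].
    - intros y _; apply (cont_mult (U := R_UniformSpace) (fun _ => Ci)); [apply cont_const|apply cont_ver, Hf]. }
  rewrite (Cint_FTC (fun s => F (s, c)) (fun s => f (s, c))) by
    (intros; first [apply rd_hor, HF|apply cont_hor, Hf]).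
  rewrite (Cint_FTC (fun s => F (s, d)) (fun s => f (s, d))) by
    (intros; first [apply rd_hor, HF|apply cont_hor, Hf]).
  replace (Ci * (Cint (fun y => f (b, y)) c d - Cint (fun y => f (a, y)) c d))%C
   with (Ci * Cint (fun y => f (b, y)) c d - Ci * Cint (fun y => f (a, y)) c d)%C by ring.
  rewrite !V; ring.
Qed.

Lemma exC_edges f a b c d : a <= b -> c <= d ->
  (forall z, rect a b c d z -> @cont C_UniformSpace f z) ->
  (forall y u v, c <= y <= d -> a <= u -> u <= v -> v <= b -> exC (fun x => f (x, y)) u v) /\
  (forall x u v, a <= x <= b -> c <= u -> u <= v -> v <= d -> exC (fun y => f (x, y)) u v).
Proof.
  intros Hab Hcd Hf; split; intros y u v Hy Hu Huv Hv; [apply (exC_hor f)|apply (exC_ver f)];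
    rewrite Rmin_left, Rmax_right by lra; intros; apply Hf; split; simpl; lra.
Qed.

Lemma J_minus f g a b c d : a <= b -> c <= d ->
  (forall z, rect a b c d z -> @cont C_UniformSpace f z) ->
  (forall z, rect a b c d z -> @cont C_UniformSpace g z) ->
  J (fun z => f z - g z)%C a b c d = (J f a b c d - J g a b c d)%C.
Proof.
  intros Hab Hcd Hf Hg; unfold J.
  destruct (exC_edges f a b c d Hab Hcd Hf) as [F1 F2], (exC_edges g a b c d Hab Hcd Hg) as [G1 G2].
  rewrite (Cint_minus (fun x => f (x, c)) (fun x => g (x, c)) a b (F1 c a b ltac:(lra) ltac:(lra) ltac:(lra) ltac:(lra))
     (G1 c a b ltac:(lra) ltac:(lra) ltac:(lra) ltac:(lra))).
  rewrite (Cint_minus (fun x => f (x, d)) (fun x => g (x, d)) a b (F1 d a b ltac:(lra) ltac:(lra) ltac:(lra) ltac:(lra))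
     (G1 d a b ltac:(lra) ltac:(lra) ltac:(lra) ltac:(lra))).
  rewrite (Cint_minus (fun x => f (a, x)) (fun x => g (a, x)) c d (F2 a c d ltac:(lra) ltac:(lra) ltac:(lra) ltac:(lra))
     (G2 a c d ltac:(lra) ltac:(lra) ltac:(lra) ltac:(lra))).
  rewrite (Cint_minus (fun x => f (b, x)) (fun x => g (b, x)) c d (F2 b c d ltac:(lra) ltac:(lra) ltac:(lra) ltac:(lra))
     (G2 b c d ltac:(lra) ltac:(lra) ltac:(lra) ltac:(lra))).
  ring.
Qed.

Lemma J_bound f a b c d K : a <= b -> c <= d ->
  (forall z, rect a b c d z -> @cont C_UniformSpace f z) ->
  (forall z, rect a b c d z -> Cmod (f z) <= K) ->
  Cmod (J f a b c d) <= 2 * K * ((b - a) + (d - c)).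
Proof.
  intros Hab Hcd Hf HK.
  assert (H1 : forall y, c <= y <= d -> Cmod (Cint (fun x => f (x, y)) a b) <= K * (b - a)).
  { intros y Hy; rewrite <- (Rabs_pos_eq (b - a)) by lra; apply Cint_bound.
    - apply (exC_hor f); rewrite Rmin_left, Rmax_right by lra; intros; apply Hf; split; simpl; lra.
    - rewrite Rmin_left, Rmax_right by lra; intros; apply HK; split; simpl; lra. }
  assert (H2 : forall x, a <= x <= b -> Cmod (Cint (fun y => f (x, y)) c d) <= K * (d - c)).
  { intros x Hx; rewrite <- (Rabs_pos_eq (d - c)) by lra; apply Cint_bound.
    - apply (exC_ver f); rewrite Rmin_left, Rmax_right by lra; intros; apply Hf; split; simpl; lra.
    - rewrite Rmin_left, Rmax_right by lra; intros; apply HK; split; simpl; lra. }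
  unfold J.
  eapply Rle_trans; [apply Cmod_triangle|]; rewrite Cmod_mult, Cmod_Ci, Rmult_1_l.
  generalize (Cmod_minus_triangle (Cint (fun x => f (x, c)) a b) (Cint (fun x => f (x, d)) a b))
    (Cmod_minus_triangle (Cint (fun y => f (b, y)) c d) (Cint (fun y => f (a, y)) c d))
    (H1 c ltac:(lra)) (H1 d ltac:(lra)) (H2 a ltac:(lra)) (H2 b ltac:(lra)); lra.
Qed.

Lemma J_split f a b c d : a <= b -> c <= d ->
  (forall z, rect a b c d z -> @cont C_UniformSpace f z) ->
  let m := (a + b) / 2 in let n := (c + d) / 2 in
  J f a b c d = (J f a m c n + J f m b c n + J f a m n d + J f m b n d)%C.
Proof.
  intros Hab Hcd Hf m n; unfold J.
  assert (Hm : a <= m <= b) by (unfold m; lra). assert (Hn : c <= n <= d) by (unfold n; lra).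
  clearbody m n.
  destruct (exC_edges f a b c d Hab Hcd Hf) as [E1 E2].
  rewrite <- (Cint_Chasles (fun x => f (x, c)) a m b) by (apply E1; lra).
  rewrite <- (Cint_Chasles (fun x => f (x, d)) a m b) by (apply E1; lra).
  rewrite <- (Cint_Chasles (fun y => f (a, y)) c n d) by (apply E2; lra).
  rewrite <- (Cint_Chasles (fun y => f (b, y)) c n d) by (apply E2; lra).
  ring.
Qed.

(** Four pieces, each below a quarter of the modulus, could not add up to the whole. *)
Lemma J_quarter f a c w h : 0 <= w -> 0 <= h ->
  (forall z, rect a (a + w) c (c + h) z -> @cont C_UniformSpace f z) ->
  exists a' c', a <= a' <= a + w / 2 /\ c <= c' <= c + h / 2 /\
    Cmod (J f a (a + w) c (c + h)) <= 4 * Cmod (J f a' (a' + w / 2) c' (c' + h / 2)).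
Proof.
  intros Hw Hh Hf.
  assert (S := J_split f a (a + w) c (c + h) ltac:(lra) ltac:(lra) Hf); cbv zeta in S.
  replace ((a + (a + w)) / 2) with (a + w / 2) in S by field.
  replace ((c + (c + h)) / 2) with (c + h / 2) in S by field.
  apply NNPP; intros N.
  assert (N' : forall a' c', a <= a' <= a + w / 2 -> c <= c' <= c + h / 2 ->
    Cmod (J f a' (a' + w / 2) c' (c' + h / 2)) < / 4 * Cmod (J f a (a + w) c (c + h))).
  { intros a' c' Ha Hc; apply Rnot_le_lt; intros L; apply N; exists a', c'; repeat split; try lra. }
  generalize (N' a c ltac:(lra) ltac:(lra)) (N' (a + w / 2) c ltac:(lra) ltac:(lra))
    (N' a (c + h / 2) ltac:(lra) ltac:(lra)) (N' (a + w / 2) (c + h / 2) ltac:(lra) ltac:(lra)).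
  replace (a + w / 2 + w / 2) with (a + w) by field.
  replace (c + h / 2 + h / 2) with (c + h) by field.
  set (X1 := J f a (a + w / 2) c (c + h / 2)) in *.
  set (X2 := J f (a + w / 2) (a + w) c (c + h / 2)) in *.
  set (X3 := J f a (a + w / 2) (c + h / 2) (c + h)) in *.
  set (X4 := J f (a + w / 2) (a + w) (c + h / 2) (c + h)) in *.
  rewrite S.
  generalize (Cmod_triangle (X1 + X2 + X3) X4) (Cmod_triangle (X1 + X2) X3) (Cmod_triangle X1 X2); lra.
Qed.

(** Every left end lies below every right end, so the supremum of the left ends lies in all the
    intervals. *)
Lemma nested_point (a : nat -> R) w : 0 <= w -> (forall n, a n <= a (S n) <= a n + w / 2 ^ (S n)) ->
  exists p, forall n, a n <= p <= a n + w / 2 ^ n.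
Proof.
  intros Hw H.
  assert (P2 : forall n, 0 < 2 ^ n) by (intros; apply pow_lt; lra).
  assert (D : forall n, w / 2 ^ n = w / 2 ^ S n + w / 2 ^ S n).
  { intros n; simpl; field; apply Rgt_not_eq, P2. }
  assert (Hp : forall n, 0 <= w / 2 ^ n) by (intros; apply Rdiv_le_0_compat; [lra|apply P2]).
  assert (M : forall n k, a n <= a (n + k)%nat /\ a (n + k)%nat + w / 2 ^ (n + k) <= a n + w / 2 ^ n).
  { intros n k; induction k as [|k IH]; [rewrite Nat.add_0_r; lra|].
    replace (n + S k)%nat with (S (n + k)) by lia.
    generalize (H (n + k)%nat) (D (n + k)%nat); lra. }
  assert (B : forall n m, a m <= a n + w / 2 ^ n).
  { intros n m; destruct (Nat.le_ge_cases n m) as [L|L].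
    - replace m with (n + (m - n))%nat by lia. generalize (M n (m - n)%nat) (Hp (n + (m - n))%nat); lra.
    - replace n with (m + (n - m))%nat by lia. generalize (M m (n - m)%nat) (Hp (m + (n - m))%nat); lra. }
  destruct (completeness (fun x => exists n, x = a n)) as [p [P1 P3]].
  - exists (a O + w / 2 ^ 0); intros x [n E]; rewrite E; apply B.
  - exists (a O), O; reflexivity.
  - exists p; intros n; split; [apply P1; exists n; reflexivity|].
    apply P3; intros x [m E]; rewrite E; apply B.
Qed.

Theorem Goursat f a b c d : a <= b -> c <= d ->
  (forall z, rect a b c d z -> exists l, cd f z l) -> J f a b c d = 0.
Proof.
  intros Hab Hcd Hf.
  set (w := b - a); set (h := d - c).
  assert (Hw : 0 <= w) by (unfold w; lra). assert (Hh : 0 <= h) by (unfold h; lra).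
  replace b with (a + w) in * by (unfold w; ring). replace d with (c + h) in * by (unfold h; ring).
  clearbody w h; clear Hab Hcd.
  assert (Hc : forall z, rect a (a + w) c (c + h) z -> @cont C_UniformSpace f z).
  { intros z Hz; destruct (Hf z Hz) as [l Hl]; eapply cd_cont, Hl. }
  assert (P2 : forall n, 0 < 2 ^ n) by (intros; apply pow_lt; lra).
  assert (Hp : forall n v, 0 <= v -> 0 <= v / 2 ^ n) by (intros; apply Rdiv_le_0_compat; [lra|apply P2]).
  assert (D : forall n v, v / 2 ^ S n = (v / 2 ^ n) / 2).
  { intros n v; simpl; field; apply Rgt_not_eq, P2. }
  (* The invariant keeps every subrectangle inside the original one; where it fails [step] is
     vacuous, which makes the choice function [nxt] total. *)
  pose (good := fun (n : nat) (p : R * R) =>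
    a <= fst p /\ fst p + w / 2 ^ n <= a + w /\ c <= snd p /\ snd p + h / 2 ^ n <= c + h).
  pose (Jn := fun (n : nat) (p : R * R) => Cmod (J f (fst p) (fst p + w / 2 ^ n) (snd p) (snd p + h / 2 ^ n))).
  assert (step : forall n p, exists q, good n p -> good (S n) q /\ Jn n p <= 4 * Jn (S n) q /\
     fst p <= fst q <= fst p + w / 2 ^ (S n) /\ snd p <= snd q <= snd p + h / 2 ^ (S n)).
  { intros n p; destruct (classic (good n p)) as [G|G]; [|exists p; tauto].
    destruct (J_quarter f (fst p) (snd p) (w / 2 ^ n) (h / 2 ^ n)) as [a' [c' [A [B Q]]]]; auto.
    - intros z [Z1 Z2]; apply Hc; unfold good in G; split; lra.
    - exists (a', c'); intros _; unfold Jn, good in *; simpl fst; simpl snd; rewrite !D; repeat split; lra. }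
  pose (nxt := fun n p => proj1_sig (constructive_indefinite_description _ (step n p))).
  pose (u := fix u n := match n with O => (a, c) | S k => nxt k (u k) end).
  assert (G0 : good O (u O)) by (unfold good, u; simpl; unfold Rdiv; rewrite Rinv_1; lra).
  assert (U : forall n, good n (u n)).
  { induction n as [|n IH]; [exact G0|]. simpl; unfold nxt.
    destruct (constructive_indefinite_description _ (step n (u n))) as [q Hq]; simpl; apply Hq, IH. }
  assert (V : forall n, Jn n (u n) <= 4 * Jn (S n) (u (S n)) /\
     fst (u n) <= fst (u (S n)) <= fst (u n) + w / 2 ^ (S n) /\
     snd (u n) <= snd (u (S n)) <= snd (u n) + h / 2 ^ (S n)).
  { intros n; change (u (S n)) with (nxt n (u n)); unfold nxt.
    destruct (constructive_indefinite_description _ (step n (u n))) as [q Hq]; simpl; apply Hq, U. }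
  assert (JJ : forall n, Jn O (u O) <= 4 ^ n * Jn n (u n)).
  { induction n as [|n IH]; [simpl; lra|]. destruct (V n) as [A _].
    simpl pow; assert (0 < 4 ^ n) by (apply pow_lt; lra). nra. }
  destruct (nested_point (fun n => fst (u n)) w Hw) as [p1 Hp1]; [intros; apply V|].
  destruct (nested_point (fun n => snd (u n)) h Hh) as [p2 Hp2]; [intros; apply V|].
  cbv beta in Hp1, Hp2.
  assert (Hz : rect a (a + w) c (c + h) (p1, p2)).
  { generalize (Hp1 O) (Hp2 O); unfold u; simpl; unfold Rdiv; rewrite Rinv_1; intros; split; simpl; lra. }
  destruct (Hf _ Hz) as [l Hl].
  (* The affine approximation [g] at the nested point has zero integral, so stage [n] contributes at
     most [e] times a perimeter times a diameter, of order [4 ^ (- n)], against the factor [4 ^ n]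
     from quartering. *)
  assert (Fin : forall e, 0 < e -> Cmod (J f a (a + w) c (c + h)) <= e * (2 * (w + h) * (w + h))).
  { intros e He.
    destruct (proj1 (cd_eps f (p1, p2) l) Hl e He) as [del [Hd Q]].
    assert (L : is_lim_seq (fun n => (w + h) * (/ 2) ^ n) 0).
    { replace (Finite 0) with (Rbar_mult (w + h) 0) by (simpl; f_equal; ring).
      apply is_lim_seq_scal_l, is_lim_seq_geom; rewrite Rabs_pos_eq; lra. }
    apply is_lim_seq_spec in L; destruct (L (mkposreal del Hd)) as [n Hn].
    specialize (Hn n (le_n _)); simpl in Hn.
    assert (I2 : (/ 2) ^ n = / 2 ^ n) by (apply pow_inv).
    rewrite I2, Rminus_0_r in Hn. apply Rabs_def2 in Hn; destruct Hn as [Hn _].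
    assert (Gn := U n); unfold good in Gn.
    generalize (Hp1 n) (Hp2 n); intros Q1 Q2.
    set (wn := w / 2 ^ n) in *; set (hn := h / 2 ^ n) in *.
    assert (Hwn : 0 <= wn) by (apply Hp, Hw). assert (Hhn : 0 <= hn) by (apply Hp, Hh).
    assert (Ewh : wn + hn < del) by (unfold wn, hn, Rdiv; lra).
    set (A := fst (u n)) in *; set (B := snd (u n)) in *.
    pose (g := fun z : C => (f (p1, p2) + l * (z - (p1, p2)))%C).
    assert (Hg : forall z, @cont C_UniformSpace g z).
    { intros z; unfold g; apply cont_plus; [apply (cont_const (U:=C_UniformSpace))|].
      apply cont_mult; [apply (cont_const (U:=C_UniformSpace))|].
      apply cont_minus; [apply cont_id|apply (cont_const (U:=C_UniformSpace))]. }
    assert (Jg : J g A (A + wn) B (B + hn) = 0).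
    { apply (J_primitive (fun z => f (p1, p2) * z + l * / 2 * ((z - (p1, p2)) * (z - (p1, p2))))%C); [|exact Hg].
      intros z. eapply cd_eq.
      - apply cd_plus.
        + apply cd_mult; [apply cd_const|apply cd_id].
        + apply cd_mult; [apply cd_const|apply cd_mult];
          (apply cd_minus; [apply cd_id|apply cd_const]).
      - unfold g; cbv beta. field. }
    assert (Jb : Jn n (u n) <= 2 * (e * (wn + hn)) * (wn + hn)).
    { unfold Jn; fold A B wn hn.
      replace (J f A (A + wn) B (B + hn)) with (J (fun z => f z - g z)%C A (A + wn) B (B + hn)).
      2: { rewrite J_minus; [rewrite Jg; ring|lra|lra| |intros; apply Hg].
           intros z [Z1 Z2]; apply Hc; split; lra. }
      replace (wn + hn) with (A + wn - A + (B + hn - B)) at 2 by ring.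
      apply J_bound; [lra|lra| |].
      - intros z [Z1 Z2]; apply cont_minus; [apply Hc; split; lra|apply Hg].
      - intros z [Z1 Z2].
        assert (Dz : Cmod (z - (p1, p2)) <= wn + hn).
        { eapply Rle_trans; [apply Cmod_le_parts|].
          unfold Cminus, Cplus, Copp, Re, Im in *; simpl in *.
          apply Rplus_le_compat; apply Rabs_le; lra. }
        unfold g; replace (f z - (f (p1, p2) + l * (z - (p1, p2))))%C
          with (f z - f (p1, p2) - l * (z - (p1, p2)))%C by ring.
        eapply Rle_trans; [apply Q; lra|]. apply Rmult_le_compat_l; lra. }
    generalize (JJ n). unfold Jn at 1, u at 1 2 3 4; simpl fst; simpl snd.
    replace (a + w / 2 ^ 0) with (a + w) by (simpl; field).
    replace (c + h / 2 ^ 0) with (c + h) by (simpl; field).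
    intros JJn; eapply Rle_trans; [exact JJn|].
    eapply Rle_trans; [apply Rmult_le_compat_l; [apply pow_le; lra|exact Jb]|].
    right; unfold wn, hn; replace 4 with (2 * 2) by ring; rewrite Rpow_mult_distr; field.
    apply Rgt_not_eq, P2. }
  apply Cmod_eq_0, Rle_antisym; [|apply Cmod_ge_0].
  apply Rnot_lt_le; intros Pos.
  set (X := Cmod (J f a (a + w) c (c + h))) in *; set (Y := 2 * (w + h) * (w + h)) in *.
  assert (HY : 0 <= Y) by (unfold Y; nra).
  (* The summand 1 in the denominator admits a degenerate rectangle, with [Y = 0]. *)
  assert (He : 0 < X / (2 * (Y + 1))) by (apply Rdiv_lt_0_compat; lra).
  specialize (Fin _ He).
  assert (X / (2 * (Y + 1)) * Y <= X / 2).
  { apply Rmult_le_reg_r with (2 * (Y + 1)); [lra|].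
    replace (X / (2 * (Y + 1)) * Y * (2 * (Y + 1))) with (X * Y) by (field; lra).
    replace (X / 2 * (2 * (Y + 1))) with (X * (Y + 1)) by field. nra. }
  lra.
Qed.

(** * Cauchy's formula on circles *)

(** A Lebesgue number argument: local thresholds are replaced by a single one, because [Phi] is
    monotone in it. Most later compactness arguments take this form. *)
Lemma box_compact (a b c d : R) (Phi : R -> C -> Prop) :
  (forall e e' z, e' <= e -> Phi e z -> Phi e' z) ->
  (forall z, rect a b c d z -> exists e, 0 < e /\
     forall w, rect a b c d w -> Cmod (w - z) < e -> Phi e w) ->
  exists e, 0 < e /\ forall w, rect a b c d w -> Phi e w.
Proof.
  intros Mono H.
  (* The radius is [2 * e] because the covering theorem gives closeness below [e] in each
     coordinate. *)
  assert (H' : forall x y, exists e : posreal, rect a b c d (x, y) ->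
     forall w, rect a b c d w -> Cmod (w - (x, y)) < 2 * e -> Phi e w).
  { intros x y; destruct (classic (rect a b c d (x, y))) as [D|D].
    - destruct (H _ D) as [e [He P]]. assert (He2 : 0 < e / 2) by lra.
      exists (mkposreal _ He2); simpl; intros _ w Hw L; apply (Mono e); [lra|apply P; [exact Hw|lra]].
    - exists (mkposreal 1 Rlt_0_1); tauto. }
  pose (del := fun x y => proj1_sig (constructive_indefinite_description _ (H' x y))).
  destruct (compactness_value_2d a b c d del) as [e He].
  exists e; split; [apply cond_pos|]; intros w [W1 W2]; apply NNPP; intros N.
  apply (He (Re w) (Im w) W1 W2); intros [u [v [Hu [Hv [Lu [Lv Le]]]]]]; apply N.
  revert Lu Lv Le; unfold del.
  destruct (constructive_indefinite_description _ (H' u v)) as [e' P]; simpl; intros Lu Lv Le.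
  apply (Mono e'); [exact Le|]. apply P; [split; assumption|split; assumption|].
  eapply Rle_lt_trans; [apply Cmod_le_parts|].
  unfold Cminus, Cplus, Copp, Re, Im in *; simpl in *; unfold Rminus in *; lra.
Qed.

Lemma cd_ext_loc f g z l : (exists d, 0 < d /\ forall w, Cmod (w - z) < d -> f w = g w) ->
  cd f z l -> cd g z l.
Proof.
  intros [d [Hd E]] H; apply cd_eps; intros e He.
  destruct (proj1 (cd_eps f z l) H e He) as [d' [Hd' P]].
  exists (Rmin d d'); split; [apply Rmin_pos; auto|]; intros w Hw.
  rewrite <- !E.
  - apply P; eapply Rlt_le_trans; [exact Hw|apply Rmin_r].
  - replace (z - z)%C with (RtoC 0) by ring; rewrite Cmod_0; exact Hd.
  - eapply Rlt_le_trans; [exact Hw|apply Rmin_l].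
Qed.

Lemma cd_unique f z l m : cd f z l -> cd f z m -> l = m.
Proof.
  intros A B; apply cd_is_derive, is_C_derive_unique in A; apply cd_is_derive, is_C_derive_unique in B.
  congruence.
Qed.

Lemma Cinv_cont (z : C) : z <> 0 -> @cont C_UniformSpace Cinv z.
Proof.
  intros Hz; apply cont_C_eps; intros e He.
  apply Cmod_gt_0 in Hz; set (m := Cmod z) in *.
  exists (Rmin (m / 2) (e * (m * m) / 4)); split.
  { apply Rmin_pos; [lra|]. apply Rdiv_lt_0_compat; [|lra]. apply Rmult_lt_0_compat; [lra|nra]. }
  intros w Hw.
  assert (Hw1 := Rlt_le_trans _ _ _ Hw (Rmin_l _ _)); assert (Hw2 := Rlt_le_trans _ _ _ Hw (Rmin_r _ _)).
  assert (Mw : m / 2 < Cmod w).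
  { generalize (Cmod_triangle_inv z w); rewrite Cmod_minus_sym; fold m; lra. }
  assert (W0 : w <> 0) by (apply Cmod_gt_0; lra). assert (Z0 : z <> 0) by (apply Cmod_gt_0; exact Hz).
  replace (/ w - / z)%C with ((z - w) / (w * z))%C by (field; auto).
  rewrite Cmod_div by (apply Cmult_neq_0; auto); rewrite Cmod_mult, Cmod_minus_sym; fold m.
  apply Rmult_lt_reg_r with (Cmod w * m); [nra|].
  unfold Rdiv; rewrite Rmult_assoc, Rinv_l by nra. rewrite Rmult_1_r.
  assert (e * (m / 2 * m) < e * (Cmod w * m)) by (apply Rmult_lt_compat_l; nra). nra.
Qed.

Lemma cd_inv (z : C) : z <> 0 -> cd Cinv z (- / (z * z))%C.
Proof.
  intros Hz.
  (* The factorization must also hold at [w = 0], where [/ 0 = 0]; this dictates the value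
     [/ (z * z)]. *)
  pose (f := fun w : C => if excluded_middle_informative (w = 0) then (/ (z * z))%C else (- / (z * w))%C).
  exists f; split; [|split].
  - assert (C1 : @cont C_UniformSpace (fun w => - / (z * w))%C z).
    { apply (cont_opp (U := C_UniformSpace)).
      apply (cont_comp_C (U := C_UniformSpace) (fun w => z * w)%C Cinv).
      - apply (cont_mult (U := C_UniformSpace) (fun _ => z) (fun w => w)); [apply (cont_const (U := C_UniformSpace))|apply cont_id].
      - apply Cinv_cont, Cmult_neq_0; assumption. }
    apply cont_C_eps; intros e He; destruct (proj1 (cont_C_eps _ _) C1 e He) as [d [Hd P]].
    assert (M := proj1 (Cmod_gt_0 z) Hz).
    exists (Rmin d (Cmod z)); split; [apply Rmin_pos; auto|]; intros w Hw.
    assert (W0 : w <> 0).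
    { intros E; subst w; apply (Rlt_irrefl (Cmod z)).
      eapply Rle_lt_trans; [|eapply Rlt_le_trans; [exact Hw|apply Rmin_r]].
      rewrite Cmod_minus_sym; right; f_equal; ring. }
    unfold f; destruct (excluded_middle_informative (w = 0)); [tauto|].
    destruct (excluded_middle_informative (z = 0)); [tauto|].
    apply P; eapply Rlt_le_trans; [exact Hw|apply Rmin_l].
  - unfold f; destruct (excluded_middle_informative (z = 0)); [tauto|reflexivity].
  - refine (fun w : C => _); unfold f; destruct (excluded_middle_informative (w = 0)) as [E|E].
    + subst w; replace (/ 0)%C with (RtoC 0).
      * change (@eq C 0 (/ z + / (z * z) * (0 - z))%C); field; exact Hz.
      * unfold Cinv, RtoC; simpl; f_equal; unfold Rdiv; ring.
    + change (@eq C (/ w)%C (/ z + - / (z * w) * (w - z))%C); field; auto.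
Qed.

Definition cis (t : R) : C := (cos t, sin t).

Lemma Cmod_cis t : Cmod (cis t) = 1.
Proof.
  unfold Cmod, cis; simpl; rewrite !Rmult_1_r; fold (Rsqr (cos t)) (Rsqr (sin t)).
  rewrite Rplus_comm, sin2_cos2; apply sqrt_1.
Qed.

Lemma rd_cis t : rd cis t (Ci * cis t).
Proof.
  apply rd_parts; split.
  - replace (Re (Ci * cis t)) with (- sin t) by (unfold Ci, cis, Cmult, Re; simpl; ring).
    apply is_derive_cos.
  - replace (Im (Ci * cis t)) with (cos t) by (unfold Ci, cis, Cmult, Im; simpl; ring).
    apply is_derive_sin.
Qed.

Lemma cont_cis t : @cont R_UniformSpace cis t.
Proof. eapply rd_cont, rd_cis. Qed.

Lemma cis_period : cis (2 * PI) = cis 0.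
Proof. unfold cis; rewrite cos_2PI, sin_2PI, cos_0, sin_0; reflexivity. Qed.

Lemma PI2_pos : 0 < 2 * PI. Proof. generalize PI_RGT_0; lra. Qed.

(** Differentiation under the integral sign, stated for [dv] so that the parameter can be a real
    radius or a complex centre. *)
Lemma dv_Cint {U : UniformSpace} (e : U -> C) (h : U -> R -> C) (x : U) (k : R -> C) a b : a < b ->
  (forall y, e y = e x -> h y = h x) -> locally x (fun y => exC (h y) a b) -> exC k a b ->
  (forall eps, 0 < eps -> locally x (fun y => forall t, a <= t <= b ->
     Cmod (h y t - h x t - k t * (e y - e x)) <= eps * Cmod (e y - e x))) ->
  dv e (fun y => Cint (h y) a b) x (Cint k a b).
Proof.
  intros Hab Hinj Hh Hk H; apply dv_of_eps.
  - intros y E; rewrite (Hinj y E); reflexivity.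
  - intros eps He.
    assert (He' : 0 < eps / (b - a)) by (apply Rdiv_lt_0_compat; lra).
    generalize (filter_and _ _ Hh (H _ He')); apply filter_imp; intros y [Ey P].
    assert (Ex := locally_singleton _ _ Hh); cbv beta in Ex.
    rewrite (Cmult_comm (Cint k a b)), <- Cint_scal, <- Cint_minus by assumption.
    assert (E1 := exC_minus _ _ _ _ Ey Ex); assert (E2 := exC_scal (e y - e x)%C _ _ _ Hk).
    rewrite <- (Cint_minus _ _ _ _ E1 E2).
    eapply Rle_trans; [apply (Cint_bound _ a b (eps / (b - a) * Cmod (e y - e x)))|].
    + exact (exC_minus _ _ _ _ E1 E2).
    + rewrite Rmin_left, Rmax_right by lra; intros t Ht.
      rewrite (Cmult_comm (e y - e x)); apply P, Ht.
    + rewrite Rabs_pos_eq by lra; right; field; lra.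
Qed.

(* [K] is compact: bounded, with open complement. *)
Lemma uniform_derivative (K O : C -> Prop) (H h : C -> C) (R0 : R) :
  (forall z, K z -> Cmod z <= R0) ->
  (forall z, ~ K z -> exists e, 0 < e /\ forall w, Cmod (w - z) < e -> ~ K w) ->
  (forall z, K z -> exists e, 0 < e /\ forall w, Cmod (w - z) < e -> O w) ->
  (forall z, O z -> cd H z (h z)) -> (forall z, O z -> @cont C_UniformSpace h z) ->
  forall eps, 0 < eps -> exists d, 0 < d /\ forall z, K z -> forall w, Cmod (w - z) < d ->
    O w /\ Cmod (H w - H z - h z * (w - z)) <= eps * Cmod (w - z).
Proof.
  intros KB KC KO HH Hh eps He.
  destruct (box_compact (- R0) R0 (- R0) R0 (fun d z => K z -> forall w, Cmod (w - z) < d ->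
    O w /\ Cmod (H w - H z - h z * (w - z)) <= eps * Cmod (w - z))) as [d [Hd P]].
  - intros e e' z Le P Kz w Hw; apply P; [exact Kz|lra].
  - intros z _; destruct (classic (K z)) as [Kz|Kz].
    + destruct (KO z Kz) as [d1 [Hd1 P1]].
      assert (Oz : O z).
      { apply P1; replace (z - z)%C with (RtoC 0) by ring; rewrite Cmod_0; exact Hd1. }
      assert (He2 : 0 < eps / 2) by lra.
      destruct (proj1 (cont_C_eps _ _) (Hh z Oz) _ He2) as [d2 [Hd2 P2]].
      assert (M1 := Rmin_l d1 d2); assert (M2 := Rmin_r d1 d2); assert (M0 := Rmin_pos _ _ Hd1 Hd2).
      set (d := Rmin d1 d2) in *.
      exists (d / 2); split; [lra|]; intros v _ Hv Kv w Hw.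
      assert (Near : forall u, Cmod (u - v) < d / 2 -> Cmod (u - z) < d).
      { intros u Hu; generalize (Cmod_le_via u v z); lra. }
      assert (Nv : forall u, Cmod (u - v) < d / 2 -> O u).
      { intros u Hu; apply P1; generalize (Near u Hu); lra. }
      split; [apply Nv, Hw|].
      (* With the linear part removed, the mean value inequality bounds the remainder by the
         oscillation of [h], which is at most [eps] because [h] stays within [eps / 2] of [h z] on
         the segment. *)
      replace (H w - H v - h v * (w - v))%C with ((H w - h v * w) - (H v - h v * v))%C by ring.
      assert (Seg : forall t, 0 <= t <= 1 -> Cmod (v + RtoC t * (w - v) - v) < d / 2).
      { intros t Ht; replace (v + RtoC t * (w - v) - v)%C with (RtoC t * (w - v))%C by ring.
        rewrite Cmod_mult, Cmod_R, Rabs_pos_eq by lra.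
        generalize (Cmod_ge_0 (w - v)); nra. }
      apply (cd_mean_value (fun u => H u - h v * u)%C (fun u => h u - h v)%C).
      * intros t Ht; eapply cd_eq.
        -- apply cd_minus; [apply HH, Nv, Seg, Ht|].
           apply cd_mult; [apply cd_const|apply cd_id].
        -- cbv beta; ring.
      * intros t Ht. generalize (P2 v ltac:(lra)) (P2 (v + RtoC t * (w - v))%C ltac:(generalize (Near _ (Seg t Ht)); lra)).
        generalize (Cmod_le_via (h (v + RtoC t * (w - v))%C) (h z) (h v)).
        rewrite (Cmod_minus_sym (h z) (h v)); lra.
    + destruct (KC z Kz) as [e [He' P]]; exists e; split; [exact He'|].
      intros w _ Hw Kw; destruct (P w Hw Kw).
  - exists d; split; [exact Hd|]; intros z Kz; apply P; [|exact Kz].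
    generalize (KB z Kz) (re_le_Cmod z) (im_le_Cmod z); intros.
    split; apply Rabs_le_between; lra.
Qed.

Lemma circle_closed (c : C) (r : R) z : Cmod (z - c) <> r ->
  exists e, 0 < e /\ forall w, Cmod (w - z) < e -> Cmod (w - c) <> r.
Proof.
  intros N; exists (Rabs (Cmod (z - c) - r)); split; [apply Rabs_pos_lt; lra|].
  intros w Hw E.
  generalize (Cmod_le_via w z c) (Cmod_le_via z w c); rewrite (Cmod_minus_sym z w).
  unfold Rabs in Hw; destruct (Rcase_abs _); lra.
Qed.

Lemma Cmod_circle c r t : 0 <= r -> Cmod (c + RtoC r * cis t - c) = r.
Proof.
  intros Hr; replace (c + RtoC r * cis t - c)%C with (RtoC r * cis t)%C by ring.
  rewrite Cmod_mult, Cmod_cis, Cmod_R, Rabs_pos_eq by lra; ring.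
Qed.

Lemma cont_circle (f : C -> C) c r t : @cont C_UniformSpace f (c + RtoC r * cis t)%C ->
  @cont R_UniformSpace (fun t => f (c + RtoC r * cis t)%C) t.
Proof.
  intros Hf; apply (cont_comp_C (U := R_UniformSpace) (fun t => c + RtoC r * cis t)%C f); [|exact Hf].
  apply cont_plus; [apply cont_const|apply cont_mult; [apply cont_const|apply cont_cis]].
Qed.

(* The radial derivative of [H (c + s e^{it})] is [1/(is)] times its angular derivative,
   so its circular mean does not depend on the radius. *)
Theorem circle_mean (c : C) (rho : R) (H h : C -> C) :
  @cont C_UniformSpace H c ->
  (forall z, 0 < Cmod (z - c) < rho -> cd H z (h z)) ->
  (forall z, 0 < Cmod (z - c) < rho -> @cont C_UniformSpace h z) ->
  forall r, 0 < r < rho -> Cint (fun t => H (c + RtoC r * cis t)%C) 0 (2 * PI) = (RtoC (2 * PI) * H c)%C.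
Proof.
  intros Hc HH Hh.
  assert (HcH : forall z, 0 < Cmod (z - c) < rho -> @cont C_UniformSpace H z) by (intros; eapply cd_cont, HH; auto).
  assert (PP := PI2_pos).
  assert (ExH : forall s, 0 < s < rho -> exC (fun t => H (c + RtoC s * cis t)%C) 0 (2 * PI)).
  { intros s Hs; apply exC_cont; intros t _; apply (cont_circle H); apply HcH; rewrite Cmod_circle; lra. }
  pose (phi := fun s => Cint (fun t => H (c + RtoC s * cis t)%C) 0 (2 * PI)).
  assert (D0 : forall s, 0 < s < rho -> rd phi s 0).
  { intros s Hs.
    assert (Hck : forall t, @cont R_UniformSpace (fun t => h (c + RtoC s * cis t) * cis t)%C t).
    { intros t; apply cont_mult; [apply (cont_circle h), Hh; rewrite Cmod_circle; lra|apply cont_cis]. }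
    assert (Ek : exC (fun t => h (c + RtoC s * cis t) * cis t)%C 0 (2 * PI)) by (apply exC_cont; intros; apply Hck).
    (* Up to the factor [i s], this is the integral of an angular derivative over a full period. *)
    assert (Z : Cint (fun t => h (c + RtoC s * cis t) * cis t)%C 0 (2 * PI) = 0).
    { assert (F := Cint_FTC (fun t => H (c + RtoC s * cis t))%C (fun t => (Ci * RtoC s) * (h (c + RtoC s * cis t) * cis t))%C 0 (2 * PI)).
      rewrite Cint_scal, cis_period in F by exact Ek.
      set (X := Cint (fun t => (h (c + RtoC s * cis t) * cis t)%C) 0 (2 * PI)) in *.
      assert (E : (Ci * RtoC s * X)%C = 0).
      { rewrite F; [ring| |].
        - intros t _; eapply rd_eq; [apply (rd_comp (fun t => c + RtoC s * cis t)%C H)|].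
          + apply dv_plus; [apply dv_const|apply rd_mult; [apply dv_const|apply rd_cis]].
          + apply HH; rewrite Cmod_circle; lra.
          + cbv beta; ring.
        - intros t _; apply (cont_mult (U := R_UniformSpace) (fun _ => _)); [apply cont_const|apply Hck]. }
      replace X with (/ (Ci * RtoC s) * (Ci * RtoC s * X))%C.
      - rewrite E; ring.
      - field; split.
        + intros Q; apply (f_equal Re) in Q; unfold RtoC, Re in Q; simpl in Q; lra.
        + intros Q; apply (f_equal Im) in Q; unfold RtoC, Ci, Im in Q; simpl in Q; lra. }
    rewrite <- Z; apply dv_Cint; [lra| | |exact Ek|].
    - intros y E; apply (f_equal Re) in E; unfold RtoC, Re in E; simpl in E; rewrite E; reflexivity.
    - apply locally_R_eps; exists (Rmin s (rho - s)); split; [apply Rmin_pos; lra|]; intros y Hy.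
      apply ExH; generalize (Rmin_l s (rho - s)) (Rmin_r s (rho - s)); apply Rabs_def2 in Hy; lra.
    - intros eps He; apply locally_R_eps.
      destruct (uniform_derivative (fun z => Cmod (z - c) = s) (fun z => 0 < Cmod (z - c) < rho) H h (Cmod c + s))
        with (eps := eps) as [d [Hd P]]; auto.
      + intros z Kz; generalize (Cmod_triangle_inv z c); lra.
      + apply circle_closed.
      + intros z Kz; exists (Rmin s (rho - s)); split; [apply Rmin_pos; lra|]; intros w Hw.
        generalize (Rmin_l s (rho - s)) (Rmin_r s (rho - s)) (Cmod_le_via w z c) (Cmod_le_via z w c).
        rewrite (Cmod_minus_sym z w); lra.
      + exists d; split; [exact Hd|]; intros y Hy t Ht.
        assert (Ed : (c + RtoC y * cis t - (c + RtoC s * cis t))%C = ((RtoC y - RtoC s) * cis t)%C) by ring.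
        destruct (P (c + RtoC s * cis t)%C ltac:(apply Cmod_circle; lra) (c + RtoC y * cis t)%C) as [_ Q].
        * rewrite Ed, Cmod_mult, Cmod_cis, RtoC_minus', Cmod_R; lra.
        * rewrite Ed, Cmod_mult, Cmod_cis, Rmult_1_r in Q.
          replace (h (c + RtoC s * cis t) * cis t * (RtoC y - RtoC s))%C with
            (h (c + RtoC s * cis t) * ((RtoC y - RtoC s) * cis t))%C by ring; exact Q. }
  assert (Const : forall s r, 0 < s -> s <= r -> r < rho -> phi r = phi s).
  { intros s r Hs Hsr Hr.
    assert (B := rd_mean_value phi (fun _ => RtoC 0) s r 0 Hsr).
    rewrite Rmult_0_l in B.
    assert (E : (phi r - phi s)%C = 0).
    { apply Cmod_eq_0, Rle_antisym; [|apply Cmod_ge_0]; apply B; intros; [apply D0; lra|rewrite Cmod_0; lra]. }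
    replace (phi r) with (phi r - phi s + phi s)%C by ring; rewrite E; ring. }
  intros r Hr; change (phi r = (RtoC (2 * PI) * H c)%C).
  assert (E : (phi r - RtoC (2 * PI) * H c)%C = 0).
  { apply Cmod_eq_0, Rle_antisym; [|apply Cmod_ge_0].
    apply Rnot_lt_le; intros Pos; set (X := Cmod (phi r - RtoC (2 * PI) * H c)) in *.
    assert (He : 0 < X / (4 * PI)) by (apply Rdiv_lt_0_compat; lra).
    destruct (proj1 (cont_C_eps _ _) Hc _ He) as [d [Hd P]].
    (* Since the radius does not matter, the circle may be shrunk until [H] is within [X / (4 PI)]
       of [H c]; this gives [X <= X / 2]. *)
    pose (s := Rmin r (d / 2)).
    assert (Hs : 0 < s <= r) by (unfold s; split; [apply Rmin_pos; lra|apply Rmin_l]).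
    assert (Hsd : s < d) by (unfold s; generalize (Rmin_r r (d / 2)); lra).
    assert (B : X <= X / (4 * PI) * Rabs (2 * PI - 0)).
    { set (e0 := X / (4 * PI)) in *; clearbody e0; unfold X; rewrite (Const s r) by lra.
      replace (RtoC (2 * PI) * H c)%C with (Cint (fun _ => H c) 0 (2 * PI)) by (rewrite Cint_const, Rminus_0_r; reflexivity).
      unfold phi; assert (Es : 0 < s < rho) by lra.
      rewrite <- (Cint_minus _ _ _ _ (ExH s Es) (exC_const (H c) 0 (2 * PI))).
      apply Cint_bound; [exact (exC_minus _ _ _ _ (ExH s Es) (exC_const (H c) 0 (2 * PI)))|].
      intros t _; left; apply P; rewrite Cmod_circle; lra. }
    rewrite Rminus_0_r, Rabs_pos_eq in B by lra.
    replace (X / (4 * PI) * (2 * PI)) with (X / 2) in B by (field; lra); lra. }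
  replace (phi r) with (phi r - RtoC (2 * PI) * H c + RtoC (2 * PI) * H c)%C by ring; rewrite E; ring.
Qed.

(** * Holomorphic functions on the upper half-plane *)

Definition holo (f : C -> C) : Prop := forall z, 0 < Im z -> exists l, cd f z l.

Lemma holo_cont f z : holo f -> 0 < Im z -> @cont C_UniformSpace f z.
Proof. intros H Hz; destruct (H z Hz) as [l Hl]; eapply cd_cont, Hl. Qed.

Lemma upper_open z : 0 < Im z -> forall w, Cmod (w - z) < Im z -> 0 < Im w.
Proof.
  intros Hz w Hw; generalize (im_le_Cmod (w - z));
  unfold Cminus, Cplus, Copp, Im in *; simpl; intros H.
  assert (H' := Rle_lt_trans _ _ _ H Hw); apply Rabs_def2 in H'; lra.
Qed.

Lemma J_swap_h f a b c d : exC (fun x => f (x, c)) a b -> exC (fun x => f (x, d)) a b ->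
  J f b a c d = (- J f a b c d)%C.
Proof.
  intros A B; unfold J; rewrite (Cint_swap (fun x => f (x, c)) a b A), (Cint_swap (fun x => f (x, d)) a b B); ring.
Qed.

Lemma J_swap_v f a b c d : exC (fun y => f (a, y)) c d -> exC (fun y => f (b, y)) c d ->
  J f a b d c = (- J f a b c d)%C.
Proof.
  intros A B; unfold J; rewrite (Cint_swap (fun x => f (a, x)) c d A), (Cint_swap (fun x => f (b, x)) c d B); ring.
Qed.

Theorem Morera f : (forall z, 0 < Im z -> @cont C_UniformSpace f z) ->
  (forall a b c d, a <= b -> 0 < c -> c <= d -> J f a b c d = 0) ->
  exists F, forall z, 0 < Im z -> cd F z (f z).
Proof.
  intros Hf HJ.
  assert (E1 : forall y a b, 0 < y -> exC (fun x => f (x, y)) a b).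
  { intros; apply (exC_hor f); intros; apply Hf; simpl; lra. }
  assert (E2 : forall x c d, 0 < c -> 0 < d -> exC (fun y => f (x, y)) c d).
  { intros x c d Hc Hd; apply (exC_ver f); intros; apply Hf; simpl.
    generalize (Rmin_pos c d Hc Hd); lra. }
  (* Increments of the primitive run in all directions, so the rectangle identity is needed for
     either orientation of each side. *)
  assert (HJ' : forall a b c d, 0 < c -> 0 < d -> J f a b c d = 0).
  { assert (W : forall a b c d, a <= b -> 0 < c -> 0 < d -> J f a b c d = 0).
    { intros a b c d Hab Hc Hd; destruct (Rle_dec c d); [apply HJ; auto|].
      rewrite J_swap_v by (apply E2; auto); rewrite HJ by lra; ring. }
    intros a b c d Hc Hd; destruct (Rle_dec a b); [apply W; auto|].
    rewrite J_swap_h by (apply E1; auto); rewrite W by lra; ring. }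
  (* Integration from the base point [i], first horizontally at height 1, then vertically. *)
  pose (F := fun z : C => (Cint (fun s => f (s, 1%R)) 0 (Re z) + Ci * Cint (fun t => f (Re z, t)) 1 (Im z))%C).
  exists F.
  (* The vanishing integral over the rectangle between the heights 1 and [y] moves the horizontal
     stretch from height 1 to height [y]. *)
  assert (Inc : forall x y x' y', 0 < y -> 0 < y' -> (F (x', y') - F (x, y))%C =
    (Cint (fun s => f (s, y)) x x' + Ci * Cint (fun t => f (x', t)) y y')%C).
  { intros x y x' y' Hy Hy'.
    assert (Z := HJ' x x' 1 y Rlt_0_1 Hy); unfold J in Z.
    unfold F; simpl Re; simpl Im.
    rewrite <- (Cint_Chasles (fun s => f (s, 1)) 0 x x') by (apply E1; lra).
    rewrite <- (Cint_Chasles (fun s => f (x', s)) 1 y y') by (apply E2; lra).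
    apply (f_equal (Cplus (Cint (fun s => f (s, y)) x x' + Ci * Cint (fun t => f (x', t)) y y')%C)) in Z.
    rewrite Cplus_0_r in Z; rewrite <- Z at 1; ring. }
  intros [x y] Hz; simpl in Hz; apply cd_eps; intros e He.
  assert (He2 : 0 < e / 2) by lra.
  destruct (proj1 (cont_C_eps _ _) (Hf (x, y) Hz) _ He2) as [d [Hd P]].
  exists (Rmin (d / 2) y); split; [apply Rmin_pos; lra|]; intros [x' y'] Hw.
  generalize (Rmin_l (d / 2) y) (Rmin_r (d / 2) y); intros M1 M2.
  assert (Bx : Rabs (x' - x) <= Cmod ((x', y') - (x, y))).
  { eapply Rle_trans; [|apply re_le_Cmod]; right; reflexivity. }
  assert (By : Rabs (y' - y) <= Cmod ((x', y') - (x, y))).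
  { eapply Rle_trans; [|apply im_le_Cmod]; right; reflexivity. }
  set (h := Cmod ((x', y') - (x, y))) in *.
  assert (Hy' : 0 < y') by (assert (Q := Rle_lt_trans _ _ _ By Hw); apply Rabs_def2 in Q; lra).
  rewrite Inc by assumption.
  replace (Cint (fun s => f (s, y)) x x' + Ci * Cint (fun t => f (x', t)) y y' - f (x, y) * ((x', y') - (x, y)))%C
    with ((Cint (fun s => f (s, y)) x x' - Cint (fun _ => f (x, y)) x x') +
       Ci * (Cint (fun t => f (x', t)) y y' - Cint (fun _ => f (x, y)) y y'))%C.
  2: { rewrite !Cint_const.
       replace ((x', y') - (x, y))%C with (RtoC (x' - x) + Ci * RtoC (y' - y))%C; [ring|].
       apply C_ext; unfold Cminus, Cplus, Copp, Cmult, Ci, RtoC, Re, Im; simpl; ring. }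
  rewrite <- (Cint_minus _ _ _ _ (E1 y x x' Hz) (exC_const (f (x, y)) x x')).
  rewrite <- (Cint_minus _ _ _ _ (E2 x' y y' Hz Hy') (exC_const (f (x, y)) y y')).
  eapply Rle_trans; [apply Cmod_triangle|]; rewrite Cmod_mult, Cmod_Ci, Rmult_1_l.
  assert (Near : forall u v, Rabs (u - x) <= h -> Rabs (v - y) <= h -> Cmod (f (u, v) - f (x, y)) <= e / 2).
  { intros u v Hu Hv; left; apply P; eapply Rle_lt_trans; [apply Cmod_le_parts|].
    unfold Cminus, Cplus, Copp, Re, Im; simpl; unfold Rminus in *; lra. }
  assert (Btw : forall u p q, Rmin p q <= u <= Rmax p q -> Rabs (u - p) <= Rabs (q - p)).
  { intros u p q; unfold Rmin, Rmax; destruct (Rle_dec p q); intros; unfold Rabs;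
    destruct (Rcase_abs _), (Rcase_abs _); lra. }
  assert (Z0 : Rabs (y - y) <= h) by (rewrite Rminus_diag, Rabs_R0; apply Cmod_ge_0).
  generalize (Cint_bound _ x x' (e / 2) (exC_minus _ _ _ _ (E1 y x x' Hz) (exC_const (f (x, y)) x x'))
     ltac:(intros t Ht; apply Near; [eapply Rle_trans; [apply Btw, Ht|exact Bx]|exact Z0]))
   (Cint_bound _ y y' (e / 2) (exC_minus _ _ _ _ (E2 x' y y' Hz Hy') (exC_const (f (x, y)) y y'))
     ltac:(intros t Ht; apply Near; [exact Bx|eapply Rle_trans; [apply Btw, Ht|exact By]])).
  intros I1 I2.
  assert (e / 2 * Rabs (x' - x) <= e / 2 * h) by (apply Rmult_le_compat_l; lra).
  assert (e / 2 * Rabs (y' - y) <= e / 2 * h) by (apply Rmult_le_compat_l; lra). lra.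
Qed.

Lemma cis_conj t : (cis t * Cconj (cis t))%C = 1.
Proof.
  unfold cis, Cconj, Cmult, RtoC; simpl; f_equal; [|ring].
  generalize (sin2_cos2 t); unfold Rsqr; lra.
Qed.

Lemma cis_neq_0 t : cis t <> 0.
Proof. apply Cmod_gt_0; rewrite Cmod_cis; lra. Qed.

Lemma cont_ccis t : @cont R_UniformSpace (fun t => Cconj (cis t)) t.
Proof. apply cont_conj, cont_cis. Qed.

Lemma Cint_ccis : Cint (fun t => Cconj (cis t)) 0 (2 * PI) = 0.
Proof.
  rewrite (Cint_FTC (fun t => Ci * Cconj (cis t))%C).
  - rewrite cis_period; ring.
  - intros t _; eapply rd_eq; [apply rd_mult; [apply dv_const|apply rd_conj, rd_cis]|].
    cbv beta; rewrite Cmult_conj; apply C_ext; unfold Ci, cis, Cconj, Cplus, Cmult, RtoC, Re, Im; simpl; ring.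
  - intros t _; apply cont_ccis.
Qed.

Section Cauchy.
Variables (F f : C -> C).
Hypothesis HF : forall z, 0 < Im z -> cd F z (f z).
Hypothesis Hf : forall z, 0 < Im z -> @cont C_UniformSpace f z.

Lemma circle_upper z r t : 0 < r < Im z -> 0 < Im (z + RtoC r * cis t)%C.
Proof. intros Hr; apply (upper_open z); [lra|]; rewrite Cmod_circle; lra. Qed.

Lemma exC_circle g z r : (forall w, 0 < Im w -> @cont C_UniformSpace g w) -> 0 < r < Im z ->
  exC (fun t => g (z + RtoC r * cis t) * Cconj (cis t))%C 0 (2 * PI).
Proof.
  intros Hg Hr; apply exC_cont; intros t _; apply cont_mult; [|apply cont_ccis].
  apply (cont_circle g), Hg, circle_upper, Hr.
Qed.

(* Apply the mean value property to the difference quotient of [F] at [z]. *)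
Lemma primitive_formula z r : 0 < r < Im z ->
  f z = (/ RtoC (2 * PI * r) * Cint (fun t => F (z + RtoC r * cis t) * Cconj (cis t)) 0 (2 * PI))%C.
Proof.
  intros Hr; destruct (HF z ltac:(lra)) as [phi [Hp [Ep Fp]]].
  assert (Q : forall u, u <> z -> phi u = ((F u - F z) * / (u - z))%C).
  { intros u Hu; rewrite (Fp u); field; intros E; apply Hu; replace u with (u - z + z)%C by ring; rewrite E; ring. }
  assert (HFc : forall w, 0 < Im w -> @cont C_UniformSpace F w) by (intros; eapply cd_cont, HF; auto).
  assert (N : forall u, 0 < Cmod (u - z) -> (u - z)%C <> 0) by (intros; apply Cmod_gt_0; auto).
  assert (N' : forall u, 0 < Cmod (u - z) -> u <> z).
  { intros u Hu E; apply (N u Hu); rewrite E; ring. }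
  (* [phi] is continuous at [z] but not known to be differentiable there; at the centre
     [circle_mean] asks for no more. *)
  assert (M := circle_mean z (Im z) phi (fun u => f u * / (u - z) + (F u - F z) * - / ((u - z) * (u - z)))%C Hp).
  assert (Ci_inv : forall u, 0 < Cmod (u - z) -> cd (fun u => / (u - z))%C u (- / ((u - z) * (u - z)))%C).
  { intros u Hu; eapply cd_eq; [apply (cd_comp (fun u => u - z)%C Cinv)|].
    - apply cd_minus; [apply cd_id|apply cd_const].
    - apply cd_inv, N, Hu.
    - ring. }
  rewrite <- Ep; assert (PP := PI2_pos).
  assert (R0 : (RtoC r) <> 0) by (intros E; apply (f_equal Re) in E; simpl in E; lra).
  assert (P0 : (RtoC (2 * PI)) <> 0) by (intros E; apply (f_equal Re) in E; simpl in E; lra).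
  assert (Eq1 : (RtoC r * (RtoC (2 * PI) * phi z))%C = Cint (fun t => F (z + RtoC r * cis t) * Cconj (cis t))%C 0 (2 * PI)).
  { rewrite <- (M ltac:(intros u Hu; apply (cd_ext_loc (fun u => (F u - F z) * / (u - z))%C);
       [exists (Cmod (u - z)); split; [lra|]; intros v Hv; symmetry; apply Q; intros E; subst v;
          rewrite Cmod_minus_sym in Hv; lra|]; eapply cd_eq; [apply cd_mult;
       [apply cd_minus; [apply HF, (upper_open z); lra|apply cd_const]
       |apply Ci_inv; lra]|cbv beta; ring])
      ltac:(intros u Hu; assert (Uu : 0 < Im u) by (apply (upper_open z); lra);
        assert (CI : @cont C_UniformSpace (fun u => / (u - z))%C u) by (eapply cd_cont, Ci_inv; lra);
        apply (cont_plus (U := C_UniformSpace));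
        [apply (cont_mult (U := C_UniformSpace)); [apply Hf, Uu|exact CI]|
         apply (cont_mult (U := C_UniformSpace));
          [apply (cont_minus (U := C_UniformSpace)); [apply HFc, Uu|apply (cont_const (U := C_UniformSpace))]|
           apply (cont_opp (U := C_UniformSpace)),
            (cont_comp_C (U := C_UniformSpace) (fun u => (u - z) * (u - z))%C Cinv)];
            [apply (cont_mult (U := C_UniformSpace)); (apply (cont_minus (U := C_UniformSpace));
              [apply cont_id|apply (cont_const (U := C_UniformSpace))])|
             apply Cinv_cont, Cmult_neq_0; apply N; lra]]) r Hr).
    assert (Ephi : exC (fun t => phi (z + RtoC r * cis t)%C) 0 (2 * PI)).
    { apply (exC_ext (fun t => / RtoC r * ((F (z + RtoC r * cis t) * Cconj (cis t)) - F z * Cconj (cis t)))%C).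
      - intros t _; rewrite Q by (apply N'; rewrite Cmod_circle; lra).
        assert (C0 := cis_neq_0 t).
        replace (z + RtoC r * cis t - z)%C with (RtoC r * cis t)%C by ring.
        replace (Cconj (cis t)) with (/ cis t * (cis t * Cconj (cis t)))%C by (field; exact C0).
        rewrite cis_conj; field; auto.
      - apply exC_scal, exC_minus; [apply exC_circle; auto|apply exC_scal, exC_cont; intros; apply cont_ccis]. }
    rewrite <- Cint_scal by exact Ephi.
    transitivity (Cint (fun t => F (z + RtoC r * cis t) * Cconj (cis t) - F z * Cconj (cis t))%C 0 (2 * PI)).
    - apply Cint_ext; intros t _; rewrite Q by (apply N'; rewrite Cmod_circle; lra).
      assert (C0 := cis_neq_0 t).
      replace (z + RtoC r * cis t - z)%C with (RtoC r * cis t)%C by ring.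
      replace (Cconj (cis t)) with (/ cis t * (cis t * Cconj (cis t)))%C by (field; exact C0).
      rewrite cis_conj; field; auto.
    - assert (Ec : exC (fun t => Cconj (cis t)) 0 (2 * PI)) by (apply exC_cont; intros; apply cont_ccis).
      rewrite (Cint_minus _ _ _ _ (exC_circle F z r HFc Hr) (exC_scal (F z) _ _ _ Ec)).
      rewrite (Cint_scal _ _ _ _ Ec), Cint_ccis; ring. }
  rewrite <- Eq1. rewrite RtoC_mult. field; auto.
Qed.

(** Near [z], [primitive_formula] writes [f] as an integral of [F]; differentiating this in the
    centre replaces [F] by [f] under the integral. Thus [f] is shown to be differentiable from its
    continuity and its primitive alone. *)
Lemma derivative_formula z r : 0 < r < Im z ->
  cd f z (/ RtoC (2 * PI * r) * Cint (fun t => f (z + RtoC r * cis t) * Cconj (cis t)) 0 (2 * PI))%C.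
Proof.
  intros Hr.
  assert (HFc : forall w, 0 < Im w -> @cont C_UniformSpace F w) by (intros; eapply cd_cont, HF; auto).
  assert (PP := PI2_pos).
  assert (Up : forall w, Cmod (w - z) < Im z - r -> 0 < r < Im w).
  { intros w Hw; split; [lra|]. generalize (im_le_Cmod (z - w)); rewrite Cmod_minus_sym; intros B.
    generalize (Rle_abs (Im (z - w))); unfold Cminus, Cplus, Copp, Im in *; simpl in *; lra. }
  apply (cd_ext_loc (fun w => / RtoC (2 * PI * r) * Cint (fun t => F (w + RtoC r * cis t) * Cconj (cis t)) 0 (2 * PI))%C).
  { exists (Im z - r); split; [lra|]; intros w Hw; symmetry; apply primitive_formula, Up, Hw. }
  eapply cd_eq; [apply cd_mult; [apply cd_const|]|cbv beta; rewrite Cmult_0_l, Cplus_0_l; reflexivity].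
  apply (dv_Cint (U := C_UniformSpace) (fun w => w) (fun w t => F (w + RtoC r * cis t) * Cconj (cis t))%C z); [lra| | | |].
  - intros y E; rewrite E; reflexivity.
  - apply locally_C_eps; exists (Im z - r); split; [lra|]; intros w Hw; apply exC_circle; [exact HFc|apply Up, Hw].
  - apply exC_circle; auto.
  - intros eps He; apply locally_C_eps.
    destruct (uniform_derivative (fun u => Cmod (u - z) = r) (fun u => 0 < Im u) F f (Cmod z + r))
      with (eps := eps) as [d [Hd P]]; auto.
    + intros u Ku; generalize (Cmod_triangle_inv u z); lra.
    + apply circle_closed.
    + intros u Ku; assert (Uu : 0 < Im u) by (apply (upper_open z); lra).
      exists (Im u); split; [exact Uu|]; intros w Hw; apply (upper_open u); auto.
    + exists d; split; [exact Hd|]; intros w Hw t _.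
      assert (Ed : (w + RtoC r * cis t - (z + RtoC r * cis t))%C = (w - z)%C) by ring.
      destruct (P (z + RtoC r * cis t)%C ltac:(apply Cmod_circle; lra) (w + RtoC r * cis t)%C) as [_ Q].
      * rewrite Ed; exact Hw.
      * rewrite Ed in Q.
        replace (F (w + r * cis t) * Cconj (cis t) - F (z + r * cis t) * Cconj (cis t) -
          f (z + r * cis t) * Cconj (cis t) * (w - z))%C with
          (Cconj (cis t) * (F (w + r * cis t) - F (z + r * cis t) - f (z + r * cis t) * (w - z)))%C by ring.
        rewrite Cmod_mult, Cmod_conj, Cmod_cis, Rmult_1_l; exact Q.
Qed.

End Cauchy.

Lemma holo_primitive f : holo f -> exists F, forall z, 0 < Im z -> cd F z (f z).
Proof.
  intros H; apply Morera; [intros; apply holo_cont; auto|].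
  intros a b c d Hab Hc Hcd; apply Goursat; auto; intros z [_ Hz]; apply H; lra.
Qed.

Lemma holo_formula f z r : holo f -> 0 < r < Im z ->
  cd f z (/ RtoC (2 * PI * r) * Cint (fun t => f (z + RtoC r * cis t) * Cconj (cis t)) 0 (2 * PI))%C.
Proof.
  intros H Hr; destruct (holo_primitive f H) as [F HF].
  apply (derivative_formula F f); auto; intros; apply holo_cont; auto.
Qed.

Lemma Cauchy_estimate f z l r K : holo f -> cd f z l -> 0 < r < Im z ->
  (forall w, Cmod (w - z) = r -> Cmod (f w) <= K) -> Cmod l <= K / r.
Proof.
  intros H Hl Hr HK; rewrite (cd_unique _ _ _ _ Hl (holo_formula f z r H Hr)).
  assert (PP := PI2_pos).
  assert (P0 : 0 < 2 * PI * r) by (apply Rmult_lt_0_compat; lra).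
  rewrite Cmod_mult, Cmod_inv by (intros E; apply (f_equal Re) in E; simpl in E; lra).
  rewrite Cmod_R, Rabs_pos_eq by lra.
  apply Rmult_le_reg_l with (2 * PI * r); [exact P0|].
  rewrite <- Rmult_assoc, Rinv_r, Rmult_1_l by lra.
  replace (2 * PI * r * (K / r)) with (K * Rabs (2 * PI - 0)) by (rewrite Rabs_pos_eq by lra; field; lra).
  apply Cint_bound.
  - apply (exC_circle f); [intros; apply holo_cont; auto|exact Hr].
  - intros t _; rewrite Cmod_mult, Cmod_conj, Cmod_cis, Rmult_1_r; apply HK, Cmod_circle; lra.
Qed.

(** One radius serves in [holo_formula] for all centres near [z], so a difference of derivatives is
    an integral of increments of [f], controlled by uniform continuity along one circle. *)
Lemma holo_derivative_cont f D : holo f -> (forall z, 0 < Im z -> cd f z (D z)) ->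
  forall z, 0 < Im z -> @cont C_UniformSpace D z.
Proof.
  intros H HD z Hz; apply cont_C_eps; intros e He.
  set (r := Im z / 2); assert (Hr : 0 < r < Im z) by (unfold r; lra).
  assert (PP := PI2_pos).
  assert (He' : 0 < e * r / 2) by (apply Rdiv_lt_0_compat; [apply Rmult_lt_0_compat; lra|lra]).
  destruct (box_compact (- (Cmod z + r)) (Cmod z + r) (- (Cmod z + r)) (Cmod z + r)
    (fun d u => Cmod (u - z) = r -> forall v, Cmod (v - u) < d -> Cmod (f v - f u) <= e * r / 2)) as [d [Hd P]].
  - intros a b u Hab Hu Ku v Hv; apply Hu; [exact Ku|lra].
  - intros u _; destruct (classic (Cmod (u - z) = r)) as [Ku|Ku].
    + assert (Uu : 0 < Im u) by (apply (upper_open z); lra).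
      destruct (proj1 (cont_C_eps _ _) (holo_cont f u H Uu) (e * r / 4) ltac:(lra)) as [d [Hd P]].
      exists (d / 2); split; [lra|]; intros w _ Hw _ v Hv.
      generalize (P v ltac:(generalize (Cmod_le_via v w u); lra)) (P w ltac:(lra)) (Cmod_le_via (f v) (f u) (f w)).
      rewrite (Cmod_minus_sym (f u) (f w)); lra.
    + destruct (circle_closed z r u Ku) as [d [Hd Q]]; exists d; split; [exact Hd|].
      intros w _ Hw Kw; destruct (Q w Hw Kw).
  - exists (Rmin d (Im z - r)); split; [apply Rmin_pos; lra|]; intros w Hw.
    assert (Hw1 := Rlt_le_trans _ _ _ Hw (Rmin_l _ _)); assert (Hw2 := Rlt_le_trans _ _ _ Hw (Rmin_r _ _)).
    assert (Uw : 0 < r < Im w).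
    { split; [lra|]. generalize (im_le_Cmod (z - w)); rewrite Cmod_minus_sym; intros B.
      generalize (Rle_abs (Im (z - w))); unfold Cminus, Cplus, Copp, Im in *; simpl in *; lra. }
    assert (Hc : forall w, 0 < Im w -> @cont C_UniformSpace f w) by (intros; apply holo_cont; auto).
    rewrite (cd_unique _ _ _ _ (HD w ltac:(lra)) (holo_formula f w r H Uw)).
    rewrite (cd_unique _ _ _ _ (HD z Hz) (holo_formula f z r H Hr)).
    set (X := (/ RtoC (2 * PI * r))%C).
    assert (EX : Cmod X = / (2 * PI * r)).
    { assert (P0 : 0 < 2 * PI * r) by (apply Rmult_lt_0_compat; lra).
      unfold X; rewrite Cmod_inv by (intros E; apply (f_equal Re) in E; simpl in E; lra).
      rewrite Cmod_R, Rabs_pos_eq by lra; reflexivity. }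
    match goal with |- Cmod (X * ?A - X * ?B) < e =>
      replace (X * A - X * B)%C with ((A - B) * X)%C by ring end.
    rewrite <- (Cint_minus _ _ _ _ (exC_circle f w r Hc Uw) (exC_circle f z r Hc Hr)).
    rewrite Cmod_mult, EX.
    apply Rle_lt_trans with (e * r / 2 * Rabs (2 * PI - 0) * / (2 * PI * r)).
    + apply Rmult_le_compat_r; [left; apply Rinv_0_lt_compat, Rmult_lt_0_compat; lra|].
      apply Cint_bound; [exact (exC_minus _ _ _ _ (exC_circle f w r Hc Uw) (exC_circle f z r Hc Hr))|].
      intros t _.
      replace (f (w + r * cis t) * Cconj (cis t) - f (z + r * cis t) * Cconj (cis t))%C with
        ((f (w + r * cis t) - f (z + r * cis t)) * Cconj (cis t))%C by ring.
      rewrite Cmod_mult, Cmod_conj, Cmod_cis, Rmult_1_r.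
      apply P.
      * generalize (Cmod_circle z r t ltac:(lra)) (Cmod_triangle_inv (z + RtoC r * cis t) z)
         (re_le_Cmod (z + RtoC r * cis t)) (im_le_Cmod (z + RtoC r * cis t)); intros.
        split; apply Rabs_le_between; lra.
      * apply Cmod_circle; lra.
      * replace (w + r * cis t - (z + r * cis t))%C with (w - z)%C by ring; exact Hw1.
    + rewrite Rminus_0_r, Rabs_pos_eq by lra.
      replace (e * r / 2 * (2 * PI) * / (2 * PI * r)) with (e / 2) by (field; lra); lra.
Qed.

Lemma holo_derivative f D : holo f -> (forall z, 0 < Im z -> cd f z (D z)) -> holo D.
Proof.
  intros H HD z Hz; eexists; apply (derivative_formula f D HD) with (r := Im z / 2); [|lra].
  apply (holo_derivative_cont f); auto.
Qed.

(* Weierstrass: rectangle integrals pass to the limit, then Morera. *)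
Lemma holo_limit (fn : nat -> C -> C) f : (forall n, holo (fn n)) ->
  (forall K e, 0 < e -> exists n, forall z, 0 < Im z -> Cmod z <= K -> Cmod (fn n z - f z) <= e) ->
  holo f.
Proof.
  intros Hn HL.
  assert (Hc : forall z, 0 < Im z -> @cont C_UniformSpace f z).
  { intros z Hz; apply cont_C_eps; intros e He.
    destruct (HL (Cmod z + 1) (e / 4) ltac:(lra)) as [n P].
    destruct (proj1 (cont_C_eps _ _) (holo_cont _ _ (Hn n) Hz) (e / 4) ltac:(lra)) as [d [Hd Q]].
    exists (Rmin (Rmin d 1) (Im z)); split; [repeat apply Rmin_pos; lra|]; intros w Hw.
    assert (M1 := Rmin_l (Rmin d 1) (Im z)); assert (M2 := Rmin_r (Rmin d 1) (Im z));
    assert (M3 := Rmin_l d 1); assert (M4 := Rmin_r d 1).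
    assert (Uw : 0 < Im w) by (apply (upper_open z); lra).
    generalize (Q w ltac:(lra)) (P w Uw ltac:(generalize (Cmod_triangle_inv w z); lra)) (P z Hz ltac:(lra))
      (Cmod_le_via (f w) (fn n w) (f z)) (Cmod_le_via (fn n w) (fn n z) (f z)).
    rewrite (Cmod_minus_sym (f w) (fn n w)); lra. }
  destruct (Morera f Hc) as [F HF].
  - intros a b c d Hab Hcd0 Hcd; apply Cmod_eq_0, Rle_antisym; [|apply Cmod_ge_0].
    apply Rnot_lt_le; intros Pos; set (X := Cmod (J f a b c d)) in *.
    set (Y := (b - a) + (d - c)); assert (HY : 0 <= Y) by (unfold Y; lra).
    destruct (HL (Rabs a + Rabs b + d) (X / (4 * (Y + 1)))) as [n P]; [apply Rdiv_lt_0_compat; lra|].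
    assert (B : X <= 2 * (X / (4 * (Y + 1))) * Y).
    { unfold X at 1; replace (J f a b c d) with (- J (fun z => fn n z - f z) a b c d)%C.
      - rewrite Cmod_opp; apply J_bound; auto.
        + intros z [_ Hz]; apply cont_minus; [apply holo_cont; [apply Hn|lra]|apply Hc; lra].
        + intros z [Hz1 Hz2]; apply P; [lra|].
          eapply Rle_trans; [apply Cmod_le_parts|].
          rewrite (Rabs_pos_eq (Im z)) by lra.
          assert (Rabs (Re z) <= Rabs a + Rabs b).
          { generalize (Rle_abs b) (Rle_abs (- a)) (Rabs_pos a) (Rabs_pos b); rewrite (Rabs_Ropp a); intros; apply Rabs_le; lra. }
          lra.
      - rewrite J_minus; auto.
        + rewrite (Goursat (fn n)); [ring|lra|lra|intros z [_ Hz]; apply Hn; lra].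
        + intros z [_ Hz]; apply holo_cont; [apply Hn|lra].
        + intros z [_ Hz]; apply Hc; lra. }
    assert (2 * (X / (4 * (Y + 1))) * Y <= X / 2); [|lra].
    apply Rmult_le_reg_r with (2 * (Y + 1)); [lra|].
    replace (2 * (X / (4 * (Y + 1))) * Y * (2 * (Y + 1))) with (X * Y) by (field; lra).
    replace (X / 2 * (2 * (Y + 1))) with (X * (Y + 1)) by field; nra.
  - intros z Hz; eexists; apply (derivative_formula F f HF Hc) with (r := Im z / 2); lra.
Qed.

(** * Uniqueness of the extension to the upper half-plane *)

Definition rel_cont (S : C -> Prop) (f : C -> C) : Prop :=
  forall z, S z -> forall e, 0 < e -> exists d, 0 < d /\
    forall w, S w -> Cmod (w - z) < d -> Cmod (f w - f z) < e.

(** The form in which [circle_mean] takes its hypotheses. *)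
Definition C1on (S : C -> Prop) (f : C -> C) : Prop :=
  exists g, forall z, S z -> cd f z (g z) /\ @cont C_UniformSpace g z.

Lemma rel_cont_mult S f g : rel_cont S f -> rel_cont S g -> rel_cont S (fun z => f z * g z)%C.
Proof.
  intros Hf Hg z Sz e He.
  set (A := Cmod (f z)); set (B := Cmod (g z)).
  assert (A0 := Cmod_ge_0 (f z) : 0 <= A); assert (B0 := Cmod_ge_0 (g z) : 0 <= B).
  assert (T : 0 < A + B + 2) by lra.
  set (e' := Rmin 1 (e / (A + B + 2))).
  assert (E1 : 0 < e') by (apply Rmin_pos; [lra|apply Rdiv_lt_0_compat; lra]).
  assert (E2 : e' <= 1) by apply Rmin_l.
  assert (E3 : e' * (A + B + 2) <= e).
  { apply Rle_trans with (e / (A + B + 2) * (A + B + 2)); [|right; field; lra].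
    apply Rmult_le_compat_r; [lra|apply Rmin_r]. }
  destruct (Hf z Sz e' E1) as [d1 [D1 P1]]; destruct (Hg z Sz e' E1) as [d2 [D2 P2]].
  exists (Rmin d1 d2); split; [apply Rmin_pos; auto|]; intros w Sw Hw.
  specialize (P1 w Sw (Rlt_le_trans _ _ _ Hw (Rmin_l _ _))).
  specialize (P2 w Sw (Rlt_le_trans _ _ _ Hw (Rmin_r _ _))).
  replace (f w * g w - f z * g z)%C with
    ((f w - f z) * (g w - g z) + (f w - f z) * g z + f z * (g w - g z))%C by ring.
  generalize (Cmod_triangle ((f w - f z) * (g w - g z) + (f w - f z) * g z) (f z * (g w - g z)))
    (Cmod_triangle ((f w - f z) * (g w - g z)) ((f w - f z) * g z)).
  rewrite !Cmod_mult; fold A B.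
  generalize (Cmod_ge_0 (f w - f z)) (Cmod_ge_0 (g w - g z)); nra.
Qed.

Lemma C1on_mult S f g : C1on S f -> C1on S g -> C1on S (fun z => f z * g z)%C.
Proof.
  intros [f' Hf] [g' Hg]; exists (fun z => f' z * g z + f z * g' z)%C; intros z Sz.
  destruct (Hf z Sz) as [A B]; destruct (Hg z Sz) as [A' B']; split.
  - apply cd_mult; assumption.
  - apply (cont_plus (U := C_UniformSpace)); apply (cont_mult (U := C_UniformSpace)); auto; eapply cd_cont; eassumption.
Qed.

Definition square (c : C) (h : R) (z : C) : Prop := rect (Re c - h) (Re c + h) (Im c - h) (Im c + h) z.
Definition isquare (c : C) (h : R) (z : C) : Prop := Rabs (Re z - Re c) < h /\ Rabs (Im z - Im c) < h.

Lemma Re_Cplus z w : Re (z + w)%C = Re z + Re w. Proof. reflexivity. Qed.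
Lemma Im_Cplus z w : Im (z + w)%C = Im z + Im w. Proof. reflexivity. Qed.
Lemma Re_Cminus z w : Re (z - w)%C = Re z - Re w. Proof. reflexivity. Qed.
Lemma Im_Cminus z w : Im (z - w)%C = Im z - Im w. Proof. reflexivity. Qed.
Lemma Re_Cmult z w : Re (z * w)%C = Re z * Re w - Im z * Im w. Proof. reflexivity. Qed.
Lemma Im_Cmult z w : Im (z * w)%C = Re z * Im w + Im z * Re w. Proof. reflexivity. Qed.

(* At an interior maximum of [|G|^2 + eps |z - c|^2] the mean value property fails by [eps r^2]. *)
Theorem max_square c h G : 0 < h -> rel_cont (square c h) G -> C1on (isquare c h) G ->
  (forall z, square c h z -> ~ isquare c h z -> G z = 0) -> G c = 0.
Proof.
  intros Hh HG [g Hg] HB.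
  apply Cmod_eq_0, Rle_antisym; [|apply Cmod_ge_0]; apply Rnot_lt_le; intros Pos.
  set (X := Cmod (G c)) in *.
  (* Points of the square lie within [h sqrt 2] of [c], so on its boundary the function [m] below is
     at most [eps * 2 h^2 = X^2 / 4], less than its value [X^2] at the centre. *)
  set (eps := X ^ 2 / (8 * h ^ 2)).
  assert (Hh2 : 0 < h ^ 2) by (apply pow_lt; lra). assert (HX2 : 0 < X ^ 2) by (apply pow_lt; lra).
  assert (Heps : 0 < eps) by (apply Rdiv_lt_0_compat; lra).
  assert (Epsh : eps * (2 * h ^ 2) = X ^ 2 / 4) by (unfold eps; field; lra).
  clearbody eps.
  pose (m := fun z => Cmod (G z) ^ 2 + eps * Cmod (z - c) ^ 2).
  assert (Mc : m c = X ^ 2).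
  { unfold m; replace (c - c)%C with (RtoC 0) by ring; rewrite Cmod_0; fold X; ring. }
  assert (Sc : square c h c) by (split; lra).
  assert (Dist : forall z, square c h z -> Cmod (z - c) ^ 2 <= 2 * h ^ 2).
  { intros z [A B]; rewrite Cmod2_alt, Re_Cminus, Im_Cminus; nra. }
  assert (Bd : forall z, square c h z -> ~ isquare c h z -> m z < X ^ 2).
  { intros z Sz Nz; unfold m; rewrite (HB z Sz Nz), Cmod_0; generalize (Dist z Sz); intros D.
    apply Rle_lt_trans with (eps * (2 * h ^ 2)); [replace (0 ^ 2) with 0 by ring; nra|].
    lra. }
  assert (mc : forall z, square c h z -> forall e, 0 < e -> exists d, 0 < d /\
    forall w, square c h w -> Cmod (w - z) < d -> Rabs (m w - m z) < e).
  { intros z Sz e He.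
    assert (He' : 0 < Rmin 1 (e / 2 / (2 * Cmod (G z) + 1))).
    { apply Rmin_pos; [lra|]; generalize (Cmod_ge_0 (G z)); intros; apply Rdiv_lt_0_compat; lra. }
    destruct (HG z Sz _ He') as [d1 [D1 P1]].
    set (L := Cmod (z - c)); assert (L0 : 0 <= L) by apply Cmod_ge_0.
    assert (Hd2 : 0 < e / 2 / (eps * (2 * L + 1))).
    { apply Rdiv_lt_0_compat; [lra|apply Rmult_lt_0_compat; lra]. }
    exists (Rmin d1 (Rmin 1 (e / 2 / (eps * (2 * L + 1))))); split; [repeat apply Rmin_pos; lra|].
    intros w Sw Hw.
    assert (W1 := Rlt_le_trans _ _ _ Hw (Rmin_l _ _)).
    assert (W2 := Rlt_le_trans _ _ _ (Rlt_le_trans _ _ _ Hw (Rmin_r _ _)) (Rmin_l _ _)).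
    assert (W3 := Rlt_le_trans _ _ _ (Rlt_le_trans _ _ _ Hw (Rmin_r _ _)) (Rmin_r _ _)).
    specialize (P1 w Sw W1).
    assert (Q1 := Rlt_le_trans _ _ _ P1 (Rmin_l _ _)); assert (Q2 := Rlt_le_trans _ _ _ P1 (Rmin_r _ _)).
    assert (Sq : forall a b t, 0 <= a -> 0 <= b -> Rabs (a - b) < 1 -> Rabs (a - b) * (2 * b + 1) < t -> Rabs (a ^ 2 - b ^ 2) < t).
    { intros a b t Ha Hb H1 Ht; replace (a ^ 2 - b ^ 2) with ((a - b) * (a + b)) by ring.
      rewrite Rabs_mult, (Rabs_pos_eq (a + b)) by lra.
      eapply Rle_lt_trans; [|exact Ht]; apply Rmult_le_compat_l; [apply Rabs_pos|].
      apply Rabs_def2 in H1; lra. }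
    assert (Tri : forall a b, Rabs (Cmod a - Cmod b) <= Cmod (a - b)).
    { intros a b; generalize (Cmod_triangle_inv a b) (Cmod_triangle_inv b a).
      rewrite (Cmod_minus_sym b a); intros; apply Rabs_le; lra. }
    assert (Dv : forall x y t, 0 < y -> x < t / y -> x * y < t).
    { intros x y t Hy H; apply Rmult_lt_compat_r with (r := y) in H; [|exact Hy].
      replace (t / y * y) with t in H by (field; lra); exact H. }
    assert (B1 : Rabs (Cmod (G w) ^ 2 - Cmod (G z) ^ 2) < e / 2).
    { generalize (Tri (G w) (G z)); intros T; apply Sq; try apply Cmod_ge_0; [lra|].
      apply Dv; [generalize (Cmod_ge_0 (G z)); lra|lra]. }
    assert (B2 : Rabs (Cmod (w - c) ^ 2 - Cmod (z - c) ^ 2) < e / 2 / eps).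
    { assert (T := Tri (w - c)%C (z - c)%C); replace (w - c - (z - c))%C with (w - z)%C in T by ring.
      apply Sq; try apply Cmod_ge_0; [lra|]; fold L; apply Dv; [lra|].
      replace (e / 2 / eps / (2 * L + 1)) with (e / 2 / (eps * (2 * L + 1))) by (clear - Heps L0; field; split; lra); fold L in T; lra. }
    unfold m; replace (Cmod (G w) ^ 2 + eps * Cmod (w - c) ^ 2 - (Cmod (G z) ^ 2 + eps * Cmod (z - c) ^ 2))
      with ((Cmod (G w) ^ 2 - Cmod (G z) ^ 2) + (Cmod (w - c) ^ 2 - Cmod (z - c) ^ 2) * eps) by ring.
    eapply Rle_lt_trans; [apply Rabs_triang|]; rewrite Rabs_mult, (Rabs_pos_eq eps) by lra.
    apply Dv in B2; lra. }
  assert (Bnd : exists K, forall z, square c h z -> m z <= K).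
  { destruct (box_compact (Re c - h) (Re c + h) (Im c - h) (Im c + h) (fun e z => 0 < e -> m z <= / e)) as [e [He P]].
    - intros e e' z Le Q He'; eapply Rle_trans; [apply Q; lra|]; apply Rinv_le_contravar; lra.
    - intros z Sz; destruct (mc z Sz 1 Rlt_0_1) as [d [Hd P]].
      assert (M0 : 0 <= m z) by (unfold m; generalize (pow2_ge_0 (Cmod (G z))) (pow2_ge_0 (Cmod (z - c))); nra).
      exists (Rmin d (/ (m z + 1))); split; [apply Rmin_pos; [lra|apply Rinv_0_lt_compat; lra]|].
      intros w Sw Hw He; specialize (P w Sw (Rlt_le_trans _ _ _ Hw (Rmin_l _ _))); apply Rabs_def2 in P.
      apply Rle_trans with (m z + 1); [lra|]. rewrite <- (Rinv_inv (m z + 1)) at 1; apply Rinv_le_contravar; [exact He|apply Rmin_r].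
    - exists (/ e); intros z Sz; apply P; auto. }
  destruct (completeness (fun v => exists z, square c h z /\ v = m z)) as [M [M1 M2]].
  { destruct Bnd as [K HK]; exists K; intros v [z [Sz E]]; rewrite E; apply HK, Sz. }
  { exists (m c), c; auto. }
  (* The supremum is attained, as otherwise [box_compact] would produce a uniform gap below it. *)
  assert (Att : exists z1, square c h z1 /\ m z1 = M).
  { apply NNPP; intros N.
    destruct (box_compact (Re c - h) (Re c + h) (Im c - h) (Im c + h) (fun e z => m z <= M - e)) as [e [He P]].
    - intros; lra.
    - intros z Sz. assert (Lt : m z < M).
      { destruct (Rle_lt_or_eq_dec (m z) M) as [L|L]; [apply M1; exists z; auto|exact L|].
        exfalso; apply N; exists z; auto. }
      destruct (mc z Sz ((M - m z) / 2) ltac:(lra)) as [d [Hd P]].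
      exists (Rmin d ((M - m z) / 2)); split; [apply Rmin_pos; lra|]; intros w Sw Hw.
      specialize (P w Sw (Rlt_le_trans _ _ _ Hw (Rmin_l _ _))); apply Rabs_def2 in P.
      generalize (Rmin_r d ((M - m z) / 2)); lra.
    - assert (M <= M - e); [|lra]. apply M2; intros v [z [Sz E]]; rewrite E; apply P, Sz. }
  destruct Att as [z1 [S1 E1]].
  assert (I1 : isquare c h z1).
  { apply NNPP; intros N; generalize (Bd z1 S1 N); rewrite E1; intros.
    assert (m c <= M) by (apply M1; exists c; auto). lra. }
  assert (Op : exists rho, 0 < rho /\ forall w, Cmod (w - z1) < rho -> isquare c h w).
  { destruct I1 as [A B].
    exists (Rmin (h - Rabs (Re z1 - Re c)) (h - Rabs (Im z1 - Im c))); split; [apply Rmin_pos; lra|].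
    intros w Hw; generalize (Rlt_le_trans _ _ _ Hw (Rmin_l _ _)) (Rlt_le_trans _ _ _ Hw (Rmin_r _ _)); intros.
    split.
    - replace (Re w - Re c) with ((Re w - Re z1) + (Re z1 - Re c)) by ring.
      eapply Rle_lt_trans; [apply Rabs_triang|]; generalize (re_le_Cmod (w - z1)); rewrite Re_Cminus; lra.
    - replace (Im w - Im c) with ((Im w - Im z1) + (Im z1 - Im c)) by ring.
      eapply Rle_lt_trans; [apply Rabs_triang|]; generalize (im_le_Cmod (w - z1)); rewrite Im_Cminus; lra. }
  destruct Op as [rho [Hrho Op]].
  assert (Mean := circle_mean z1 rho G g).
  set (r := rho / 2); assert (Hr : 0 < r < rho) by (unfold r; lra).
  assert (Hz1 : @cont C_UniformSpace G z1).
  { eapply cd_cont, Hg, Op; replace (z1 - z1)%C with (RtoC 0) by ring; rewrite Cmod_0; lra. }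
  specialize (Mean Hz1 ltac:(intros z Hz; apply Hg, Op; lra) ltac:(intros z Hz; apply Hg, Op; lra) r Hr).
  assert (PP := PI2_pos).
  assert (EG : exC (fun t => G (z1 + RtoC r * cis t)%C) 0 (2 * PI)).
  { apply exC_cont; intros t _; apply (cont_circle G); eapply cd_cont, Hg, Op; rewrite Cmod_circle; lra. }
  assert (Ecis : exC cis 0 (2 * PI)) by (apply exC_cont; intros; apply cont_cis).
  (* The real part of [K t] is the part of [m u - m z1] that is linear in [G u - G z1] and [cis t],
     for [u] on the circle. Its mean vanishes, while the remaining quadratic part is at least
     [eps r^2]. *)
  pose (K1 := (RtoC 2 * Cconj (G z1))%C); pose (K2 := (RtoC (2 * eps * r) * Cconj (z1 - c))%C).
  pose (K := fun t => (K1 * (G (z1 + RtoC r * cis t) - G z1) + K2 * cis t)%C).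
  assert (E_1 := exC_minus _ _ _ _ EG (exC_const (G z1) 0 (2 * PI))).
  assert (EK : exC K 0 (2 * PI)).
  { exact (exC_plus _ _ _ _ (exC_scal K1 _ _ _ E_1) (exC_scal K2 _ _ _ Ecis)). }
  assert (Zcis : Cint cis 0 (2 * PI) = 0).
  { rewrite (Cint_FTC (fun t => - Ci * cis t)%C); [rewrite cis_period; ring| |intros; apply cont_cis].
    intros t _; eapply rd_eq; [apply rd_mult; [apply dv_const|apply rd_cis]|].
    cbv beta; apply C_ext; unfold Ci, cis, Copp, Cplus, Cmult, RtoC, Re, Im; simpl; ring. }
  assert (ZK : Cint K 0 (2 * PI) = 0).
  { unfold K; rewrite (Cint_plus _ _ _ _ (exC_scal K1 _ _ _ E_1) (exC_scal K2 _ _ _ Ecis)).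
    rewrite (Cint_scal _ _ _ _ E_1), (Cint_scal _ _ _ _ Ecis), Zcis.
    rewrite (Cint_minus _ _ _ _ EG (exC_const (G z1) 0 (2 * PI))), Mean, Cint_const, Rminus_0_r; ring. }
  assert (Neg : forall t, Re (K t) <= - (eps * r ^ 2)).
  { intros t.
    set (u := (z1 + RtoC r * cis t)%C).
    assert (Su : square c h u).
    { assert (Iu : isquare c h u) by (apply Op; unfold u; rewrite Cmod_circle; lra).
      destruct Iu as [A B]; apply Rabs_def2 in A; apply Rabs_def2 in B; split; lra. }
    assert (Mu : m u <= m z1) by (rewrite E1; apply M1; exists u; auto).
    revert Mu; unfold m, K; fold u; rewrite !Cmod2_alt.
    assert (T := sin2_cos2 t); unfold Rsqr in T.
    assert (Eu : Re u = Re z1 + r * cos t) by (unfold u, cis, Cplus, Cmult, RtoC, Re; simpl; ring).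
    assert (Eu' : Im u = Im z1 + r * sin t) by (unfold u, cis, Cplus, Cmult, RtoC, Im; simpl; ring).
    rewrite !Re_Cminus, !Im_Cminus, Re_Cplus, !Re_Cmult, Re_Cminus, Im_Cminus, Eu, Eu'.
    replace (Re K1) with (2 * Re (G z1)) by (unfold K1, Cconj, Cmult, RtoC, Re; simpl; ring).
    replace (Im K1) with (- 2 * Im (G z1)) by (unfold K1, Cconj, Cmult, RtoC, Im; simpl; ring).
    replace (Re K2) with (2 * eps * r * (Re z1 - Re c)) by (unfold K2; rewrite Re_Cmult, re_conj, im_conj, Re_Cminus; simpl; ring).
    replace (Im K2) with (- (2 * eps * r * (Im z1 - Im c))) by (unfold K2; rewrite Im_Cmult, re_conj, im_conj, Im_Cminus; simpl; ring).
    unfold cis; simpl Re; simpl Im.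
    generalize (pow2_ge_0 (Re (G u) - Re (G z1))) (pow2_ge_0 (Im (G u) - Im (G z1))); intros S1' S2' Mu.
    replace (r ^ 2) with (r ^ 2 * (sin t * sin t + cos t * cos t)) by (rewrite T; ring). nra. }
  assert (RK : RInt (fun t => Re (K t)) 0 (2 * PI) <= RInt (fun _ => - (eps * r ^ 2)) 0 (2 * PI)).
  { apply RInt_le; [lra|apply EK|apply ex_RInt_const|intros; apply Neg]. }
  rewrite RInt_const in RK; unfold scal in RK; simpl in RK; unfold mult in RK; simpl in RK.
  apply (f_equal Re) in ZK; unfold Cint in ZK; simpl in ZK; fold (Re (K 0)) in ZK.
  assert (0 < eps * r ^ 2) by (apply Rmult_lt_0_compat; [lra|apply pow_lt; lra]).
  unfold Re in *; simpl in *. nra.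
Qed.

(* Rotating [H] about [c] by quarter turns, one of the four factors vanishes
   on each side of the square centered at [c] that touches the real axis. *)
Theorem upper_unique H : rel_cont (fun z => 0 <= Im z) H -> holo H ->
  (forall x : R, H (RtoC x) = 0) -> forall z, 0 < Im z -> H z = 0.
Proof.
  intros HC Hh H0 c Hc.
  set (h := Im c).
  pose (D := C_derive H).
  assert (HD : forall z, 0 < Im z -> cd H z (D z)).
  { intros z Hz; destruct (Hh z Hz) as [l Hl].
    assert (E := proj1 (cd_is_derive _ _ _) Hl); apply is_C_derive_unique in E; unfold D; rewrite E; exact Hl. }
  assert (DC := holo_derivative_cont H D Hh HD).
  pose (rot := fun q z => (c + q * (z - c))%C).
  pose (unitq := fun q : C => q = RtoC 1 \/ q = Ci \/ q = (- RtoC 1)%C \/ q = (- Ci)%C).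
  assert (Uq : forall q, unitq q -> Cmod q = 1).
  { intros q [E|[E|[E|E]]]; rewrite E, ?Cmod_opp, ?Cmod_Ci, ?Cmod_R, ?Rabs_R1; reflexivity. }
  assert (Irot : forall q z, Im (rot q z) = h + (Re q * Im (z - c) + Im q * Re (z - c))) by reflexivity.
  assert (Side : forall q z, unitq q -> square c h z -> 0 <= Im (rot q z)).
  { intros q z [E|[E|[E|E]]] [[A A'] [B B']]; rewrite Irot, Re_Cminus, Im_Cminus, E; simpl;
    change (Im c) with h; change (Im c) with h in B, B'; lra. }
  assert (Side' : forall q z, unitq q -> isquare c h z -> 0 < Im (rot q z)).
  { intros q z [E|[E|[E|E]]] [A B]; apply Rabs_def2 in A; apply Rabs_def2 in B;
    rewrite Irot, Re_Cminus, Im_Cminus, E; simpl; change (Im c) with h; change (Im c) with h in B; lra. }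
  assert (RC : forall q, unitq q -> rel_cont (square c h) (fun z => H (rot q z))).
  { intros q Hq z Sz e He. destruct (HC _ (Side q z Hq Sz) e He) as [d [Hd P]].
    exists d; split; [exact Hd|]; intros w Sw Hw; apply P; [apply Side; auto|].
    unfold rot; replace (c + q * (w - c) - (c + q * (z - c)))%C with (q * (w - z))%C by ring.
    rewrite Cmod_mult, (Uq q Hq); lra. }
  assert (C1 : forall q, unitq q -> C1on (isquare c h) (fun z => H (rot q z))).
  { intros q Hq; exists (fun z => D (rot q z) * q)%C; intros z Sz.
    assert (Cr : cd (rot q) z q).
    { eapply cd_eq; [apply cd_plus; [apply cd_const|];
        apply cd_mult; [apply cd_const|];
        apply cd_minus; [apply cd_id|apply cd_const]|cbv beta; ring]. }
    split.
    - apply (cd_comp (rot q) H); [exact Cr|apply HD, Side'; auto].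
    - apply (cont_mult (U := C_UniformSpace)); [|apply (cont_const (U := C_UniformSpace))].
      apply (cont_comp_C (U := C_UniformSpace) (rot q) D); [eapply cd_cont, Cr|apply DC, Side'; auto]. }
  assert (U1 : unitq (RtoC 1)) by (left; reflexivity). assert (U2 : unitq Ci) by (right; left; reflexivity).
  assert (U3 : unitq (- RtoC 1)%C) by (right; right; left; reflexivity).
  assert (U4 : unitq (- Ci)%C) by (right; right; right; reflexivity).
  assert (Z := max_square c h (fun z => H (rot (RtoC 1) z) * H (rot Ci z) * (H (rot (- RtoC 1) z) * H (rot (- Ci) z)))%C Hc).
  (* All the rotations fix [c], so the product at [c] is the fourth power of [H c]. *)
  assert (Rc : forall q, rot q c = c) by (intros; unfold rot; ring).
  cbv beta in Z; rewrite !Rc in Z.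
  apply Cmod_eq_0; apply (f_equal Cmod) in Z.
  - rewrite !Cmod_mult, Cmod_0 in Z.
    apply Rmult_integral in Z; destruct Z as [Z|Z]; apply Rmult_integral in Z; destruct Z; assumption.
  - apply rel_cont_mult; apply rel_cont_mult; apply RC; assumption.
  - apply C1on_mult; apply C1on_mult; apply C1; assumption.
  - intros z [[A A'] [B B']] N.
    assert (Van : forall q, Im (rot q z) = 0 -> H (rot q z) = 0).
    { intros q E; replace (rot q z) with (RtoC (Re (rot q z))); [apply H0|].
      apply C_ext; [reflexivity|rewrite E; reflexivity]. }
    change (Im c) with h in B, B'.
    assert (Cs : Re z - Re c = - h \/ Re z - Re c = h \/ Im z - h = - h \/ Im z - h = h).
    { apply NNPP; intros Q; apply N; split; apply Rabs_def1; change (Im c) with h;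
      apply Rnot_le_lt; intros L; apply Q; lra. }
    destruct Cs as [E|[E|[E|E]]].
    + rewrite (Van Ci); [ring|]; rewrite Irot, Re_Cminus, Im_Cminus; simpl; lra.
    + rewrite (Van (- Ci)%C); [ring|]; rewrite Irot, Re_Cminus, Im_Cminus; simpl; lra.
    + rewrite (Van (RtoC 1)); [ring|]; rewrite Irot, Re_Cminus, Im_Cminus; simpl; change (Im c) with h; lra.
    + rewrite (Van (- RtoC 1)%C); [ring|]; rewrite Irot, Re_Cminus, Im_Cminus; simpl; change (Im c) with h; lra.
Qed.

Lemma is_upper_ext_iff f F : is_upper_ext f F <->
  (forall x : R, F (RtoC x) = f x) /\ rel_cont (fun z => 0 <= Im z) F /\ holo F.
Proof.
  assert (A : @continuous_on C_UniformSpace C_UniformSpace (fun z => 0 <= Im z) F <-> rel_cont (fun z => 0 <= Im z) F).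
  { split.
    - intros Hc z Sz e He.
      assert (He' : 0 < e / 2) by lra.
      assert (L := proj1 (filterlim_locally _ _) (Hc z Sz) (mkposreal _ He')).
      apply locally_C_eps in L; destruct L as [d [Hd P]]; exists d; split; [exact Hd|].
      intros w Sw Hw; destruct (P w Hw Sw) as [Q1 Q2].
      change (Rabs (Re (F w) - Re (F z)) < e / 2) in Q1; change (Rabs (Im (F w) - Im (F z)) < e / 2) in Q2.
      eapply Rle_lt_trans; [apply Cmod_le_parts|]; rewrite Re_Cminus, Im_Cminus; lra.
    - intros Hc z Sz; apply filterlim_locally; intros e.
      destruct (Hc z Sz e (cond_pos e)) as [d [Hd P]].
      apply locally_C_eps; exists d; split; [exact Hd|]; intros w Hw Sw.
      apply C_NormedModule_mixin_compat1; apply P; assumption. }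
  unfold is_upper_ext; rewrite A; split; intros [H1 [H2 H3]]; (split; [exact H1|split; [exact H2|]]).
  - intros z Hz; destruct (H3 z Hz) as [l Hl]; exists l; apply cd_is_derive, Hl.
  - intros z Hz; destruct (H3 z Hz) as [l Hl]; exists l; apply cd_is_derive, Hl.
Qed.

(** On the closed half-plane the choice operator in [upper_ext] has a single candidate, by
    [upper_unique] applied to the difference of two extensions. *)
Lemma upper_ext_eq f F : is_upper_ext f F -> forall z, 0 <= Im z -> upper_ext f z = F z.
Proof.
  intros HF.
  assert (HE : is_upper_ext f (upper_ext f)) by exact (epsilon_spec _ (is_upper_ext f) (ex_intro _ F HF)).
  apply is_upper_ext_iff in HF; apply is_upper_ext_iff in HE.
  destruct HF as [F1 [F2 F3]], HE as [E1 [E2 E3]].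
  assert (R0 : forall x : R, upper_ext f (RtoC x) = F (RtoC x)) by (intros; rewrite E1, F1; reflexivity).
  intros z [Hz|Hz].
  - assert (Z : (upper_ext f z - F z)%C = 0).
    { apply (upper_unique (fun z => upper_ext f z - F z)%C); [| | |exact Hz].
      - intros u Su e He; destruct (E2 u Su (e / 2) ltac:(lra)) as [d1 [D1 P1]];
        destruct (F2 u Su (e / 2) ltac:(lra)) as [d2 [D2 P2]].
        exists (Rmin d1 d2); split; [apply Rmin_pos; auto|]; intros w Sw Hw.
        specialize (P1 w Sw (Rlt_le_trans _ _ _ Hw (Rmin_l _ _))); specialize (P2 w Sw (Rlt_le_trans _ _ _ Hw (Rmin_r _ _))).
        replace (upper_ext f w - F w - (upper_ext f u - F u))%C with ((upper_ext f w - upper_ext f u) - (F w - F u))%C by ring.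
        eapply Rle_lt_trans; [apply Cmod_minus_triangle|lra].
      - intros u Su; destruct (E3 u Su) as [l1 L1]; destruct (F3 u Su) as [l2 L2]; exists (l1 - l2)%C.
        apply cd_minus; assumption.
      - intros x; rewrite R0; ring. }
    replace (upper_ext f z) with (upper_ext f z - F z + F z)%C by ring; rewrite Z; ring.
  - replace z with (RtoC (Re z)); [apply R0|]. apply C_ext; [reflexivity|exact Hz].
Qed.

(** * Linear differential systems *)

Lemma decreasing_of_derive (F f : R -> R) a b : a <= b ->
  (forall t, a <= t <= b -> is_derive F t (f t)) -> (forall t, a <= t <= b -> f t <= 0) -> F b <= F a.
Proof.
  intros Hab HF Hf.
  destruct (MVT_gen F a b f) as [c [Hc E]].
  - rewrite Rmin_left, Rmax_right by lra; intros; apply HF; lra.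
  - rewrite Rmin_left, Rmax_right by lra; intros t Ht; apply continuity_pt_filterlim.
    apply (ex_derive_continuous F); eexists; apply HF, Ht.
  - rewrite Rmin_left, Rmax_right in Hc by lra; generalize (Hf c Hc); nra.
Qed.

Lemma exp_le (x y : R) : x <= y -> exp x <= exp y.
Proof. intros [L|E]; [left; apply exp_increasing, L|right; rewrite E; reflexivity]. Qed.

Definition contR (f : R -> R) : Prop := forall x, continuous f x.
Definition contC (f : R -> C) : Prop := forall x, @cont R_UniformSpace f x.

Lemma contR_ex f a b : contR f -> ex_RInt f a b.
Proof. intros H; apply (ex_RInt_continuous (V := R_CompleteNormedModule)); intros; apply H. Qed.

Lemma contC_exC f a b : contC f -> exC f a b.
Proof. intros H; apply exC_cont; intros; apply H. Qed.

Lemma contR_plus f g : contR f -> contR g -> contR (fun x => f x + g x).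
Proof. intros A B x; apply (continuous_plus (V := R_NormedModule)); auto. Qed.

Lemma contR_Cmod f : contC f -> contR (fun x => Cmod (f x)).
Proof. intros A x; apply (cont_Cmod (U := R_UniformSpace)), A. Qed.

Lemma is_derive_RInt_cont f a x : contR f -> is_derive (fun y => RInt f a y) x (f x).
Proof.
  intros H; apply (is_derive_RInt (V := R_CompleteNormedModule) f (fun y => RInt f a y) a x); [|apply H].
  apply filter_forall; intros y; apply (RInt_correct (V := R_CompleteNormedModule)), contR_ex, H.
Qed.

Lemma rd_Cint f a x : contC f -> rd (fun y => Cint f a y) x (f x).
Proof.
  intros H; apply rd_parts; split; apply is_derive_RInt_cont; intros t; apply (cont_parts f t), H.
Qed.

(* The sign of [Im z] makes the diagonal term dissipative, so it drops out of the
   energy estimate for [|a|^2 + |b|^2]; [eps] keeps the square root differentiable. *)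
Theorem gronwall (z : C) (q p f g a b : R -> C) (x0 x1 K N : R) : 0 <= Im z -> x0 <= x1 ->
  contC q -> contC p -> contC f -> contC g ->
  (forall t, rd a t (q t * b t + f t)%C) ->
  (forall t, rd b t (RtoC 2 * Ci * z * b t + p t * a t + g t)%C) ->
  RInt (fun t => Cmod (q t) + Cmod (p t)) x0 x1 <= K ->
  RInt (fun t => Cmod (f t) + Cmod (g t)) x0 x1 <= N ->
  Cmod (a x1) <= exp K * (Cmod (a x0) + Cmod (b x0) + N) /\
  Cmod (b x1) <= exp K * (Cmod (a x0) + Cmod (b x0) + N).
Proof.
  intros Hz Hx Hq Hp Hf Hg Ha Hb HK HN.
  set (mu := fun t => Cmod (q t) + Cmod (p t)) in *; set (nu := fun t => Cmod (f t) + Cmod (g t)) in *.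
  assert (Cmu : contR mu) by (apply contR_plus; apply contR_Cmod; assumption).
  assert (Cnu : contR nu) by (apply contR_plus; apply contR_Cmod; assumption).
  assert (mu0 : forall t, 0 <= mu t) by (intros t; unfold mu; generalize (Cmod_ge_0 (q t)) (Cmod_ge_0 (p t)); lra).
  assert (nu0 : forall t, 0 <= nu t) by (intros t; unfold nu; generalize (Cmod_ge_0 (f t)) (Cmod_ge_0 (g t)); lra).
  pose (w := fun t => Cmod (a t) ^ 2 + Cmod (b t) ^ 2).
  pose (w' := fun t => 2 * Re (Cconj (a t) * (q t * b t + f t) + Cconj (b t) * (RtoC 2 * Ci * z * b t + p t * a t + g t))%C).
  assert (Dw : forall t, is_derive w t (w' t)).
  { intros t.
    assert (E := proj1 (rd_parts _ _ _) (dv_plus _ _ _ _ _ _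
       (rd_mult _ _ _ _ _ (rd_conj _ _ _ (Ha t)) (Ha t)) (rd_mult _ _ _ _ _ (rd_conj _ _ _ (Hb t)) (Hb t)))).
    destruct E as [E _].
    replace (w' t) with (Re (Cconj (q t * b t + f t) * a t + Cconj (a t) * (q t * b t + f t) +
       (Cconj (RtoC 2 * Ci * z * b t + p t * a t + g t) * b t + Cconj (b t) * (RtoC 2 * Ci * z * b t + p t * a t + g t)))%C).
    - eapply is_derive_ext; [|exact E]; intros s; unfold w; rewrite !Cmod2_alt.
      unfold Cconj, Cplus, Cmult, Re, Im; simpl; ring.
    - unfold w'. set (X := (q t * b t + f t)%C); set (Y := (RtoC 2 * Ci * z * b t + p t * a t + g t)%C).
      clearbody X Y; unfold Cconj, Cplus, Cmult, Re, Im; simpl; ring. }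
  assert (w0 : forall t, 0 <= w t) by (intros t; unfold w; generalize (pow2_ge_0 (Cmod (a t))) (pow2_ge_0 (Cmod (b t))); lra).
  assert (Bw : forall t s, 0 < s -> w t <= s ^ 2 -> w' t <= mu t * s ^ 2 + 2 * nu t * s).
  { intros t s Hs Hw; unfold w'.
    set (A := Cmod (a t)); set (B := Cmod (b t)).
    assert (A0 := Cmod_ge_0 (a t) : 0 <= A); assert (B0 := Cmod_ge_0 (b t) : 0 <= B).
    unfold w in Hw; fold A B in Hw.
    assert (As : A <= s) by (apply Rnot_lt_le; intros L; nra).
    assert (Bs : B <= s) by (apply Rnot_lt_le; intros L; nra).
    assert (AB : A * B <= s ^ 2 / 2) by (generalize (pow2_ge_0 (A - B)); nra).
    replace (Re (Cconj (a t) * (q t * b t + f t) + Cconj (b t) * (RtoC 2 * Ci * z * b t + p t * a t + g t))%C)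
      with (Re (Cconj (a t) * q t * b t)%C + Re (Cconj (a t) * f t)%C +
        (- (2 * Im z) * B ^ 2 + Re (Cconj (b t) * p t * a t)%C + Re (Cconj (b t) * g t)%C)).
    2: { unfold B; rewrite Cmod2_alt; unfold Cconj, Cplus, Cmult, Ci, RtoC, Re, Im; simpl; ring. }
    assert (R1 : forall u, Re u <= Cmod u) by (intros; eapply Rle_trans; [apply Rle_abs|apply re_le_Cmod]).
    generalize (R1 (Cconj (a t) * q t * b t)%C) (R1 (Cconj (a t) * f t)%C)
      (R1 (Cconj (b t) * p t * a t)%C) (R1 (Cconj (b t) * g t)%C).
    rewrite !Cmod_mult, !Cmod_conj; fold A B.
    generalize (Cmod_ge_0 (q t)) (Cmod_ge_0 (p t)) (Cmod_ge_0 (f t)) (Cmod_ge_0 (g t)).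
    unfold mu, nu; intros;
    assert (Cmod (q t) * (A * B) <= Cmod (q t) * (s ^ 2 / 2)) by (apply Rmult_le_compat_l; auto).
    assert (Cmod (p t) * (A * B) <= Cmod (p t) * (s ^ 2 / 2)) by (apply Rmult_le_compat_l; auto).
    assert (A * Cmod (f t) <= s * Cmod (f t)) by (apply Rmult_le_compat_r; auto).
    assert (B * Cmod (g t) <= s * Cmod (g t)) by (apply Rmult_le_compat_r; auto).
    assert (0 <= Im z * B ^ 2) by (apply Rmult_le_pos; [exact Hz|apply pow2_ge_0]). lra. }
  assert (Core : forall d, 0 < d -> sqrt (w x1) <= exp K * (Cmod (a x0) + Cmod (b x0) + d + N)).
  { intros d Hd.
    pose (s := fun t => sqrt (w t + d ^ 2)).
    assert (d2 : 0 < d ^ 2) by (apply pow_lt; lra).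
    assert (s0 : forall t, 0 < s t) by (intros t; apply sqrt_lt_R0; generalize (w0 t); lra).
    assert (s2 : forall t, s t ^ 2 = w t + d ^ 2) by (intros t; unfold s; apply pow2_sqrt; generalize (w0 t); lra).
    assert (Ds : forall t, is_derive s t (w' t / (2 * s t))).
    { intros t; unfold s.
      replace (w' t / (2 * sqrt (w t + d ^ 2))) with ((w' t + 0) / (2 * sqrt (w t + d ^ 2))) by (f_equal; ring).
      apply (is_derive_sqrt (fun t => w t + d ^ 2)).
      - apply (is_derive_plus (V := R_NormedModule)); [apply Dw|apply (is_derive_const (V := R_NormedModule))].
      - generalize (w0 t); lra. }
    pose (Mu := fun t => RInt mu x0 t); pose (Nu := fun t => RInt nu x0 t).
    (* From [w' <= mu s^2 + 2 nu s] one gets [s' <= mu s / 2 + nu]. Hence this function decreases: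
       the exponential absorbs the first term and, being at most 1, leaves the second below [nu]. *)
    pose (Phi := fun t => s t * exp (- (/ 2 * Mu t)) - Nu t).
    pose (Phi' := fun t => w' t / (2 * s t) * exp (- (/ 2 * Mu t)) + s t * (- (/ 2 * mu t) * exp (- (/ 2 * Mu t))) - nu t).
    assert (DPhi : forall t, is_derive Phi t (Phi' t)).
    { intros t; apply (is_derive_minus (V := R_NormedModule)); [|apply is_derive_RInt_cont, Cnu].
      apply (is_derive_mult (K := R_AbsRing) s (fun t => exp (- (/ 2 * Mu t))) t (w' t / (2 * s t))
        (- (/ 2 * mu t) * exp (- (/ 2 * Mu t)))); [apply Ds| |intros; apply Rmult_comm].
      apply (is_derive_comp (V := R_NormedModule) exp (fun t => - (/ 2 * Mu t))).
      - apply is_derive_exp.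
      - apply (is_derive_opp (V := R_NormedModule)), is_derive_scal, is_derive_RInt_cont, Cmu. }
    assert (Mu0 : forall t, x0 <= t -> 0 <= Mu t).
    { intros t Ht; apply RInt_ge_0; [lra|apply contR_ex, Cmu|intros; apply mu0]. }
    assert (Dec : Phi x1 <= Phi x0).
    { apply (decreasing_of_derive Phi Phi'); [exact Hx|intros; apply DPhi|].
      intros t [Ht _]; unfold Phi'; set (E := exp (- (/ 2 * Mu t))).
      assert (E0 : 0 < E) by apply exp_pos.
      assert (E1 : E <= 1) by (unfold E; rewrite <- exp_0; apply exp_le; generalize (Mu0 t Ht); lra).
      assert (W := Bw t (s t) (s0 t) ltac:(rewrite s2; lra)).
      assert (W2 : w' t / (2 * s t) <= / 2 * mu t * s t + nu t).
      { apply Rmult_le_reg_r with (2 * s t); [generalize (s0 t); lra|].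
        unfold Rdiv; rewrite Rmult_assoc, Rinv_l by (generalize (s0 t); lra). nra. }
      assert (w' t / (2 * s t) * E <= (/ 2 * mu t * s t + nu t) * E) by (apply Rmult_le_compat_r; lra).
      assert (nu t * E <= nu t * 1) by (apply Rmult_le_compat_l; auto). lra. }
    unfold Phi, Mu, Nu in Dec; rewrite !RInt_point in Dec; unfold zero in Dec; simpl in Dec.
    rewrite Rmult_0_r, Ropp_0, exp_0, Rmult_1_r, Rminus_0_r in Dec.
    set (I := RInt mu x0 x1) in *.
    assert (I0 : 0 <= I) by (apply (Mu0 x1); lra).
    assert (Ls : s x0 <= Cmod (a x0) + Cmod (b x0) + d).
    { apply Rnot_lt_le; intros L.
      generalize (s2 x0) (Cmod_ge_0 (a x0)) (Cmod_ge_0 (b x0)); unfold w; intros; nra. }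
    assert (S1 : s x1 <= exp (/ 2 * I) * (s x0 + RInt nu x0 x1)).
    { apply Rmult_le_reg_r with (exp (- (/ 2 * I))); [apply exp_pos|].
      replace (exp (/ 2 * I) * (s x0 + RInt nu x0 x1) * exp (- (/ 2 * I))) with
        (exp (/ 2 * I) * exp (- (/ 2 * I)) * (s x0 + RInt nu x0 x1)) by ring.
      rewrite <- exp_plus, Rplus_opp_r, exp_0; lra. }
    assert (exp (/ 2 * I) <= exp K) by (apply exp_le; lra).
    assert (Nu0 : 0 <= RInt nu x0 x1) by (apply RInt_ge_0; [lra|apply contR_ex, Cnu|intros; apply nu0]).
    assert (sqrt (w x1) <= s x1) by (apply sqrt_le_1_alt; lra).
    eapply Rle_trans; [eassumption|]; eapply Rle_trans; [exact S1|].
    apply Rmult_le_compat; [left; apply exp_pos|generalize (s0 x0); lra|assumption|lra]. }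
  assert (Fin : sqrt (w x1) <= exp K * (Cmod (a x0) + Cmod (b x0) + N)).
  { apply le_epsilon; intros e He.
    assert (EK := exp_pos K).
    assert (T := Core (e / exp K) ltac:(apply Rdiv_lt_0_compat; assumption)).
    replace (exp K * (Cmod (a x0) + Cmod (b x0) + e / exp K + N)) with
      (exp K * (Cmod (a x0) + Cmod (b x0) + N) + e) in T by (field; lra). exact T. }
  split; (eapply Rle_trans; [|exact Fin]).
  - rewrite <- (sqrt_pow2 (Cmod (a x1))) by apply Cmod_ge_0; apply sqrt_le_1_alt; unfold w; generalize (pow2_ge_0 (Cmod (b x1))); lra.
  - rewrite <- (sqrt_pow2 (Cmod (b x1))) by apply Cmod_ge_0; apply sqrt_le_1_alt; unfold w; generalize (pow2_ge_0 (Cmod (a x1))); lra.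
Qed.

Lemma Cauchy_C_eps (u : nat -> C) :
  (forall e, 0 < e -> exists n0, forall n m, (n0 <= n)%nat -> (n0 <= m)%nat -> Cmod (u n - u m) <= e) ->
  exists l, forall e, 0 < e -> exists n0, forall n, (n0 <= n)%nat -> Cmod (u n - l) <= e.
Proof.
  intros H.
  assert (Part : forall P : C -> R, (forall z w, Rabs (P z - P w) <= Cmod (z - w)) ->
     exists l : R, is_lim_seq (fun n => P (u n)) l).
  { intros P HP; apply ex_lim_seq_cauchy_corr; intros e.
    destruct (H (e / 2) ltac:(generalize (cond_pos e); lra)) as [n0 Hn].
    exists n0; intros n m A B; eapply Rle_lt_trans; [apply HP|].
    generalize (Hn n m A B) (cond_pos e); lra. }
  destruct (Part Re) as [lr Hr]; [intros; rewrite <- Re_Cminus; apply re_le_Cmod|].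
  destruct (Part Im) as [li Hi]; [intros; rewrite <- Im_Cminus; apply im_le_Cmod|].
  exists (lr, li); intros e He.
  apply is_lim_seq_spec in Hr; apply is_lim_seq_spec in Hi.
  destruct (Hr (mkposreal (e / 2) ltac:(lra))) as [n1 H1]; destruct (Hi (mkposreal (e / 2) ltac:(lra))) as [n2 H2].
  exists (n1 + n2)%nat; intros n Hn; specialize (H1 n ltac:(lia)); specialize (H2 n ltac:(lia)); simpl in H1, H2.
  eapply Rle_trans; [apply Cmod_le_parts|]; rewrite Re_Cminus, Im_Cminus; simpl; lra.
Qed.

(** The rate survives in the limit, since the Cauchy bound does not involve the larger index. *)
Lemma Cauchy_C (u : nat -> C) (eps : nat -> R) :
  (forall n m, (n <= m)%nat -> Cmod (u n - u m) <= eps n) -> is_lim_seq eps 0 ->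
  exists l, forall n, Cmod (u n - l) <= eps n.
Proof.
  intros H L; destruct (Cauchy_C_eps u) as [l Hl].
  - intros e He; apply is_lim_seq_spec in L; destruct (L (mkposreal (e / 2) ltac:(lra))) as [n0 Hn0].
    exists n0; intros n m Hn Hm; specialize (Hn0 n0 (le_n _)); simpl in Hn0.
    rewrite Rminus_0_r in Hn0; apply Rabs_def2 in Hn0.
    generalize (Cmod_le_via (u n) (u n0) (u m)) (H n0 n Hn) (H n0 m Hm); rewrite (Cmod_minus_sym (u n) (u n0)); lra.
  - exists l; intros n; apply le_epsilon; intros e He; destruct (Hl e He) as [n0 Hn0].
    generalize (Cmod_le_via (u n) (u (n + n0)%nat) l) (H n (n + n0)%nat ltac:(lia)) (Hn0 (n + n0)%nat ltac:(lia)); lra.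
Qed.

Lemma unif_contC (P : nat -> R -> C) (g : R -> C) : (forall n, contC (P n)) ->
  (forall e, 0 < e -> exists n, forall x, Cmod (P n x - g x) <= e) -> contC g.
Proof.
  intros HP HL x; apply cont_R_eps; intros e He.
  destruct (HL (e / 4) ltac:(lra)) as [n Hn'].
  destruct (proj1 (cont_R_eps _ _) (HP n x) (e / 4) ltac:(lra)) as [d [Hd Q]].
  exists d; split; [exact Hd|]; intros y Hy.
  generalize (Hn' y) (Hn' x) (Q y Hy) (Cmod_le_via (g y) (P n y) (g x)) (Cmod_le_via (P n y) (P n x) (g x)).
  rewrite (Cmod_minus_sym (g y) (P n y)); lra.
Qed.

(** The mean value inequality is applied to [Fn n t - G x t]. The approximation error [eta] is
    removed once [y] is fixed, so it need not be small relative to [y - x]. *)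
Lemma rd_limit (Fn Gn : nat -> R -> C) (F G : R -> C) x del : 0 < del ->
  @cont R_UniformSpace G x ->
  (forall e, 0 < e -> exists n, forall t, Rabs (t - x) < del ->
     Cmod (Fn n t - F t) <= e /\ Cmod (Gn n t - G t) <= e /\ rd (Fn n) t (Gn n t)) ->
  rd F x (G x).
Proof.
  intros Hdel HG H; apply rd_eps; intros eps He.
  destruct (proj1 (cont_R_eps _ _) HG (eps / 2) ltac:(lra)) as [d [Hd P]].
  exists (Rmin d del); split; [apply Rmin_pos; auto|]; intros y Hy.
  assert (Y1 := Rlt_le_trans _ _ _ Hy (Rmin_l _ _)); assert (Y2 := Rlt_le_trans _ _ _ Hy (Rmin_r _ _)).
  apply le_epsilon; intros eta Heta.
  destruct (H (Rmin (eta / 2) (eps / 2)) ltac:(apply Rmin_pos; lra)) as [n Hn].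
  assert (M1 := Rmin_l (eta / 2) (eps / 2)); assert (M2 := Rmin_r (eta / 2) (eps / 2)).
  set (e := Rmin (eta / 2) (eps / 2)) in *.
  pose (L := fun t => (Fn n t - G x * RtoC t)%C).
  assert (BL : Cmod (L y - L x) <= eps * Rabs (y - x)).
  { assert (DL : forall t, Rabs (t - x) < Rmin d del -> rd L t (Gn n t - G x)%C /\ Cmod (Gn n t - G x) <= eps).
    { intros t Ht.
      assert (T1 := Rlt_le_trans _ _ _ Ht (Rmin_l _ _)); assert (T2 := Rlt_le_trans _ _ _ Ht (Rmin_r _ _)).
      destruct (Hn t T2) as [_ [Q D]]; split.
      - eapply rd_eq; [apply dv_minus; [exact D|apply rd_mult; [apply dv_const|apply rd_RtoC]]|cbv beta; ring].
      - eapply Rle_trans; [apply (Cmod_le_via _ (G t))|]; generalize (P t T1); lra. }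
    destruct (Rle_dec x y) as [Lxy|Lxy].
    - rewrite Rabs_pos_eq in * by lra.
      apply (rd_mean_value L (fun t => Gn n t - G x)%C); [lra| |]; intros t Ht; apply DL; rewrite Rabs_pos_eq; lra.
    - rewrite Cmod_minus_sym, Rabs_minus_sym; rewrite Rabs_minus_sym in Hy.
      rewrite Rabs_pos_eq in * by lra.
      apply (rd_mean_value L (fun t => Gn n t - G x)%C); [lra| |]; intros t Ht; apply DL; rewrite Rabs_minus_sym, Rabs_pos_eq; lra. }
  replace (F y - F x - G x * RtoC (y - x))%C with ((L y - L x) - ((Fn n y - F y) - (Fn n x - F x)))%C.
  2: { unfold L; rewrite <- RtoC_minus'; ring. }
  generalize (Cmod_minus_triangle (L y - L x) ((Fn n y - F y) - (Fn n x - F x)))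
    (Cmod_minus_triangle (Fn n y - F y) (Fn n x - F x)).
  destruct (Hn y Y2) as [Q1 _]; destruct (Hn x) as [Q2 _]; [rewrite Rminus_diag, Rabs_R0; exact Hdel|]. lra.
Qed.

Lemma rel_cont_limit (S : C -> Prop) (fn : nat -> C -> C) f : (forall n, rel_cont S (fn n)) ->
  (forall K e, 0 < e -> exists n, forall z, S z -> Cmod z <= K -> Cmod (fn n z - f z) <= e) -> rel_cont S f.
Proof.
  intros Hn HL z Hz e He.
  destruct (HL (Cmod z + 1) (e / 4) ltac:(lra)) as [n P].
  destruct (Hn n z Hz (e / 4) ltac:(lra)) as [d [Hd Q]].
  exists (Rmin d 1); split; [apply Rmin_pos; lra|]; intros w Sw Hw.
  assert (M1 := Rmin_l d 1); assert (M2 := Rmin_r d 1).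
  generalize (Q w Sw ltac:(lra)) (P w Sw ltac:(generalize (Cmod_triangle_inv w z); lra)) (P z Hz ltac:(lra))
    (Cmod_le_via (f w) (fn n w) (f z)) (Cmod_le_via (fn n w) (fn n z) (f z)).
  rewrite (Cmod_minus_sym (f w) (fn n w)); lra.
Qed.

(* The shape of the Picard iterates, which makes them holomorphic in [z]. *)
Inductive zpoly : (R -> C -> C) -> Prop :=
| zpoly_coef c : contC c -> zpoly (fun x _ => c x)
| zpoly_plus f g : zpoly f -> zpoly g -> zpoly (fun x z => f x z + g x z)%C
| zpoly_z f : zpoly f -> zpoly (fun x z => z * f x z)%C.

Lemma zpoly_contC f z : zpoly f -> contC (fun x => f x z).
Proof.
  induction 1 as [c Hc|f g _ IHf _ IHg|f _ IH]; intros x.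
  - apply Hc.
  - apply cont_plus; [apply IHf|apply IHg].
  - apply cont_mult; [apply cont_const|apply IH].
Qed.

Lemma zpoly_cd f x z : zpoly f -> exists l, cd (f x) z l.
Proof.
  induction 1 as [c Hc|f g _ IHf _ IHg|f _ IH].
  - exists 0; apply cd_const.
  - destruct IHf as [l Hl], IHg as [m Hm]; exists (l + m)%C; apply cd_plus; assumption.
  - destruct IH as [l Hl]; eexists; apply cd_mult; [apply cd_id|exact Hl].
Qed.

Lemma zpoly_scal h f : contC h -> zpoly f -> zpoly (fun x z => h x * f x z)%C.
Proof.
  intros Hh; induction 1 as [c Hc|f g _ IHf _ IHg|f _ IH].
  - apply zpoly_coef; intros x; apply cont_mult; [apply Hh|apply Hc].
  - replace (fun x z => h x * (f x z + g x z))%C with (fun x z => h x * f x z + h x * g x z)%C.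
    + apply zpoly_plus; assumption.
    + apply functional_extensionality; intros x; apply functional_extensionality; intros z; ring.
  - replace (fun x z => h x * (z * f x z))%C with (fun x z => z * (h x * f x z))%C.
    + apply zpoly_z; assumption.
    + apply functional_extensionality; intros x; apply functional_extensionality; intros z; ring.
Qed.

Lemma zpoly_Cint x0 f : zpoly f -> zpoly (fun x z => Cint (fun t => f t z) x0 x).
Proof.
  induction 1 as [c Hc|f g Hf IHf Hg IHg|f Hf IH].
  - apply (zpoly_coef (fun x => Cint c x0 x)); intros x; eapply rd_cont, rd_Cint, Hc.
  - replace (fun x z => Cint (fun t => f t z + g t z)%C x0 x)
      with (fun x z => Cint (fun t => f t z) x0 x + Cint (fun t => g t z) x0 x)%C.
    + apply zpoly_plus; assumption.
    + apply functional_extensionality; intros x; apply functional_extensionality; intros z; symmetry.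
      apply (Cint_plus _ _ _ _ (contC_exC _ x0 x (zpoly_contC f z Hf)) (contC_exC _ x0 x (zpoly_contC g z Hg))).
  - replace (fun x z => Cint (fun t => z * f t z)%C x0 x) with (fun x z => z * Cint (fun t => f t z) x0 x)%C.
    + apply zpoly_z; assumption.
    + apply functional_extensionality; intros x; apply functional_extensionality; intros z; symmetry.
      apply (Cint_scal z _ _ _ (contC_exC _ x0 x (zpoly_contC f z Hf))).
Qed.

Section Picard.
Variables (q p : R -> C) (x0 S0 : R).
Hypotheses (Hq : contC q) (Hp : contC p).
Hypotheses (Bq : forall x, Cmod (q x) <= S0) (Bp : forall x, Cmod (p x) <= S0).
Hypothesis (Zp : forall x, x <= x0 -> p x = 0).

(** Iterates of the integral equations with data [(1, 0)] at [x0]. As [p] vanishes to the left of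
    [x0], they keep this value there, so their limit has the Jost normalization. *)
Fixpoint picard (n : nat) : (R -> C -> C) * (R -> C -> C) :=
  match n with
  | O => (fun _ _ => RtoC 1, fun _ _ => RtoC 0)
  | S k => (fun x z => 1 + Cint (fun t => q t * snd (picard k) t z) x0 x,
            fun x z => Cint (fun t => RtoC 2 * Ci * (z * snd (picard k) t z) + p t * fst (picard k) t z) x0 x)%C
  end.

Lemma contC_const c : contC (fun _ => c).
Proof. intros x; apply cont_const. Qed.

Lemma picard_zpoly n : zpoly (fst (picard n)) /\ zpoly (snd (picard n)).
Proof.
  induction n as [|n [IHa IHb]]; simpl; split.
  - apply (zpoly_coef (fun _ => RtoC 1)), contC_const.
  - apply (zpoly_coef (fun _ => RtoC 0)), contC_const.
  - apply (zpoly_plus (fun _ _ => RtoC 1)); [apply (zpoly_coef (fun _ => RtoC 1)), contC_const|].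
    apply (zpoly_Cint x0 (fun t z => q t * snd (picard n) t z)%C), zpoly_scal; assumption.
  - apply (zpoly_Cint x0 (fun t z => RtoC 2 * Ci * (z * snd (picard n) t z) + p t * fst (picard n) t z)%C).
    apply (zpoly_plus (fun t z => RtoC 2 * Ci * (z * snd (picard n) t z))%C (fun t z => p t * fst (picard n) t z)%C).
    + apply (zpoly_scal (fun _ => (RtoC 2 * Ci)%C) (fun t z => z * snd (picard n) t z)%C); [apply contC_const|].
      apply zpoly_z, IHb.
    + apply zpoly_scal; assumption.
Qed.

Lemma picard_int n z : contC (fun t => q t * snd (picard n) t z)%C /\
  contC (fun t => RtoC 2 * Ci * (z * snd (picard n) t z) + p t * fst (picard n) t z)%C.
Proof.
  destruct (picard_zpoly n) as [A B]; split.
  - apply (zpoly_contC (fun t z => q t * snd (picard n) t z)%C), zpoly_scal; assumption.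
  - intros x; apply cont_plus; apply cont_mult; [apply cont_const| |apply Hp|apply (zpoly_contC _ z A)].
    apply cont_mult; [apply cont_const|apply (zpoly_contC _ z B)].
Qed.

Lemma picard_left n z x : x <= x0 -> fst (picard n) x z = 1 /\ snd (picard n) x z = 0.
Proof.
  revert x; induction n as [|n IH]; intros x Hx; simpl; [auto|].
  assert (Z : forall f, (forall t, x <= t <= x0 -> f t = RtoC 0) -> Cint f x0 x = 0).
  { intros f Hf; rewrite (Cint_ext f (fun _ => RtoC 0)); [rewrite Cint_const; ring|].
    rewrite Rmin_right, Rmax_left by lra; exact Hf. }
  rewrite !Z; [split; [ring|reflexivity]| |].
  - intros t Ht; destruct (IH t) as [_ E]; [lra|]; rewrite E, (Zp t) by lra; ring.
  - intros t Ht; destruct (IH t) as [_ E]; [lra|]; rewrite E; ring.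
Qed.

(** With the weight [exp (2 kap (x - x0))], integration with coefficient [kap] gains a factor 1/2,
    whence a geometric rate for all [z] in a disc; [kap] is the sum of the coefficient bounds [S0]
    of [a] and [S0 + 2 Z] of [b]. *)
Lemma picard_diff Z n z x : Cmod z <= Z -> x0 <= x ->
  Cmod (fst (picard (S n)) x z - fst (picard n) x z) + Cmod (snd (picard (S n)) x z - snd (picard n) x z)
   <= (/ 2) ^ n * exp (2 * (2 * S0 + 2 * Z) * (x - x0)).
Proof.
  intros HZ; set (kap := 2 * S0 + 2 * Z).
  assert (S0p : 0 <= S0) by (eapply Rle_trans; [apply Cmod_ge_0|apply (Bq 0)]).
  assert (Zpos : 0 <= Z) by (eapply Rle_trans; [apply Cmod_ge_0|exact HZ]).
  assert (Kp : 0 <= kap) by (unfold kap; lra).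
  revert x; induction n as [|n IH]; intros x Hx.
  - simpl picard; simpl fst; simpl snd.
    rewrite (Cint_ext _ (fun _ => RtoC 0)) by (intros; ring).
    rewrite Cint_const; replace (1 + RtoC (x - x0) * 0 - 1)%C with (RtoC 0) by ring; rewrite Cmod_0.
    rewrite (Cint_ext _ p) by (intros; ring).
    replace (Cint p x0 x - 0)%C with (Cint p x0 x) by ring.
    assert (B := Cint_bound p x0 x S0 (contC_exC p x0 x Hp) ltac:(intros; apply Bp)).
    rewrite Rabs_pos_eq in B by lra.
    assert (E := exp_ineq1_le (2 * kap * (x - x0))).
    assert (S0 * (x - x0) <= kap * (x - x0)) by (apply Rmult_le_compat_r; unfold kap; lra).
    assert (0 <= kap * (x - x0)) by (apply Rmult_le_pos; lra). simpl; lra.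
  - destruct (picard_int n z) as [C1 C2]; destruct (picard_int (S n) z) as [C3 C4].
    assert (X1 := contC_exC _ x0 x C1); assert (X2 := contC_exC _ x0 x C2);
    assert (X3 := contC_exC _ x0 x C3); assert (X4 := contC_exC _ x0 x C4).
    pose (g := fun t => (/ 2) ^ n * kap * exp (2 * kap * (t - x0))).
    assert (Cg : contR g).
    { intros t; apply (continuous_scal_r (V := R_NormedModule) ((/ 2) ^ n * kap) (fun t => exp (2 * kap * (t - x0)))).
      apply (continuous_comp (fun t => 2 * kap * (t - x0)) exp).
      - apply (continuous_scal_r (V := R_NormedModule) (2 * kap) (fun t => t - x0)).
        apply (continuous_minus (V := R_NormedModule)); [apply continuous_id|apply continuous_const].
      - apply continuity_pt_filterlim, derivable_continuous_pt, derivable_pt_exp. }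
    assert (Ig : RInt g x0 x <= (/ 2) ^ S n * exp (2 * kap * (x - x0))).
    { pose (G := fun t => (/ 2) ^ S n * exp (2 * kap * (t - x0))).
      assert (E : is_RInt g x0 x (minus (G x) (G x0))).
      { apply (is_RInt_derive (V := R_CompleteNormedModule)).
        - intros t _; unfold G, g.
          replace ((/ 2) ^ n * kap * exp (2 * kap * (t - x0))) with ((/ 2) ^ S n * (2 * kap * exp (2 * kap * (t - x0))))
            by (simpl; field).
          apply is_derive_scal.
          apply (is_derive_comp (V := R_NormedModule) exp (fun t => 2 * kap * (t - x0))); [apply is_derive_exp|].
          auto_derive; [exact I|ring].
        - intros t _; apply Cg. }
      rewrite (is_RInt_unique _ _ _ _ E); unfold minus, plus, opp, G; simpl; fold (pow (/ 2) (S n)).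
      assert (0 <= (/ 2) ^ S n) by (apply pow_le; lra).
      generalize (Rmult_le_pos _ _ H (Rlt_le _ _ (exp_pos (2 * kap * (x0 - x0))))); simpl; lra. }
    assert (B1 : Cmod (fst (picard (S (S n))) x z - fst (picard (S n)) x z) <=
      RInt (fun t => S0 * Cmod (snd (picard (S n)) t z - snd (picard n) t z)) x0 x).
    { change (fst (picard (S (S n))) x z) with (1 + Cint (fun t => q t * snd (picard (S n)) t z) x0 x)%C.
      change (fst (picard (S n)) x z) with (1 + Cint (fun t => q t * snd (picard n) t z) x0 x)%C.
      match goal with |- Cmod (RtoC 1 + ?A - (RtoC 1 + ?B))%C <= _ => replace (RtoC 1 + A - (RtoC 1 + B))%C with (A - B)%C by ring end.
      rewrite <- (Cint_minus _ _ _ _ X3 X1).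
      apply Cint_le; [exact Hx|exact (exC_minus _ _ _ _ X3 X1)| |].
      - apply contR_ex; intros t; apply (continuous_scal_r (V := R_NormedModule)).
        apply (contR_Cmod (fun t => snd (picard (S n)) t z - snd (picard n) t z)%C).
        intros s; apply cont_minus; apply (zpoly_contC _ z); apply picard_zpoly.
      - intros t _.
        replace (q t * snd (picard (S n)) t z - q t * snd (picard n) t z)%C with
          (q t * (snd (picard (S n)) t z - snd (picard n) t z))%C by ring.
        rewrite Cmod_mult; apply Rmult_le_compat_r; [apply Cmod_ge_0|apply Bq]. }
    assert (B2 : Cmod (snd (picard (S (S n))) x z - snd (picard (S n)) x z) <=
      RInt (fun t => 2 * Z * Cmod (snd (picard (S n)) t z - snd (picard n) t z) +
         S0 * Cmod (fst (picard (S n)) t z - fst (picard n) t z)) x0 x).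
    { change (snd (picard (S (S n))) x z) with (Cint (fun t => RtoC 2 * Ci * (z * snd (picard (S n)) t z) + p t * fst (picard (S n)) t z) x0 x)%C.
      change (snd (picard (S n)) x z) with (Cint (fun t => RtoC 2 * Ci * (z * snd (picard n) t z) + p t * fst (picard n) t z) x0 x)%C.
      rewrite <- (Cint_minus _ _ _ _ X4 X2).
      apply Cint_le; [exact Hx|exact (exC_minus _ _ _ _ X4 X2)| |].
      - apply contR_ex; apply contR_plus; intros t; apply (continuous_scal_r (V := R_NormedModule)).
        + apply (contR_Cmod (fun t => snd (picard (S n)) t z - snd (picard n) t z)%C).
          intros s; apply cont_minus; apply (zpoly_contC _ z); apply picard_zpoly.
        + apply (contR_Cmod (fun t => fst (picard (S n)) t z - fst (picard n) t z)%C).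
          intros s; apply cont_minus; apply (zpoly_contC _ z); apply picard_zpoly.
      - intros t _.
        match goal with |- Cmod (?u * (z * ?b1) + ?c * ?a1 - (?u * (z * ?b0) + ?c * ?a0))%C <= _ =>
          replace (u * (z * b1) + c * a1 - (u * (z * b0) + c * a0))%C with
          (u * z * (b1 - b0) + c * (a1 - a0))%C by ring end.
        eapply Rle_trans; [apply Cmod_triangle|]; rewrite !Cmod_mult, Cmod_Ci, Cmod_R, (Rabs_pos_eq 2) by lra.
        apply Rplus_le_compat; (apply Rmult_le_compat_r; [apply Cmod_ge_0|]); [nra|apply Bp]. }
    eapply Rle_trans; [apply Rplus_le_compat; [exact B1|exact B2]|].
    assert (Cb : contR (fun t => Cmod (snd (picard (S n)) t z - snd (picard n) t z))).
    { apply (contR_Cmod (fun t => snd (picard (S n)) t z - snd (picard n) t z)%C).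
      intros s; apply cont_minus; apply (zpoly_contC _ z); apply picard_zpoly. }
    assert (Ca : contR (fun t => Cmod (fst (picard (S n)) t z - fst (picard n) t z))).
    { apply (contR_Cmod (fun t => fst (picard (S n)) t z - fst (picard n) t z)%C).
      intros s; apply cont_minus; apply (zpoly_contC _ z); apply picard_zpoly. }
    assert (Cs : forall k f, contR f -> contR (fun t => k * f t)).
    { intros k f Hf t; apply (continuous_scal_r (V := R_NormedModule)), Hf. }
    rewrite <- (RInt_plus (V := R_CompleteNormedModule)) by (apply contR_ex; try apply contR_plus; apply Cs; assumption).
    eapply Rle_trans; [|exact Ig]; apply RInt_le; [exact Hx| |apply contR_ex, Cg|].
    + apply contR_ex; apply contR_plus; [apply Cs, Cb|apply contR_plus; apply Cs; assumption].
    + intros t Ht; match goal with |- plus ?u ?v <= _ => change (plus u v) with (u + v) end; unfold g.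
      specialize (IH t ltac:(lra)).
      match type of IH with ?A + ?B <= ?C => set (a := A) in *; set (b := B) in *; set (E := C) in * end.
      assert (a0 : 0 <= a) by apply Cmod_ge_0. assert (b0 : 0 <= b) by apply Cmod_ge_0.
      replace ((/ 2) ^ n * kap * exp (2 * kap * (t - x0))) with (kap * E) by (unfold E; ring).
      apply Rle_trans with (kap * (a + b)); [|apply Rmult_le_compat_l; auto].
      unfold kap; generalize (Rmult_le_pos _ _ S0p a0) (Rmult_le_pos _ _ S0p b0) (Rmult_le_pos _ _ Zpos a0) (Rmult_le_pos _ _ Zpos b0). intros; lra.
Qed.

Theorem picard_solution : exists a b : R -> C -> C,
  (forall z x, rd (fun y => a y z) x (q x * b x z)%C) /\
  (forall z x, rd (fun y => b y z) x (RtoC 2 * Ci * z * b x z + p x * a x z)%C) /\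
  (forall z x, x <= x0 -> a x z = 1 /\ b x z = 0) /\
  (forall x, holo (a x) /\ holo (b x)) /\
  (forall x, rel_cont (fun z => 0 <= Im z) (a x) /\ rel_cont (fun z => 0 <= Im z) (b x)).
Proof.
  (* One bound for all [x <= L] and [|z| <= Z], so that convergence is uniform in either variable
     while the other is fixed. *)
  pose (Ex := fun Z L => exp (2 * (2 * S0 + 2 * Z) * (L - x0))).
  assert (S0p : 0 <= S0) by (eapply Rle_trans; [apply Cmod_ge_0|apply (Bq 0)]).
  assert (P2 : forall n, 0 < (/ 2) ^ n) by (intros; apply pow_lt; lra).
  assert (D1 : forall Z L n z x, Cmod z <= Z -> x <= L -> x0 <= L ->
    Cmod (fst (picard (S n)) x z - fst (picard n) x z) <= (/ 2) ^ n * Ex Z L /\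
    Cmod (snd (picard (S n)) x z - snd (picard n) x z) <= (/ 2) ^ n * Ex Z L).
  { intros Z L n z x Hz Hx HL.
    assert (Zpos : 0 <= Z) by (eapply Rle_trans; [apply Cmod_ge_0|exact Hz]).
    destruct (Rle_dec x x0) as [Q|Q].
    - destruct (picard_left n z x Q) as [E1 E2]; destruct (picard_left (S n) z x Q) as [E3 E4].
      rewrite E1, E2, E3, E4; replace (1 - 1)%C with (RtoC 0) by ring; replace (0 - 0)%C with (RtoC 0) by ring.
      rewrite Cmod_0; assert (0 < (/ 2) ^ n * Ex Z L) by (apply Rmult_lt_0_compat; [apply P2|apply exp_pos]); lra.
    - assert (B := picard_diff Z n z x Hz ltac:(lra)).
      assert (exp (2 * (2 * S0 + 2 * Z) * (x - x0)) <= Ex Z L).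
      { apply exp_le, Rmult_le_compat_l; lra. }
      assert ((/ 2) ^ n * exp (2 * (2 * S0 + 2 * Z) * (x - x0)) <= (/ 2) ^ n * Ex Z L).
      { apply Rmult_le_compat_l; [left; apply P2|assumption]. }
      match type of B with Cmod ?u + Cmod ?v <= _ => generalize (Cmod_ge_0 u) (Cmod_ge_0 v) end; lra. }
  assert (D2 : forall Z L n m z x, Cmod z <= Z -> x <= L -> x0 <= L -> (n <= m)%nat ->
    Cmod (fst (picard n) x z - fst (picard m) x z) <= 2 * Ex Z L * (/ 2) ^ n /\
    Cmod (snd (picard n) x z - snd (picard m) x z) <= 2 * Ex Z L * (/ 2) ^ n).
  { intros Z L n m z x Hz Hx HL Hnm.
    assert (T : forall k, Cmod (fst (picard n) x z - fst (picard (n + k)) x z) <= 2 * Ex Z L * ((/ 2) ^ n - (/ 2) ^ (n + k)) /\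
      Cmod (snd (picard n) x z - snd (picard (n + k)) x z) <= 2 * Ex Z L * ((/ 2) ^ n - (/ 2) ^ (n + k))).
    { induction k as [|k [IH1 IH2]].
      - rewrite Nat.add_0_r; replace (fst (picard n) x z - fst (picard n) x z)%C with (RtoC 0) by ring;
        replace (snd (picard n) x z - snd (picard n) x z)%C with (RtoC 0) by ring; rewrite Cmod_0; lra.
      - replace (n + S k)%nat with (S (n + k)) by lia.
        destruct (D1 Z L (n + k)%nat z x Hz Hx HL) as [Q1 Q2].
        rewrite Cmod_minus_sym in Q1; rewrite Cmod_minus_sym in Q2.
        replace ((/ 2) ^ S (n + k)) with (/ 2 * (/ 2) ^ (n + k)) by reflexivity.
        split; (eapply Rle_trans; [eapply Rle_trans; [apply Cmod_le_via|apply Rplus_le_compat; [first [exact IH1|exact IH2]|first [exact Q1|exact Q2]]]|lra]). }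
    destruct (T (m - n)%nat) as [T1 T2]; replace (n + (m - n))%nat with m in * by lia.
    assert (0 < Ex Z L * (/ 2) ^ m) by (apply Rmult_lt_0_compat; [apply exp_pos|apply P2]).
    split; lra. }
  assert (LimG : forall K, is_lim_seq (fun n => K * (/ 2) ^ n) 0).
  { intros K; replace (Finite 0) with (Rbar_mult K 0) by (simpl; f_equal; ring).
    apply is_lim_seq_scal_l, is_lim_seq_geom; rewrite Rabs_pos_eq; lra. }
  assert (Lim : forall x z, exists l : C * C, forall Z L n, Cmod z <= Z -> x <= L -> x0 <= L ->
     Cmod (fst (picard n) x z - fst l) <= 2 * Ex Z L * (/ 2) ^ n /\
     Cmod (snd (picard n) x z - snd l) <= 2 * Ex Z L * (/ 2) ^ n).
  { intros x z.
    assert (Base := fun n m => D2 (Cmod z) (Rmax x x0) n m z x (Rle_refl _) (Rmax_l _ _) (Rmax_r _ _)).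
    destruct (Cauchy_C (fun n => fst (picard n) x z) (fun n => 2 * Ex (Cmod z) (Rmax x x0) * (/ 2) ^ n)) as [la Hla];
      [intros; apply Base; assumption|apply LimG|].
    destruct (Cauchy_C (fun n => snd (picard n) x z) (fun n => 2 * Ex (Cmod z) (Rmax x x0) * (/ 2) ^ n)) as [lb Hlb];
      [intros; apply Base; assumption|apply LimG|].
    (* The limit was found with the bounds belonging to this [x] and [z]; the rate for any other [Z]
       and [L] follows by comparison with a far iterate. *)
    exists (la, lb); intros Z L n Hz Hx HL; simpl.
    split; apply le_epsilon; intros e He;
    (assert (LG := LimG (2 * Ex (Cmod z) (Rmax x x0))); apply is_lim_seq_spec in LG;
     destruct (LG (mkposreal e He)) as [m Hm]; specialize (Hm (n + m)%nat ltac:(lia)); simpl in Hm;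
     rewrite Rminus_0_r in Hm; apply Rabs_def2 in Hm;
     destruct (D2 Z L n (n + m)%nat z x Hz Hx HL ltac:(lia)) as [Q1 Q2]).
    - generalize (Cmod_le_via (fst (picard n) x z) (fst (picard (n + m)) x z) la) (Hla (n + m)%nat); lra.
    - generalize (Cmod_le_via (snd (picard n) x z) (snd (picard (n + m)) x z) lb) (Hlb (n + m)%nat); lra. }
  pose (l := fun x z => proj1_sig (constructive_indefinite_description _ (Lim x z))).
  assert (Hl : forall x z Z L n, Cmod z <= Z -> x <= L -> x0 <= L ->
     Cmod (fst (picard n) x z - fst (l x z)) <= 2 * Ex Z L * (/ 2) ^ n /\
     Cmod (snd (picard n) x z - snd (l x z)) <= 2 * Ex Z L * (/ 2) ^ n).
  { intros x z; unfold l; destruct (constructive_indefinite_description _ (Lim x z)) as [l' Hl']; exact Hl'. }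
  clearbody l.
  assert (Small : forall Z L e, 0 < e -> exists n, forall k, (n <= k)%nat -> 2 * Ex Z L * (/ 2) ^ k <= e).
  { intros Z L e He; assert (LG := LimG (2 * Ex Z L)); apply is_lim_seq_spec in LG.
    destruct (LG (mkposreal e He)) as [m Hm]; exists m; intros k Hk; specialize (Hm k Hk); simpl in Hm.
    rewrite Rminus_0_r in Hm; apply Rabs_def2 in Hm; lra. }
  assert (U : forall x K e, 0 < e -> exists n, forall k z, (n <= k)%nat -> Cmod z <= K ->
     Cmod (fst (picard k) x z - fst (l x z)) <= e /\ Cmod (snd (picard k) x z - snd (l x z)) <= e).
  { intros x K e He; destruct (Small K (Rmax x x0) e He) as [n Hn]; exists n; intros k z Hk Hz.
    destruct (Hl x z K (Rmax x x0) k Hz (Rmax_l _ _) (Rmax_r _ _)); specialize (Hn k Hk); lra. }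
  assert (Ux : forall z L e, x0 <= L -> 0 < e -> exists n, forall k x, (n <= k)%nat -> x <= L ->
     Cmod (fst (picard k) x z - fst (l x z)) <= e /\ Cmod (snd (picard k) x z - snd (l x z)) <= e).
  { intros z L e HL He; destruct (Small (Cmod z) L e He) as [n Hn]; exists n; intros k x Hk Hx.
    destruct (Hl x z (Cmod z) L k (Rle_refl _) Hx HL); specialize (Hn k Hk); lra. }
  assert (UC : forall (P : (R -> C -> C) * (R -> C -> C) -> R -> C -> C) (g : R -> C) z,
     (forall n, contC (fun x => P (picard n) x z)) ->
     (forall L e, x0 <= L -> 0 < e -> exists n, forall x, x <= L -> Cmod (P (picard n) x z - g x) <= e) -> contC g).
  { intros P g z HP HL x; apply cont_R_eps; intros e He.
    destruct (HL (Rmax x x0 + 1) (e / 4)) as [n Hn]; [generalize (Rmax_r x x0); lra|lra|].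
    destruct (proj1 (cont_R_eps _ _) (HP n x) (e / 4) ltac:(lra)) as [d [Hd Q]].
    exists (Rmin d 1); split; [apply Rmin_pos; lra|]; intros y Hy.
    assert (M1 := Rmin_l d 1); assert (M2 := Rmin_r d 1); assert (M3 := Rmax_l x x0).
    assert (Y : y <= Rmax x x0 + 1).
    { assert (Y1 : Rabs (y - x) < 1) by lra; apply Rabs_def2 in Y1; lra. }
    generalize (Hn y Y) (Hn x ltac:(lra)) (Q y ltac:(lra))
      (Cmod_le_via (g y) (P (picard n) y z) (g x)) (Cmod_le_via (P (picard n) y z) (P (picard n) x z) (g x)).
    rewrite (Cmod_minus_sym (g y) (P (picard n) y z)); lra. }
  assert (Cla : forall z, contC (fun x => fst (l x z))).
  { intros z; apply (UC fst (fun x => fst (l x z)) z); [intros n; apply (zpoly_contC _ z), picard_zpoly|].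
    intros L e HL He; destruct (Ux z L e HL He) as [n Hn]; exists n; intros x Hx; apply (Hn n); auto. }
  assert (Clb : forall z, contC (fun x => snd (l x z))).
  { intros z; apply (UC snd (fun x => snd (l x z)) z); [intros n; apply (zpoly_contC _ z), picard_zpoly|].
    intros L e HL He; destruct (Ux z L e HL He) as [n Hn]; exists n; intros x Hx; apply (Hn n); auto. }
  exists (fun x z => fst (l x z)), (fun x z => snd (l x z)).
  split; [|split; [|split; [|split]]].
  - intros z x.
    apply (rd_limit (fun n y => fst (picard (S n)) y z) (fun n y => q y * snd (picard n) y z)%C
      (fun y => fst (l y z)) (fun y => q y * snd (l y z))%C x 1 Rlt_0_1).
    + apply cont_mult; [apply Hq|apply Clb].
    + intros e He.
      destruct (Ux z (Rmax x x0 + 1) (e / (S0 + 1))) as [n Hn];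
        [generalize (Rmax_r x x0); lra|apply Rdiv_lt_0_compat; lra|].
      assert (Es : e / (S0 + 1) * (S0 + 1) = e) by (field; lra).
      assert (E0 : 0 < e / (S0 + 1)) by (apply Rdiv_lt_0_compat; lra).
      set (e' := e / (S0 + 1)) in *.
      exists n; intros t Ht.
      assert (Tl : t <= Rmax x x0 + 1) by (apply Rabs_def2 in Ht; generalize (Rmax_l x x0); lra).
      destruct (Hn n t (le_n _) Tl) as [_ Q2]; destruct (Hn (S n) t ltac:(lia) Tl) as [Q1 _].
      split; [|split].
      * nra.
      * replace (q t * snd (picard n) t z - q t * snd (l t z))%C with (q t * (snd (picard n) t z - snd (l t z)))%C by ring.
        rewrite Cmod_mult; apply Rle_trans with (S0 * e'); [|nra].
        apply Rmult_le_compat; auto; apply Cmod_ge_0.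
      * simpl; eapply rd_eq; [apply dv_plus; [apply dv_const|apply rd_Cint, (picard_int n z)]|cbv beta; ring].
  - intros z x.
    apply (rd_limit (fun n y => snd (picard (S n)) y z)
      (fun n y => RtoC 2 * Ci * (z * snd (picard n) y z) + p y * fst (picard n) y z)%C
      (fun y => snd (l y z)) (fun y => RtoC 2 * Ci * z * snd (l y z) + p y * fst (l y z))%C x 1 Rlt_0_1).
    + apply cont_plus; apply cont_mult; try apply cont_const; [apply Clb|apply Hp|apply Cla].
    + intros e He.
      set (T := S0 + 2 * Cmod z + 1); assert (T1 : 1 <= T) by (unfold T; generalize (Cmod_ge_0 z); lra).
      destruct (Ux z (Rmax x x0 + 1) (e / T)) as [n Hn];
        [generalize (Rmax_r x x0); lra|apply Rdiv_lt_0_compat; lra|].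
      assert (Es : e / T * T = e) by (field; lra).
      assert (E0 : 0 < e / T) by (apply Rdiv_lt_0_compat; lra).
      set (e' := e / T) in *.
      exists n; intros t Ht.
      assert (Tl : t <= Rmax x x0 + 1) by (apply Rabs_def2 in Ht; generalize (Rmax_l x x0); lra).
      destruct (Hn n t (le_n _) Tl) as [Q3 Q2]; destruct (Hn (S n) t ltac:(lia) Tl) as [_ Q1].
      split; [|split].
      * nra.
      * replace (RtoC 2 * Ci * (z * snd (picard n) t z) + p t * fst (picard n) t z -
          (RtoC 2 * Ci * z * snd (l t z) + p t * fst (l t z)))%C with
         (RtoC 2 * Ci * z * (snd (picard n) t z - snd (l t z)) + p t * (fst (picard n) t z - fst (l t z)))%C by ring.
        eapply Rle_trans; [apply Cmod_triangle|]; rewrite !Cmod_mult, Cmod_Ci, Cmod_R, (Rabs_pos_eq 2) by lra.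
        assert (Cmod (p t) * Cmod (fst (picard n) t z - fst (l t z)) <= S0 * e').
        { apply Rmult_le_compat; auto; apply Cmod_ge_0. }
        assert (2 * 1 * Cmod z * Cmod (snd (picard n) t z - snd (l t z)) <= 2 * 1 * Cmod z * e').
        { apply Rmult_le_compat_l; [generalize (Cmod_ge_0 z); lra|assumption]. }
        unfold T in Es; lra.
      * simpl; apply (rd_Cint (fun t => RtoC 2 * Ci * (z * snd (picard n) t z) + p t * fst (picard n) t z)%C), (picard_int n z).
  - intros z x Hx.
    assert (Z : forall u v : C, (forall e, 0 < e -> Cmod (u - v) <= e) -> v = u).
    { intros u v H; assert (E : (u - v)%C = 0).
      { apply Cmod_eq_0, Rle_antisym; [|apply Cmod_ge_0]; apply le_epsilon; intros e He; rewrite Rplus_0_l; apply H, He. }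
      replace v with (u - (u - v))%C by ring; rewrite E; ring. }
    split; apply Z; intros e He; destruct (U x (Cmod z) e He) as [n Hn];
    destruct (Hn n z (le_n _) (Rle_refl _)) as [Q1 Q2]; destruct (picard_left n z x Hx) as [E1 E2].
    + rewrite E1 in Q1; exact Q1.
    + rewrite E2 in Q2; exact Q2.
  - intros x; split.
    + apply (holo_limit (fun n => fst (picard n) x)).
      * intros n z _; apply zpoly_cd, picard_zpoly.
      * intros K e He; destruct (U x K e He) as [n Hn]; exists n; intros z _ Hz; apply (Hn n); auto.
    + apply (holo_limit (fun n => snd (picard n) x)).
      * intros n z _; apply zpoly_cd, picard_zpoly.
      * intros K e He; destruct (U x K e He) as [n Hn]; exists n; intros z _ Hz; apply (Hn n); auto.
  - assert (PC : forall f x, zpoly f -> rel_cont (fun z => 0 <= Im z) (f x)).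
    { intros f x Hf z _ e He; destruct (zpoly_cd f x z Hf) as [d Hd].
      destruct (proj1 (cont_C_eps _ _) (cd_cont _ _ _ Hd) e He) as [r [Hr Q]]; exists r; split; auto. }
    intros x; split.
    + apply (rel_cont_limit _ (fun n => fst (picard n) x)).
      * intros n; apply PC, picard_zpoly.
      * intros K e He; destruct (U x K e He) as [n Hn]; exists n; intros z _ Hz; apply (Hn n); auto.
    + apply (rel_cont_limit _ (fun n => snd (picard n) x)).
      * intros n; apply PC, picard_zpoly.
      * intros K e He; destruct (U x K e He) as [n Hn]; exists n; intros z _ Hz; apply (Hn n); auto.
Qed.

End Picard.

(** * Jost solutions of the Zakharov-Shabat system *)

(** For nonnegative functions an L^1 bound, stated on bounded intervals so that no improper integral
    is involved. *)
Definition L1le (f : R -> R) (K : R) : Prop := forall A B, A <= B -> RInt f A B <= K.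

Definition size2 (q p : R -> C) (x : R) : R := Cmod (q x) + Cmod (p x).
Definition dist2 (q p q1 p1 : R -> C) (x : R) : R := Cmod (q x - q1 x) + Cmod (p x - p1 x).

Definition near (e : R) (q p q1 p1 : R -> C) : Prop :=
  (forall x, Cmod (q x - q1 x) <= e /\ Cmod (p x - p1 x) <= e) /\ L1le (dist2 q p q1 p1) e.

(** C^1 potentials of compact support, for which a Jost solution can be started at a finite
    point. *)
Definition nice (q p : R -> C) : Prop :=
  exists (q' p' : R -> C) (S M : R),
    (forall x, rd q x (q' x)) /\ (forall x, rd p x (p' x)) /\ contC q' /\ contC p' /\
    (forall x, Cmod (q x) <= S /\ Cmod (p x) <= S /\ Cmod (q' x) <= S /\ Cmod (p' x) <= S) /\
    (forall x, M <= Rabs x -> q x = 0 /\ p x = 0).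

(** Limits of nice pairs in sup and L^1 norm; [good_pot] places the potentials coming from H^{2,2}
    here. *)
Definition good (q p : R -> C) : Prop :=
  contC q /\ contC p /\ (exists K, L1le (size2 q p) K) /\
  forall e, 0 < e -> exists q1 p1, nice q1 p1 /\ near e q p q1 p1.

(* The system [Phi_x = [[-i z, q], [p, i z]] Phi] with the exponential [e^{-i z x}] factored out. *)
Definition left_jost (q p : R -> C) (z : C) (a b : R -> C) : Prop :=
  (forall x, rd a x (q x * b x)%C) /\
  (forall x, rd b x (RtoC 2 * Ci * z * b x + p x * a x)%C) /\
  (forall e, 0 < e -> exists X, forall x, x <= X -> Cmod (a x - 1) <= e /\ Cmod (b x) <= e).

Lemma contR_size2 q p : contC q -> contC p -> contR (size2 q p).
Proof. intros; apply contR_plus; apply contR_Cmod; assumption. Qed.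

Lemma contC_minus f g : contC f -> contC g -> contC (fun x => f x - g x)%C.
Proof. intros A B x; apply cont_minus; auto. Qed.

Lemma contC_mult f g : contC f -> contC g -> contC (fun x => f x * g x)%C.
Proof. intros A B x; apply cont_mult; auto. Qed.

Lemma contR_dist2 q p q1 p1 : contC q -> contC p -> contC q1 -> contC p1 -> contR (dist2 q p q1 p1).
Proof. intros; apply contR_plus; apply (contR_Cmod (fun x => _)); apply contC_minus; assumption. Qed.

Lemma rd_contC f f' : (forall x, rd f x (f' x)) -> contC f.
Proof. intros H x; eapply rd_cont, H. Qed.

Lemma RInt_const_bound f a b K : a <= b -> contR f -> (forall t, a <= t <= b -> f t <= K) -> RInt f a b <= K * (b - a).
Proof.
  intros Hab Hf H; replace (K * (b - a)) with (RInt (fun _ => K) a b).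
  - apply RInt_le; [exact Hab|apply contR_ex, Hf|apply ex_RInt_const|intros; apply H; lra].
  - rewrite (RInt_const (V := R_CompleteNormedModule)); unfold scal; simpl; unfold mult; simpl; ring.
Qed.

Lemma RInt_scal_R k f a b : contR f -> RInt (fun t => k * f t) a b = k * RInt f a b.
Proof. intros H; apply (RInt_scal (V := R_CompleteNormedModule) f a b k), contR_ex, H. Qed.

Lemma contR_scal k f : contR f -> contR (fun t => k * f t).
Proof. intros Hf t; apply (continuous_scal_r (V := R_NormedModule)), Hf. Qed.

Lemma L1le_le f g K : contR f -> contR g -> (forall x, f x <= g x) -> L1le g K -> L1le f K.
Proof.
  intros Hf Hg H HK A B HAB; eapply Rle_trans; [|apply (HK A B HAB)].
  apply RInt_le; [exact HAB|apply contR_ex, Hf|apply contR_ex, Hg|intros; apply H].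
Qed.

Lemma L1le_plus f g K L : contR f -> contR g -> L1le f K -> L1le g L -> L1le (fun x => f x + g x) (K + L).
Proof.
  intros Hf Hg HK HL A B HAB.
  rewrite (RInt_plus (V := R_CompleteNormedModule) f g) by (apply contR_ex; assumption).
  apply Rplus_le_compat; [apply HK|apply HL]; exact HAB.
Qed.

Lemma L1le_near q p q1 p1 K e : contC q -> contC p -> contC q1 -> contC p1 ->
  L1le (size2 q p) K -> L1le (dist2 q p q1 p1) e -> L1le (size2 q1 p1) (K + e).
Proof.
  intros Hq Hp Hq1 Hp1 HK He.
  apply (L1le_le _ (fun x => size2 q p x + dist2 q p q1 p1 x)).
  - apply contR_size2; assumption.
  - apply contR_plus; [apply contR_size2|apply contR_dist2]; assumption.
  - intros x; unfold size2, dist2.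
    generalize (Cmod_triangle_inv (q1 x) (q x)) (Cmod_triangle_inv (p1 x) (p x)).
    rewrite (Cmod_minus_sym (q1 x)), (Cmod_minus_sym (p1 x)); lra.
  - apply L1le_plus; [apply contR_size2|apply contR_dist2| |]; assumption.
Qed.

Lemma left_jost_contC q p z a b : left_jost q p z a b -> contC a /\ contC b.
Proof. intros [A [B _]]; split; [exact (rd_contC a _ A)|exact (rd_contC b _ B)]. Qed.

(** Gronwall from a point so far to the left that the data are almost [(1, 0)]; the resulting bound
    does not depend on [z]. *)
Lemma left_jost_bound q p z a b K : 0 <= Im z -> contC q -> contC p -> L1le (size2 q p) K ->
  left_jost q p z a b -> forall x, Cmod (a x) <= exp K /\ Cmod (b x) <= exp K.
Proof.
  intros Hz Hq Hp HK [Ha [Hb HL]] x.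
  assert (EK := exp_pos K).
  assert (T : forall e, 0 < e -> Cmod (a x) <= exp K + e /\ Cmod (b x) <= exp K + e).
  { intros e He; destruct (HL (e / (2 * exp K))) as [X HX]; [apply Rdiv_lt_0_compat; lra|].
    assert (Ee : exp K * (e / (2 * exp K)) = e / 2) by (field; lra).
    set (e' := e / (2 * exp K)) in *.
    destruct (HX (Rmin X x) (Rmin_l _ _)) as [Q1 Q2].
    destruct (gronwall z q p (fun _ => RtoC 0) (fun _ => RtoC 0) a b (Rmin X x) x K 0) as [G1 G2]; auto.
    - apply Rmin_r.
    - apply contC_const.
    - apply contC_const.
    - intros t; eapply rd_eq; [apply Ha|ring].
    - intros t; eapply rd_eq; [apply Hb|ring].
    - apply HK, Rmin_r.
    - rewrite (RInt_ext _ (fun _ => 0)) by (intros; rewrite Cmod_0; apply Rplus_0_l).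
      rewrite (RInt_const (V := R_CompleteNormedModule)); unfold scal; simpl; unfold mult; simpl; lra.
    - assert (Ba : Cmod (a (Rmin X x)) <= 1 + e').
      { generalize (Cmod_triangle (a (Rmin X x) - 1) 1); rewrite Cmod_1.
        replace (a (Rmin X x) - 1 + 1)%C with (a (Rmin X x)) by ring; lra. }
      assert (exp K * (Cmod (a (Rmin X x)) + Cmod (b (Rmin X x)) + 0) <= exp K * (1 + 2 * e')) by (apply Rmult_le_compat_l; lra).
      split; lra. }
  split; apply le_epsilon; intros e He; apply (T e He).
Qed.

(** The difference of the solutions solves the first system with forcing [(q - q1) b1] and
    [(p - p1) a1]. One factor [exp K] bounds [a1] and [b1], the other comes from Gronwall. *)
Lemma left_jost_lip q p q1 p1 z a b a1 b1 K e : 0 <= Im z ->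
  contC q -> contC p -> contC q1 -> contC p1 ->
  L1le (size2 q p) K -> L1le (size2 q1 p1) K -> L1le (dist2 q p q1 p1) e ->
  left_jost q p z a b -> left_jost q1 p1 z a1 b1 ->
  forall x, Cmod (a x - a1 x) <= exp K * (exp K * e) /\ Cmod (b x - b1 x) <= exp K * (exp K * e).
Proof.
  intros Hz Hq Hp Hq1 Hp1 HK HK1 He J J1 x.
  assert (Bd := left_jost_bound q1 p1 z a1 b1 K Hz Hq1 Hp1 HK1 J1).
  destruct (left_jost_contC _ _ _ _ _ J1) as [Ca1 Cb1].
  destruct J as [Ha [Hb HL]], J1 as [Ha1 [Hb1 HL1]].
  assert (EK := exp_pos K).
  assert (T : forall d, 0 < d -> Cmod (a x - a1 x) <= exp K * (exp K * e) + d /\ Cmod (b x - b1 x) <= exp K * (exp K * e) + d).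
  { intros d Hd.
    assert (Ee : exp K * (d / (4 * exp K)) = d / 4) by (field; lra).
    assert (Hd' : 0 < d / (4 * exp K)) by (apply Rdiv_lt_0_compat; lra).
    set (d' := d / (4 * exp K)) in *.
    destruct (HL d' Hd') as [X HX]; destruct (HL1 d' Hd') as [X1 HX1].
    set (x0 := Rmin (Rmin X X1) x).
    assert (L0 : x0 <= x) by apply Rmin_r.
    destruct (HX x0) as [Q1 Q2]; [eapply Rle_trans; apply Rmin_l|].
    destruct (HX1 x0) as [Q3 Q4]; [eapply Rle_trans; [apply Rmin_l|apply Rmin_r]|].
    destruct (gronwall z q p (fun t => (q t - q1 t) * b1 t)%C (fun t => (p t - p1 t) * a1 t)%C
       (fun t => a t - a1 t)%C (fun t => b t - b1 t)%C x0 x K (exp K * e)) as [G1 G2]; auto.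
    - apply (contC_mult (fun t => q t - q1 t)%C); [apply contC_minus; assumption|assumption].
    - apply (contC_mult (fun t => p t - p1 t)%C); [apply contC_minus; assumption|assumption].
    - intros t; eapply rd_eq; [apply dv_minus; [apply Ha|apply Ha1]|ring].
    - intros t; eapply rd_eq; [apply dv_minus; [apply Hb|apply Hb1]|ring].
    - apply Rle_trans with (RInt (fun t => exp K * dist2 q p q1 p1 t) x0 x).
      + apply RInt_le; [exact L0| | |].
        * apply contR_ex, contR_plus; apply (contR_Cmod (fun t => _));
          [apply (contC_mult (fun t => q t - q1 t)%C)|apply (contC_mult (fun t => p t - p1 t)%C)]; auto; apply contC_minus; assumption.
        * apply contR_ex, contR_scal, contR_dist2; assumption.
        * intros t _; unfold dist2; rewrite !Cmod_mult; destruct (Bd t).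
          generalize (Cmod_ge_0 (q t - q1 t)) (Cmod_ge_0 (p t - p1 t)); intros.
          rewrite Rmult_plus_distr_l; apply Rplus_le_compat; rewrite Rmult_comm; apply Rmult_le_compat_r; auto.
      + rewrite RInt_scal_R by (apply contR_dist2; assumption).
        apply Rmult_le_compat_l; [lra|apply He, L0].
    - assert (B1 : Cmod (a x0 - a1 x0) <= 2 * d').
      { replace (a x0 - a1 x0)%C with ((a x0 - 1) - (a1 x0 - 1))%C by ring.
        generalize (Cmod_minus_triangle (a x0 - 1) (a1 x0 - 1)); lra. }
      assert (B2 : Cmod (b x0 - b1 x0) <= 2 * d') by (generalize (Cmod_minus_triangle (b x0) (b1 x0)); lra).
      assert (exp K * (Cmod (a x0 - a1 x0) + Cmod (b x0 - b1 x0) + exp K * e) <= exp K * (4 * d' + exp K * e)) by (apply Rmult_le_compat_l; lra).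
      split; lra. }
  split; apply le_epsilon; intros d Hd; apply (T d Hd).
Qed.

Definition jost_family (q p : R -> C) (a b : R -> C -> C) : Prop :=
  (forall z, 0 <= Im z -> left_jost q p z (fun x => a x z) (fun x => b x z)) /\
  (forall x, holo (a x) /\ holo (b x)) /\
  (forall x, rel_cont (fun z => 0 <= Im z) (a x) /\ rel_cont (fun z => 0 <= Im z) (b x)) /\
  (forall x e, 0 < e -> exists R0, forall z, 0 <= Im z -> R0 <= Cmod z ->
     Cmod (a x z - 1) <= e /\ Cmod (b x z) <= e).

(* The substitution [b + p a / (2 i z)] trades the forcing [p a] for one of size [1/|z|]. *)
Lemma nice_jost q p : nice q p -> exists a b, jost_family q p a b.
Proof.
  intros [q' [p' [S [M [Hq [Hp [Cq' [Cp' [B Z]]]]]]]]].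
  assert (Cq := rd_contC q q' Hq); assert (Cp := rd_contC p p' Hp).
  set (x0 := - Rabs M).
  assert (Zl : forall x, x <= x0 -> q x = 0 /\ p x = 0).
  { intros x Hx; apply Z; unfold x0 in Hx; generalize (Rle_abs M) (Rabs_pos M) (Rle_abs (- x)); rewrite Rabs_Ropp; lra. }
  assert (S0 : 0 <= S) by (eapply Rle_trans; [apply Cmod_ge_0|apply (B 0)]).
  destruct (picard_solution q p x0 S Cq Cp) as [a [b [Ha [Hb [Hl [Hh Hc]]]]]];
    [intros; apply B|intros; apply B|intros; apply Zl; assumption|].
  exists a, b; split; [|split; [exact Hh|split; [exact Hc|]]].
  - intros z _; split; [apply Ha|split; [apply Hb|]].
    intros e He; exists x0; intros x Hx; destruct (Hl z x Hx) as [E1 E2]; rewrite E1, E2.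
    replace (1 - 1)%C with (RtoC 0) by ring; rewrite Cmod_0; lra.
  - intros x e He.
    destruct (Rle_dec x x0) as [Lx|Lx].
    { exists 0; intros z _ _; destruct (Hl z x Lx) as [E1 E2]; rewrite E1, E2.
      replace (1 - 1)%C with (RtoC 0) by ring; rewrite Cmod_0; lra. }
    set (K := 2 * S * (x - x0)); set (E := exp K).
    assert (EK : 0 < E) by apply exp_pos.
    assert (K0 : 0 <= K) by (unfold K; apply Rmult_le_pos; lra).
    assert (RK : forall t, x0 <= t <= x -> RInt (size2 q p) x0 t <= K).
    { intros t Ht; eapply Rle_trans; [apply (RInt_const_bound _ x0 t (2 * S)); [lra|apply contR_size2; assumption|]|].
      - intros s _; unfold size2; destruct (B s) as [B1 [B2 _]]; lra.
      - unfold K; apply Rmult_le_compat_l; lra. }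
    assert (Bab : forall z t, 0 <= Im z -> x0 <= t <= x -> Cmod (a t z) <= E /\ Cmod (b t z) <= E).
    { intros z t Hz Ht; destruct (Hl z x0 (Rle_refl _)) as [E1 E2].
      destruct (gronwall z q p (fun _ => RtoC 0) (fun _ => RtoC 0) (fun x => a x z) (fun x => b x z) x0 t K 0) as [G1 G2];
        try apply contC_const; auto; try lra.
      - intros s; eapply rd_eq; [apply Ha|ring].
      - intros s; eapply rd_eq; [apply Hb|ring].
      - rewrite (RInt_ext _ (fun _ => 0)) by (intros; rewrite Cmod_0; apply Rplus_0_l).
        rewrite (RInt_const (V := R_CompleteNormedModule)); unfold scal; simpl; unfold mult; simpl; lra.
      - rewrite E1, E2, Cmod_0, Cmod_1 in G1, G2; unfold E; lra. }
    set (F := (2 * S * S + S) * E).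
    assert (F0 : 0 <= F) by (unfold F; apply Rmult_le_pos; [nra|lra]).
    (* With [c = 1 / (2 i z)], [T |c|] bounds both errors: the first summand is Gronwall's bound for
       the transformed pair, the second pays for the term [p a c] when the substitution is
       undone. *)
    set (T := E * (F * (x - x0)) + S * E).
    assert (T0 : 0 <= T) by (unfold T; apply Rplus_le_le_0_compat; repeat (apply Rmult_le_pos; try lra)).
    exists (T / e + 1); intros z Hz Hzr.
    assert (Te : 0 <= T / e) by (apply Rdiv_le_0_compat; lra).
    assert (Mz : 0 < Cmod z) by lra. assert (z0 : z <> 0) by (apply Cmod_gt_0, Mz).
    pose (c := (/ (RtoC 2 * Ci * z))%C).
    assert (Ci0 : Ci <> 0) by (intros Q; apply (f_equal Im) in Q; simpl in Q; lra).
    assert (C20 : RtoC 2 <> 0) by (intros Q; apply (f_equal Re) in Q; simpl in Q; lra).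
    assert (cE : (RtoC 2 * Ci * z * c)%C = 1) by (unfold c; field; auto).
    assert (Mc : Cmod c <= / Cmod z).
    { unfold c; rewrite Cmod_inv by (repeat apply Cmult_neq_0; auto).
      rewrite !Cmod_mult, Cmod_Ci, Cmod_R, (Rabs_pos_eq 2) by lra; apply Rinv_le_contravar; lra. }
    assert (Mc0 := Cmod_ge_0 c).
    clearbody c.
    destruct (Hl z x0 (Rle_refl _)) as [E1 E2].
    assert (Ca : contC (fun x => a x z)) by exact (rd_contC _ _ (Ha z)).
    assert (Cb : contC (fun x => b x z)) by exact (rd_contC _ _ (Hb z)).
    pose (f := fun t => (- (q t * p t * a t z * c))%C).
    pose (g := fun t => ((p' t * a t z + p t * q t * b t z) * c)%C).
    assert (Cf : contC f).
    { intros t; unfold f; apply cont_opp, cont_mult; [|apply cont_const].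
      apply cont_mult; [apply cont_mult; [apply Cq|apply Cp]|apply Ca]. }
    assert (Cg : contC g).
    { intros t; unfold g; apply cont_mult; [|apply cont_const].
      apply cont_plus; apply cont_mult; [apply Cp'|apply Ca| |apply Cb]; apply cont_mult; [apply Cp|apply Cq]. }
    (* The pair [(a - 1, b + p a c)] vanishes at [x0] and solves the system with second potential 0
       and forcing [(f, g)] of order [|c|], since [2 i z c = 1] cancels the term [p a]. *)
    destruct (gronwall z q (fun _ => RtoC 0) f g (fun t => a t z - 1)%C (fun t => b t z + p t * a t z * c)%C x0 x
       K (F * Cmod c * (x - x0))) as [G1 G2]; auto; try lra.
    + apply contC_const.
    + intros t; eapply rd_eq; [apply dv_minus; [apply Ha|apply dv_const]|unfold f; ring].
    + intros t; eapply rd_eq; [apply dv_plus; [apply Hb|apply rd_mult; [apply rd_mult; [apply Hp|apply Ha]|apply dv_const]]|].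
      unfold g; cbv beta.
      transitivity (RtoC 2 * Ci * z * b t z + p t * a t z * 1 + (p' t * a t z + p t * (q t * b t z)) * c)%C; [ring|].
      rewrite <- cE; ring.
    + eapply Rle_trans; [|apply (RK x); lra].
      apply RInt_le; [lra|apply contR_ex, contR_size2; [exact Cq|apply contC_const]|apply contR_ex, contR_size2; assumption|].
      intros t _; unfold size2; rewrite Cmod_0; generalize (Cmod_ge_0 (p t)); lra.
    + apply RInt_const_bound; [lra|apply contR_size2; assumption|].
      intros t Ht; unfold f, g; rewrite Cmod_opp, !Cmod_mult.
      destruct (Bab z t Hz Ht) as [Ba Bb]; destruct (B t) as [B1 [B2 [_ B3]]].
      assert (U : Cmod (p' t * a t z + p t * q t * b t z) <= S * E + S * S * E).
      { eapply Rle_trans; [apply Cmod_triangle|]; rewrite !Cmod_mult.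
        apply Rplus_le_compat; repeat (apply Rmult_le_compat; try apply Cmod_ge_0; try (apply Rmult_le_pos; apply Cmod_ge_0); auto). }
      assert (V : Cmod (q t) * Cmod (p t) * Cmod (a t z) <= S * S * E).
      { repeat (apply Rmult_le_compat; try apply Cmod_ge_0; try (apply Rmult_le_pos; apply Cmod_ge_0); auto). }
      rewrite <- Rmult_plus_distr_r; apply Rmult_le_compat_r; [exact Mc0|]. unfold F; lra.
    + destruct (Zl x0 (Rle_refl _)) as [_ Zp0]; cbv beta in G1, G2; rewrite E1, E2, Zp0 in G1, G2.
      replace (1 - 1)%C with (RtoC 0) in * by ring; replace (0 + 0 * 1 * c)%C with (RtoC 0) in * by ring.
      rewrite !Cmod_0 in G1, G2.
      replace (exp K * (0 + 0 + F * Cmod c * (x - x0))) with (E * (F * (x - x0)) * Cmod c) in * by (unfold E; ring).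
      assert (Tc : T * Cmod c <= e).
      { apply Rle_trans with (T * / Cmod z); [apply Rmult_le_compat_l; assumption|].
        apply Rmult_le_reg_r with (Cmod z); [exact Mz|]. rewrite Rmult_assoc, Rinv_l, Rmult_1_r by lra.
        apply Rle_trans with (e * (T / e + 1)); [|apply Rmult_le_compat_l; lra].
        replace (e * (T / e + 1)) with (T + e) by (field; lra); lra. }
      assert (P1 : 0 <= S * E * Cmod c) by (repeat apply Rmult_le_pos; lra).
      unfold T in Tc; split; [lra|].
      replace (b x z) with (b x z + p x * a x z * c - p x * a x z * c)%C by ring.
      eapply Rle_trans; [apply Cmod_minus_triangle|].
      assert (Cmod (p x * a x z * c) <= S * E * Cmod c).
      { rewrite !Cmod_mult; apply Rmult_le_compat_r; [exact Mc0|].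
        apply Rmult_le_compat; try apply Cmod_ge_0; [apply B|apply Bab; [exact Hz|lra]]. }
      lra.
Qed.

Lemma is_lim_seq_geom_scal (K : R) : is_lim_seq (fun n => K * (/ 2) ^ n) 0.
Proof.
  replace (Finite 0) with (Rbar_mult K 0) by (simpl; f_equal; ring).
  apply is_lim_seq_scal_l, is_lim_seq_geom; rewrite Rabs_pos_eq; lra.
Qed.

Lemma geom_small (K e : R) : 0 < e -> exists n, forall m, (n <= m)%nat -> K * (/ 2) ^ m <= e.
Proof.
  intros He; assert (L := is_lim_seq_geom_scal K); apply is_lim_seq_spec in L.
  destruct (L (mkposreal e He)) as [n Hn]; exists n; intros m Hm; specialize (Hn m Hm); simpl in Hn.
  rewrite Rminus_0_r in Hn; apply Rabs_def2 in Hn; lra.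
Qed.

(** Nice pairs at distance [(1/2)^n] have solutions that form a Cauchy sequence by [left_jost_lip],
    uniformly in [x] and in the closed half-plane; so every clause of [jost_family] passes to the
    limit. *)
Theorem good_jost q p : good q p -> exists a b, jost_family q p a b.
Proof.
  intros [Cq [Cp [[K HK] App]]].
  assert (P2 : forall n, 0 < (/ 2) ^ n) by (intros; apply pow_lt; lra).
  assert (P21 : forall n, (/ 2) ^ n <= 1).
  { intros n; replace 1 with (1 ^ n) by apply pow1; apply pow_incr; lra. }
  assert (Seq : forall n, exists t : ((R -> C) * (R -> C)) * ((R -> C -> C) * (R -> C -> C)),
    nice (fst (fst t)) (snd (fst t)) /\ near ((/ 2) ^ n) q p (fst (fst t)) (snd (fst t)) /\
    jost_family (fst (fst t)) (snd (fst t)) (fst (snd t)) (snd (snd t))).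
  { intros n; destruct (App _ (P2 n)) as [q1 [p1 [N1 N2]]]; destruct (nice_jost q1 p1 N1) as [a1 [b1 J1]].
    exists ((q1, p1), (a1, b1)); auto. }
  pose (tt := fun n => proj1_sig (constructive_indefinite_description _ (Seq n))).
  pose (qn := fun n => fst (fst (tt n))); pose (pn := fun n => snd (fst (tt n))).
  pose (an := fun n => fst (snd (tt n))); pose (bn := fun n => snd (snd (tt n))).
  assert (Hn : forall n, nice (qn n) (pn n) /\ near ((/ 2) ^ n) q p (qn n) (pn n) /\ jost_family (qn n) (pn n) (an n) (bn n)).
  { intros n; unfold qn, pn, an, bn, tt; destruct (constructive_indefinite_description _ (Seq n)) as [t Ht]; exact Ht. }
  clearbody qn pn an bn; clear tt Seq.
  assert (Cqn : forall n, contC (qn n)).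
  { intros n; destruct (Hn n) as [[q' [p' [S [M [A _]]]]] _]; exact (rd_contC _ _ A). }
  assert (Cpn : forall n, contC (pn n)).
  { intros n; destruct (Hn n) as [[q' [p' [S [M [_ [A _]]]]]] _]; exact (rd_contC _ _ A). }
  (* All the approximating pairs are within 1 of [(q, p)], so [K + 1] bounds their L^1 sizes. *)
  set (K1 := K + 1); set (E := exp K1); assert (EK : 0 < E) by apply exp_pos.
  assert (LK : forall n, L1le (size2 (qn n) (pn n)) K1).
  { intros n A B HAB; destruct (Hn n) as [_ [[_ N] _]].
    generalize (L1le_near q p _ _ K _ Cq Cp (Cqn n) (Cpn n) HK N A B HAB) (P21 n); unfold K1; lra. }
  assert (Dn : forall n m, (n <= m)%nat -> L1le (dist2 (qn n) (pn n) (qn m) (pn m)) (2 * (/ 2) ^ n)).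
  { intros n m Hnm.
    destruct (Hn n) as [_ [[_ N] _]]; destruct (Hn m) as [_ [[_ N'] _]].
    assert (Pm : (/ 2) ^ m <= (/ 2) ^ n).
    { replace m with (n + (m - n))%nat by lia; rewrite pow_add; generalize (P2 n) (P21 (m - n)%nat); nra. }
    intros A B HAB; apply Rle_trans with ((/ 2) ^ n + (/ 2) ^ m); [|lra].
    revert A B HAB; apply (L1le_le _ (fun x => dist2 q p (qn n) (pn n) x + dist2 q p (qn m) (pn m) x)).
    - apply contR_dist2; auto.
    - apply contR_plus; apply contR_dist2; auto.
    - intros x; unfold dist2.
      generalize (Cmod_le_via (qn n x) (q x) (qn m x)) (Cmod_le_via (pn n x) (p x) (pn m x)).
      rewrite (Cmod_minus_sym (qn n x) (q x)), (Cmod_minus_sym (pn n x) (p x)); lra.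
    - apply L1le_plus; try apply contR_dist2; auto. }
  set (T := E * (E * 2)).
  assert (T0 : 0 < T) by (unfold T; repeat apply Rmult_lt_0_compat; lra).
  assert (Cau : forall x z n m, 0 <= Im z -> (n <= m)%nat ->
     Cmod (an n x z - an m x z) <= T * (/ 2) ^ n /\ Cmod (bn n x z - bn m x z) <= T * (/ 2) ^ n).
  { intros x z n m Hz Hnm; destruct (Hn n) as [_ [_ [Jn _]]]; destruct (Hn m) as [_ [_ [Jm _]]].
    replace (T * (/ 2) ^ n) with (exp K1 * (exp K1 * (2 * (/ 2) ^ n))) by (unfold T, E; ring).
    apply (left_jost_lip (qn n) (pn n) (qn m) (pn m) z (fun x => an n x z) (fun x => bn n x z) (fun x => an m x z) (fun x => bn m x z)); auto. }
  assert (Lim : forall x z, exists l : C * C, 0 <= Im z -> forall n,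
     Cmod (an n x z - fst l) <= T * (/ 2) ^ n /\ Cmod (bn n x z - snd l) <= T * (/ 2) ^ n).
  { intros x z; destruct (Rle_dec 0 (Im z)) as [Hz|Hz]; [|exists (RtoC 0, RtoC 0); tauto].
    destruct (Cauchy_C (fun n => an n x z) (fun n => T * (/ 2) ^ n)) as [la Hla];
      [intros; apply Cau; assumption|apply is_lim_seq_geom_scal|].
    destruct (Cauchy_C (fun n => bn n x z) (fun n => T * (/ 2) ^ n)) as [lb Hlb];
      [intros; apply Cau; assumption|apply is_lim_seq_geom_scal|].
    exists (la, lb); intros _ n; split; [apply Hla|apply Hlb]. }
  pose (l := fun x z => proj1_sig (constructive_indefinite_description _ (Lim x z))).
  assert (Hl : forall x z, 0 <= Im z -> forall n,
     Cmod (an n x z - fst (l x z)) <= T * (/ 2) ^ n /\ Cmod (bn n x z - snd (l x z)) <= T * (/ 2) ^ n).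
  { intros x z; unfold l; destruct (constructive_indefinite_description _ (Lim x z)) as [l' Hl']; exact Hl'. }
  clearbody l; clear Lim.
  exists (fun x z => fst (l x z)), (fun x z => snd (l x z)).
  assert (Unif : forall e, 0 < e -> exists n, forall m, (n <= m)%nat -> forall x z, 0 <= Im z ->
     Cmod (an m x z - fst (l x z)) <= e /\ Cmod (bn m x z - snd (l x z)) <= e).
  { intros e He; destruct (geom_small T e He) as [n Hn']; exists n; intros m Hm x z Hz.
    specialize (Hn' m Hm); destruct (Hl x z Hz m); lra. }
  assert (Bd : forall n x z, 0 <= Im z -> Cmod (an n x z) <= E /\ Cmod (bn n x z) <= E).
  { intros n x z Hz; destruct (Hn n) as [_ [_ [Jn _]]].
    apply (left_jost_bound (qn n) (pn n) z (fun x => an n x z) (fun x => bn n x z) K1); auto. }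
  assert (Sup : exists S, 0 <= S /\ forall x, Cmod (q x) <= S /\ Cmod (p x) <= S).
  { destruct (Hn O) as [[q' [p' [S [M [_ [_ [_ [_ [B _]]]]]]]]] [[N _] _]].
    exists (S + 1); split; [generalize (Cmod_ge_0 (qn O 0)) (proj1 (B 0)); lra|].
    intros x; destruct (N x) as [N1 N2]; destruct (B x) as [B1 [B2 _]]; simpl in N1, N2.
    generalize (Cmod_triangle_inv (q x) (qn O x)) (Cmod_triangle_inv (p x) (pn O x)); lra. }
  destruct Sup as [S [S0 HS]].
  assert (Cl : forall z, 0 <= Im z -> contC (fun x => fst (l x z)) /\ contC (fun x => snd (l x z))).
  { intros z Hz; split.
    - apply (unif_contC (fun n x => an n x z)).
      + intros n; destruct (Hn n) as [_ [_ [Jn _]]]; apply (left_jost_contC _ _ _ _ _ (Jn z Hz)).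
      + intros e He; destruct (Unif e He) as [n Hn']; exists n; intros x; apply (Hn' n); auto.
    - apply (unif_contC (fun n x => bn n x z)).
      + intros n; destruct (Hn n) as [_ [_ [Jn _]]]; apply (left_jost_contC _ _ _ _ _ (Jn z Hz)).
      + intros e He; destruct (Unif e He) as [n Hn']; exists n; intros x; apply (Hn' n); auto. }
  assert (Prod : forall e, 0 < e -> exists n0, forall n, (n0 <= n)%nat -> forall u v t (r rn : R -> C),
     Cmod v <= S -> Cmod (rn t) <= E -> Cmod (u - v) <= (/ 2) ^ n -> Cmod (rn t - r t) <= T * (/ 2) ^ n ->
     Cmod (u * rn t - v * r t) <= e).
  { intros e He; destruct (geom_small (E + S * T) e He) as [n0 Hn0]; exists n0; intros n Hnn u v t r rn Hv Hr Huv Hrr.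
    replace (u * rn t - v * r t)%C with ((u - v) * rn t + v * (rn t - r t))%C by ring.
    eapply Rle_trans; [apply Cmod_triangle|]; rewrite !Cmod_mult.
    eapply Rle_trans; [|apply (Hn0 n Hnn)].
    assert (Cmod (u - v) * Cmod (rn t) <= (/ 2) ^ n * E) by (apply Rmult_le_compat; auto; apply Cmod_ge_0).
    assert (Cmod v * Cmod (rn t - r t) <= S * (T * (/ 2) ^ n)) by (apply Rmult_le_compat; auto; apply Cmod_ge_0). lra. }
  split; [|split; [|split]].
  - intros z Hz; split; [|split].
    + intros x.
      apply (rd_limit (fun n y => an n y z) (fun n y => qn n y * bn n y z)%C (fun y => fst (l y z))
         (fun y => q y * snd (l y z))%C x 1 Rlt_0_1).
      * apply cont_mult; [apply Cq|apply (Cl z Hz)].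
      * intros e He; destruct (Unif e He) as [n1 H1]; destruct (Prod e He) as [n2 H2].
        exists (n1 + n2)%nat; intros t _; split; [apply H1; [lia|exact Hz]|split].
        -- apply (H2 (n1 + n2)%nat ltac:(lia) _ _ t (fun t => snd (l t z)) (fun t => bn (n1 + n2)%nat t z)).
           ++ apply HS.
           ++ apply Bd, Hz.
           ++ rewrite Cmod_minus_sym; apply (Hn (n1 + n2)%nat).
           ++ apply Hl, Hz.
        -- destruct (Hn (n1 + n2)%nat) as [_ [_ [Jn _]]]; apply (Jn z Hz).
    + intros x.
      apply (rd_limit (fun n y => bn n y z) (fun n y => RtoC 2 * Ci * z * bn n y z + pn n y * an n y z)%C (fun y => snd (l y z))
         (fun y => RtoC 2 * Ci * z * snd (l y z) + p y * fst (l y z))%C x 1 Rlt_0_1).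
      * apply cont_plus; apply cont_mult; [apply cont_const|apply (Cl z Hz)|apply Cp|apply (Cl z Hz)].
      * intros e He; destruct (Unif (e / (2 * (2 * Cmod z + 1)))) as [n1 H1].
        { apply Rdiv_lt_0_compat; generalize (Cmod_ge_0 z); lra. }
        assert (Ez : 2 * Cmod z * (e / (2 * (2 * Cmod z + 1))) <= e / 2 /\ e / (2 * (2 * Cmod z + 1)) <= e).
        { assert (Z0 := Cmod_ge_0 z).
          assert (Ee : e / (2 * (2 * Cmod z + 1)) * (2 * Cmod z + 1) = e / 2) by (field; lra).
          assert (0 < e / (2 * (2 * Cmod z + 1))) by (apply Rdiv_lt_0_compat; lra). nra. }
        set (e' := e / (2 * (2 * Cmod z + 1))) in *.
        destruct (Prod (e / 2) ltac:(lra)) as [n2 H2].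
        exists (n1 + n2)%nat; intros t _; split; [|split].
        -- destruct (H1 (n1 + n2)%nat ltac:(lia) t z Hz); lra.
        -- match goal with |- Cmod (?k * ?b1 + ?p1 * ?a1 - (?k * ?b2 + ?p2 * ?a2))%C <= _ =>
             replace (k * b1 + p1 * a1 - (k * b2 + p2 * a2))%C with (k * (b1 - b2) + (p1 * a1 - p2 * a2))%C by ring end.
           eapply Rle_trans; [apply Cmod_triangle|]; rewrite !Cmod_mult, Cmod_Ci, Cmod_R, (Rabs_pos_eq 2) by lra.
           assert (Q1 : Cmod (pn (n1 + n2)%nat t * an (n1 + n2)%nat t z - p t * fst (l t z)) <= e / 2).
           { apply (H2 (n1 + n2)%nat ltac:(lia) _ _ t (fun t => fst (l t z)) (fun t => an (n1 + n2)%nat t z)).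
             - apply HS.
             - apply Bd, Hz.
             - rewrite Cmod_minus_sym; apply (Hn (n1 + n2)%nat).
             - apply Hl, Hz. }
           destruct (H1 (n1 + n2)%nat ltac:(lia) t z Hz) as [_ Q2].
           assert (2 * 1 * Cmod z * Cmod (bn (n1 + n2)%nat t z - snd (l t z)) <= 2 * 1 * Cmod z * e')
             by (apply Rmult_le_compat_l; [generalize (Cmod_ge_0 z); lra|exact Q2]). lra.
        -- destruct (Hn (n1 + n2)%nat) as [_ [_ [Jn _]]]; apply (Jn z Hz).
    + intros e He; destruct (Unif (e / 2) ltac:(lra)) as [n H1].
      destruct (Hn n) as [_ [_ [Jn _]]]; destruct (Jn z Hz) as [_ [_ JL]]; destruct (JL (e / 2) ltac:(lra)) as [X HX].
      exists X; intros x Hx; destruct (HX x Hx) as [Q1 Q2]; destruct (H1 n (le_n _) x z Hz) as [Q3 Q4].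
      split.
      * generalize (Cmod_le_via (fst (l x z)) (an n x z) 1); rewrite (Cmod_minus_sym (fst (l x z)) (an n x z)); lra.
      * generalize (Cmod_triangle_inv (snd (l x z)) (bn n x z)); rewrite (Cmod_minus_sym (snd (l x z)) (bn n x z)); lra.
  - intros x; split.
    + apply (holo_limit (fun n => an n x)); [intros n; destruct (Hn n) as [_ [_ [_ [Jh _]]]]; apply Jh|].
      intros K0 e He; destruct (Unif e He) as [n H1]; exists n; intros z Hz _; apply (H1 n (le_n _)); lra.
    + apply (holo_limit (fun n => bn n x)); [intros n; destruct (Hn n) as [_ [_ [_ [Jh _]]]]; apply Jh|].
      intros K0 e He; destruct (Unif e He) as [n H1]; exists n; intros z Hz _; apply (H1 n (le_n _)); lra.
  - intros x; split.
    + apply (rel_cont_limit _ (fun n => an n x)); [intros n; destruct (Hn n) as [_ [_ [_ [_ [Jc _]]]]]; apply Jc|].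
      intros K0 e He; destruct (Unif e He) as [n H1]; exists n; intros z Hz _; apply (H1 n (le_n _)); lra.
    + apply (rel_cont_limit _ (fun n => bn n x)); [intros n; destruct (Hn n) as [_ [_ [_ [_ [Jc _]]]]]; apply Jc|].
      intros K0 e He; destruct (Unif e He) as [n H1]; exists n; intros z Hz _; apply (H1 n (le_n _)); lra.
  - intros x e He; destruct (Unif (e / 2) ltac:(lra)) as [n H1].
    destruct (Hn n) as [_ [_ [_ [_ [_ JA]]]]]; destruct (JA x (e / 2) ltac:(lra)) as [R0 HR].
    exists R0; intros z Hz Hr; destruct (HR z Hz Hr) as [Q1 Q2]; destruct (H1 n (le_n _) x z Hz) as [Q3 Q4].
    split.
    + generalize (Cmod_le_via (fst (l x z)) (an n x z) 1); rewrite (Cmod_minus_sym (fst (l x z)) (an n x z)); lra.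
    + generalize (Cmod_triangle_inv (snd (l x z)) (bn n x z)); rewrite (Cmod_minus_sym (snd (l x z)) (bn n x z)); lra.
Qed.

(** * Estimates for functions in H^{2,2} *)

Ltac ringR := match goal with |- @eq _ ?a ?b => cut (@eq R a b); [exact (fun h => h)|ring] end.

Lemma RInt_plus_R f g a b : contR f -> contR g -> RInt (fun x => f x + g x) a b = RInt f a b + RInt g a b.
Proof. intros; apply (RInt_plus (V := R_CompleteNormedModule)); apply contR_ex; assumption. Qed.

Lemma RInt_zero f a b : (forall x, Rmin a b <= x <= Rmax a b -> f x = 0) -> RInt f a b = 0.
Proof.
  intros H; rewrite (RInt_ext _ (fun _ => 0)) by (intros; apply H; lra).
  rewrite (RInt_const (V := R_CompleteNormedModule)); unfold scal; simpl; unfold mult; simpl; ring.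
Qed.

Lemma RInt_Chasles_R f a b c : contR f -> RInt f a b + RInt f b c = RInt f a c.
Proof. intros H; apply (RInt_Chasles (V := R_CompleteNormedModule)); apply contR_ex, H. Qed.

Lemma RInt_support f M a b : contR f -> 0 <= M -> (forall x, M <= Rabs x -> f x = 0) -> a <= - M -> M <= b ->
  RInt f a b = RInt f (- M) M.
Proof.
  intros Hf HM Z Ha Hb.
  rewrite <- (RInt_Chasles_R f a (- M) b), <- (RInt_Chasles_R f (- M) M b) by exact Hf.
  assert (E1 : RInt f a (- M) = 0).
  { apply RInt_zero; rewrite Rmin_left, Rmax_right by lra; intros x Hx; apply Z; rewrite Rabs_left1; lra. }
  assert (E2 : RInt f M b = 0).
  { apply RInt_zero; rewrite Rmin_left, Rmax_right by lra; intros x Hx; apply Z; rewrite Rabs_pos_eq; lra. }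
  rewrite E1, E2; rewrite Rplus_0_l, Rplus_0_r; reflexivity.
Qed.

Lemma RInt_support_le f M A B : contR f -> 0 <= M -> (forall x, 0 <= f x) -> (forall x, M <= Rabs x -> f x = 0) ->
  A <= B -> RInt f A B <= RInt f (- M) M.
Proof.
  intros Hf HM P Z HAB.
  set (a := Rmin A (- M)); set (b := Rmax B M).
  assert (a <= A) by apply Rmin_l. assert (a <= - M) by apply Rmin_r.
  assert (B <= b) by apply Rmax_l. assert (M <= b) by apply Rmax_r.
  rewrite <- (RInt_support f M a b) by assumption.
  rewrite <- (RInt_Chasles_R f a A b), <- (RInt_Chasles_R f A B b) by exact Hf.
  assert (0 <= RInt f a A) by (apply RInt_ge_0; [lra|apply contR_ex, Hf|intros; apply P]).
  assert (0 <= RInt f B b) by (apply RInt_ge_0; [lra|apply contR_ex, Hf|intros; apply P]). lra.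
Qed.

Lemma RInt_FTC (F f : R -> R) a b : (forall x, is_derive F x (f x)) -> contR f -> RInt f a b = F b - F a.
Proof.
  intros HF Hf; apply is_RInt_unique, (is_RInt_derive (V := R_CompleteNormedModule) F f); intros; [apply HF|apply Hf].
Qed.

(** The integral over the whole line is [PI], at most 4. *)
Lemma RInt_inv_1x2 A B : RInt (fun x => / (1 + x ^ 2)) A B <= 4.
Proof.
  assert (Cf : contR (fun x => / (1 + x ^ 2))).
  { intros x; apply (ex_derive_continuous (fun x => / (1 + x ^ 2))); auto_derive; generalize (pow2_ge_0 x); simpl; lra. }
  rewrite (RInt_FTC atan (fun x => / (1 + x ^ 2))); [|intros x; apply is_derive_Reals|exact Cf].
  - generalize (atan_bound B) (atan_bound A) PI_4; lra.
  - apply derivable_pt_lim_atan.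
Qed.

Lemma contR_mult f g : contR f -> contR g -> contR (fun x => f x * g x).
Proof. intros A B x; apply (continuous_mult (K := R_AbsRing)); auto. Qed.

Lemma contR_Rabs f : contR f -> contR (fun x => Rabs (f x)).
Proof. intros H x; apply (continuous_comp f Rabs); [apply H|apply continuous_Rabs]. Qed.

Lemma contR_ext f g : (forall x, f x = g x) -> contR f -> contR g.
Proof. intros E H; rewrite <- (functional_extensionality f g E); exact H. Qed.

Lemma contR_derive F f : (forall x, is_derive F x (f x)) -> contR F.
Proof. intros H x; apply (ex_derive_continuous F); eexists; apply H. Qed.

Lemma contR_const c : contR (fun _ => c). Proof. intros x; apply continuous_const. Qed.
Lemma contR_id : contR (fun x => x). Proof. intros x; apply continuous_id. Qed.

Section RealEstimates.
Variables (u u1 u2 : R -> R) (M s : R).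
Hypotheses (D1 : forall x, is_derive u x (u1 x)) (D2 : forall x, is_derive u1 x (u2 x)) (C2 : contR u2).
Hypotheses (HM : 0 <= M) (Z : forall x, M <= Rabs x -> u x = 0 /\ u1 x = 0 /\ u2 x = 0).
Let e x := (1 + x * x) * (1 + x * x) * (u x * u x) + u2 x * u2 x.
Hypotheses (Hs : 0 < s) (HE : RInt e (- M) M <= s ^ 2).

Let Cu : contR u := contR_derive u u1 D1.
Let Cu1 : contR u1 := contR_derive u1 u2 D2.

Lemma cont_1x2 : contR (fun x => 1 + x * x).
Proof. apply contR_plus; [apply contR_const|apply contR_mult; apply contR_id]. Qed.

Lemma cont_energy : contR e.
Proof.
  unfold e; apply contR_plus; [|apply contR_mult; assumption].
  apply contR_mult; [apply contR_mult; apply cont_1x2|apply contR_mult; assumption].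
Qed.

Lemma cont_g : contR (fun x => (1 + x * x) * (u1 x * u1 x)).
Proof. apply contR_mult; [apply cont_1x2|apply contR_mult; assumption]. Qed.

(* Integrate the derivative of [(1+x^2) u u'] and complete squares. *)
Lemma weighted_derivative : RInt (fun x => (1 + x * x) * (u1 x * u1 x)) (- M) M <= 5 * s ^ 2.
Proof.
  pose (F := fun x => (1 + x * x) * (u x * u1 x)).
  pose (d := fun x => 2 * x * (u x * u1 x) + (1 + x * x) * (u1 x * u1 x + u x * u2 x)).
  assert (DF : forall x, is_derive F x (d x)).
  { intros x; unfold F.
    assert (Dx : is_derive (fun x => 1 + x * x) x (2 * x)) by (auto_derive; [exact I|ring]).
    assert (Du := is_derive_mult (K := R_AbsRing) u u1 x _ _ (D1 x) (D2 x) Rmult_comm).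
    exact (is_derive_mult (K := R_AbsRing) (fun x => 1 + x * x) (fun x => u x * u1 x) x _ _ Dx Du Rmult_comm). }
  assert (Cd : contR d).
  { unfold d; apply contR_plus; apply contR_mult.
    - apply contR_scal, contR_id.
    - apply contR_mult; assumption.
    - apply cont_1x2.
    - apply contR_plus; apply contR_mult; assumption. }
  assert (I0 : RInt d (- M) M = 0).
  { rewrite (RInt_FTC F d) by assumption; unfold F.
    destruct (Z M) as [E1 _]; [rewrite Rabs_pos_eq; lra|]; destruct (Z (- M)) as [E2 _]; [rewrite Rabs_left1; lra|].
    rewrite E1, E2; ringR. }
  (* The squares of [x u' + 2 u] and [(1 + x^2) u + u''] absorb the cross terms of [2 d]. The first
     costs [4 u^2 <= 4 e] and the second [e], which explains the 5. *)
  apply Rle_trans with (RInt (fun x => 2 * d x + 5 * e x) (- M) M).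
  - apply RInt_le; [lra|apply contR_ex, cont_g|apply contR_ex, contR_plus; apply contR_scal; [exact Cd|apply cont_energy]|].
    intros x _; unfold d, e.
    generalize (pow2_ge_0 (x * u1 x + 2 * u x)) (pow2_ge_0 ((1 + x * x) * u x + u2 x)) (pow2_ge_0 (u2 x)).
    assert (H1 : 0 <= (u x * u x) * (x * x)) by (apply Rmult_le_pos; nra).
    assert (H2 : 0 <= (u x * u x) * (x * x) * (x * x)) by (apply Rmult_le_pos; nra).
    intros; nra.
  - rewrite (RInt_plus_R (fun x => 2 * d x) (fun x => 5 * e x)) by (apply contR_scal; [exact Cd || apply cont_energy]).
    rewrite !RInt_scal_R by (exact Cd || apply cont_energy). rewrite I0; lra.
Qed.

Lemma zero_outside f : (forall x, M <= Rabs x -> f x = 0) ->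
  (forall x, - M <= x <= M -> f x * f x <= 6 * s ^ 2) -> forall x, Rabs (f x) <= 3 * s.
Proof.
  intros Zf H x; destruct (Rle_dec M (Rabs x)) as [L|L].
  - rewrite Zf, Rabs_R0 by exact L; lra.
  - assert (Q := H x ltac:(apply Rabs_le_between; lra)).
    apply Rabs_le; split; apply Rnot_lt_le; intros N; nra.
Qed.

(** [f^2] is the integral of [2 f g <= f^2 + g^2] from the left end of the support. The 6 is 1 from
    the energy plus 5 from [weighted_derivative]; the lemma serves for [u] and for [u1]. *)
Lemma sup_by_energy f g : (forall x, is_derive f x (g x)) -> contR g -> f (- M) = 0 ->
  (forall x, f x * f x + g x * g x <= e x + (1 + x * x) * (u1 x * u1 x)) ->
  forall x, - M <= x <= M -> f x * f x <= 6 * s ^ 2.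
Proof.
  intros Df Cg Z0 H x Hx.
  assert (Cf := contR_derive f g Df).
  assert (E : RInt (fun x => g x * f x + f x * g x) (- M) x = f x * f x).
  { rewrite (RInt_FTC (fun x => f x * f x)); [rewrite Z0; ringR| |].
    - intros t; exact (is_derive_mult (K := R_AbsRing) f f t _ _ (Df t) (Df t) Rmult_comm).
    - apply contR_plus; apply contR_mult; assumption. }
  rewrite <- E.
  pose (h := fun x => e x + (1 + x * x) * (u1 x * u1 x)).
  assert (Ch : contR h) by (apply contR_plus; [apply cont_energy|apply cont_g]).
  apply Rle_trans with (RInt h (- M) x).
  { apply RInt_le; [lra|apply contR_ex, contR_plus; apply contR_mult; assumption|apply contR_ex, Ch|].
    intros t _; specialize (H t); unfold h; generalize (pow2_ge_0 (f t - g t)); nra. }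
  apply Rle_trans with (RInt h (- M) M).
  { rewrite <- (RInt_Chasles_R h (- M) x M) by exact Ch.
    assert (0 <= RInt h x M); [|lra]. apply RInt_ge_0; [lra|apply contR_ex, Ch|].
    intros t _; specialize (H t); unfold h; nra. }
  unfold h; rewrite (RInt_plus_R e (fun x => (1 + x * x) * (u1 x * u1 x))) by (apply cont_energy || apply cont_g).
  generalize weighted_derivative; lra.
Qed.

Lemma energy_u x : u x * u x <= e x.
Proof.
  unfold e.
  assert (H1 : 0 <= (u x * u x) * (x * x)) by (apply Rmult_le_pos; nra).
  assert (H2 : 0 <= (u x * u x) * (x * x) * (x * x)) by (apply Rmult_le_pos; nra). nra.
Qed.

Lemma energy_u1 x : u1 x * u1 x <= (1 + x * x) * (u1 x * u1 x).
Proof. assert (H1 : 0 <= (u1 x * u1 x) * (x * x)) by (apply Rmult_le_pos; nra). lra. Qed.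

Lemma real_sup x : Rabs (u x) <= 3 * s /\ Rabs (u1 x) <= 3 * s.
Proof.
  assert (B : M <= Rabs (- M)) by (rewrite Rabs_left1; lra).
  split; revert x; apply zero_outside; try (intros; apply Z; assumption).
  - apply (sup_by_energy u u1); auto; [apply Z, B|].
    intros x; generalize (energy_u x) (energy_u1 x); lra.
  - apply (sup_by_energy u1 u2); auto; [apply Z, B|].
    intros x; generalize (energy_u1 x); unfold e.
    assert (H1 : 0 <= (1 + x * x) * (1 + x * x) * (u x * u x)) by (generalize (pow2_ge_0 ((1 + x * x) * u x)); nra). lra.
Qed.

(* AM-GM against the integrable weight [1/(1+x^2)]. *)
Lemma L1_by_weight f g K : contR f -> contR g -> (forall x, 0 <= g x) -> (forall x, M <= Rabs x -> g x = 0) ->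
  (forall x, f x * f x * (1 + x * x) <= g x) -> RInt g (- M) M <= K * s ^ 2 -> K <= 5 ->
  L1le (fun x => Rabs (f x)) (5 * s).
Proof.
  intros Cf Cg Pg Zg Hfg HK K5 A B HAB.
  assert (Ci : contR (fun x => / (1 + x ^ 2))).
  { intros x; apply (ex_derive_continuous (fun x => / (1 + x ^ 2))); auto_derive; generalize (pow2_ge_0 x); simpl; lra. }
  (* Weighting by [s] makes both integrals linear in [s]: they are at most [5 s / 2] and [2 s]. *)
  apply Rle_trans with (RInt (fun x => / (2 * s) * g x + s / 2 * / (1 + x ^ 2)) A B).
  - apply RInt_le; [exact HAB|apply contR_ex, contR_Rabs, Cf|apply contR_ex, contR_plus; apply contR_scal; assumption|].
    intros x _; specialize (Hfg x); set (w := 1 + x ^ 2).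
    assert (Hw : 1 <= w) by (unfold w; generalize (pow2_ge_0 x); lra).
    replace (1 + x * x) with w in Hfg by (unfold w; ring).
    set (y := Rabs (f x)). replace (f x * f x) with (y * y) in Hfg.
    2: { unfold y; generalize (pow2_abs (f x)); simpl; intros; nra. }
    apply Rmult_le_reg_l with (2 * s * w); [apply Rmult_lt_0_compat; lra|].
    replace (2 * s * w * (/ (2 * s) * g x + s / 2 * / w)) with (w * g x + s * s) by (field; lra).
    generalize (pow2_ge_0 (w * y - s)); assert (w * (y * y * w) <= w * g x) by (apply Rmult_le_compat_l; lra). nra.
  - rewrite (RInt_plus_R (fun x => / (2 * s) * g x) (fun x => s / 2 * / (1 + x ^ 2))) by (apply contR_scal; assumption).
    rewrite !RInt_scal_R by assumption.
    assert (G := RInt_support_le g M A B Cg HM Pg Zg HAB).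
    assert (I := RInt_inv_1x2 A B).
    assert (/ (2 * s) * RInt g A B <= 5 / 2 * s).
    { apply Rmult_le_reg_l with (2 * s); [lra|]. rewrite <- Rmult_assoc, Rinv_r, Rmult_1_l by lra.
      assert (K * s ^ 2 <= 5 * s ^ 2) by (apply Rmult_le_compat_r; [apply pow2_ge_0|exact K5]). nra. }
    assert (s / 2 * RInt (fun x => / (1 + x ^ 2)) A B <= s / 2 * 4) by (apply Rmult_le_compat_l; lra). lra.
Qed.

Lemma real_L1 : L1le (fun x => Rabs (u x)) (5 * s) /\ L1le (fun x => Rabs (u1 x)) (5 * s).
Proof.
  split.
  - apply (L1_by_weight u e 1); auto; try lra.
    + apply cont_energy.
    + intros x; generalize (energy_u x); nra.
    + intros x Hx; destruct (Z x Hx) as [E1 [_ E2]]; unfold e; rewrite E1, E2; ring.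
    + intros x; unfold e.
      assert (H1 : 0 <= (u x * u x) * (x * x)) by (apply Rmult_le_pos; nra).
      assert (H2 : 0 <= (u x * u x) * (x * x) * (x * x)) by (apply Rmult_le_pos; nra). nra.
  - apply (L1_by_weight u1 (fun x => (1 + x * x) * (u1 x * u1 x)) 5); auto; try lra.
    + apply cont_g.
    + intros x; generalize (energy_u1 x); nra.
    + intros x Hx; destruct (Z x Hx) as [_ [E1 _]]; rewrite E1; ring.
    + intros x; right; ring.
    + apply weighted_derivative.
Qed.

End RealEstimates.

(** * Test functions and their norm *)

Definition dphi (phi : R -> C) (x : R) : C :=
  (Derive (fun y => Re (phi y)) x, Derive (fun y => Im (phi y)) x).

Lemma smooth_real (f : R -> R) : (forall n x, ex_derive_n f n x) ->
  forall n x, is_derive (Derive_n f n) x (Derive_n f (S n) x).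
Proof. intros H n x; apply Derive_correct; exact (H (S n) x). Qed.

Lemma cpt_smooth_parts phi : cpt_smooth phi ->
  (forall n x, is_derive (Derive_n (fun y => Re (phi y)) n) x (Derive_n (fun y => Re (phi y)) (S n) x)) /\
  (forall n x, is_derive (Derive_n (fun y => Im (phi y)) n) x (Derive_n (fun y => Im (phi y)) (S n) x)).
Proof. intros [H _]; split; apply smooth_real; intros; apply H. Qed.

Lemma cpt_smooth_rd phi : cpt_smooth phi -> (forall x, rd phi x (dphi phi x)) /\
  (forall x, rd (dphi phi) x (D2 phi x)) /\ contC (D2 phi).
Proof.
  intros H; destruct (cpt_smooth_parts phi H) as [A B]; split; [|split].
  - intros x; apply rd_parts; split; [apply (A 0%nat)|apply (B 0%nat)].
  - intros x; apply rd_parts; split; [apply (A 1%nat)|apply (B 1%nat)].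
  - intros x; apply cont_parts; split; [apply (contR_derive _ _ (A 2%nat))|apply (contR_derive _ _ (B 2%nat))].
Qed.

Lemma Derive_zero_outside (f : R -> R) M : (forall x, M < Rabs x -> f x = 0) ->
  forall x, M < Rabs x -> Derive f x = 0.
Proof.
  intros H x Hx; rewrite (Derive_ext_loc f (fun _ => 0)); [apply Derive_const|].
  apply locally_R_eps; exists (Rabs x - M); split; [lra|]; intros y Hy; apply H.
  generalize (Rabs_triang_inv x y); rewrite (Rabs_minus_sym x y); lra.
Qed.

Lemma cpt_smooth_support phi : cpt_smooth phi -> exists M0, forall M, M0 <= M -> 0 <= M /\
  forall x, M <= Rabs x -> phi x = 0 /\ dphi phi x = 0 /\ D2 phi x = 0.
Proof.
  intros [_ [M HM]]; exists (Rabs M + 1); intros M' HM'.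
  split; [generalize (Rabs_pos M); lra|]; intros x Hx.
  assert (L : M < Rabs x) by (generalize (Rle_abs M); lra).
  assert (Zr : forall x, M < Rabs x -> Re (phi x) = 0) by (intros y Hy; rewrite HM by exact Hy; reflexivity).
  assert (Zi : forall x, M < Rabs x -> Im (phi x) = 0) by (intros y Hy; rewrite HM by exact Hy; reflexivity).
  assert (Zr1 := Derive_zero_outside _ M Zr); assert (Zi1 := Derive_zero_outside _ M Zi).
  assert (Zr2 := Derive_zero_outside _ M Zr1); assert (Zi2 := Derive_zero_outside _ M Zi1).
  split; [apply HM, L|split; apply C_ext; simpl; auto].
Qed.

Definition energy (phi : R -> C) (x : R) : R :=
  (1 + x * x) * (1 + x * x) * Cmod (phi x) ^ 2 + Cmod (D2 phi x) ^ 2.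

Lemma contR_sq f : contR f -> contR (fun x => f x ^ 2).
Proof. intros H; apply (contR_ext (fun x => f x * f x)); [intros; ring|apply contR_mult; exact H]. Qed.

(** The truncated integrals are constant once they cover the support, so the improper integral is
    attained. *)
Lemma L2sq_support f M : contC f -> 0 <= M -> (forall x, M <= Rabs x -> f x = 0) ->
  L2sq f = RInt (fun x => Cmod (f x) ^ 2) (- M) M.
Proof.
  intros Hf HM Z.
  assert (Cg : contR (fun x => Cmod (f x) ^ 2)) by (apply contR_sq, contR_Cmod, Hf).
  assert (Zg : forall x, M <= Rabs x -> Cmod (f x) ^ 2 = 0) by (intros x Hx; rewrite Z, Cmod_0 by exact Hx; ring).
  unfold L2sq; apply (is_RInt_gen_unique (V := R_CompleteNormedModule)); try apply Proper_StrongProper, Rbar_locally_filter.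
  intros P HP.
  apply (Filter_prod _ _ _ (fun a => a < - M) (fun b => M < b)).
  - exists (- M); auto.
  - exists M; auto.
  - intros a b Ha Hb; simpl.
    exists (RInt (fun x => Cmod (f x) ^ 2) (- M) M); split; [|apply locally_singleton, HP].
    rewrite <- (RInt_support _ M a b Cg HM Zg) by lra.
    apply (RInt_correct (V := R_CompleteNormedModule)), contR_ex, Cg.
Qed.

Lemma cont_weight : contC (fun x => RtoC (1 + x ^ 2)).
Proof.
  intros x; apply (cont_RtoC (U := R_UniformSpace)).
  apply (contR_ext (fun x => 1 + x * x)); [intros; ring|]; apply cont_1x2.
Qed.

Lemma energy_cont phi : cpt_smooth phi -> contR (energy phi).
Proof.
  intros H; destruct (cpt_smooth_rd phi H) as [A [B Cc]].
  apply contR_plus; [apply contR_mult; [apply contR_mult; apply cont_1x2|]|]; apply contR_sq, contR_Cmod; [|exact Cc].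
  exact (rd_contC _ _ A).
Qed.

Lemma energy_pos phi x : 0 <= energy phi x.
Proof.
  unfold energy; generalize (pow2_ge_0 ((1 + x * x) * Cmod (phi x))) (pow2_ge_0 (Cmod (D2 phi x))); simpl; intros; nra.
Qed.

Lemma test_norm_energy phi M : cpt_smooth phi -> 0 <= M ->
  (forall x, M <= Rabs x -> phi x = 0 /\ dphi phi x = 0 /\ D2 phi x = 0) ->
  test_norm phi = sqrt (RInt (energy phi) (- M) M).
Proof.
  intros H HM Z; destruct (cpt_smooth_rd phi H) as [A [B Cc]].
  assert (Cp := rd_contC _ _ A).
  unfold test_norm; f_equal.
  assert (Cw : contC (fun x => RtoC (1 + x ^ 2) * phi x)%C) by (apply (contC_mult (fun x => RtoC (1 + x ^ 2))); [apply cont_weight|exact Cp]).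
  rewrite (L2sq_support (fun x => RtoC (1 + x ^ 2) * phi x)%C M); [|exact Cw|exact HM|].
  - rewrite (L2sq_support (D2 phi) M); [|exact Cc|exact HM|intros; apply Z; assumption].
    rewrite <- RInt_plus_R by (apply contR_sq, contR_Cmod; assumption).
    apply RInt_ext; intros x _; unfold energy; rewrite Cmod_mult, Cmod_R, Rabs_pos_eq by (generalize (pow2_ge_0 x); lra).
    ringR.
  - intros x Hx; destruct (Z x Hx) as [E _]; rewrite E; ring.
Qed.

Lemma test_norm_pos phi : 0 <= test_norm phi.
Proof. apply sqrt_pos. Qed.

Lemma test_norm_sq phi : cpt_smooth phi -> exists M0, forall M, M0 <= M -> test_norm phi ^ 2 = RInt (energy phi) (- M) M.
Proof.
  intros H; destruct (cpt_smooth_support phi H) as [M0 HM0]; exists M0; intros M HM.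
  destruct (HM0 M HM) as [P Z]; rewrite (test_norm_energy phi M H P Z); apply pow2_sqrt.
  apply RInt_ge_0; [lra|apply contR_ex, energy_cont, H|intros; apply energy_pos].
Qed.

(** Integrating [(a + b)^2 <= (1 + t) a^2 + (1 + 1/t) b^2] and optimizing in [t] replaces the
    Cauchy-Schwarz inequality. Domination by moduli, instead of an equation for [w], lets the lemma
    serve for sums and differences alike. *)
Lemma test_norm_triangle u v w : cpt_smooth u -> cpt_smooth v -> cpt_smooth w ->
  (forall x, Cmod (w x) <= Cmod (u x) + Cmod (v x)) -> (forall x, Cmod (D2 w x) <= Cmod (D2 u x) + Cmod (D2 v x)) ->
  test_norm w <= test_norm u + test_norm v.
Proof.
  intros Hu Hv Hw H0 H2.
  destruct (test_norm_sq u Hu) as [Mu Eu]; destruct (test_norm_sq v Hv) as [Mv Ev]; destruct (test_norm_sq w Hw) as [Mw Ew].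
  set (M := Rabs Mu + Rabs Mv + Rabs Mw).
  assert (HM : Mu <= M /\ Mv <= M /\ Mw <= M /\ 0 <= M).
  { unfold M; generalize (Rle_abs Mu) (Rle_abs Mv) (Rle_abs Mw) (Rabs_pos Mu) (Rabs_pos Mv) (Rabs_pos Mw); lra. }
  specialize (Eu M ltac:(lra)); specialize (Ev M ltac:(lra)); specialize (Ew M ltac:(lra)).
  assert (U0 := test_norm_pos u); assert (V0 := test_norm_pos v); assert (W0 := test_norm_pos w).
  set (U := test_norm u) in *; set (V := test_norm v) in *; set (W := test_norm w) in *.
  assert (T : forall t, 0 < t -> W ^ 2 <= (1 + t) * U ^ 2 + (1 + / t) * V ^ 2).
  { intros t Ht; rewrite Ew, Eu, Ev.
    rewrite <- !RInt_scal_R by (apply energy_cont; assumption).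
    rewrite <- RInt_plus_R by (apply contR_scal, energy_cont; assumption).
    apply RInt_le; [lra|apply contR_ex, energy_cont, Hw|apply contR_ex, contR_plus; apply contR_scal, energy_cont; assumption|].
    intros x _.
    assert (Sq : forall a b c, 0 <= a -> 0 <= b -> 0 <= c -> c <= a + b -> c ^ 2 <= (1 + t) * a ^ 2 + (1 + / t) * b ^ 2).
    { intros a b c Ha Hb Hc Habc. apply Rle_trans with ((a + b) ^ 2); [apply pow_incr; lra|].
      assert (It : 0 < / t) by (apply Rinv_0_lt_compat, Ht).
      assert (P : 0 <= (t * a - b) ^ 2 * / t) by (apply Rmult_le_pos; [apply pow2_ge_0|lra]).
      replace ((t * a - b) ^ 2 * / t) with (t * a ^ 2 - 2 * a * b + / t * b ^ 2) in P by (field; lra). lra. }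
    unfold energy.
    assert (Q1 := Sq _ _ _ (Cmod_ge_0 (u x)) (Cmod_ge_0 (v x)) (Cmod_ge_0 (w x)) (H0 x)).
    assert (Q2 := Sq _ _ _ (Cmod_ge_0 (D2 u x)) (Cmod_ge_0 (D2 v x)) (Cmod_ge_0 (D2 w x)) (H2 x)).
    assert (Wt : 0 <= (1 + x * x) * (1 + x * x)) by nra.
    apply (Rmult_le_compat_l _ _ _ Wt) in Q1. lra. }
  apply le_epsilon; intros e He.
  (* The optimal parameter is [V / U]; adding [h] to both norms keeps it defined and positive when
     one of them is 0. *)
  set (h := e / 2); assert (Hh : 0 < h) by (unfold h; lra).
  assert (T' := T ((V + h) / (U + h)) ltac:(apply Rdiv_lt_0_compat; lra)).
  assert (It : 0 < / ((V + h) / (U + h))) by (apply Rinv_0_lt_compat, Rdiv_lt_0_compat; lra).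
  assert (It' : 0 < (V + h) / (U + h)) by (apply Rdiv_lt_0_compat; lra).
  assert (B : W ^ 2 <= (U + V + e) ^ 2).
  { eapply Rle_trans; [exact T'|].
    apply Rle_trans with ((1 + (V + h) / (U + h)) * (U + h) ^ 2 + (1 + / ((V + h) / (U + h))) * (V + h) ^ 2).
    - apply Rplus_le_compat; (apply Rmult_le_compat_l; [lra|apply pow_incr; lra]).
    - right; replace e with (2 * h) by (unfold h; field); field; lra. }
  apply Rnot_lt_le; intros L; nra.
Qed.

(** The real estimates are applied to real and imaginary parts; their constants 3 and 5 double, and
    10 covers both. *)
Lemma test_bounds phi s : cpt_smooth phi -> 0 < s -> test_norm phi <= s ->
  (forall x, Cmod (phi x) <= 10 * s /\ Cmod (dphi phi x) <= 10 * s) /\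
  L1le (fun x => Cmod (phi x)) (10 * s) /\ L1le (fun x => Cmod (dphi phi x)) (10 * s).
Proof.
  intros H Hs HN.
  destruct (cpt_smooth_support phi H) as [M0 HM0]; destruct (HM0 M0 (Rle_refl _)) as [HM Z]; clear HM0.
  set (M := M0) in *; clearbody M; clear M0.
  destruct (cpt_smooth_rd phi H) as [A [B Cc]].
  assert (Cp := rd_contC _ _ A). assert (Cd := rd_contC _ _ B).
  assert (E : RInt (energy phi) (- M) M <= s ^ 2).
  { rewrite (test_norm_energy phi M H HM Z) in HN.
    assert (P : 0 <= RInt (energy phi) (- M) M) by (apply RInt_ge_0; [lra|apply contR_ex, energy_cont, H|intros; apply energy_pos]).
    rewrite <- (pow2_sqrt _ P); apply pow_incr; split; [apply sqrt_pos|exact HN]. }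
  assert (Part : forall P : C -> R, (P = Re \/ P = Im) ->
    (forall x, Rabs (P (phi x)) <= 3 * s /\ Rabs (P (dphi phi x)) <= 3 * s) /\
    L1le (fun x => Rabs (P (phi x))) (5 * s) /\ L1le (fun x => Rabs (P (dphi phi x))) (5 * s)).
  { intros P HP.
    assert (D1' : forall x, is_derive (fun y => P (phi y)) x (P (dphi phi x))).
    { intros x; destruct HP; subst P; apply (rd_parts _ _ _), A. }
    assert (D2' : forall x, is_derive (fun y => P (dphi phi y)) x (P (D2 phi x))).
    { intros x; destruct HP; subst P; apply (proj1 (rd_parts _ _ _) (B x)). }
    assert (Cu2 : contR (fun y => P (D2 phi y))).
    { intros x; destruct HP; subst P; apply (proj1 (cont_parts _ _) (Cc x)). }
    assert (Zu : forall x, M <= Rabs x -> P (phi x) = 0 /\ P (dphi phi x) = 0 /\ P (D2 phi x) = 0).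
    { intros x Hx; destruct (Z x Hx) as [E1 [E2 E3]]; rewrite E1, E2, E3; destruct HP; subst P; auto. }
    assert (Eu : RInt (fun x => (1 + x * x) * (1 + x * x) * (P (phi x) * P (phi x)) + P (D2 phi x) * P (D2 phi x)) (- M) M <= s ^ 2).
    { eapply Rle_trans; [|exact E]; apply RInt_le; [lra| |apply contR_ex, energy_cont, H|].
      - apply contR_ex. apply (cont_energy (fun x => P (phi x)) (fun x => P (dphi phi x)) (fun x => P (D2 phi x))); assumption.
      - intros x _; unfold energy; rewrite !Cmod2_alt.
        assert (Wt : 0 <= (1 + x * x) * (1 + x * x)) by nra.
        assert (Q : P (phi x) * P (phi x) <= Re (phi x) ^ 2 + Im (phi x) ^ 2) by (destruct HP; subst P; nra).
        assert (Q2 : P (D2 phi x) * P (D2 phi x) <= Re (D2 phi x) ^ 2 + Im (D2 phi x) ^ 2) by (destruct HP; subst P; nra).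
        apply (Rmult_le_compat_l _ _ _ Wt) in Q; lra. }
    split.
    - intros x; apply (real_sup (fun x => P (phi x)) (fun x => P (dphi phi x)) (fun x => P (D2 phi x)) M s D1' D2' Cu2 HM Zu Hs Eu).
    - apply (real_L1 (fun x => P (phi x)) (fun x => P (dphi phi x)) (fun x => P (D2 phi x)) M s D1' D2' Cu2 HM Zu Hs Eu). }
  destruct (Part Re (or_introl eq_refl)) as [R1 [R2 R3]]; destruct (Part Im (or_intror eq_refl)) as [I1 [I2 I3]].
  assert (L1 : forall f, contC f -> L1le (fun x => Rabs (Re (f x))) (5 * s) -> L1le (fun x => Rabs (Im (f x))) (5 * s) ->
     L1le (fun x => Cmod (f x)) (10 * s)).
  { intros f Cf Fr Fi; replace (10 * s) with (5 * s + 5 * s) by ring.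
    assert (Cr : contR (fun x => Rabs (Re (f x)))) by (apply contR_Rabs; intros x; apply (proj1 (cont_parts _ _) (Cf x))).
    assert (Ci' : contR (fun x => Rabs (Im (f x)))) by (apply contR_Rabs; intros x; apply (proj1 (cont_parts _ _) (Cf x))).
    apply (L1le_le _ (fun x => Rabs (Re (f x)) + Rabs (Im (f x)))).
    - apply contR_Cmod, Cf.
    - apply contR_plus; assumption.
    - intros x; apply Cmod_le_parts.
    - apply L1le_plus; assumption. }
  split; [|split; apply L1; assumption].
  intros x; destruct (R1 x), (I1 x); generalize (Cmod_le_parts (phi x)) (Cmod_le_parts (dphi phi x)); lra.
Qed.

Lemma fsub_smooth u v : cpt_smooth u -> cpt_smooth v -> cpt_smooth (fsub u v) /\
  (forall x, dphi (fsub u v) x = (dphi u x - dphi v x)%C) /\ (forall x, D2 (fsub u v) x = (D2 u x - D2 v x)%C).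
Proof.
  intros [Hu [Mu Zu]] [Hv [Mv Zv]].
  assert (Er : (fun y => Re (fsub u v y)) = (fun y => Re (u y) - Re (v y))) by reflexivity.
  assert (Ei : (fun y => Im (fsub u v y)) = (fun y => Im (u y) - Im (v y))) by reflexivity.
  assert (Loc : forall (f : R -> R), (forall n x, ex_derive_n f n x) -> forall x n, locally x (fun y => forall k, (k <= n)%nat -> ex_derive_n f k y)).
  { intros f Hf x n; apply filter_forall; intros; apply Hf. }
  assert (Ur : forall n x, ex_derive_n (fun y => Re (u y)) n x) by (intros; apply Hu).
  assert (Ui : forall n x, ex_derive_n (fun y => Im (u y)) n x) by (intros; apply Hu).
  assert (Vr : forall n x, ex_derive_n (fun y => Re (v y)) n x) by (intros; apply Hv).
  assert (Vi : forall n x, ex_derive_n (fun y => Im (v y)) n x) by (intros; apply Hv).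
  split; [split|split].
  - intros n x; rewrite Er, Ei; split; apply ex_derive_n_minus; apply Loc; assumption.
  - exists (Rmax Mu Mv); intros x Hx; unfold fsub.
    rewrite Zu by (eapply Rle_lt_trans; [apply Rmax_l|exact Hx]); rewrite Zv by (eapply Rle_lt_trans; [apply Rmax_r|exact Hx]); ring.
  - intros x; unfold dphi; rewrite Er, Ei.
    rewrite !Derive_minus by (first [apply (Ur 1%nat)|apply (Ui 1%nat)|apply (Vr 1%nat)|apply (Vi 1%nat)]); reflexivity.
  - intros x; unfold D2; rewrite Er, Ei.
    rewrite !Derive_n_minus by (apply Loc; assumption); reflexivity.
Qed.

(** * From test functions to the completion *)

Definition C1near (e : R) (f f' g g' : R -> C) : Prop :=
  (forall x, Cmod (f x - g x) <= e /\ Cmod (f' x - g' x) <= e) /\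
  L1le (fun x => Cmod (f x - g x)) e /\ L1le (fun x => Cmod (f' x - g' x)) e.

Lemma rd_unique f x l m : rd f x l -> rd f x m -> l = m.
Proof.
  intros A B; apply rd_parts in A; apply rd_parts in B; destruct A as [A1 A2], B as [B1 B2].
  apply C_ext; eapply eq_trans; [symmetry; apply is_derive_unique, A1|apply is_derive_unique, B1|
    symmetry; apply is_derive_unique, A2|apply is_derive_unique, B2].
Qed.

(** The interval is fixed before the uniform error is chosen, so an error [e / (B - A + 1)]
    contributes at most [e] to the integral. *)
Lemma L1le_limit (f : R -> R) K : contR f ->
  (forall e, 0 < e -> exists h, contR h /\ L1le h K /\ forall x, f x <= h x + e) -> L1le f K.
Proof.
  intros Hf H A B HAB; apply le_epsilon; intros e He.
  destruct (H (e / (B - A + 1))) as [h [Ch [Lh Hh]]]; [apply Rdiv_lt_0_compat; lra|].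
  set (d := e / (B - A + 1)) in *.
  assert (Ed : d * (B - A) <= e).
  { assert (d * (B - A + 1) = e) by (unfold d; field; lra).
    assert (0 < d) by (apply Rdiv_lt_0_compat; lra). lra. }
  apply Rle_trans with (RInt (fun x => h x + d) A B).
  - apply RInt_le; [exact HAB|apply contR_ex, Hf|apply contR_ex, contR_plus; [exact Ch|apply contR_const]|intros; apply Hh].
  - rewrite (RInt_plus_R h (fun _ => d)) by (exact Ch || apply contR_const).
    rewrite (RInt_const (V := R_CompleteNormedModule)); unfold scal; simpl; unfold mult; simpl.
    generalize (Lh A B HAB); lra.
Qed.

(** Sup bounds pass to the limit pointwise, L^1 bounds by [L1le_limit]. *)
Lemma C1near_limit e f f' (gn gn' : nat -> R -> C) g g' :
  contC f -> contC f' -> contC g -> contC g' -> (forall n, contC (gn n) /\ contC (gn' n)) ->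
  (forall d, 0 < d -> exists n, C1near e f f' (gn n) (gn' n) /\
     forall x, Cmod (gn n x - g x) <= d /\ Cmod (gn' n x - g' x) <= d) ->
  C1near e f f' g g'.
Proof.
  intros Cf Cf' Cg Cg' Cn H.
  assert (L : forall (u v : R -> C) (w : nat -> R -> C), contC u -> contC v -> (forall n, contC (w n)) ->
    (forall d, 0 < d -> exists n, L1le (fun x => Cmod (u x - w n x)) e /\ forall x, Cmod (w n x - v x) <= d) ->
    L1le (fun x => Cmod (u x - v x)) e).
  { intros u v w Cu Cv Cw Hw.
    assert (Cuv : contR (fun x => Cmod (u x - v x))) by (apply (contR_Cmod (fun x => u x - v x)%C), contC_minus; assumption).
    apply (L1le_limit _ e Cuv); intros d Hd; destruct (Hw d Hd) as [n [L1 L2]].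
    exists (fun x => Cmod (u x - w n x)); split; [apply (contR_Cmod (fun x => u x - w n x)%C), contC_minus; auto|split; [exact L1|]].
    intros x; generalize (Cmod_le_via (u x) (w n x) (v x)) (L2 x); lra. }
  split; [|split].
  - intros x; split; apply le_epsilon; intros d Hd; destruct (H d Hd) as [n [[N _] L2]]; destruct (N x), (L2 x).
    + generalize (Cmod_le_via (f x) (gn n x) (g x)); lra.
    + generalize (Cmod_le_via (f' x) (gn' n x) (g' x)); lra.
  - apply (L f g gn); auto; [intros n; apply Cn|]; intros d Hd; destruct (H d Hd) as [n [[_ [N _]] L2]].
    exists n; split; [exact N|apply L2].
  - apply (L f' g' gn'); auto; [intros n; apply Cn|]; intros d Hd; destruct (H d Hd) as [n [[_ [_ N]] L2]].
    exists n; split; [exact N|apply L2].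
Qed.

(** By [test_bounds] a Cauchy sequence for the norm is Cauchy in C^1 and, with first derivatives, in
    L^1; so its pointwise limit is C^1 and is approximated in the same sense. *)
Lemma approximates_C1 phi q : approximates phi q -> exists q', (forall x, rd q x (q' x)) /\ contC q' /\
  forall e, 0 < e -> exists n0, forall n, (n0 <= n)%nat -> C1near e (phi n) (dphi (phi n)) q q'.
Proof.
  intros [Sm [Cau Lim]].
  assert (Cn : forall n, contC (phi n) /\ contC (dphi (phi n))).
  { intros n; destruct (cpt_smooth_rd _ (Sm n)) as [A [B _]]; split; [exact (rd_contC _ _ A)|exact (rd_contC _ _ B)]. }
  assert (Nr : forall e, 0 < e -> exists n0, forall n m, (n0 <= n)%nat -> (n0 <= m)%nat ->
     C1near e (phi n) (dphi (phi n)) (phi m) (dphi (phi m))).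
  { intros e He; destruct (Cau (e / 10) ltac:(lra)) as [n0 H]; exists n0; intros n m Hn Hm.
    destruct (fsub_smooth _ _ (Sm n) (Sm m)) as [S1 [S2 _]].
    destruct (test_bounds _ (e / 10) S1 ltac:(lra) (Rlt_le _ _ (H n m Hn Hm))) as [B1 [B2 B3]].
    replace (10 * (e / 10)) with e in * by field.
    split; [|split; [exact B2|]].
    - intros x; destruct (B1 x) as [P Q]; rewrite S2 in Q; split; assumption.
    - replace (fun x => Cmod (dphi (phi n) x - dphi (phi m) x)) with (fun x => Cmod (dphi (fsub (phi n) (phi m)) x)); [exact B3|].
      apply functional_extensionality; intros x; rewrite S2; reflexivity. }
  assert (Ptq : forall x e, 0 < e -> exists n0, forall n, (n0 <= n)%nat -> Cmod (phi n x - q x) <= e).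
  { intros x e He; specialize (Lim x).
    assert (Lx : @locally C_UniformSpace (q x) (fun w => Cmod (w - q x) < e)) by (apply locally_C_eps; exists e; auto).
    destruct (Lim _ Lx) as [n0 Hn]; exists n0; intros n H; left; apply Hn, H. }
  assert (Ptd : forall x, exists l, forall e, 0 < e -> exists n0, forall n, (n0 <= n)%nat -> Cmod (dphi (phi n) x - l) <= e).
  { intros x; apply Cauchy_C_eps; intros e He; destruct (Nr e He) as [n0 Hn]; exists n0; intros n m A B.
    apply (Hn n m A B). }
  pose (q' := fun x => proj1_sig (constructive_indefinite_description _ (Ptd x))).
  assert (Hq' : forall x e, 0 < e -> exists n0, forall n, (n0 <= n)%nat -> Cmod (dphi (phi n) x - q' x) <= e).
  { intros x; unfold q'; destruct (constructive_indefinite_description _ (Ptd x)) as [l Hl]; exact Hl. }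
  clearbody q'; clear Ptd.
  assert (Un : forall e, 0 < e -> exists n0, forall n, (n0 <= n)%nat -> forall x,
     Cmod (phi n x - q x) <= e /\ Cmod (dphi (phi n) x - q' x) <= e).
  { intros e He; destruct (Nr e He) as [n0 Hn]; exists n0; intros n H x.
    split; apply le_epsilon; intros d Hd.
    - destruct (Ptq x d Hd) as [n1 H1]; destruct (Hn n (n0 + n1)%nat H ltac:(lia)) as [B _]; destruct (B x) as [B1 _].
      generalize (Cmod_le_via (phi n x) (phi (n0 + n1)%nat x) (q x)) (H1 (n0 + n1)%nat ltac:(lia)); lra.
    - destruct (Hq' x d Hd) as [n1 H1]; destruct (Hn n (n0 + n1)%nat H ltac:(lia)) as [B _]; destruct (B x) as [_ B1].
      generalize (Cmod_le_via (dphi (phi n) x) (dphi (phi (n0 + n1)%nat) x) (q' x)) (H1 (n0 + n1)%nat ltac:(lia)); lra. }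
  assert (Cq : contC q).
  { apply (unif_contC phi); [apply Cn|]; intros e He; destruct (Un e He) as [n Hn]; exists n; intros x; apply (Hn n (le_n _)). }
  assert (Cq' : contC q').
  { apply (unif_contC (fun n => dphi (phi n))); [apply Cn|]; intros e He; destruct (Un e He) as [n Hn]; exists n; intros x; apply (Hn n (le_n _)). }
  exists q'; split; [|split; [exact Cq'|]].
  - intros x; apply (rd_limit phi (fun n => dphi (phi n)) q q' x 1 Rlt_0_1 (Cq' x)).
    intros e He; destruct (Un e He) as [n Hn]; exists n; intros t _; destruct (Hn n (le_n _) t).
    split; [assumption|split; [assumption|apply (cpt_smooth_rd _ (Sm n))]].
  - intros e He; destruct (Nr e He) as [n0 Hn]; exists n0; intros n H.
    apply (C1near_limit e (phi n) (dphi (phi n)) phi (fun n => dphi (phi n)) q q'); try apply Cn; auto.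
    intros d Hd; destruct (Un d Hd) as [n1 H1]; exists (n0 + n1)%nat; split; [apply Hn; lia|].
    intros x; apply H1; lia.
Qed.

Lemma approximates_fsub phi psi q q0 : approximates phi q -> approximates psi q0 ->
  approximates (fun n => fsub (phi n) (psi n)) (fsub q q0).
Proof.
  intros [S1 [C1 L1]] [S2 [C2 L2]]; split; [|split].
  - intros n; apply fsub_smooth; auto.
  - intros e He; destruct (C1 (e / 2) ltac:(lra)) as [n1 H1]; destruct (C2 (e / 2) ltac:(lra)) as [n2 H2].
    exists (n1 + n2)%nat; intros n m Hn Hm.
    destruct (fsub_smooth _ _ (S1 n) (S2 n)) as [A1 [_ A2]]; destruct (fsub_smooth _ _ (S1 m) (S2 m)) as [B1 [_ B2]].
    destruct (fsub_smooth _ _ (S1 n) (S1 m)) as [P1 [_ P2]]; destruct (fsub_smooth _ _ (S2 n) (S2 m)) as [Q1 [_ Q2]].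
    destruct (fsub_smooth _ _ A1 B1) as [W1 [_ W2]].
    apply Rle_lt_trans with (test_norm (fsub (phi n) (phi m)) + test_norm (fsub (psi n) (psi m))).
    + apply test_norm_triangle; auto.
      * intros x; unfold fsub.
        replace (phi n x - psi n x - (phi m x - psi m x))%C with ((phi n x - phi m x) - (psi n x - psi m x))%C by ring.
        apply Cmod_minus_triangle.
      * intros x; rewrite W2, A2, B2, P2, Q2.
        replace (D2 (phi n) x - D2 (psi n) x - (D2 (phi m) x - D2 (psi m) x))%C with
          ((D2 (phi n) x - D2 (phi m) x) - (D2 (psi n) x - D2 (psi m) x))%C by ring.
        apply Cmod_minus_triangle.
    + generalize (H1 n m ltac:(lia) ltac:(lia)) (H2 n m ltac:(lia) ltac:(lia)); lra.
  - intros x; apply filterlim_locally; intros e.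
    assert (He2 : 0 < e / 2) by (generalize (cond_pos e); lra).
    generalize (proj1 (filterlim_locally _ _) (L1 x) (mkposreal _ He2)) (proj1 (filterlim_locally _ _) (L2 x) (mkposreal _ He2)).
    intros A B; generalize (filter_and _ _ A B); apply filter_imp; intros n [[P1 P2] [Q1 Q2]].
    change (Rabs (Re (phi n x) - Re (q x)) < e / 2) in P1; change (Rabs (Im (phi n x) - Im (q x)) < e / 2) in P2.
    change (Rabs (Re (psi n x) - Re (q0 x)) < e / 2) in Q1; change (Rabs (Im (psi n x) - Im (q0 x)) < e / 2) in Q2.
    split.
    + change (Rabs (Re (phi n x - psi n x) - Re (q x - q0 x)) < e); rewrite !Re_Cminus.
      apply Rabs_def2 in P1; apply Rabs_def2 in Q1; apply Rabs_def1; lra.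
    + change (Rabs (Im (phi n x - psi n x) - Im (q x - q0 x)) < e); rewrite !Im_Cminus.
      apply Rabs_def2 in P2; apply Rabs_def2 in Q2; apply Rabs_def1; lra.
Qed.

(** Norms along a Cauchy sequence converge, so the choice has a candidate. The estimates need only
    this much: whichever admissible value is chosen, some approximating sequence realizes it. *)
Lemma H22norm_spec q : H22 q -> exists phi, approximates phi q /\ is_lim_seq (fun n => test_norm (phi n)) (H22norm q).
Proof.
  intros [phi H].
  apply (epsilon_spec (inhabits 0) (is_H22norm q)).
  assert (L : exists r : R, is_lim_seq (fun n => test_norm (phi n)) r).
  { apply ex_lim_seq_cauchy_corr; intros e; destruct H as [S [Cc _]].
    destruct (Cc e (cond_pos e)) as [n0 Hn]; exists n0; intros n m A B.
    assert (T : forall i j, test_norm (phi i) <= test_norm (phi j) + test_norm (fsub (phi i) (phi j))).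
    { intros i j; destruct (fsub_smooth _ _ (S i) (S j)) as [P1 [_ P2]]; apply test_norm_triangle; auto.
      - intros x; unfold fsub; generalize (Cmod_triangle_inv (phi i x) (phi j x)); lra.
      - intros x; rewrite P2; generalize (Cmod_triangle_inv (D2 (phi i) x) (D2 (phi j) x)); lra. }
    generalize (T n m) (T m n) (Hn n m A B) (Hn m n B A); intros; apply Rabs_def1; lra. }
  destruct L as [r Hr]; exists r, phi; split; assumption.
Qed.

Lemma H22_fsub q q0 : H22 q -> H22 q0 -> H22 (fsub q q0).
Proof. intros [phi H] [psi H']; eexists; apply approximates_fsub; eassumption. Qed.

Lemma H22norm_pos q : H22 q -> 0 <= H22norm q.
Proof.
  intros H; destruct (H22norm_spec q H) as [phi [_ L]].
  apply (is_lim_seq_le (fun _ => 0) _ 0 _ (fun n => test_norm_pos (phi n)) (is_lim_seq_const 0) L).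
Qed.

(** [test_bounds] passes to the limit along a sequence whose norms tend to [H22norm q]. Taking 0 as
    the second function turns [C1near] into a bound on size. *)
Lemma H22_bound q q' : H22 q -> (forall x, rd q x (q' x)) ->
  C1near (10 * H22norm q) q q' (fun _ => RtoC 0) (fun _ => RtoC 0).
Proof.
  intros H Hq'.
  destruct (H22norm_spec q H) as [phi [Ap L]].
  assert (N0 := H22norm_pos q H).
  assert (Sm := proj1 Ap).
  destruct (approximates_C1 phi q Ap) as [q1 [D1 [C1 N1]]].
  assert (E : q1 = q') by (apply functional_extensionality; intros x; eapply rd_unique; [apply D1|apply Hq']).
  subst q1; clear D1.
  assert (Cq := rd_contC _ _ Hq').
  set (r := H22norm q) in *.
  assert (Lc : forall f, contC f -> contR (fun x => Cmod (f x - 0))).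
  { intros f Cf; apply (contR_Cmod (fun x => f x - 0)%C), contC_minus; [exact Cf|apply contC_const]. }
  assert (Bs : forall d, 0 < d -> exists n,
     ((forall x, Cmod (phi n x) <= 10 * r + d /\ Cmod (dphi (phi n) x) <= 10 * r + d) /\
     L1le (fun x => Cmod (phi n x)) (10 * r + d) /\ L1le (fun x => Cmod (dphi (phi n) x)) (10 * r + d)) /\
     C1near d (phi n) (dphi (phi n)) q q').
  { intros d Hd; apply is_lim_seq_spec in L; destruct (L (mkposreal (d / 10) ltac:(lra))) as [n1 H1].
    destruct (N1 d Hd) as [n2 H2]; exists (n1 + n2)%nat; split; [|apply H2; lia].
    specialize (H1 (n1 + n2)%nat ltac:(lia)); simpl in H1; apply Rabs_def2 in H1.
    replace (10 * r + d) with (10 * (r + d / 10)) by field.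
    apply test_bounds; [apply Sm|lra|lra]. }
  assert (Cphi : forall n, contC (phi n)) by (intros n; exact (rd_contC _ _ (proj1 (cpt_smooth_rd _ (Sm n))))).
  assert (C2 : forall n, contC (dphi (phi n))) by (intros n; exact (rd_contC _ _ (proj1 (proj2 (cpt_smooth_rd _ (Sm n)))))).
  split; [|split].
  - intros x; replace (q x - 0)%C with (q x) by ring; replace (q' x - 0)%C with (q' x) by ring.
    split; apply le_epsilon; intros d Hd; destruct (Bs (d / 2) ltac:(lra)) as [n [[B _] [N _]]]; destruct (B x), (N x).
    + generalize (Cmod_triangle_inv (q x) (phi n x)); rewrite Cmod_minus_sym; lra.
    + generalize (Cmod_triangle_inv (q' x) (dphi (phi n) x)); rewrite Cmod_minus_sym; lra.
  - intros A B HAB; apply le_epsilon; intros d Hd; destruct (Bs (d / 2) ltac:(lra)) as [n [[_ [B1 _]] [_ [N _]]]].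
    apply Rle_trans with ((10 * r + d / 2) + d / 2); [|lra].
    revert A B HAB; apply (L1le_le _ (fun x => Cmod (phi n x) + Cmod (phi n x - q x))).
    + apply Lc, Cq.
    + apply contR_plus; [apply contR_Cmod, Cphi|apply (contR_Cmod (fun x => phi n x - q x)%C), contC_minus; auto].
    + intros x; replace (q x - 0)%C with (q x) by ring; generalize (Cmod_triangle_inv (q x) (phi n x)); rewrite Cmod_minus_sym; lra.
    + apply L1le_plus; auto; [apply contR_Cmod, Cphi|apply (contR_Cmod (fun x => phi n x - q x)%C), contC_minus; auto].
  - intros A B HAB; apply le_epsilon; intros d Hd; destruct (Bs (d / 2) ltac:(lra)) as [n [[_ [_ B1]] [_ [_ N]]]].
    apply Rle_trans with ((10 * r + d / 2) + d / 2); [|lra].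
    revert A B HAB; apply (L1le_le _ (fun x => Cmod (dphi (phi n) x) + Cmod (dphi (phi n) x - q' x))).
    + apply Lc; assumption.
    + apply contR_plus; [apply contR_Cmod, C2|apply (contR_Cmod (fun x => dphi (phi n) x - q' x)%C), contC_minus; auto].
    + intros x; replace (q' x - 0)%C with (q' x) by ring; generalize (Cmod_triangle_inv (q' x) (dphi (phi n) x)); rewrite Cmod_minus_sym; lra.
    + apply L1le_plus; auto; [apply contR_Cmod, C2|apply (contR_Cmod (fun x => dphi (phi n) x - q' x)%C), contC_minus; auto].
Qed.

Lemma H22_near q q' q0 q0' : H22 q -> H22 q0 -> (forall x, rd q x (q' x)) -> (forall x, rd q0 x (q0' x)) ->
  C1near (10 * H22norm (fsub q q0)) q q' q0 q0'.
Proof.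
  intros H H0 D D0.
  assert (B := H22_bound (fsub q q0) (fun x => q' x - q0' x)%C (H22_fsub q q0 H H0)
    ltac:(intros x; apply dv_minus; [apply D|apply D0])).
  destruct B as [B1 [B2 B3]].
  assert (Z : forall w : C, (w - 0)%C = w) by (intros; ring).
  split; [|split].
  - intros x; destruct (B1 x) as [P Q]; rewrite Z in P, Q; split; assumption.
  - replace (fun x => Cmod (q x - q0 x)) with (fun x => Cmod (fsub q q0 x - 0)); [exact B2|].
    apply functional_extensionality; intros x; rewrite Z; reflexivity.
  - replace (fun x => Cmod (q' x - q0' x)) with (fun x => Cmod (q' x - q0' x - 0)); [exact B3|].
    apply functional_extensionality; intros x; rewrite Z; reflexivity.
Qed.

(** * The gauge-transformed potential *)

(* The second potential after the gauge transformation
   [Psi = [[1, 0], [- (i/2) conj q, 1]] Phi] of the Lax system. *)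
Definition pot (q q' : R -> C) (x : R) : C :=
  (Ci * / RtoC 2 * Cconj (q' x) - / RtoC 4 * (q x * Cconj (q x) * Cconj (q x)))%C.

Lemma Cmod_inv_R (r : R) : 0 < r -> Cmod (/ RtoC r) = / r.
Proof.
  intros H; rewrite Cmod_inv by (intros E; apply (f_equal Re) in E; simpl in E; lra).
  rewrite Cmod_R, Rabs_pos_eq by lra; reflexivity.
Qed.

(** The cubic term is telescoped; its constant [3 B^2 / 4] is rounded up to [B^2]. *)
Lemma pot_lip q q' q0 q0' B x : Cmod (q x) <= B -> Cmod (q0 x) <= B ->
  Cmod (pot q q' x - pot q0 q0' x) <= Cmod (q' x - q0' x) + B ^ 2 * Cmod (q x - q0 x).
Proof.
  intros H H0; unfold pot.
  set (u := q x) in *; set (v := q0 x) in *.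
  replace (Ci * / RtoC 2 * Cconj (q' x) - / RtoC 4 * (u * Cconj u * Cconj u) -
    (Ci * / RtoC 2 * Cconj (q0' x) - / RtoC 4 * (v * Cconj v * Cconj v)))%C with
    (Ci * / RtoC 2 * (Cconj (q' x) - Cconj (q0' x)) -
     / RtoC 4 * ((u - v) * (Cconj u * Cconj u) + v * ((Cconj u - Cconj v) * (Cconj u + Cconj v))))%C by ring.
  rewrite <- !Cminus_conj, <- Cplus_conj.
  eapply Rle_trans; [apply Cmod_minus_triangle|].
  rewrite !Cmod_mult, Cmod_Ci, !Cmod_inv_R, Cmod_conj by lra.
  generalize (Cmod_triangle ((u - v) * (Cconj u * Cconj u)) (v * (Cconj (u - v) * Cconj (u + v)))).
  rewrite !Cmod_mult, !Cmod_conj.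
  set (d := Cmod (u - v)); assert (d0 := Cmod_ge_0 (u - v) : 0 <= d).
  assert (S : Cmod (u + v) <= 2 * B) by (generalize (Cmod_triangle u v); lra).
  assert (U0 := Cmod_ge_0 u); assert (V0 := Cmod_ge_0 v); assert (S0 := Cmod_ge_0 (u + v)).
  assert (d * (Cmod u * Cmod u) <= d * (B * B)) by (apply Rmult_le_compat_l; [exact d0|apply Rmult_le_compat; lra]).
  assert (Cmod v * (d * Cmod (u + v)) <= B * (d * (2 * B))).
  { apply Rmult_le_compat; auto; [apply Rmult_le_pos; auto|apply Rmult_le_compat_l; auto]. }
  generalize (Cmod_ge_0 (q' x - q0' x)); intros.
  assert (0 <= d * (B * B)) by (apply Rmult_le_pos; [exact d0|nra]).
  replace (B ^ 2) with (B * B) by ring. lra.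
Qed.

Lemma contC_pot q q' : contC q -> contC q' -> contC (pot q q').
Proof.
  intros A B x; unfold pot; apply cont_minus; apply cont_mult; try apply cont_const.
  - apply cont_conj, B.
  - apply cont_mult; [apply cont_mult; [apply A|apply cont_conj, A]|apply cont_conj, A].
Qed.

(** In the L^1 distance, [1 + B^2] multiplies the difference of the functions and 1 that of the
    derivatives. *)
Lemma near_pot e f f' g g' B : contC f -> contC f' -> contC g -> contC g' ->
  (forall x, Cmod (f x) <= B /\ Cmod (g x) <= B) -> C1near e f f' g g' ->
  near ((2 + B ^ 2) * e) f (pot f f') g (pot g g').
Proof.
  intros Cf Cf' Cg Cg' HB [N [L1 L2]].
  assert (e0 : 0 <= e) by (destruct (N 0) as [Q _]; generalize (Cmod_ge_0 (f 0 - g 0)); lra).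
  assert (B2 := pow2_ge_0 B).
  assert (P : forall x, Cmod (pot f f' x - pot g g' x) <= Cmod (f' x - g' x) + B ^ 2 * Cmod (f x - g x)).
  { intros x; apply pot_lip; apply HB. }
  split.
  - intros x; specialize (P x); destruct (N x) as [N1 N2].
    assert (B ^ 2 * Cmod (f x - g x) <= B ^ 2 * e) by (apply Rmult_le_compat_l; assumption).
    assert (0 <= B ^ 2 * e) by (apply Rmult_le_pos; assumption). split; lra.
  - assert (Cfg : contR (fun x => Cmod (f x - g x))) by (apply (contR_Cmod (fun x => f x - g x)%C), contC_minus; assumption).
    assert (Cfg' : contR (fun x => Cmod (f' x - g' x))) by (apply (contR_Cmod (fun x => f' x - g' x)%C), contC_minus; assumption).
    replace ((2 + B ^ 2) * e) with ((1 + B ^ 2) * e + e) by ring.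
    apply (L1le_le _ (fun x => (1 + B ^ 2) * Cmod (f x - g x) + Cmod (f' x - g' x))).
    + apply contR_dist2; auto; apply contC_pot; assumption.
    + apply contR_plus; [apply contR_scal, Cfg|exact Cfg'].
    + intros x; unfold dist2; specialize (P x); lra.
    + apply L1le_plus; [apply contR_scal, Cfg|exact Cfg'| |exact L2].
      intros a b Hab; rewrite RInt_scal_R by exact Cfg; apply Rmult_le_compat_l; [lra|apply L1, Hab].
Qed.

Lemma bounded_support f M : contC f -> (forall x, M <= Rabs x -> f x = 0) -> exists S, 0 <= S /\ forall x, Cmod (f x) <= S.
Proof.
  intros Cf Z.
  destruct (continuity_ab_maj (fun x => Cmod (f x)) (- Rabs M) (Rabs M)) as [m [Hm _]].
  - generalize (Rabs_pos M); lra.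
  - intros x _; apply continuity_pt_filterlim, contR_Cmod, Cf.
  - exists (Cmod (f m)); split; [apply Cmod_ge_0|]; intros x.
    destruct (Rle_dec M (Rabs x)) as [L|L]; [rewrite Z, Cmod_0 by exact L; apply Cmod_ge_0|].
    apply Hm, Rabs_le_between; generalize (Rle_abs M); lra.
Qed.

Lemma nice_pot phi : cpt_smooth phi -> nice phi (pot phi (dphi phi)).
Proof.
  intros H; destruct (cpt_smooth_rd phi H) as [A [B Cc]].
  destruct (cpt_smooth_support phi H) as [M HM]; destruct (HM M (Rle_refl _)) as [M0 Z].
  assert (Cp := rd_contC _ _ A); assert (Cd := rd_contC _ _ B).
  pose (p' := fun x => (Ci * / RtoC 2 * Cconj (D2 phi x) - / RtoC 4 *
     ((dphi phi x * Cconj (phi x) + phi x * Cconj (dphi phi x)) * Cconj (phi x) + phi x * Cconj (phi x) * Cconj (dphi phi x)))%C).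
  assert (Dp : forall x, rd (pot phi (dphi phi)) x (p' x)).
  { intros x; eapply rd_eq.
    - apply dv_minus; apply rd_mult; [apply dv_const|apply rd_conj, B|apply dv_const|].
      apply rd_mult; [apply rd_mult; [apply A|apply rd_conj, A]|apply rd_conj, A].
    - unfold p'; cbv beta; ring. }
  assert (Cp' : contC p').
  { intros x; unfold p'; apply cont_minus; apply cont_mult; try apply cont_const; [apply cont_conj, Cc|].
    apply cont_plus; apply cont_mult; try (apply cont_conj; first [apply Cp|apply Cd]).
    - apply cont_plus; apply cont_mult; try (apply cont_conj; first [apply Cp|apply Cd]); [apply Cd|apply Cp].
    - apply cont_mult; [apply Cp|apply cont_conj, Cp]. }
  assert (Zp : forall x, M <= Rabs x -> pot phi (dphi phi) x = 0).
  { intros x Hx; destruct (Z x Hx) as [E1 [E2 E3]]; unfold pot; rewrite E1, E2.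
    apply C_ext; unfold Cconj, Cminus, Cplus, Copp, Cmult, RtoC, Re, Im; simpl; ring. }
  assert (Zp' : forall x, M <= Rabs x -> p' x = 0).
  { intros x Hx; destruct (Z x Hx) as [E1 [E2 E3]]; unfold p'; rewrite E1, E2, E3.
    apply C_ext; unfold Cconj, Cminus, Cplus, Copp, Cmult, RtoC, Re, Im; simpl; ring. }
  destruct (bounded_support phi M Cp) as [S1 [P1 B1]]; [intros; apply Z; assumption|].
  destruct (bounded_support (dphi phi) M Cd) as [S2 [P2 B2]]; [intros; apply Z; assumption|].
  destruct (bounded_support _ M (rd_contC _ _ Dp) Zp) as [S3 [P3 B3]].
  destruct (bounded_support p' M Cp' Zp') as [S4 [P4 B4]].
  exists (dphi phi), p', (S1 + S2 + S3 + S4), M.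
  split; [exact A|split; [exact Dp|split; [exact Cd|split; [exact Cp'|split]]]].
  - intros x; generalize (B1 x) (B2 x) (B3 x) (B4 x); lra.
  - intros x Hx; split; [apply Z, Hx|apply Zp, Hx].
Qed.

Lemma H22_derivative q : H22 q -> exists q', (forall x, rd q x (q' x)) /\ contC q'.
Proof. intros [phi H]; destruct (approximates_C1 phi q H) as [q' [D [Cq _]]]; exists q'; auto. Qed.

Lemma size2_dist2 q p : size2 q p = dist2 q p (fun _ => RtoC 0) (fun _ => RtoC 0).
Proof.
  apply functional_extensionality; intros x; unfold size2, dist2.
  f_equal; f_equal; ring.
Qed.

Theorem good_pot q q' : H22 q -> (forall x, rd q x (q' x)) -> good q (pot q q').
Proof.
  intros H D; destruct H as [phi Ap].
  destruct (approximates_C1 phi q Ap) as [q1 [D1 [C1 N1]]].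
  assert (E : q1 = q') by (apply functional_extensionality; intros x; eapply rd_unique; [apply D1|apply D]).
  subst q1; clear D1.
  assert (Cq := rd_contC _ _ D).
  assert (H : H22 q) by (exists phi; exact Ap).
  assert (Bd := H22_bound q q' H D); set (B := 10 * H22norm q) in *.
  assert (B0 : 0 <= B) by (unfold B; generalize (H22norm_pos q H); lra).
  assert (Bq : forall x, Cmod (q x) <= B).
  { intros x; destruct Bd as [Bd _]; destruct (Bd x) as [Q _]; replace (q x - 0)%C with (q x) in Q by ring; exact Q. }
  split; [exact Cq|split; [apply contC_pot; assumption|split]].
  (* The L^1 size is a distance to 0, and 0 is its own transformed potential, so [near_pot]
     applies. *)
  - exists ((2 + B ^ 2) * B); rewrite size2_dist2.
    assert (N := near_pot B q q' (fun _ => RtoC 0) (fun _ => RtoC 0) B Cq C1 (contC_const _) (contC_const _)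
      ltac:(intros x; split; [apply Bq|rewrite Cmod_0; exact B0]) Bd).
    destruct N as [_ N]; replace (fun _ : R => RtoC 0) with (pot (fun _ => RtoC 0) (fun _ => RtoC 0)) at 2; [exact N|].
    apply functional_extensionality; intros x; unfold pot.
    apply C_ext; unfold Cconj, Cminus, Cplus, Copp, Cmult, RtoC, Re, Im; simpl; ring.
  - intros e He.
    (* The cap 1 keeps the approximating test function below [B + 1], the bound with which
       [near_pot] is used. *)
    set (d := Rmin 1 (e / (2 + (B + 1) ^ 2))).
    assert (P2 := pow2_ge_0 (B + 1)).
    assert (Hd : 0 < d) by (apply Rmin_pos; [lra|apply Rdiv_lt_0_compat; lra]).
    assert (Hd1 : d <= 1) by apply Rmin_l.
    assert (Hd2 : (2 + (B + 1) ^ 2) * d <= e).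
    { apply Rle_trans with ((2 + (B + 1) ^ 2) * (e / (2 + (B + 1) ^ 2))); [|right; field; lra].
      apply Rmult_le_compat_l; [lra|apply Rmin_r]. }
    destruct (N1 d Hd) as [n Hn]; specialize (Hn n (le_n _)).
    assert (Sm := proj1 Ap n).
    destruct (cpt_smooth_rd _ Sm) as [A1' [A2' _]].
    exists (phi n), (pot (phi n) (dphi (phi n))); split; [apply nice_pot, Sm|].
    assert (N := near_pot d (phi n) (dphi (phi n)) q q' (B + 1) (rd_contC _ _ A1') (rd_contC _ _ A2') Cq C1).
    destruct N as [Na Nb]; [|exact Hn|].
    + intros x; destruct Hn as [Hn _]; destruct (Hn x) as [Q _]; generalize (Cmod_triangle_inv (phi n x) (q x)) (Bq x); lra.
    + split.
      * intros x; rewrite (Cmod_minus_sym (q x)), (Cmod_minus_sym (pot q q' x)); destruct (Na x); lra.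
      * intros a b Hab; eapply Rle_trans; [|exact Hd2]; eapply Rle_trans; [|apply (Nb a b Hab)].
        right; apply RInt_ext; intros x _; unfold dist2.
        rewrite (Cmod_minus_sym (q x)), (Cmod_minus_sym (pot q q' x)); reflexivity.
Qed.

(** * Exchange of the potentials and reflection of the line *)

Lemma size2_sym q p : size2 q p = size2 p q.
Proof. apply functional_extensionality; intros x; unfold size2; ring. Qed.

Lemma near_sym2 e q p q1 p1 : near e q p q1 p1 -> near e p q p1 q1.
Proof.
  intros [A B]; split; [intros x; destruct (A x); split; assumption|].
  replace (dist2 p q p1 q1) with (dist2 q p q1 p1); [exact B|].
  apply functional_extensionality; intros x; unfold dist2; ring.
Qed.

Lemma good_swap q p : good q p -> good p q.
Proof.
  intros [A [B [[K HK] H]]]; split; [exact B|split; [exact A|split]].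
  - exists K; rewrite size2_sym; exact HK.
  - intros e He; destruct (H e He) as [q1 [p1 [[q' [p' [S [M [N1 [N2 [N3 [N4 [N5 N6]]]]]]]]] N]]].
    exists p1, q1; split; [|apply near_sym2, N].
    exists p', q', S, M; repeat split; auto; try apply N5; apply N6; assumption.
Qed.

(** Derivatives change sign under [x -> - x], hence the minus sign. Reflection combined with an
    exchange of the components turns solutions normalized on the right into solutions of
    [left_jost]. *)
Definition refl (f : R -> C) (x : R) : C := (- f (- x)%R)%C.

Lemma contC_refl f : contC f -> contC (refl f).
Proof.
  intros H x; apply cont_opp, (cont_comp_R (U := R_UniformSpace) (fun x => - x) f); [|apply H].
  apply (continuous_opp (V := R_NormedModule)), continuous_id.
Qed.

Lemma rd_flip f l x : rd f (- x) l -> rd (fun y => f (- y)) x (- l).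
Proof.
  intros H; apply rd_parts in H; destruct H as [A B]; apply rd_parts; split.
  - replace (Re (- l)%C) with (scal (- 1) (Re l)) by (unfold scal, Copp, Re; simpl; unfold mult; simpl; ring).
    apply (is_derive_comp (V := R_NormedModule) (fun y => Re (f y)) (fun y => - y)); [exact A|auto_derive; [exact I|ring]].
  - replace (Im (- l)%C) with (scal (- 1) (Im l)) by (unfold scal, Copp, Im; simpl; unfold mult; simpl; ring).
    apply (is_derive_comp (V := R_NormedModule) (fun y => Im (f y)) (fun y => - y)); [exact B|auto_derive; [exact I|ring]].
Qed.

Lemma L1le_flip f K : contR f -> L1le f K -> L1le (fun x => f (- x)) K.
Proof.
  intros Cf H A B HAB.
  assert (Cfl : contR (fun x => f (- x))).
  { intros x; apply (continuous_comp (fun x => - x) f); [apply (continuous_opp (V := R_NormedModule)), continuous_id|apply Cf]. }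
  assert (E : RInt (fun y => -1 * f (- y)) A B = RInt f (- A) (- B)).
  { apply (RInt_comp (V := R_CompleteNormedModule) f (fun y => - y) (fun _ => -1)); intros x _; [apply Cf|].
    split; [auto_derive; [exact I|ring]|apply continuous_const]. }
  rewrite RInt_scal_R in E by exact Cfl.
  assert (E2 : RInt (fun x => f (- x)) A B = RInt f (- B) (- A)).
  { rewrite <- (opp_RInt_swap (V := R_CompleteNormedModule) f (- A) (- B)) by (apply contR_ex, Cf).
    rewrite <- E; assert (T : forall t : R, t = - (-1 * t)) by (intros; ring); apply T. }
  rewrite E2; apply H; lra.
Qed.

Lemma near_refl e q p q1 p1 : contC q -> contC p -> contC q1 -> contC p1 ->
  near e q p q1 p1 -> near e (refl q) (refl p) (refl q1) (refl p1).
Proof.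
  intros Cq Cp Cq1 Cp1 [A B].
  assert (R1 : forall f g x, Cmod (refl f x - refl g x) = Cmod (f (- x)%R - g (- x)%R)).
  { intros f g x; unfold refl; rewrite <- Cmod_opp; f_equal; ring. }
  split.
  - intros x; rewrite !R1; apply A.
  - replace (dist2 (refl q) (refl p) (refl q1) (refl p1)) with (fun x => dist2 q p q1 p1 (- x)).
    + apply L1le_flip; [apply contR_dist2; assumption|exact B].
    + apply functional_extensionality; intros x; unfold dist2; rewrite !R1; reflexivity.
Qed.

Lemma size2_refl q p x : size2 (refl q) (refl p) x = size2 q p (- x).
Proof. unfold size2, refl; rewrite !Cmod_opp; reflexivity. Qed.

Lemma good_refl q p : good q p -> good (refl q) (refl p).
Proof.
  intros [A [B [[K HK] H]]]; split; [apply contC_refl, A|split; [apply contC_refl, B|split]].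
  - exists K; replace (size2 (refl q) (refl p)) with (fun x => size2 q p (- x)).
    + apply L1le_flip; [apply contR_size2; assumption|exact HK].
    + apply functional_extensionality; intros x; rewrite size2_refl; reflexivity.
  - intros e He; destruct (H e He) as [q1 [p1 [[q' [p' [S [M [N1 [N2 [N3 [N4 [N5 N6]]]]]]]]] N]]].
    exists (refl q1), (refl p1); split.
    + assert (Dr : forall f f', (forall x, rd f x (f' x)) -> forall x, rd (refl f) x (f' (- x))).
      { intros f f' Hf x; eapply rd_eq; [apply dv_opp, rd_flip, Hf|ring]. }
      assert (Cr : forall f, contC f -> contC (fun x => f (- x))).
      { intros f Cf x; apply (cont_comp_R (U := R_UniformSpace) (fun x => - x) f); [|apply Cf].
        apply (continuous_opp (V := R_NormedModule)), continuous_id. }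
      exists (fun x => q' (- x)), (fun x => p' (- x)), S, M.
      split; [apply Dr, N1|split; [apply Dr, N2|split; [apply Cr, N3|split; [apply Cr, N4|split]]]].
      * intros x; unfold refl; rewrite !Cmod_opp; apply N5.
      * intros x Hx; unfold refl; destruct (N6 (- x)) as [E1 E2]; [rewrite Rabs_Ropp; exact Hx|].
        rewrite E1, E2; split; ring.
    + apply near_refl; auto; [exact (rd_contC _ _ N1)|exact (rd_contC _ _ N2)].
Qed.

(** * Identification of the scattering data *)

Lemma Cexp_cis z : Cexp z = (RtoC (exp (Re z)) * cis (Im z))%C.
Proof. reflexivity. Qed.

Lemma Cexp_plus z w : Cexp (z + w) = (Cexp z * Cexp w)%C.
Proof.
  rewrite !Cexp_cis, Re_Cplus, Im_Cplus, exp_plus.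
  apply C_ext; unfold cis, Cmult, RtoC, Re, Im; simpl; rewrite ?cos_plus, ?sin_plus; ring.
Qed.

Lemma Cexp_0 : Cexp 0 = 1.
Proof.
  rewrite Cexp_cis; simpl; rewrite exp_0; unfold cis; rewrite cos_0, sin_0.
  apply C_ext; unfold Cmult, RtoC, Re, Im; simpl; ring.
Qed.

Lemma Cexp_opp z : (Cexp z * Cexp (- z))%C = 1.
Proof. rewrite <- Cexp_plus; replace (z + - z)%C with (RtoC 0) by ring; apply Cexp_0. Qed.

Lemma Cexp_neq_0 z : Cexp z <> 0.
Proof.
  intros E; assert (H := Cexp_opp z); rewrite E in H.
  apply (f_equal Re) in H; unfold Cmult, RtoC, Re in H; simpl in H; lra.
Qed.

Lemma Cmod_Cexp z : Cmod (Cexp z) = exp (Re z).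
Proof. rewrite Cexp_cis, Cmod_mult, Cmod_cis, Cmod_R, Rabs_pos_eq; [ring|left; apply exp_pos]. Qed.

Lemma rd_Cexp (w : C) x : rd (fun y => Cexp (w * RtoC y)%C) x (w * Cexp (w * RtoC x))%C.
Proof.
  destruct w as [u v]; apply rd_parts.
  split.
  - apply (is_derive_ext (fun y => exp (u * y) * cos (v * y))).
    + intros y; rewrite Cexp_cis; unfold cis, Cmult, RtoC, Re, Im; simpl.
      replace (u * y - v * 0) with (u * y) by ring; replace (u * 0 + v * y) with (v * y) by ring; ring.
    + auto_derive; [exact I|]; rewrite Cexp_cis; unfold cis, Cmult, RtoC, Re, Im; simpl.
      replace (u * x - v * 0) with (u * x) by ring; replace (u * 0 + v * x) with (v * x) by ring; ring.
  - apply (is_derive_ext (fun y => exp (u * y) * sin (v * y))).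
    + intros y; rewrite Cexp_cis; unfold cis, Cmult, RtoC, Re, Im; simpl.
      replace (u * y - v * 0) with (u * y) by ring; replace (u * 0 + v * y) with (v * y) by ring; ring.
    + auto_derive; [exact I|]; rewrite Cexp_cis; unfold cis, Cmult, RtoC, Re, Im; simpl.
      replace (u * x - v * 0) with (u * x) by ring; replace (u * 0 + v * x) with (v * x) by ring; ring.
Qed.

Lemma rd_constant (f : R -> C) : (forall x, rd f x 0) -> forall x y, f x = f y.
Proof.
  intros H.
  assert (W : forall x y, x <= y -> f y = f x).
  { intros x y L; assert (B := rd_mean_value f (fun _ => RtoC 0) x y 0 L (fun t _ => H t)).
    assert (E : (f y - f x)%C = 0).
    { apply Cmod_eq_0, Rle_antisym; [|apply Cmod_ge_0]; rewrite <- (Rmult_0_l (y - x)); apply B; intros; rewrite Cmod_0; lra. }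
    replace (f y) with (f y - f x + f x)%C by ring; rewrite E; ring. }
  intros x y; destruct (Rle_dec x y); [symmetry|]; apply W; lra.
Qed.

Definition tends (e : Rbar) (f : R -> C) (l : C) : Prop :=
  forall eps, 0 < eps -> Rbar_locally e (fun x => Cmod (f x - l) <= eps).

Lemma tends_filterlim e f l : tends e f l <-> filterlim f (Rbar_locally e) (@locally C_UniformSpace l).
Proof.
  split.
  - intros H P HP; apply locally_C_eps in HP; destruct HP as [d [Hd Q]].
    unfold filtermap; generalize (H (d / 2) ltac:(lra)); apply filter_imp; intros x Hx; apply Q; lra.
  - intros H eps He; apply (H (fun w => Cmod (w - l) <= eps)); apply locally_C_eps; exists eps; split; [exact He|].
    intros w Hw; lra.
Qed.

Lemma tends_plus e f g l m : tends e f l -> tends e g m -> tends e (fun x => f x + g x)%C (l + m).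
Proof.
  intros A B eps He; generalize (filter_and (F := Rbar_locally e) _ _ (A (eps / 2) ltac:(lra)) (B (eps / 2) ltac:(lra))).
  apply filter_imp; intros x [P Q].
  replace (f x + g x - (l + m))%C with ((f x - l) + (g x - m))%C by ring.
  eapply Rle_trans; [apply Cmod_triangle|lra].
Qed.

Lemma tends_const e c : tends e (fun _ => c) c.
Proof.
  intros eps He; apply filter_forall; intros x; replace (c - c)%C with (RtoC 0) by ring; rewrite Cmod_0; lra.
Qed.

Lemma tends_mult e f g l m : tends e f l -> tends e g m -> tends e (fun x => f x * g x)%C (l * m).
Proof.
  intros A B eps He.
  set (T := Cmod l + Cmod m + 1); assert (T1 : 1 <= T) by (unfold T; generalize (Cmod_ge_0 l) (Cmod_ge_0 m); lra).
  set (d := Rmin 1 (eps / T)).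
  assert (Hd : 0 < d) by (apply Rmin_pos; [lra|apply Rdiv_lt_0_compat; lra]).
  assert (Hd1 : d <= 1) by apply Rmin_l.
  assert (Hd2 : d * T <= eps).
  { apply Rle_trans with (eps / T * T); [apply Rmult_le_compat_r; [lra|apply Rmin_r]|right; field; lra]. }
  generalize (filter_and (F := Rbar_locally e) _ _ (A d Hd) (B d Hd)); apply filter_imp; intros x [P Q].
  replace (f x * g x - l * m)%C with ((f x - l) * (g x - m) + (f x - l) * m + l * (g x - m))%C by ring.
  generalize (Cmod_triangle ((f x - l) * (g x - m) + (f x - l) * m) (l * (g x - m)))
    (Cmod_triangle ((f x - l) * (g x - m)) ((f x - l) * m)).
  rewrite !Cmod_mult.
  generalize (Cmod_ge_0 (f x - l)) (Cmod_ge_0 (g x - m)) (Cmod_ge_0 l) (Cmod_ge_0 m); intros.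
  assert (Cmod (f x - l) * Cmod (g x - m) <= d * 1) by (apply Rmult_le_compat; lra).
  assert (Cmod (f x - l) * Cmod m <= d * Cmod m) by (apply Rmult_le_compat_r; lra).
  assert (Cmod l * Cmod (g x - m) <= Cmod l * d) by (apply Rmult_le_compat_l; lra).
  unfold T in Hd2; lra.
Qed.

Lemma tends_ext e f g l : (forall x, f x = g x) -> tends e f l -> tends e g l.
Proof. intros H; rewrite (functional_extensionality f g H); auto. Qed.

Lemma tends_minus e f g l m : tends e f l -> tends e g m -> tends e (fun x => f x - g x)%C (l - m).
Proof.
  intros A B; apply tends_plus; [exact A|].
  intros eps He; generalize (B eps He); apply filter_imp; intros x Hx.
  replace (- g x - - m)%C with (- (g x - m))%C by ring; rewrite Cmod_opp; exact Hx.
Qed.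

Lemma tends_eq e f l m : tends e f l -> l = m -> tends e f m.
Proof. intros H E; subst; exact H. Qed.

Lemma tends_const_unique e f c l : (forall x, f x = c) -> tends e f l -> c = l.
Proof.
  intros Hf H.
  assert (Z : Cmod (c - l) <= 0).
  { apply le_epsilon; intros eps He; rewrite Rplus_0_l.
    destruct (filter_ex (F := Rbar_locally e) _ (H eps He)) as [x Hx]; rewrite Hf in Hx; exact Hx. }
  assert (E : (c - l)%C = 0) by (apply Cmod_eq_0, Rle_antisym; [exact Z|apply Cmod_ge_0]).
  replace c with (c - l + l)%C by ring; rewrite E; ring.
Qed.

Lemma tends_zero_mod e f g : (forall x, Cmod (f x) = Cmod (g x)) -> tends e g 0 -> tends e f 0.
Proof.
  intros H Hg eps He; generalize (Hg eps He); apply filter_imp; intros x Hx.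
  replace (f x - 0)%C with (f x) by ring; replace (g x - 0)%C with (g x) in Hx by ring; rewrite H; exact Hx.
Qed.

Lemma ent_mat2 a b c d : ent (mat2 a b c d) 0 0 = a /\ ent (mat2 a b c d) 0 1 = b /\
  ent (mat2 a b c d) 1 0 = c /\ ent (mat2 a b c d) 1 1 = d.
Proof. repeat split. Qed.

Lemma ent_mul2 A B i j : (i < 2)%nat -> (j < 2)%nat ->
  ent (mul2 A B) i j = (ent A i 0 * ent B 0 j + ent A i 1 * ent B 1 j)%C.
Proof.
  intros Hi Hj; unfold ent, mul2, Mmult.
  rewrite coeff_mat_bij by assumption.
  simpl pred; rewrite sum_Sn, sum_O; reflexivity.
Qed.

Lemma ent_one i j : (i < 2)%nat -> (j < 2)%nat ->
  ent (@Mone C_Ring 2) i j = if Nat.eqb i j then RtoC 1 else RtoC 0.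
Proof.
  intros Hi Hj; unfold ent, Mone; rewrite coeff_mat_bij by assumption.
  destruct i as [|[|i]]; destruct j as [|[|j]]; try lia; reflexivity.
Qed.

Lemma M2_ext (A B : M2) : (forall i j, (i < 2)%nat -> (j < 2)%nat -> ent A i j = ent B i j) -> A = B.
Proof.
  intros H; rewrite <- (mk_matrix_bij (RtoC 0) A), <- (mk_matrix_bij (RtoC 0) B).
  apply mk_matrix_ext; intros i j Hi Hj; apply H; assumption.
Qed.

Lemma two_cases (P : nat -> nat -> Prop) : P 0%nat 0%nat -> P 0%nat 1%nat -> P 1%nat 0%nat -> P 1%nat 1%nat ->
  forall i j, (i < 2)%nat -> (j < 2)%nat -> P i j.
Proof.
  intros A B D E i j Hi Hj; destruct i as [|[|i]]; destruct j as [|[|j]]; try lia; assumption.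
Qed.

(** * Columns of the Lax system and their Wronskians *)

Definition eplus (lam x : R) : C := Cexp (Ci * RtoC (lam * x))%C.
Definition eminus (lam x : R) : C := Cexp (- (Ci * RtoC (lam * x)))%C.

Lemma eplus_eminus lam x : (eplus lam x * eminus lam x)%C = 1.
Proof. apply Cexp_opp. Qed.

Lemma Cmod_eplus lam x : Cmod (eplus lam x) = 1 /\ Cmod (eminus lam x) = 1.
Proof.
  unfold eplus, eminus; rewrite !Cmod_Cexp; split; rewrite <- exp_0; f_equal;
  unfold Ci, Cmult, Copp, RtoC, Re; simpl; ring.
Qed.

Lemma rd_eplus lam x : rd (eplus lam) x (Ci * RtoC lam * eplus lam x)%C /\ rd (eminus lam) x (- (Ci * RtoC lam) * eminus lam x)%C.
Proof.
  split.
  - replace (eplus lam) with (fun y => Cexp ((Ci * RtoC lam) * RtoC y))%C; [apply rd_Cexp|].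
    apply functional_extensionality; intros y; unfold eplus; f_equal; rewrite RtoC_mult; ring.
  - replace (eminus lam) with (fun y => Cexp ((- (Ci * RtoC lam)) * RtoC y))%C; [apply rd_Cexp|].
    apply functional_extensionality; intros y; unfold eminus; f_equal; rewrite RtoC_mult; ring.
Qed.

Section Jost.
Variables (q : R -> C) (lam : R).

Let dq (x : R) : C := (- Ci * RtoC lam + Ci / RtoC 2 * RtoC (Cmod (q x) ^ 2))%C.

Definition lax_column (U V : R -> C) : Prop :=
  (forall x, rd U x (dq x * U x + q x * V x)%C) /\
  (forall x, rd V x (- RtoC lam * Cconj (q x) * U x - dq x * V x)%C).

Lemma wronskian_constant U V U1 V1 : lax_column U V -> lax_column U1 V1 ->
  forall x y, (U x * V1 x - V x * U1 x)%C = (U y * V1 y - V y * U1 y)%C.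
Proof.
  intros [A B] [A1 B1]; apply (rd_constant (fun x => U x * V1 x - V x * U1 x)%C); intros x.
  eapply rd_eq; [apply dv_minus; apply rd_mult; [apply A|apply B1|apply B|apply A1]|cbv beta; ring].
Qed.

Lemma ent_Lax x : ent (Lax q lam x) 0 0 = dq x /\ ent (Lax q lam x) 0 1 = q x /\
  ent (Lax q lam x) 1 0 = (- RtoC lam * Cconj (q x))%C /\ ent (Lax q lam x) 1 1 = (- dq x)%C.
Proof. apply ent_mat2. Qed.

Lemma is_jost_columns e Psi : is_jost e q lam Psi <->
  (lax_column (fun x => ent (Psi x) 0 0) (fun x => ent (Psi x) 1 0) /\
   lax_column (fun x => ent (Psi x) 0 1) (fun x => ent (Psi x) 1 1)) /\
  (tends e (fun x => ent (Psi x) 0 0 * eplus lam x)%C 1 /\ tends e (fun x => ent (Psi x) 1 0 * eplus lam x)%C 0 /\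
   tends e (fun x => ent (Psi x) 0 1 * eminus lam x)%C 0 /\ tends e (fun x => ent (Psi x) 1 1 * eminus lam x)%C 1).
Proof.
  assert (EL : forall x i j, (i < 2)%nat -> (j < 2)%nat -> ent (mul2 (Lax q lam x) (Psi x)) i j =
    (ent (Lax q lam x) i 0 * ent (Psi x) 0 j + ent (Lax q lam x) i 1 * ent (Psi x) 1 j)%C) by (intros; apply ent_mul2; assumption).
  assert (EN : forall x, ent (mul2 (Psi x) (Esig lam x)) 0 0 = (ent (Psi x) 0 0 * eplus lam x)%C /\
    ent (mul2 (Psi x) (Esig lam x)) 1 0 = (ent (Psi x) 1 0 * eplus lam x)%C /\
    ent (mul2 (Psi x) (Esig lam x)) 0 1 = (ent (Psi x) 0 1 * eminus lam x)%C /\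
    ent (mul2 (Psi x) (Esig lam x)) 1 1 = (ent (Psi x) 1 1 * eminus lam x)%C).
  { intros x; unfold Esig; fold (eplus lam x) (eminus lam x).
    rewrite !ent_mul2 by lia.
    destruct (ent_mat2 (eplus lam x) 0 0 (eminus lam x)) as [E1 [E2 [E3 E4]]]; rewrite E1, E2, E3, E4.
    repeat split; ring. }
  unfold is_jost; split.
  - intros [D L].
    assert (D' : forall x i j, (i < 2)%nat -> (j < 2)%nat -> rd (fun y => ent (Psi y) i j) x
      (ent (Lax q lam x) i 0 * ent (Psi x) 0 j + ent (Lax q lam x) i 1 * ent (Psi x) 1 j)%C).
    { intros x i j Hi Hj; rewrite <- EL by assumption; apply rd_is_derive, D; assumption. }
    split; [split; split|].
    + intros x; destruct (ent_Lax x) as [E1 [E2 [E3 E4]]]; eapply rd_eq; [apply D'; lia|]; rewrite E1, E2; reflexivity.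
    + intros x; destruct (ent_Lax x) as [E1 [E2 [E3 E4]]]; eapply rd_eq; [apply D'; lia|]; rewrite E3, E4; ring.
    + intros x; destruct (ent_Lax x) as [E1 [E2 [E3 E4]]]; eapply rd_eq; [apply D'; lia|]; rewrite E1, E2; reflexivity.
    + intros x; destruct (ent_Lax x) as [E1 [E2 [E3 E4]]]; eapply rd_eq; [apply D'; lia|]; rewrite E3, E4; ring.
    + assert (L' : forall i j, (i < 2)%nat -> (j < 2)%nat -> tends e (fun x => ent (mul2 (Psi x) (Esig lam x)) i j)
        (if Nat.eqb i j then RtoC 1 else RtoC 0)).
      { intros i j Hi Hj; rewrite <- ent_one by assumption; apply tends_filterlim, L; assumption. }
      split; [|split; [|split]].
      * apply (tends_ext e (fun x => ent (mul2 (Psi x) (Esig lam x)) 0 0)); [intros x; exact (proj1 (EN x))|exact (L' 0%nat 0%nat ltac:(lia) ltac:(lia))].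
      * apply (tends_ext e (fun x => ent (mul2 (Psi x) (Esig lam x)) 1 0)); [intros x; exact (proj1 (proj2 (EN x)))|exact (L' 1%nat 0%nat ltac:(lia) ltac:(lia))].
      * apply (tends_ext e (fun x => ent (mul2 (Psi x) (Esig lam x)) 0 1)); [intros x; exact (proj1 (proj2 (proj2 (EN x))))|exact (L' 0%nat 1%nat ltac:(lia) ltac:(lia))].
      * apply (tends_ext e (fun x => ent (mul2 (Psi x) (Esig lam x)) 1 1)); [intros x; exact (proj2 (proj2 (proj2 (EN x))))|exact (L' 1%nat 1%nat ltac:(lia) ltac:(lia))].
  - intros [[[A1 A2] [A3 A4]] [L1 [L2 [L3 L4]]]]; split.
    + intros x i j Hi Hj; apply rd_is_derive; rewrite EL by assumption.
      destruct (ent_Lax x) as [E1 [E2 [E3 E4]]]; revert i j Hi Hj; apply two_cases.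
      * rewrite E1, E2; apply A1.
      * rewrite E1, E2; apply A3.
      * rewrite E3, E4; eapply rd_eq; [apply A2|ring].
      * rewrite E3, E4; eapply rd_eq; [apply A4|ring].
    + intros i j Hi Hj; apply tends_filterlim; rewrite ent_one by assumption.
      revert i j Hi Hj; apply two_cases; simpl.
      * apply (tends_ext e (fun x => ent (Psi x) 0 0 * eplus lam x)%C); [intros x; exact (eq_sym (proj1 (EN x)))|exact L1].
      * apply (tends_ext e (fun x => ent (Psi x) 0 1 * eminus lam x)%C); [intros x; exact (eq_sym (proj1 (proj2 (proj2 (EN x)))))|exact L3].
      * apply (tends_ext e (fun x => ent (Psi x) 1 0 * eplus lam x)%C); [intros x; exact (eq_sym (proj1 (proj2 (EN x))))|exact L2].
      * apply (tends_ext e (fun x => ent (Psi x) 1 1 * eminus lam x)%C); [intros x; exact (eq_sym (proj2 (proj2 (proj2 (EN x)))))|exact L4].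
Qed.

(* The exponentials normalizing the two columns multiply a Wronskian by a unimodular factor. *)
Lemma wronskian_limit e (s t : R -> C) U V U1 V1 l1 l2 m1 m2 : lax_column U V -> lax_column U1 V1 ->
  tends e (fun x => U x * s x)%C l1 -> tends e (fun x => V x * s x)%C l2 ->
  tends e (fun x => U1 x * t x)%C m1 -> tends e (fun x => V1 x * t x)%C m2 ->
  ((forall x, (s x * t x)%C = 1) -> forall x, (U x * V1 x - V x * U1 x)%C = (l1 * m2 - l2 * m1)%C) /\
  ((forall x, Cmod (s x * t x) = 1) -> (l1 * m2 - l2 * m1)%C = 0 -> forall x, (U x * V1 x - V x * U1 x)%C = 0).
Proof.
  intros H H1 T1 T2 T3 T4.
  assert (T := tends_minus _ _ _ _ _ (tends_mult _ _ _ _ _ T1 T4) (tends_mult _ _ _ _ _ T2 T3)).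
  assert (W := wronskian_constant U V U1 V1 H H1).
  assert (E : forall x, (U x * s x * (V1 x * t x) - V x * s x * (U1 x * t x) = (U x * V1 x - V x * U1 x) * (s x * t x))%C)
    by (intros; ring).
  split.
  - intros St x0; apply (tends_const_unique e (fun x => U x * V1 x - V x * U1 x)%C); [intros x; apply W|].
    refine (tends_ext _ _ _ _ _ T); intros x; cbv beta; rewrite E, St; ring.
  - intros St Z x0; apply (tends_const_unique e (fun x => U x * V1 x - V x * U1 x)%C); [intros x; apply W|].
    rewrite Z in T; refine (tends_zero_mod _ _ _ _ T); intros x; cbv beta; rewrite E, (Cmod_mult _ (s x * t x)), St; ring.
Qed.

Lemma jost_det e P : is_jost e q lam P ->
  forall x, (ent (P x) 0 0 * ent (P x) 1 1 - ent (P x) 1 0 * ent (P x) 0 1)%C = 1.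
Proof.
  intros H; apply is_jost_columns in H; destruct H as [[C1 C2] [L1 [L2 [L3 L4]]]]; intros x.
  rewrite (proj1 (wronskian_limit _ _ _ _ _ _ _ _ _ _ _ C1 C2 L1 L2 L3 L4) (eplus_eminus lam)); ring.
Qed.

(** The columns of [P1] are expanded in those of [P]; the coefficients are Wronskians, which are
    constant and known from their limits at [e]. *)
Lemma jost_unique e P P1 : is_jost e q lam P -> is_jost e q lam P1 -> forall x, P x = P1 x.
Proof.
  intros H H1.
  assert (D := jost_det e P H).
  apply is_jost_columns in H; destruct H as [[A1 A2] [L1 [L2 [L3 L4]]]].
  apply is_jost_columns in H1; destruct H1 as [[B1 B2] [M1 [M2 [M3 M4]]]].
  assert (W1 : forall x, (ent (P1 x) 0 0 * ent (P x) 1 1 - ent (P1 x) 1 0 * ent (P x) 0 1)%C = 1).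
  { intros x; rewrite (proj1 (wronskian_limit _ _ _ _ _ _ _ _ _ _ _ B1 A2 M1 M2 L3 L4) (eplus_eminus lam)); ring. }
  assert (W4 : forall x, (ent (P x) 0 0 * ent (P1 x) 1 1 - ent (P x) 1 0 * ent (P1 x) 0 1)%C = 1).
  { intros x; rewrite (proj1 (wronskian_limit _ _ _ _ _ _ _ _ _ _ _ A1 B2 L1 L2 M3 M4) (eplus_eminus lam)); ring. }
  assert (W2 : forall x, (ent (P x) 0 0 * ent (P1 x) 1 0 - ent (P x) 1 0 * ent (P1 x) 0 0)%C = 0).
  { apply (proj2 (wronskian_limit _ _ _ _ _ _ _ _ _ _ _ A1 B1 L1 L2 M1 M2)); [|ring].
    intros x; rewrite Cmod_mult; destruct (Cmod_eplus lam x) as [E _]; rewrite E; ring. }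
  assert (W3 : forall x, (ent (P1 x) 0 1 * ent (P x) 1 1 - ent (P1 x) 1 1 * ent (P x) 0 1)%C = 0).
  { apply (proj2 (wronskian_limit _ _ _ _ _ _ _ _ _ _ _ B2 A2 M3 M4 L3 L4)); [|ring].
    intros x; rewrite Cmod_mult; destruct (Cmod_eplus lam x) as [_ E]; rewrite E; ring. }
  intros x; specialize (D x); specialize (W1 x); specialize (W2 x); specialize (W3 x); specialize (W4 x).
  (* Cramer's rule in a basis of determinant 1. *)
  assert (Cr : forall a b c d u v s t : C, (a * d - c * b)%C = 1 -> (u * d - v * b)%C = s -> (a * v - c * u)%C = t ->
     u = (s * a + t * b)%C /\ v = (s * c + t * d)%C).
  { intros a b c d u v s t E1 E2 E3; split.
    - transitivity (u * (a * d - c * b))%C; [rewrite E1; ring|]; rewrite <- E2, <- E3; ring.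
    - transitivity (v * (a * d - c * b))%C; [rewrite E1; ring|]; rewrite <- E2, <- E3; ring. }
  destruct (Cr _ _ _ _ _ _ _ _ D W1 W2) as [E00 E10].
  destruct (Cr _ _ _ _ _ _ _ _ D W3 W4) as [E01 E11].
  apply M2_ext; apply two_cases.
  - rewrite E00; ring.
  - rewrite E01; ring.
  - rewrite E10; ring.
  - rewrite E11; ring.
Qed.

Lemma Psi_eq e P : is_jost e q lam P -> forall x, Psi e q lam x = P x.
Proof.
  intros H; apply (jost_unique e); [|exact H].
  apply (epsilon_spec (inhabits (fun _ : R => @Mone C_Ring 2)) (is_jost e q lam)); exists P; exact H.
Qed.

(* [T] is the adjugate of [Psi^-] times [Psi^+]; its entries are Wronskians. *)
Lemma Tmat_eq Pm Pp : is_jost m_infty q lam Pm -> is_jost p_infty q lam Pp ->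
  forall x, ent (Tmat q lam) 1 1 = (ent (Pm x) 0 0 * ent (Pp x) 1 1 - ent (Pm x) 1 0 * ent (Pp x) 0 1)%C.
Proof.
  intros Hm Hp.
  assert (D := jost_det _ _ Hm).
  assert (Ex : exists T, forall x, Psi p_infty q lam x = mul2 (Psi m_infty q lam x) T).
  { pose (w := fun (i j : nat) x => (ent (Pm x) 0 i * ent (Pp x) 1 j - ent (Pm x) 1 i * ent (Pp x) 0 j)%C).
    assert (W : forall i j, (i < 2)%nat -> (j < 2)%nat -> forall x y, w i j x = w i j y).
    { apply is_jost_columns in Hm; apply is_jost_columns in Hp; destruct Hm as [[A1 A2] _], Hp as [[B1 B2] _].
      apply (two_cases (fun i j => forall x y, w i j x = w i j y)); apply wronskian_constant; assumption. }
    exists (mat2 (- w 1%nat 0%nat 0)%C (- w 1%nat 1%nat 0)%C (w 0%nat 0%nat 0) (w 0%nat 1%nat 0)).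
    intros x; rewrite (Psi_eq _ _ Hp), (Psi_eq _ _ Hm).
    destruct (ent_mat2 (- w 1%nat 0%nat 0)%C (- w 1%nat 1%nat 0)%C (w 0%nat 0%nat 0) (w 0%nat 1%nat 0)) as [E1 [E2 [E3 E4]]].
    apply M2_ext; intros i j Hi Hj; rewrite ent_mul2 by assumption; revert i j Hi Hj.
    apply two_cases; rewrite ?E1, ?E2, ?E3, ?E4.
    - rewrite (W 1%nat 0%nat ltac:(lia) ltac:(lia) 0 x), (W 0%nat 0%nat ltac:(lia) ltac:(lia) 0 x); unfold w.
      transitivity (ent (Pp x) 0 0 * 1)%C; [ring|]; rewrite <- (D x); ring.
    - rewrite (W 1%nat 1%nat ltac:(lia) ltac:(lia) 0 x), (W 0%nat 1%nat ltac:(lia) ltac:(lia) 0 x); unfold w.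
      transitivity (ent (Pp x) 0 1 * 1)%C; [ring|]; rewrite <- (D x); ring.
    - rewrite (W 1%nat 0%nat ltac:(lia) ltac:(lia) 0 x), (W 0%nat 0%nat ltac:(lia) ltac:(lia) 0 x); unfold w.
      transitivity (ent (Pp x) 1 0 * 1)%C; [ring|]; rewrite <- (D x); ring.
    - rewrite (W 1%nat 1%nat ltac:(lia) ltac:(lia) 0 x), (W 0%nat 1%nat ltac:(lia) ltac:(lia) 0 x); unfold w.
      transitivity (ent (Pp x) 1 1 * 1)%C; [ring|]; rewrite <- (D x); ring. }
  assert (Sp := epsilon_spec (inhabits (@Mone C_Ring 2)) (fun T => forall x, Psi p_infty q lam x = mul2 (Psi m_infty q lam x) T) Ex).
  fold (Tmat q lam) in Sp; intros x; specialize (Sp x); rewrite (Psi_eq _ _ Hp), (Psi_eq _ _ Hm) in Sp.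
  rewrite Sp, !ent_mul2 by lia; specialize (D x).
  transitivity (ent (Tmat q lam) 1 1 * 1)%C; [ring|]; rewrite <- D; ring.
Qed.

End Jost.

(** * From the Zakharov-Shabat system back to the Lax system *)

Definition gauge (q : R -> C) (x : R) : C := (- (Ci * / RtoC 2 * Cconj (q x)))%C.

(** In the first row [q gauge] cancels the diagonal term [(i/2) |q|^2]. In the second,
    [2 i lam gauge = lam conj q] removes the off-diagonal term that grows with [lam], and the terms
    left over are exactly those collected in [pot]. *)
Lemma gauge_column q q' lam u v : (forall x, rd q x (q' x)) ->
  (forall x, rd u x (- (Ci * RtoC lam) * u x + q x * v x)%C) ->
  (forall x, rd v x (Ci * RtoC lam * v x + pot q q' x * u x)%C) ->
  lax_column q lam u (fun x => gauge q x * u x + v x)%C.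
Proof.
  intros Hq Hu Hv.
  assert (CC : (Ci * Ci)%C = (- RtoC 1)%C).
  { apply C_ext; unfold Ci, Copp, Cmult, RtoC, Re, Im; simpl; ring. }
  assert (CI : forall t : C, (Ci * (Ci * t))%C = (- t)%C) by (intros; rewrite Cmult_assoc, CC; ring).
  assert (C20 : RtoC 2 <> 0) by (intros E; apply (f_equal Re) in E; simpl in E; lra).
  assert (C40 : RtoC 4 <> 0) by (intros E; apply (f_equal Re) in E; simpl in E; lra).
  assert (E4 : RtoC 4 = (RtoC 2 * RtoC 2)%C) by (rewrite <- RtoC_mult; f_equal; ring).
  split; intros x.
  - eapply rd_eq; [apply Hu|].
    rewrite Cmod2_conj; unfold gauge, Cdiv. ring.
  - eapply rd_eq.
    + apply dv_plus; [apply rd_mult; [|apply Hu]|apply Hv].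
      unfold gauge; apply dv_opp, rd_mult; [apply dv_const|apply rd_conj, Hq].
    + cbv beta; rewrite Cmod2_conj; unfold gauge, pot, Cdiv; rewrite E4.
      replace (/ (RtoC 2 * RtoC 2))%C with (/ RtoC 2 * / RtoC 2)%C by (field; exact C20).
      set (h := (/ RtoC 2)%C).
      assert (Hh : (RtoC 2 * h)%C = 1) by (unfold h; field; exact C20).
      assert (Hh2 : (h + h)%C = 1) by (rewrite <- Hh; ring).
      clearbody h.
      set (Qb := Cconj (q x)); set (Q := q x); set (D := Cconj (q' x)); set (U := u x); set (V := v x); set (L := RtoC lam).
      clearbody Q Qb D U V L.
      replace (- L * Qb * U)%C with (- (h + h) * L * Qb * U)%C by (rewrite Hh2; ring).
      ring [CC].
Qed.

(** Since [q] tends to 0, the gauge matrix tends to the identity, so restoring the gauge factor and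
    the exponentials preserves the normalization at [e]. *)
Lemma jost_build e q q' lam a b c d : (forall x, rd q x (q' x)) -> tends e q 0 ->
  (forall x, rd a x (q x * b x)%C) -> (forall x, rd b x (RtoC 2 * Ci * RtoC lam * b x + pot q q' x * a x)%C) ->
  (forall x, rd d x (pot q q' x * c x)%C) -> (forall x, rd c x (- (RtoC 2 * Ci * RtoC lam) * c x + q x * d x)%C) ->
  tends e a 1 -> tends e b 0 -> tends e c 0 -> tends e d 1 ->
  is_jost e q lam (fun x => mat2 (a x * eminus lam x) (c x * eplus lam x)
     (gauge q x * (a x * eminus lam x) + b x * eminus lam x) (gauge q x * (c x * eplus lam x) + d x * eplus lam x))%C.
Proof.
  intros Hq Tq Ha Hb Hd Hc Ta Tb Tc Td; apply is_jost_columns.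
  assert (Ep := fun x => proj1 (rd_eplus lam x)); assert (Em := fun x => proj2 (rd_eplus lam x)).
  assert (EE := eplus_eminus lam).
  assert (Tg : tends e (gauge q) 0).
  { unfold gauge; eapply tends_eq.
    - apply (tends_ext e (fun x => (- (Ci * / RtoC 2)) * Cconj (q x))%C); [intros; ring|].
      apply tends_mult; [apply tends_const|].
      intros eps He; generalize (Tq eps He); apply filter_imp; intros x Hx.
      replace (Cconj (q x) - 0)%C with (Cconj (q x - 0)); [rewrite Cmod_conj; exact Hx|].
      rewrite Cminus_conj; f_equal; apply C_ext; unfold Cconj, RtoC, Re, Im; simpl; ring.
    - ring. }
  split; [split|].
  - apply (gauge_column q q' lam (fun x => a x * eminus lam x)%C (fun x => b x * eminus lam x)%C Hq); intros x.
    + eapply rd_eq; [apply rd_mult; [apply Ha|apply Em]|ring].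
    + eapply rd_eq; [apply rd_mult; [apply Hb|apply Em]|cbv beta].
      replace (RtoC 2) with (RtoC 1 + RtoC 1)%C by (rewrite <- RtoC_plus; f_equal; ring); ring.
  - apply (gauge_column q q' lam (fun x => c x * eplus lam x)%C (fun x => d x * eplus lam x)%C Hq); intros x.
    + eapply rd_eq; [apply rd_mult; [apply Hc|apply Ep]|cbv beta].
      replace (RtoC 2) with (RtoC 1 + RtoC 1)%C by (rewrite <- RtoC_plus; f_equal; ring); ring.
    + eapply rd_eq; [apply rd_mult; [apply Hd|apply Ep]|ring].
  - split; [|split; [|split]].
    + apply (tends_ext e a); [|exact Ta]; intros x.
      change (a x = a x * eminus lam x * eplus lam x)%C.
      transitivity (a x * (eplus lam x * eminus lam x))%C; [rewrite EE; ring|ring].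
    + apply (tends_ext e (fun x => gauge q x * a x + b x)%C).
      * intros x; change (gauge q x * a x + b x = (gauge q x * (a x * eminus lam x) + b x * eminus lam x) * eplus lam x)%C.
        transitivity ((gauge q x * a x + b x) * (eplus lam x * eminus lam x))%C; [rewrite EE; ring|ring].
      * eapply tends_eq; [apply tends_plus; [apply tends_mult; [exact Tg|exact Ta]|exact Tb]|ring].
    + apply (tends_ext e c); [|exact Tc]; intros x.
      change (c x = c x * eplus lam x * eminus lam x)%C.
      transitivity (c x * (eplus lam x * eminus lam x))%C; [rewrite EE; ring|ring].
    + apply (tends_ext e (fun x => gauge q x * c x + d x)%C).
      * intros x; change (gauge q x * c x + d x = (gauge q x * (c x * eplus lam x) + d x * eplus lam x) * eminus lam x)%C.
        transitivity ((gauge q x * c x + d x) * (eplus lam x * eminus lam x))%C; [rewrite EE; ring|ring].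
      * eapply tends_eq; [apply tends_plus; [apply tends_mult; [exact Tg|exact Tc]|exact Td]|ring].
Qed.

Lemma Njost_entries e q lam P x : is_jost e q lam P ->
  (forall i, (i < 2)%nat -> ent (Njost e q x lam) i 0 = (ent (P x) i 0 * eplus lam x)%C /\
     ent (Njost e q x lam) i 1 = (ent (P x) i 1 * eminus lam x)%C).
Proof.
  intros H i Hi; unfold Njost; rewrite (Psi_eq _ _ _ _ H).
  rewrite !ent_mul2 by lia; unfold Esig; fold (eplus lam x) (eminus lam x).
  destruct (ent_mat2 (eplus lam x) 0 0 (eminus lam x)) as [E1 [E2 [E3 E4]]]; rewrite E1, E2, E3, E4.
  split; ring.
Qed.

Lemma H22_decay q : H22 q -> tends m_infty q 0 /\ tends p_infty q 0.
Proof.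
  intros H; destruct H as [phi Ap].
  destruct (approximates_C1 phi q Ap) as [q' [D [_ N]]].
  assert (B : forall e, 0 < e -> exists M, forall x, M < Rabs x -> Cmod (q x) <= e).
  { intros e He; destruct (N e He) as [n Hn]; destruct (Hn n (le_n _)) as [B _].
    destruct (proj1 Ap n) as [_ [M HM]]; exists M; intros x Hx; destruct (B x) as [Q _].
    rewrite (HM x Hx) in Q; replace (q x) with (- (0 - q x))%C by ring; rewrite Cmod_opp; exact Q. }
  split; intros e He; destruct (B e He) as [M HM].
  - exists (- Rabs M); intros x Hx; replace (q x - 0)%C with (q x) by ring; apply HM.
    rewrite Rabs_left by (generalize (Rabs_pos M); lra); generalize (Rle_abs M); lra.
  - exists (Rabs M); intros x Hx; replace (q x - 0)%C with (q x) by ring; apply HM.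
    rewrite Rabs_pos_eq by (generalize (Rabs_pos M); lra); generalize (Rle_abs M); lra.
Qed.

Lemma left_jost_tends q p z a b : left_jost q p z a b -> tends m_infty a 1 /\ tends m_infty b 0 /\
  tends p_infty (fun x => a (- x)) 1 /\ tends p_infty (fun x => b (- x)) 0.
Proof.
  intros [_ [_ H]].
  assert (Z : forall w : C, (w - 0)%C = w) by (intros; ring).
  repeat split; intros e He; destruct (H e He) as [X HX].
  - exists X; intros x Hx; apply HX; lra.
  - exists X; intros x Hx; rewrite Z; apply HX; lra.
  - exists (- X); intros x Hx; apply HX; lra.
  - exists (- X); intros x Hx; rewrite Z; apply HX; lra.
Qed.

(* [(c (- x), d (- x))] is the second column of [N^+] before the gauge transformation. *)
Lemma right_jost q p z d c : left_jost (refl p) (refl q) z d c ->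
  (forall x, rd (fun y => d (- y)) x (p x * c (- x)%R)%C) /\
  (forall x, rd (fun y => c (- y)) x (- (RtoC 2 * Ci * z) * c (- x)%R + q x * d (- x)%R)%C).
Proof.
  intros [Hd [Hc _]]; split; intros x.
  - eapply rd_eq; [apply rd_flip, Hd|]; unfold refl; rewrite Ropp_involutive; ring.
  - eapply rd_eq; [apply rd_flip, Hc|]; unfold refl; rewrite Ropp_involutive; ring.
Qed.

(** * Scattering data through the extended Jost solutions *)

Section Scattering.
Variables (q q' : R -> C).
Hypotheses (Hq : H22 q) (Dq : forall x, rd q x (q' x)).
Let p := pot q q'.
Variables (a b d c : R -> C -> C).
Hypotheses (Jl : jost_family q p a b) (Jr : jost_family (refl p) (refl q) d c).

(** The Wronskian of the first column of N^- and the second of N^+, taken at [x = 0], where the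
    exponentials are 1, and before the gauge transformation, whose determinant is 1. *)
Definition alpha0 (z : C) : C := (a 0 z * d 0 z - b 0 z * c 0 z)%C.

Lemma scattering_real (lam x : R) :
  ent (Njost m_infty q x lam) 0 0 = a x (RtoC lam) /\
  ent (Njost m_infty q x lam) 1 0 = (gauge q x * a x (RtoC lam) + b x (RtoC lam))%C /\
  ent (Njost p_infty q x lam) 0 1 = c (- x) (RtoC lam) /\
  ent (Njost p_infty q x lam) 1 1 = (gauge q x * c (- x)%R (RtoC lam) + d (- x)%R (RtoC lam))%C /\
  ent (Tmat q lam) 1 1 = alpha0 (RtoC lam).
Proof.
  assert (G := good_pot q q' Hq Dq); fold p in G.
  (* [is_jost] demands full matrices. The second column of [Psi^-] comes from exchanging the
     potentials, the first of [Psi^+] from reflecting them, both at the parameter [- lam]; this is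
     admissible because [lam] is real. *)
  destruct (good_jost p q (good_swap _ _ G)) as [d2 [c2 [J2 _]]].
  destruct (good_jost (refl q) (refl p) (good_refl _ _ G)) as [a4 [b4 [J4 _]]].
  assert (I0 : 0 <= Im (RtoC lam)) by (simpl; lra). assert (I1 : 0 <= Im (RtoC (- lam))) by (simpl; lra).
  assert (L1 := proj1 Jl _ I0); assert (L2 := J2 _ I1); assert (L3 := proj1 Jr _ I0); assert (L4 := J4 _ I1).
  destruct (H22_decay q Hq) as [Qm Qp].
  destruct (left_jost_tends _ _ _ _ _ L1) as [T1 [T2 _]]; destruct (left_jost_tends _ _ _ _ _ L2) as [T3 [T4 _]].
  destruct (left_jost_tends _ _ _ _ _ L3) as [_ [_ [T5 T6]]]; destruct (left_jost_tends _ _ _ _ _ L4) as [_ [_ [T7 T8]]].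
  destruct (right_jost q p _ _ _ L3) as [R1 R2]; destruct (right_jost p q _ _ _ L4) as [R3 R4].
  destruct L1 as [A1 [A2 _]], L2 as [B1 [B2 _]].
  assert (EE := eplus_eminus lam).
  assert (Pm := jost_build m_infty q q' lam _ _ (fun x => c2 x (RtoC (- lam))) (fun x => d2 x (RtoC (- lam))) Dq Qm A1 A2 B1
    ltac:(intros y; eapply rd_eq; [apply B2|rewrite RtoC_opp; ring]) T1 T2 T4 T3).
  assert (Pp := jost_build p_infty q q' lam (fun x => a4 (- x) (RtoC (- lam))) (fun x => b4 (- x) (RtoC (- lam))) _ _ Dq Qp
    R3 ltac:(intros y; eapply rd_eq; [apply R4|rewrite RtoC_opp; fold p; ring]) R1 R2 T7 T8 T6 T5).
  destruct (Njost_entries _ _ _ _ x Pm 0%nat ltac:(lia)) as [E1 _].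
  destruct (Njost_entries _ _ _ _ x Pm 1%nat ltac:(lia)) as [E2 _].
  destruct (Njost_entries _ _ _ _ x Pp 0%nat ltac:(lia)) as [_ E3].
  destruct (Njost_entries _ _ _ _ x Pp 1%nat ltac:(lia)) as [_ E4].
  split; [|split; [|split; [|split]]].
  - rewrite E1; change (a x (RtoC lam) * eminus lam x * eplus lam x = a x (RtoC lam))%C.
    transitivity (a x (RtoC lam) * (eplus lam x * eminus lam x))%C; [ring|rewrite EE; ring].
  - rewrite E2; change ((gauge q x * (a x (RtoC lam) * eminus lam x) + b x (RtoC lam) * eminus lam x) * eplus lam x = gauge q x * a x (RtoC lam) + b x (RtoC lam))%C.
    transitivity ((gauge q x * a x (RtoC lam) + b x (RtoC lam)) * (eplus lam x * eminus lam x))%C; [ring|rewrite EE; ring].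
  - rewrite E3; change (c (- x)%R (RtoC lam) * eplus lam x * eminus lam x = c (- x)%R (RtoC lam))%C.
    transitivity (c (- x)%R (RtoC lam) * (eplus lam x * eminus lam x))%C; [ring|rewrite EE; ring].
  - rewrite E4; change ((gauge q x * (c (- x)%R (RtoC lam) * eplus lam x) + d (- x)%R (RtoC lam) * eplus lam x) * eminus lam x = gauge q x * c (- x)%R (RtoC lam) + d (- x)%R (RtoC lam))%C.
    transitivity ((gauge q x * c (- x)%R (RtoC lam) + d (- x)%R (RtoC lam)) * (eplus lam x * eminus lam x))%C; [ring|rewrite EE; ring].
  - rewrite (Tmat_eq q lam _ _ Pm Pp 0).
    change ((a 0 (RtoC lam) * eminus lam 0) * (gauge q 0 * (c (- 0)%R (RtoC lam) * eplus lam 0) + d (- 0)%R (RtoC lam) * eplus lam 0) -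
      (gauge q 0 * (a 0 (RtoC lam) * eminus lam 0) + b 0 (RtoC lam) * eminus lam 0) * (c (- 0)%R (RtoC lam) * eplus lam 0) = alpha0 (RtoC lam))%C.
    unfold alpha0; rewrite Ropp_0.
    transitivity ((a 0 (RtoC lam) * d 0 (RtoC lam) - b 0 (RtoC lam) * c 0 (RtoC lam)) * (eplus lam 0 * eminus lam 0))%C; [ring|rewrite EE; ring].
Qed.

Lemma rel_cont_const S k : rel_cont S (fun _ => k).
Proof.
  intros z _ e He; exists 1; split; [lra|]; intros w _ _; replace (k - k)%C with (RtoC 0) by ring; rewrite Cmod_0; exact He.
Qed.

Lemma rel_cont_plus S f g : rel_cont S f -> rel_cont S g -> rel_cont S (fun z => f z + g z)%C.
Proof.
  intros Hf Hg z Sz e He.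
  destruct (Hf z Sz (e / 2) ltac:(lra)) as [d1 [D1 P1]]; destruct (Hg z Sz (e / 2) ltac:(lra)) as [d2 [D2 P2]].
  exists (Rmin d1 d2); split; [apply Rmin_pos; auto|]; intros w Sw Hw.
  specialize (P1 w Sw (Rlt_le_trans _ _ _ Hw (Rmin_l _ _))); specialize (P2 w Sw (Rlt_le_trans _ _ _ Hw (Rmin_r _ _))).
  replace (f w + g w - (f z + g z))%C with ((f w - f z) + (g w - g z))%C by ring.
  eapply Rle_lt_trans; [apply Cmod_triangle|lra].
Qed.

Lemma holo_const k : holo (fun _ => k).
Proof. intros z _; exists 0; apply cd_const. Qed.

Lemma holo_plus f g : holo f -> holo g -> holo (fun z => f z + g z)%C.
Proof.
  intros Hf Hg z Hz; destruct (Hf z Hz) as [l Hl]; destruct (Hg z Hz) as [m Hm]; exists (l + m)%C.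
  apply cd_plus; assumption.
Qed.

Lemma holo_mult f g : holo f -> holo g -> holo (fun z => f z * g z)%C.
Proof.
  intros Hf Hg z Hz; destruct (Hf z Hz) as [l Hl]; destruct (Hg z Hz) as [m Hm]; eexists; apply cd_mult; eassumption.
Qed.

Lemma alpha0_regular : rel_cont (fun z => 0 <= Im z) alpha0 /\ holo alpha0.
Proof.
  destruct Jl as [_ [H1 [C1 _]]]; destruct Jr as [_ [H2 [C2 _]]].
  assert (E : alpha0 = (fun z => a 0%R z * d 0%R z + RtoC (-1) * (b 0%R z * c 0%R z))%C).
  { apply functional_extensionality; intros z; unfold alpha0.
    apply C_ext; unfold Cminus, Cplus, Copp, Cmult, RtoC, Re, Im; simpl; ring. }
  rewrite E; split.
  - apply rel_cont_plus; apply rel_cont_mult; [apply C1|apply C2|apply rel_cont_const|].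
    apply rel_cont_mult; [apply C1|apply C2].
  - apply holo_plus; apply holo_mult; [apply H1|apply H2|apply holo_const|].
    apply holo_mult; [apply H1|apply H2].
Qed.

Theorem breve_alpha_eq z : 0 <= Im z -> breve_alpha q z = alpha0 z.
Proof.
  apply upper_ext_eq, is_upper_ext_iff; split; [|apply alpha0_regular].
  intros lam; symmetry; apply (scattering_real lam 0).
Qed.

Theorem Nminus_eq z x : 0 <= Im z -> Nminus_col1 q x 0 z = a x z /\
  Nminus_col1 q x 1 z = (gauge q x * a x z + b x z)%C.
Proof.
  destruct Jl as [_ [H1 [C1 _]]].
  intros Hz; split; revert z Hz; apply upper_ext_eq, is_upper_ext_iff.
  - split; [|split; [apply C1|apply H1]]; intros lam; symmetry; apply (scattering_real lam x).
  - split; [|split].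
    + intros lam; symmetry; apply (scattering_real lam x).
    + apply rel_cont_plus; [apply rel_cont_mult; [apply rel_cont_const|apply C1]|apply C1].
    + apply holo_plus; [apply holo_mult; [apply holo_const|apply H1]|apply H1].
Qed.

Theorem Nplus_eq z x : 0 <= Im z -> Nplus_col2 q x 0 z = c (- x) z /\
  Nplus_col2 q x 1 z = (gauge q x * c (- x)%R z + d (- x)%R z)%C.
Proof.
  destruct Jr as [_ [H1 [C1 _]]].
  intros Hz; split; revert z Hz; apply upper_ext_eq, is_upper_ext_iff.
  - split; [|split; [apply C1|apply H1]]; intros lam; symmetry; apply (scattering_real lam x).
  - split; [|split].
    + intros lam; symmetry; apply (scattering_real lam x).
    + apply rel_cont_plus; [apply rel_cont_mult; [apply rel_cont_const|apply C1]|apply C1].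
    + apply holo_plus; [apply holo_mult; [apply holo_const|apply H1]|apply H1].
Qed.

End Scattering.

(** * Perturbation of zeros *)

Lemma holo_lip f z : holo f -> 0 < Im z -> exists L d, 0 <= L /\ 0 < d /\
  forall w, Cmod (w - z) < d -> Cmod (f w - f z) <= L * Cmod (w - z).
Proof.
  intros H Hz; destruct (H z Hz) as [l Hl].
  destruct (proj1 (cd_eps f z l) Hl 1 Rlt_0_1) as [d [Hd P]].
  exists (Cmod l + 1), d; split; [generalize (Cmod_ge_0 l); lra|split; [exact Hd|]].
  intros w Hw; specialize (P w Hw).
  replace (f w - f z)%C with ((f w - f z - l * (w - z)) + l * (w - z))%C by ring.
  eapply Rle_trans; [apply Cmod_triangle|]; rewrite Cmod_mult; lra.
Qed.

Lemma holo_C_derive f z : holo f -> 0 < Im z -> cd f z (C_derive f z).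
Proof.
  intros H Hz; destruct (H z Hz) as [l Hl].
  rewrite (is_C_derive_unique f z l); [exact Hl|apply cd_is_derive, Hl].
Qed.

(* Contraction mapping for [z - f z / m]. *)
Lemma contraction_zero (f : C -> C) (lam m : C) (rho del : R) : m <> 0 -> 0 < rho ->
  (forall z w, Cmod (z - lam) < rho -> Cmod (w - lam) < rho ->
     Cmod (f z - f w - m * (z - w)) <= / 2 * Cmod m * Cmod (z - w)) ->
  Cmod (f lam) <= del -> 2 * del / Cmod m < rho ->
  exists zeta, Cmod (zeta - lam) <= 2 * del / Cmod m /\ f zeta = 0.
Proof.
  intros Hm Hrho HL Hf Hd.
  assert (M := proj1 (Cmod_gt_0 m) Hm).
  assert (d0 : 0 <= del) by (eapply Rle_trans; [apply Cmod_ge_0|exact Hf]).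
  set (s := del / Cmod m); assert (s0 : 0 <= s) by (apply Rdiv_le_0_compat; lra).
  replace (2 * del / Cmod m) with (2 * s) in * by (unfold s; field; lra).
  pose (g := fun z => (z - f z / m)%C).
  pose (u := fix u n := match n with O => lam | S k => g (u k) end).
  assert (P2 : forall n, 0 < (/ 2) ^ n) by (intros; apply pow_lt; lra).
  assert (Hg : forall z w, Cmod (z - lam) < rho -> Cmod (w - lam) < rho -> Cmod (g z - g w) <= / 2 * Cmod (z - w)).
  { intros z w Hz Hw; unfold g.
    replace (z - f z / m - (w - f w / m))%C with (- ((f z - f w - m * (z - w)) / m))%C by (field; exact Hm).
    rewrite Cmod_opp, Cmod_div by exact Hm.
    apply Rmult_le_reg_r with (Cmod m); [exact M|].
    unfold Rdiv; rewrite Rmult_assoc, Rinv_l, Rmult_1_r by lra. generalize (HL z w Hz Hw); lra. }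
  (* The first step has length at most [s] and the following ones halve, so the iterates stay within
     [2 s < rho] of [lam]. *)
  assert (U : forall n, Cmod (u n - lam) <= 2 * s * (1 - (/ 2) ^ n) /\ Cmod (u (S n) - u n) <= s * (/ 2) ^ n).
  { assert (I0 : Cmod (u 1%nat - u 0%nat) <= s).
    { simpl; unfold g; replace (lam - f lam / m - lam)%C with (- (f lam / m))%C by ring.
      rewrite Cmod_opp, Cmod_div by exact Hm; unfold s; apply Rmult_le_compat_r; [left; apply Rinv_0_lt_compat, M|exact Hf]. }
    induction n as [|n [IH1 IH2]].
    - split; [simpl u; replace (lam - lam)%C with (RtoC 0) by ring; rewrite Cmod_0; simpl; lra|].
      replace (s * (/ 2) ^ 0) with s by (simpl; ring); exact I0.
    - assert (E : (/ 2) ^ S n = / 2 * (/ 2) ^ n) by reflexivity.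
      assert (A1 : Cmod (u (S n) - lam) <= 2 * s * (1 - (/ 2) ^ S n)).
      { generalize (Cmod_le_via (u (S n)) (u n) lam); rewrite E; lra. }
      split; [exact A1|].
      assert (B : forall k, 2 * s * (1 - (/ 2) ^ k) < rho) by (intros k; generalize (P2 k); nra).
      change (Cmod (g (u (S n)) - g (u n)) <= s * (/ 2) ^ S n).
      eapply Rle_trans; [apply Hg; [eapply Rle_lt_trans; [exact A1|apply B]|eapply Rle_lt_trans; [exact IH1|apply B]]|].
      rewrite E; lra. }
  assert (Cau : forall n k, Cmod (u n - u (n + k)%nat) <= 2 * s * ((/ 2) ^ n - (/ 2) ^ (n + k))).
  { intros n; induction k as [|k IH].
    - rewrite Nat.add_0_r; replace (u n - u n)%C with (RtoC 0) by ring; rewrite Cmod_0; lra.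
    - replace (n + S k)%nat with (S (n + k)) by lia.
      destruct (U (n + k)%nat) as [_ Q]; rewrite Cmod_minus_sym in Q.
      assert (E : (/ 2) ^ S (n + k) = / 2 * (/ 2) ^ (n + k)) by reflexivity.
      generalize (Cmod_le_via (u n) (u (n + k)%nat) (u (S (n + k)))); rewrite E; lra. }
  destruct (Cauchy_C u (fun n => 2 * s * (/ 2) ^ n)) as [zeta Hz].
  { intros n k Hnk; replace k with (n + (k - n))%nat by lia; eapply Rle_trans; [apply Cau|].
    assert (Q := P2 (n + (k - n))%nat). assert (0 <= s * (/ 2) ^ (n + (k - n))) by (apply Rmult_le_pos; lra). lra. }
  { apply is_lim_seq_geom_scal. }
  exists zeta.
  assert (Z0 : Cmod (zeta - lam) <= 2 * s).
  { rewrite Cmod_minus_sym; generalize (Hz 0%nat); simpl; lra. }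
  split; [exact Z0|].
  apply Cmod_eq_0, Rle_antisym; [|apply Cmod_ge_0]; apply le_epsilon; intros e He; rewrite Rplus_0_l.
  destruct (geom_small (4 * Cmod m * s) e He) as [n Hn]; specialize (Hn n (le_n _)).
  assert (Un : Cmod (u n - lam) < rho).
  { destruct (U n) as [Q _]; eapply Rle_lt_trans; [exact Q|]; generalize (P2 n); nra. }
  assert (Q1 := HL zeta (u n) ltac:(lra) Un).
  assert (Q2 : Cmod (f (u n)) <= Cmod m * (s * (/ 2) ^ n)).
  { destruct (U n) as [_ Q].
    replace (f (u n)) with (m * - (g (u n) - u n))%C by (unfold g; field; exact Hm).
    rewrite Cmod_mult, Cmod_opp; apply Rmult_le_compat_l; [lra|exact Q]. }
  assert (Q3 := Hz n); rewrite Cmod_minus_sym in Q3.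
  replace (f zeta) with ((f zeta - f (u n) - m * (zeta - u n)) + m * (zeta - u n) + f (u n))%C by ring.
  eapply Rle_trans; [apply Cmod_triangle|].
  assert (Cmod (f zeta - f (u n) - m * (zeta - u n) + m * (zeta - u n)) <= / 2 * Cmod m * Cmod (zeta - u n) + Cmod m * Cmod (zeta - u n)).
  { eapply Rle_trans; [apply Cmod_triangle|]; rewrite Cmod_mult; lra. }
  assert (Cmod m * Cmod (zeta - u n) <= Cmod m * (2 * s * (/ 2) ^ n)) by (apply Rmult_le_compat_l; lra). lra.
Qed.

(** The contraction argument is applied with the slope [m] of [f0]; Cauchy's estimate shows that the
    slope of [f] stays within [|m| / 2] of it. The radius may still be shrunk below [rho0], as
    separating several zeros requires. *)
Lemma local_zero f0 lam : holo f0 -> 0 < Im lam -> f0 lam = 0 -> C_derive f0 lam <> 0 ->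
  exists rho0, 0 < rho0 /\ rho0 <= Im lam / 2 /\ forall rho, 0 < rho -> rho <= rho0 ->
  exists eta K, 0 < eta /\ 0 <= K /\ forall f del, holo f -> del <= eta ->
    (forall z, 0 < Im z -> Cmod (f z - f0 z) <= del) ->
    exists zeta, Cmod (zeta - lam) <= K * del /\ Cmod (zeta - lam) < rho /\ f zeta = 0 /\
      C_derive f zeta <> 0 /\ Cmod (C_derive f zeta - C_derive f0 lam) <= K * del /\
      (forall z, Cmod (z - lam) < rho -> f z = 0 -> z = zeta).
Proof.
  intros H0 Hl Z0 Hm; set (m := C_derive f0 lam) in *.
  assert (M := proj1 (Cmod_gt_0 m) Hm).
  assert (HD0 : forall z, 0 < Im z -> cd f0 z (C_derive f0 z)) by (intros; apply holo_C_derive; assumption).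
  assert (HhD := holo_derivative f0 _ H0 HD0).
  destruct (holo_lip _ lam HhD Hl) as [L [d [L0 [Hd HL]]]]; fold m in HL.
  (* The three bounds keep the disc inside the region where the derivative of [f0] is Lipschitz,
     away from the real axis, and where that derivative varies by at most [|m| / 4]. *)
  set (rho0 := Rmin (d / 2) (Rmin (Im lam / 2) (Cmod m / (4 * (L + 1))))).
  assert (R0 : 0 < rho0) by (repeat apply Rmin_pos; try lra; apply Rdiv_lt_0_compat; lra).
  assert (R1 : rho0 <= d / 2) by apply Rmin_l.
  assert (R2 : rho0 <= Im lam / 2) by (eapply Rle_trans; [apply Rmin_r|apply Rmin_l]).
  assert (R3 : L * rho0 <= Cmod m / 4).
  { assert (R3 : rho0 <= Cmod m / (4 * (L + 1))) by (eapply Rle_trans; [apply Rmin_r|apply Rmin_r]).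
    apply Rle_trans with ((L + 1) * (Cmod m / (4 * (L + 1)))); [|right; field; lra].
    apply Rmult_le_compat; lra. }
  exists rho0; split; [exact R0|split; [exact R2|]]; intros rho Hr Hr0.
  set (I4 := Im lam / 4); assert (HI : 0 < I4) by (unfold I4; lra).
  (* By Cauchy's estimate on circles of radius [I4], the first bound makes the derivatives of [f]
     and [f0] differ by at most [|m| / 4]; the second makes the displacement [2 del / |m|] at most
     [rho / 2]. *)
  set (eta := Rmin (Cmod m * I4 / 4) (Cmod m * rho / 4)).
  assert (E0 : 0 < eta) by (apply Rmin_pos; apply Rdiv_lt_0_compat; try lra; apply Rmult_lt_0_compat; lra).
  assert (Ei : 0 < / I4) by (apply Rinv_0_lt_compat, HI).
  (* The displacement of the zero, then the change of the derivative: from [f0] to [f] at the new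
     zero, and of the derivative of [f0] along the displacement. *)
  exists eta, (2 / Cmod m + (/ I4 + L * (2 / Cmod m))).
  assert (K1 : 0 < 2 / Cmod m) by (apply Rdiv_lt_0_compat; lra).
  assert (K2 : 0 <= L * (2 / Cmod m)) by (apply Rmult_le_pos; lra).
  split; [exact E0|split; [lra|]].
  intros f del Hf Hdel Hff.
  assert (del0 : 0 <= del) by (eapply Rle_trans; [apply Cmod_ge_0|apply (Hff lam Hl)]).
  assert (E1 : del <= Cmod m * I4 / 4) by (eapply Rle_trans; [exact Hdel|apply Rmin_l]).
  assert (E2 : del <= Cmod m * rho / 4) by (eapply Rle_trans; [exact Hdel|apply Rmin_r]).
  assert (HD : forall z, 0 < Im z -> cd f z (C_derive f z)) by (intros; apply holo_C_derive; assumption).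
  assert (Up : forall z, Cmod (z - lam) < rho -> 2 * I4 <= Im z).
  { intros z Hz; generalize (im_le_Cmod (z - lam)); rewrite Im_Cminus; intros B.
    assert (B' : Rabs (Im z - Im lam) < Im lam / 2) by lra; apply Rabs_def2 in B'; unfold I4; lra. }
  assert (DD : forall z, Cmod (z - lam) < rho -> Cmod (C_derive f z - C_derive f0 z) <= / I4 * del).
  { intros z Hz; assert (Uz := Up z Hz).
    assert (Hh : holo (fun w => f w - f0 w)%C).
    { intros w Hw; eexists; apply cd_minus; [apply HD, Hw|apply HD0, Hw]. }
    rewrite Rmult_comm; apply (Cauchy_estimate (fun w => f w - f0 w)%C z); [exact Hh| |lra|].
    - apply cd_minus; [apply HD|apply HD0]; lra.
    - intros w Hw; apply Hff, (upper_open z); lra. }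
  assert (Dm : forall z, Cmod (z - lam) < rho -> Cmod (C_derive f z - m) <= / 2 * Cmod m).
  { intros z Hz; eapply Rle_trans; [apply (Cmod_le_via _ (C_derive f0 z))|].
    assert (T1 := DD z Hz). assert (T2 := HL z ltac:(lra)).
    assert (/ I4 * del <= Cmod m / 4).
    { apply Rmult_le_reg_l with I4; [exact HI|]; rewrite <- Rmult_assoc, Rinv_r, Rmult_1_l by lra; lra. }
    assert (L * Cmod (z - lam) <= L * rho0) by (apply Rmult_le_compat_l; lra). lra. }
  assert (Lin : forall z w, Cmod (z - lam) < rho -> Cmod (w - lam) < rho ->
     Cmod (f z - f w - m * (z - w)) <= / 2 * Cmod m * Cmod (z - w)).
  { intros z w Hz Hw.
    replace (f z - f w - m * (z - w))%C with ((f z - m * z) - (f w - m * w))%C by ring.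
    assert (Seg : forall t, 0 <= t <= 1 -> Cmod (w + RtoC t * (z - w) - lam) < rho).
    { intros t Ht.
      replace (w + RtoC t * (z - w) - lam)%C with (RtoC (1 - t) * (w - lam) + RtoC t * (z - lam))%C.
      - eapply Rle_lt_trans; [apply Cmod_triangle|]; rewrite !Cmod_mult, !Cmod_R, !Rabs_pos_eq by lra.
        destruct (Req_dec t 0) as [E|E]; [subst t; lra|].
        assert (t * Cmod (z - lam) < t * rho) by (apply Rmult_lt_compat_l; lra).
        assert ((1 - t) * Cmod (w - lam) <= (1 - t) * rho) by (apply Rmult_le_compat_l; lra). lra.
      - rewrite RtoC_minus; ring. }
    apply (cd_mean_value (fun u => f u - m * u)%C (fun u => C_derive f u - m)%C).
    - intros t Ht; eapply cd_eq.
      + apply cd_minus; [apply HD; generalize (Up _ (Seg t Ht)); lra|].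
        apply cd_mult; [apply cd_const|apply cd_id].
      + cbv beta; ring.
    - intros t Ht; apply Dm, Seg, Ht. }
  assert (Small : 2 * del / Cmod m < rho).
  { apply Rmult_lt_reg_r with (Cmod m); [exact M|]; unfold Rdiv; rewrite Rmult_assoc, Rinv_l, Rmult_1_r by lra.
    assert (0 < Cmod m * rho) by (apply Rmult_lt_0_compat; lra). lra. }
  destruct (contraction_zero f lam m rho del Hm Hr Lin) as [zeta [Q1 Q2]]; [|exact Small|].
  { assert (T := Hff lam Hl); rewrite Z0 in T; replace (f lam - 0)%C with (f lam) in T by ring; exact T. }
  assert (Q3 : Cmod (zeta - lam) < rho) by lra.
  assert (Q1' : Cmod (zeta - lam) <= 2 / Cmod m * del) by (unfold Rdiv in *; lra).
  assert (Ei2 : 0 <= / I4 * del) by (apply Rmult_le_pos; lra).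
  assert (K3 : 0 <= L * (2 / Cmod m) * del) by (apply Rmult_le_pos; lra).
  assert (K4 : 0 <= 2 / Cmod m * del) by (apply Rmult_le_pos; lra).
  exists zeta; split; [lra|split; [exact Q3|split; [exact Q2|split; [|split]]]].
  - intros E; assert (T := Dm zeta Q3); rewrite E in T.
    replace (0 - m)%C with (- m)%C in T by ring; rewrite Cmod_opp in T; lra.
  - eapply Rle_trans; [apply (Cmod_le_via _ (C_derive f0 zeta))|].
    assert (T1 := DD zeta Q3); assert (T2 := HL zeta ltac:(lra)).
    assert (L * Cmod (zeta - lam) <= L * (2 / Cmod m * del)) by (apply Rmult_le_compat_l; lra). lra.
  - intros z Hz Hfz; assert (T := Lin z zeta Hz Q3); rewrite Hfz, Q2 in T.
    replace (0 - 0 - m * (z - zeta))%C with (- (m * (z - zeta)))%C in T by ring.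
    rewrite Cmod_opp, Cmod_mult in T.
    assert (E : Cmod (z - zeta) <= 0).
    { apply Rnot_lt_le; intros Pos. assert (0 < Cmod m * Cmod (z - zeta)) by (apply Rmult_lt_0_compat; lra). lra. }
    assert (E' : (z - zeta)%C = 0) by (apply Cmod_eq_0, Rle_antisym; [exact E|apply Cmod_ge_0]).
    replace z with (z - zeta + zeta)%C by ring; rewrite E'; ring.
Qed.

(** The difference of the quotients is [(u - u0) - (u0 / v0) (v - v0)] divided by [v], and [|v|]
    stays above half of [|v0|]. *)
Lemma quotient_lip (u v u0 v0 : C) (k r : R) : v0 <> 0 -> k * r <= Cmod v0 / 2 ->
  Cmod (u - u0) <= k * r -> Cmod (v - v0) <= k * r ->
  Cmod v0 / 2 <= Cmod v /\ Cmod (u / v - u0 / v0) <= 2 / Cmod v0 * (1 + Cmod (u0 / v0)) * k * r.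
Proof.
  intros H0 Hk Hu Hv.
  assert (V0 := proj1 (Cmod_gt_0 v0) H0).
  assert (Bv : Cmod v0 / 2 <= Cmod v) by (generalize (Cmod_triangle_inv v0 v); rewrite Cmod_minus_sym; lra).
  assert (Nv : v <> 0) by (apply Cmod_gt_0; lra).
  split; [exact Bv|].
  replace (u / v - u0 / v0)%C with (((u - u0) - u0 / v0 * (v - v0)) / v)%C by (field; auto).
  rewrite Cmod_div by exact Nv.
  assert (T0 := Cmod_ge_0 (u0 / v0)); set (t := Cmod (u0 / v0)) in *.
  assert (B : Cmod (u - u0 - u0 / v0 * (v - v0)) <= (1 + t) * (k * r)).
  { eapply Rle_trans; [apply Cmod_minus_triangle|]; rewrite Cmod_mult; fold t.
    assert (t * Cmod (v - v0) <= t * (k * r)) by (apply Rmult_le_compat_l; assumption). lra. }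
  assert (kr : 0 <= k * r) by (eapply Rle_trans; [apply Cmod_ge_0|exact Hu]).
  assert (P : 0 <= (1 + t) * (k * r)) by (apply Rmult_le_pos; lra).
  apply Rmult_le_reg_r with (Cmod v); [lra|].
  unfold Rdiv at 1; rewrite Rmult_assoc, Rinv_l, Rmult_1_r by lra.
  apply Rle_trans with (2 / Cmod v0 * (1 + t) * k * r * (Cmod v0 / 2)).
  - replace (2 / Cmod v0 * (1 + t) * k * r * (Cmod v0 / 2)) with ((1 + t) * (k * r)) by (field; lra); exact B.
  - apply Rmult_le_compat_l; [|exact Bv].
    replace (2 / Cmod v0 * (1 + t) * k * r) with (2 / Cmod v0 * ((1 + t) * (k * r))) by (field; lra).
    apply Rmult_le_pos; [left; apply Rdiv_lt_0_compat; lra|exact P].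
Qed.

(** Far out [f0] is within 1/2 of 1. The rest is a compact box reaching down to the real axis, where
    the claim is void near the zeros and follows from continuity elsewhere. *)
Lemma zero_free_bound f0 N (lam : nat -> C) rho : rel_cont (fun z => 0 <= Im z) f0 ->
  (forall e, 0 < e -> exists R0, forall z, 0 <= Im z -> R0 <= Cmod z -> Cmod (f0 z - 1) <= e) ->
  (forall z, 0 <= Im z -> f0 z = 0 -> exists j, (j < N)%nat /\ z = lam j) -> 0 < rho ->
  exists m, 0 < m /\ forall z, 0 <= Im z -> (forall j, (j < N)%nat -> rho <= Cmod (z - lam j)) -> m <= Cmod (f0 z).
Proof.
  intros Hc HI HZ Hr.
  destruct (HI (/ 2) ltac:(lra)) as [R0 HR].
  set (R1 := Rabs R0 + 1).
  assert (P1 : 0 < R1) by (unfold R1; generalize (Rabs_pos R0); lra).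
  destruct (box_compact (- R1) R1 0 R1 (fun e z => (forall j, (j < N)%nat -> rho <= Cmod (z - lam j)) -> e <= Cmod (f0 z)))
    as [m [Hm P]].
  - intros e e' z Le Q Hz; specialize (Q Hz); lra.
  - intros z [_ [Hz _]].
    destruct (classic (exists j, (j < N)%nat /\ Cmod (z - lam j) < rho)) as [[j [Hj Lj]]|Nj].
    + exists (rho - Cmod (z - lam j)); split; [lra|]; intros w _ Hw Q; exfalso.
      generalize (Q j Hj) (Cmod_le_via w z (lam j)); lra.
    + assert (Nz : f0 z <> 0).
      { intros E; destruct (HZ z Hz E) as [j [Hj Ej]]; apply Nj; exists j; split; [exact Hj|].
        rewrite Ej; replace (lam j - lam j)%C with (RtoC 0) by ring; rewrite Cmod_0; exact Hr. }
      assert (M := proj1 (Cmod_gt_0 _) Nz).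
      destruct (Hc z Hz (Cmod (f0 z) / 2) ltac:(lra)) as [d [Hd Q]].
      exists (Rmin d (Cmod (f0 z) / 2)); split; [apply Rmin_pos; lra|]; intros w [_ [Hw _]] Dw _.
      specialize (Q w Hw (Rlt_le_trans _ _ _ Dw (Rmin_l _ _))).
      generalize (Cmod_triangle_inv (f0 z) (f0 w)) (Rmin_r d (Cmod (f0 z) / 2)); rewrite Cmod_minus_sym; lra.
  - exists (Rmin m (/ 2)); split; [apply Rmin_pos; lra|]; intros z Hz Q.
    destruct (Rle_dec R0 (Cmod z)) as [L|L].
    + generalize (HR z Hz L) (Cmod_triangle_inv 1 (f0 z)) (Rmin_r m (/ 2)); rewrite Cmod_1, (Cmod_minus_sym 1); lra.
    + eapply Rle_trans; [apply Rmin_l|]; apply P; [|exact Q].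
      assert (Lz : Cmod z <= R1) by (unfold R1; generalize (Rle_abs R0); lra).
      generalize (re_le_Cmod z) (im_le_Cmod z); intros A B.
      assert (A' : Rabs (Re z) <= R1) by lra; assert (B' : Rabs (Im z) <= R1) by lra.
      apply Rabs_le_between in A'; apply Rabs_le_between in B'; split; lra.
Qed.

(** * Dependence of the scattering data on the potential *)

(** In the closed half-plane [(a, b)] at [x] and [(c, d)] at [- x] are the first column of N^- and
    the second of N^+ before the gauge transformation. *)
Definition jost_data (q : R -> C) (a b d c : R -> C -> C) : Prop :=
  exists q', (forall x, rd q x (q' x)) /\ jost_family q (pot q q') a b /\
    jost_family (refl (pot q q')) (refl q) d c.

Lemma jost_data_exists q : H22 q -> exists a b d c, jost_data q a b d c.
Proof.
  intros H; destruct (H22_derivative q H) as [q' [D _]].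
  assert (G := good_pot q q' H D).
  destruct (good_jost _ _ G) as [a [b J1]].
  destruct (good_jost _ _ (good_refl _ _ (good_swap _ _ G))) as [d [c J2]].
  exists a, b, d, c, q'; auto.
Qed.

Lemma near_comm e q p q1 p1 : near e q p q1 p1 -> near e q1 p1 q p.
Proof.
  intros [A B]; split.
  - intros x; rewrite (Cmod_minus_sym (q1 x)), (Cmod_minus_sym (p1 x)); apply A.
  - replace (dist2 q1 p1 q p) with (dist2 q p q1 p1); [exact B|].
    apply functional_extensionality; intros x; unfold dist2.
    rewrite (Cmod_minus_sym (q x)), (Cmod_minus_sym (p x)); reflexivity.
Qed.

Lemma jost_data_lip q0 a0 b0 d0 c0 : H22 q0 -> jost_data q0 a0 b0 d0 c0 -> exists K, 0 <= K /\
  forall q a b d c, H22 q -> H22norm (fsub q q0) <= 1 -> jost_data q a b d c ->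
  forall x z, 0 <= Im z ->
    (Cmod (a x z - a0 x z) <= K * H22norm (fsub q q0) /\ Cmod (b x z - b0 x z) <= K * H22norm (fsub q q0) /\
     Cmod (d x z - d0 x z) <= K * H22norm (fsub q q0) /\ Cmod (c x z - c0 x z) <= K * H22norm (fsub q q0)) /\
    (Cmod (a x z) <= K /\ Cmod (b x z) <= K /\ Cmod (d x z) <= K /\ Cmod (c x z) <= K) /\
    (Cmod (a0 x z) <= K /\ Cmod (b0 x z) <= K /\ Cmod (d0 x z) <= K /\ Cmod (c0 x z) <= K).
Proof.
  intros H0 [q0' [D0 [J0 J0']]].
  destruct (good_pot q0 q0' H0 D0) as [Cq0 [Cp0 [[K0 HK0] _]]].
  (* [B] bounds [q0] and every [q] in the unit ball around it. In [kap], 10 is the constant of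
     [H22_near] and [2 + B^2] that of [near_pot]. *)
  set (B := 10 * H22norm q0 + 10); set (kap := (2 + B ^ 2) * 10).
  assert (N0 := H22norm_pos q0 H0).
  assert (B0 : 0 <= B) by (unfold B; lra).
  assert (B2 := pow2_ge_0 B).
  assert (k0 : 0 <= kap) by (unfold kap; lra).
  set (K := K0 + kap); set (E := exp K); assert (E0 : 0 < E) by apply exp_pos.
  exists (E * (E * kap) + E).
  assert (P1 : 0 <= E * (E * kap)) by (repeat apply Rmult_le_pos; lra).
  split; [lra|].
  intros q a b d c H HN [q' [D [J J']]] x z Hz.
  set (r := H22norm (fsub q q0)) in *.
  assert (r0 : 0 <= r) by (apply H22norm_pos, H22_fsub; assumption).
  assert (CN := H22_near q q' q0 q0' H H0 D D0); fold r in CN.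
  assert (Cq := rd_contC _ _ D).
  assert (Cd : forall u u', H22 u -> (forall x, rd u x (u' x)) -> contC u').
  { intros u u' Hu Du; destruct (H22_derivative u Hu) as [u1 [D1 C1]].
    replace u' with u1; [exact C1|apply functional_extensionality; intros y; eapply rd_unique; [apply D1|apply Du]]. }
  assert (Cq' := Cd q q' H D); assert (Cq0' := Cd q0 q0' H0 D0).
  assert (Cp := contC_pot q q' Cq Cq').
  assert (Bq0 : forall y, Cmod (q0 y) <= 10 * H22norm q0).
  { intros y; destruct (H22_bound q0 q0' H0 D0) as [Q _]; destruct (Q y) as [Q1 _].
    replace (q0 y - 0)%C with (q0 y) in Q1 by ring; exact Q1. }
  assert (Nr : near (kap * r) q (pot q q') q0 (pot q0 q0')).
  { replace (kap * r) with ((2 + B ^ 2) * (10 * r)) by (unfold kap; ring).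
    apply near_pot; auto; intros y; specialize (Bq0 y); split; [|unfold B; lra].
    destruct CN as [Q _]; destruct (Q y) as [Q1 _].
    generalize (Cmod_triangle_inv (q y) (q0 y)); unfold B; lra. }
  assert (kr : kap * r <= kap) by nra.
  assert (SK0 : L1le (size2 q0 (pot q0 q0')) K).
  { intros u v Huv; generalize (HK0 u v Huv); unfold K; lra. }
  assert (SK : L1le (size2 q (pot q q')) K).
  { intros u v Huv; generalize (L1le_near q0 (pot q0 q0') q (pot q q') K0 (kap * r) Cq0 Cp0 Cq Cp HK0
      (proj2 (near_comm _ _ _ _ _ Nr)) u v Huv); unfold K; lra. }
  assert (RS : forall f g, contC f -> contC g -> L1le (size2 f g) K -> L1le (size2 (refl g) (refl f)) K).
  { intros f g Cf Cg S; replace (size2 (refl g) (refl f)) with (fun y => size2 f g (- y)).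
    - apply L1le_flip; [apply contR_size2; assumption|exact S].
    - apply functional_extensionality; intros y; rewrite size2_refl, size2_sym; reflexivity. }
  assert (Nr' := near_refl _ _ _ _ _ Cp Cq Cp0 Cq0 (near_sym2 _ _ _ _ _ Nr)).
  assert (Crq := contC_refl q Cq); assert (Crp := contC_refl _ Cp);
  assert (Crq0 := contC_refl q0 Cq0); assert (Crp0 := contC_refl _ Cp0).
  assert (L1 := left_jost_lip _ _ _ _ z _ _ _ _ K (kap * r) Hz Cq Cp Cq0 Cp0 SK SK0 (proj2 Nr) (proj1 J z Hz) (proj1 J0 z Hz) x).
  assert (L2 := left_jost_lip _ _ _ _ z _ _ _ _ K (kap * r) Hz Crp Crq Crp0 Crq0 (RS _ _ Cq Cp SK) (RS _ _ Cq0 Cp0 SK0)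
     (proj2 Nr') (proj1 J' z Hz) (proj1 J0' z Hz) x).
  assert (U1 := left_jost_bound _ _ z _ _ K Hz Cq Cp SK (proj1 J z Hz) x).
  assert (U2 := left_jost_bound _ _ z _ _ K Hz Crp Crq (RS _ _ Cq Cp SK) (proj1 J' z Hz) x).
  assert (V1 := left_jost_bound _ _ z _ _ K Hz Cq0 Cp0 SK0 (proj1 J0 z Hz) x).
  assert (V2 := left_jost_bound _ _ z _ _ K Hz Crp0 Crq0 (RS _ _ Cq0 Cp0 SK0) (proj1 J0' z Hz) x).
  cbv beta in L1, L2, U1, U2, V1, V2; fold E in L1, L2, U1, U2, V1, V2.
  assert (Er : 0 <= E * r) by (apply Rmult_le_pos; lra).
  replace (E * (E * (kap * r))) with (E * (E * kap) * r) in * by ring.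
  repeat split; lra.
Qed.

Lemma alpha0_lip (a b d c a0 b0 d0 c0 : R -> C -> C) z K r : 0 <= K ->
  Cmod (a 0 z - a0 0 z) <= K * r -> Cmod (b 0 z - b0 0 z) <= K * r ->
  Cmod (d 0 z - d0 0 z) <= K * r -> Cmod (c 0 z - c0 0 z) <= K * r ->
  Cmod (d 0 z) <= K -> Cmod (c 0 z) <= K -> Cmod (a0 0 z) <= K -> Cmod (b0 0 z) <= K ->
  Cmod (alpha0 a b d c z - alpha0 a0 b0 d0 c0 z) <= 4 * K * K * r.
Proof.
  intros K0 A B D E Bd Bc Ba Bb; unfold alpha0.
  replace (a 0%R z * d 0%R z - b 0%R z * c 0%R z - (a0 0%R z * d0 0%R z - b0 0%R z * c0 0%R z))%C with
    (((a 0%R z - a0 0%R z) * d 0%R z + a0 0%R z * (d 0%R z - d0 0%R z)) -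
     ((b 0%R z - b0 0%R z) * c 0%R z + b0 0%R z * (c 0%R z - c0 0%R z)))%C by ring.
  eapply Rle_trans; [apply Cmod_minus_triangle|].
  assert (P : forall u v x y, Cmod u <= x -> Cmod v <= y -> Cmod (u * v) <= x * y).
  { intros u v x y Hu Hv; rewrite Cmod_mult; apply Rmult_le_compat; auto; apply Cmod_ge_0. }
  generalize (Cmod_triangle ((a 0%R z - a0 0%R z) * d 0%R z) (a0 0%R z * (d 0%R z - d0 0%R z)))
    (Cmod_triangle ((b 0%R z - b0 0%R z) * c 0%R z) (b0 0%R z * (c 0%R z - c0 0%R z)))
    (P _ _ _ _ A Bd) (P _ _ _ _ Ba D) (P _ _ _ _ B Bc) (P _ _ _ _ Bb E); lra.
Qed.

Lemma alpha0_infinity q a b d c : jost_data q a b d c ->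
  forall e, 0 < e -> exists R0, forall z, 0 <= Im z -> R0 <= Cmod z -> Cmod (alpha0 a b d c z - 1) <= e.
Proof.
  intros [q' [D [[_ [_ [_ A]]] [_ [_ [_ A']]]]]] e He.
  set (e' := Rmin 1 (e / 4)); assert (He' : 0 < e') by (apply Rmin_pos; lra).
  assert (E1 : e' <= 1) by apply Rmin_l. assert (E2 : e' <= e / 4) by apply Rmin_r.
  destruct (A 0 e' He') as [R1 H1]; destruct (A' 0 e' He') as [R2 H2].
  exists (Rmax R1 R2); intros z Hz Hr.
  destruct (H1 z Hz) as [Ba Bb]; [eapply Rle_trans; [apply Rmax_l|exact Hr]|].
  destruct (H2 z Hz) as [Bd Bc]; [eapply Rle_trans; [apply Rmax_r|exact Hr]|].
  unfold alpha0.
  replace (a 0%R z * d 0%R z - b 0%R z * c 0%R z - 1)%C with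
    ((a 0%R z - 1) * (d 0%R z - 1) + (a 0%R z - 1) + (d 0%R z - 1) - b 0%R z * c 0%R z)%C by ring.
  eapply Rle_trans; [apply Cmod_minus_triangle|].
  assert (P : forall u v, Cmod u <= e' -> Cmod v <= e' -> Cmod (u * v) <= e').
  { intros u v Hu Hv; rewrite Cmod_mult; generalize (Cmod_ge_0 u) (Cmod_ge_0 v); nra. }
  generalize (Cmod_triangle ((a 0%R z - 1) * (d 0%R z - 1) + (a 0%R z - 1)) (d 0%R z - 1))
    (Cmod_triangle ((a 0%R z - 1) * (d 0%R z - 1)) (a 0%R z - 1)) (P _ _ Ba Bd) (P _ _ Bb Bc); lra.
Qed.

Lemma zero_of_bound (w : C) : Cmod w <= 0 -> w = 0.
Proof. intros H; apply Cmod_eq_0, Rle_antisym; [exact H|apply Cmod_ge_0]. Qed.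

(* To the left of [0], reflect and multiply by [e^{2 i z x}] so that Gronwall applies again. *)
Lemma system_unique q p z a b : 0 <= Im z -> contC q -> contC p ->
  (forall x, rd a x (q x * b x)%C) -> (forall x, rd b x (RtoC 2 * Ci * z * b x + p x * a x)%C) ->
  a 0 = 0 -> b 0 = 0 -> forall x, a x = 0 /\ b x = 0.
Proof.
  intros Hz Cq Cp Ha Hb Za Zb.
  assert (Fwd : forall q p a b, contC q -> contC p ->
    (forall x, rd a x (q x * b x)%C) -> (forall x, rd b x (RtoC 2 * Ci * z * b x + p x * a x)%C) ->
    a 0 = 0 -> b 0 = 0 -> forall x, 0 <= x -> a x = 0 /\ b x = 0).
  { clear - Hz; intros q p a b Cq Cp Ha Hb Za Zb x Hx.
    destruct (gronwall z q p (fun _ => RtoC 0) (fun _ => RtoC 0) a b 0 x (RInt (fun t => Cmod (q t) + Cmod (p t)) 0 x) 0)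
      as [G1 G2]; auto; try apply contC_const; try lra.
    - intros t; eapply rd_eq; [apply Ha|ring].
    - intros t; eapply rd_eq; [apply Hb|ring].
    - rewrite (RInt_ext _ (fun _ => 0)) by (intros; rewrite Cmod_0; apply Rplus_0_l).
      rewrite (RInt_const (V := R_CompleteNormedModule)); unfold scal; simpl; unfold mult; simpl; lra.
    - rewrite Za, Zb, Cmod_0, Rplus_0_l, Rplus_0_l, Rmult_0_r in G1, G2; split; apply zero_of_bound; assumption. }
  intros x; destruct (Rle_dec 0 x) as [L|L]; [apply (Fwd q p); assumption|].
  pose (E := fun y => Cexp (RtoC 2 * Ci * z * RtoC y)%C).
  assert (DE : forall y, rd E y (RtoC 2 * Ci * z * E y)%C) by (intros y; apply rd_Cexp).
  destruct (Fwd (refl p) (refl q) (fun y => b (- y)%R * E y)%C (fun y => a (- y)%R * E y)%C) with (x := - x) as [Q1 Q2].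
  - apply contC_refl, Cp.
  - apply contC_refl, Cq.
  - intros y; eapply rd_eq; [apply rd_mult; [apply rd_flip, Hb|apply DE]|unfold refl; ring].
  - intros y; eapply rd_eq; [apply rd_mult; [apply rd_flip, Ha|apply DE]|unfold refl; ring].
  - rewrite Ropp_0, Zb; ring.
  - rewrite Ropp_0, Za; ring.
  - lra.
  - cbv beta in Q1, Q2; rewrite Ropp_involutive in Q1, Q2.
    assert (NE := Cexp_neq_0 (RtoC 2 * Ci * z * RtoC (- x))%C); fold (E (- x)) in NE.
    split.
    + replace (a x) with (a x * E (- x)%R / E (- x)%R)%C by (field; exact NE); rewrite Q2; field; exact NE.
    + replace (b x) with (b x * E (- x)%R / E (- x)%R)%C by (field; exact NE); rewrite Q1; field; exact NE.
Qed.

Section NormingConstant.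
Variables (q : R -> C) (a b d c : R -> C -> C) (zeta : C).
Hypotheses (Hq : H22 q) (J : jost_data q a b d c) (Hz : 0 < Im zeta).

Let e (x : R) : C := Cexp (RtoC 2 * Ci * zeta * RtoC x)%C.

(** Multiplication by [e] exchanges the exponential factored out of the right solution for the one
    factored out of [(a, b)], so that both solve the same system and can be compared through their
    values at [x = 0]. *)
Lemma right_solution : exists q' , (forall x, rd q x (q' x)) /\ contC (pot q q') /\
  jost_family q (pot q q') a b /\ jost_family (refl (pot q q')) (refl q) d c /\
  (forall x, rd (fun y => e y * c (- y)%R zeta)%C x (q x * (e x * d (- x)%R zeta))%C) /\
  (forall x, rd (fun y => e y * d (- y)%R zeta)%C x
     (RtoC 2 * Ci * zeta * (e x * d (- x)%R zeta) + pot q q' x * (e x * c (- x)%R zeta))%C).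
Proof.
  destruct J as [q' [D [J1 J2]]]; exists q'.
  assert (Hz0 : 0 <= Im zeta) by lra.
  destruct (right_jost q (pot q q') zeta _ _ (proj1 J2 zeta Hz0)) as [R1 R2].
  assert (De : forall x, rd e x (RtoC 2 * Ci * zeta * e x)%C) by (intros x; apply rd_Cexp).
  destruct (good_pot q q' Hq D) as [_ [Cp _]].
  split; [exact D|split; [exact Cp|split; [exact J1|split; [exact J2|split]]]]; intros x.
  - eapply rd_eq; [apply rd_mult; [apply De|apply R2]|cbv beta; ring].
  - eapply rd_eq; [apply rd_mult; [apply De|apply R1]|cbv beta; ring].
Qed.

Lemma e_0 : e 0 = 1.
Proof. unfold e; replace (RtoC 2 * Ci * zeta * RtoC 0)%C with (RtoC 0) by ring; apply Cexp_0. Qed.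

(** A solution vanishing at 0 vanishes identically, which contradicts the normalization of [d] at
    infinity. *)
Lemma right_nonzero : c 0 zeta <> 0 \/ d 0 zeta <> 0.
Proof.
  destruct (classic (c 0 zeta = 0)) as [Zc|]; [right|left; assumption]; intros Zd.
  destruct right_solution as [q' [D [Cp [J1 [J2 [R1 R2]]]]]].
  assert (Hz0 : 0 <= Im zeta) by lra.
  assert (Z := system_unique q (pot q q') zeta _ _ Hz0 (rd_contC _ _ D) Cp R1 R2
    ltac:(cbv beta; rewrite Ropp_0, Zc; ring) ltac:(cbv beta; rewrite Ropp_0, Zd; ring)).
  destruct (left_jost_tends _ _ _ _ _ (proj1 J2 zeta Hz0)) as [_ [_ [T _]]].
  assert (E : RtoC 0 = RtoC 1).
  { refine (tends_const_unique p_infty (fun x => d (- x) zeta) 0 1 _ T); intros x.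
    destruct (Z x) as [_ Q]; assert (NE := Cexp_neq_0 (RtoC 2 * Ci * zeta * RtoC x)%C); fold (e x) in NE.
    replace (d (- x) zeta) with (e x * d (- x)%R zeta / e x)%C by (field; exact NE); rewrite Q; field; exact NE. }
  apply (f_equal Re) in E; simpl in E; lra.
Qed.

(** Proportionality at [x = 0] extends to all [x] by uniqueness for the system; the division by
    [zeta] undoes the factor [lamk] in [is_B]. *)
Lemma Bconst_eq kappa : a 0 zeta = (kappa * c 0%R zeta)%C -> b 0 zeta = (kappa * d 0%R zeta)%C ->
  Bconst q zeta = (kappa / zeta)%C.
Proof.
  intros Ea Eb.
  assert (Hz0 : 0 <= Im zeta) by lra.
  assert (Nz : zeta <> 0) by (intros E; rewrite E in Hz; simpl in Hz; lra).
  destruct right_solution as [q' [D [Cp [J1 [J2 [R1 R2]]]]]].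
  destruct (proj1 J1 zeta Hz0) as [A1 [A2 _]].
  assert (Pr : forall x, a x zeta = (kappa * (e x * c (- x)%R zeta))%C /\ b x zeta = (kappa * (e x * d (- x)%R zeta))%C).
  { intros x.
    destruct (system_unique q (pot q q') zeta (fun x => a x zeta - kappa * (e x * c (- x)%R zeta))%C
      (fun x => b x zeta - kappa * (e x * d (- x)%R zeta))%C Hz0 (rd_contC _ _ D) Cp) with (x := x) as [Q1 Q2].
    - intros y; eapply rd_eq; [apply dv_minus; [apply A1|apply rd_mult; [apply dv_const|apply R1]]|cbv beta; ring].
    - intros y; eapply rd_eq; [apply dv_minus; [apply A2|apply rd_mult; [apply dv_const|apply R2]]|cbv beta; ring].
    - rewrite Ropp_0, Ea, e_0; ring.
    - rewrite Ropp_0, Eb, e_0; ring.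
    - cbv beta in Q1, Q2; split.
      + replace (a x zeta) with (a x zeta - kappa * (e x * c (- x)%R zeta) + kappa * (e x * c (- x)%R zeta))%C by ring.
        rewrite Q1; ring.
      + replace (b x zeta) with (b x zeta - kappa * (e x * d (- x)%R zeta) + kappa * (e x * d (- x)%R zeta))%C by ring.
        rewrite Q2; ring. }
  assert (NM := fun x => Nminus_eq q q' Hq D a b d c J1 J2 zeta x Hz0).
  assert (NP := fun x => Nplus_eq q q' Hq D a b d c J1 J2 zeta x Hz0).
  assert (IB : is_B q zeta (kappa / zeta)%C).
  { intros x i Hi; fold (e x); destruct (NM x) as [M0 M1]; destruct (NP x) as [P0 P1]; destruct (Pr x) as [E1 E2].
    destruct i as [|[|i]]; [| |lia].
    - rewrite M0, P0, E1; field; exact Nz.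
    - rewrite M1, P1, E1, E2; field; exact Nz. }
  assert (IB' : is_B q zeta (Bconst q zeta)).
  { apply (epsilon_spec (inhabits (RtoC 0)) (is_B q zeta)); eexists; exact IB. }
  (* The relation at [x = 0] alone determines the constant, since [c] and [d] do not both vanish
     there. *)
  assert (S0 := IB' 0 0%nat ltac:(lia)); assert (S1 := IB' 0 1%nat ltac:(lia)).
  rewrite (IB 0 0%nat ltac:(lia)) in S0; rewrite (IB 0 1%nat ltac:(lia)) in S1.
  fold (e 0) in S0, S1; rewrite e_0 in S0, S1.
  destruct (NP 0) as [P0 P1]; rewrite P0 in S0; rewrite P1 in S1; rewrite Ropp_0 in S0, S1.
  destruct (classic (c 0 zeta = 0)) as [Zc|Zc].
  - assert (Zd : d 0 zeta <> 0) by (destruct right_nonzero; tauto).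
    rewrite Zc in S1.
    replace (Bconst q zeta) with (Bconst q zeta * zeta * 1 * (gauge q 0 * 0 + d 0%R zeta) / (zeta * d 0%R zeta))%C by (field; auto).
    rewrite <- S1; field; auto.
  - replace (Bconst q zeta) with (Bconst q zeta * zeta * 1 * c 0%R zeta / (zeta * c 0%R zeta))%C by (field; auto).
    rewrite <- S0; field; auto.
Qed.

Hypothesis Za : alpha0 a b d c zeta = 0.

(** At a zero of the Wronskian the vectors [(a, b)] and [(c, d)] at [x = 0] are parallel, with ratio
    [b / d] or [a / c]. Both forms are kept because either denominator may vanish. *)
Lemma Bconst_formula : (d 0 zeta <> 0 -> Bconst q zeta = (b 0%R zeta / (zeta * d 0%R zeta))%C) /\
  (c 0 zeta <> 0 -> Bconst q zeta = (a 0%R zeta / (zeta * c 0%R zeta))%C).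
Proof.
  assert (Nz : zeta <> 0) by (intros E; rewrite E in Hz; simpl in Hz; lra).
  unfold alpha0 in Za.
  assert (E : (a 0%R zeta * d 0%R zeta)%C = (b 0%R zeta * c 0%R zeta)%C).
  { transitivity (a 0%R zeta * d 0%R zeta - b 0%R zeta * c 0%R zeta + b 0%R zeta * c 0%R zeta)%C; [ring|rewrite Za; ring]. }
  split; intros N.
  - rewrite (Bconst_eq (b 0%R zeta / d 0%R zeta)%C); [field; auto| |field; auto].
    transitivity (a 0%R zeta * d 0%R zeta / d 0%R zeta)%C; [field; auto|rewrite E; field; auto].
  - rewrite (Bconst_eq (a 0%R zeta / c 0%R zeta)%C); [field; auto|field; auto|].
    transitivity (b 0%R zeta * c 0%R zeta / c 0%R zeta)%C; [field; auto|rewrite <- E; field; auto].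
Qed.

End NormingConstant.

Lemma jost_data_regular q a b d c : jost_data q a b d c ->
  rel_cont (fun z => 0 <= Im z) (alpha0 a b d c) /\ holo (alpha0 a b d c) /\
  (holo (a 0) /\ holo (b 0) /\ holo (d 0) /\ holo (c 0)).
Proof.
  intros [q' [D [J1 J2]]].
  destruct (alpha0_regular q q' a b d c J1 J2) as [A B].
  destruct J1 as [_ [H1 _]], J2 as [_ [H2 _]].
  repeat split; auto; apply H1 || apply H2.
Qed.

Lemma jost_data_breve q a b d c : H22 q -> jost_data q a b d c ->
  (forall z, 0 <= Im z -> breve_alpha q z = alpha0 a b d c z) /\
  (forall z, 0 < Im z -> C_derive (breve_alpha q) z = C_derive (alpha0 a b d c) z).
Proof.
  intros H J; assert (R := jost_data_regular _ _ _ _ _ J); destruct R as [_ [Hh _]].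
  destruct J as [q' [D [J1 J2]]].
  assert (E := breve_alpha_eq q q' H D a b d c J1 J2).
  split; [exact E|]; intros z Hz.
  apply is_C_derive_unique, cd_is_derive.
  apply (cd_ext_loc (alpha0 a b d c)); [|apply holo_C_derive; assumption].
  exists (Im z); split; [exact Hz|]; intros w Hw; symmetry; apply E; left; apply (upper_open z); assumption.
Qed.

(** The quotient has the shape of [Bconst_formula]; the two functions and the point of evaluation
    all vary, each by an amount of order [r]. *)
Lemma ratio_lip (U0 V0 : C -> C) lam K T : holo U0 -> holo V0 -> 0 < Im lam -> V0 lam <> 0 -> 0 <= K -> 0 <= T ->
  exists del k, 0 < del /\ 0 <= k /\ forall (U V : C -> C) zeta r, 0 <= r -> r < del ->
    (forall z, 0 <= Im z -> Cmod (U z - U0 z) <= K * r /\ Cmod (V z - V0 z) <= K * r) ->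
    Cmod (zeta - lam) <= T * r ->
    V zeta <> 0 /\ Cmod (U zeta / (zeta * V zeta) - U0 lam / (lam * V0 lam))%C <= k * r.
Proof.
  intros HU HV Hl NV K0 T0.
  assert (Nl : lam <> 0) by (intros E; rewrite E in Hl; simpl in Hl; lra).
  destruct (holo_lip U0 lam HU Hl) as [L1 [d1 [L10 [D1 P1]]]].
  destruct (holo_lip V0 lam HV Hl) as [L2 [d2 [L20 [D2 P2]]]].
  assert (M1 := Cmod_ge_0 lam). assert (M2 := Cmod_ge_0 (V0 lam)).
  (* The summands account for the error of the numerator, that of [V] times a bound on [zeta], and
     that of [zeta] times [V0 lam]. *)
  set (k := (K + L1 * T) + (Cmod lam + 1) * (K + L2 * T) + T * Cmod (V0 lam)).
  assert (S1 : 0 <= L1 * T) by (apply Rmult_le_pos; lra).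
  assert (S2 : 0 <= L2 * T) by (apply Rmult_le_pos; lra).
  assert (S3 : 0 <= T * Cmod (V0 lam)) by (apply Rmult_le_pos; lra).
  assert (S4 : 0 <= (Cmod lam + 1) * (K + L2 * T)) by (apply Rmult_le_pos; lra).
  assert (k0 : 0 <= k) by (unfold k; lra).
  assert (N0 : (lam * V0 lam)%C <> 0) by (apply Cmult_neq_0; assumption).
  assert (Mv := proj1 (Cmod_gt_0 _) N0); set (v := Cmod (lam * V0 lam)) in *.
  set (c1 := Rmin (Rmin d1 d2) (Rmin (Im lam) 1)).
  assert (C1 : 0 < c1) by (repeat apply Rmin_pos; lra).
  assert (C2 : c1 <= d1 /\ c1 <= d2 /\ c1 <= Im lam /\ c1 <= 1).
  { unfold c1; generalize (Rmin_l (Rmin d1 d2) (Rmin (Im lam) 1)) (Rmin_r (Rmin d1 d2) (Rmin (Im lam) 1))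
      (Rmin_l d1 d2) (Rmin_r d1 d2) (Rmin_l (Im lam) 1) (Rmin_r (Im lam) 1); lra. }
  set (del := Rmin (c1 / (T + 1)) (v / (2 * (k + 1)))).
  exists del, (2 / v * (1 + Cmod (U0 lam / (lam * V0 lam))) * k).
  assert (Del : 0 < del) by (apply Rmin_pos; apply Rdiv_lt_0_compat; lra).
  split; [exact Del|split].
  { apply Rmult_le_pos; [|exact k0]; apply Rmult_le_pos; [left; apply Rdiv_lt_0_compat; lra|].
    generalize (Cmod_ge_0 (U0 lam / (lam * V0 lam))); lra. }
  intros U V zeta r r0 Hr HUV Hzeta.
  assert (Q1 : T * r < c1).
  { assert (E1 : r < c1 / (T + 1)) by (eapply Rlt_le_trans; [exact Hr|apply Rmin_l]).
    assert (E2 : (T + 1) * r < (T + 1) * (c1 / (T + 1))) by (apply Rmult_lt_compat_l; lra).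
    replace ((T + 1) * (c1 / (T + 1))) with c1 in E2 by (field; lra). lra. }
  assert (Q2 : k * r <= v / 2).
  { assert (E1 : r < v / (2 * (k + 1))) by (eapply Rlt_le_trans; [exact Hr|apply Rmin_r]).
    assert (E2 : (k + 1) * r <= (k + 1) * (v / (2 * (k + 1)))) by (apply Rmult_le_compat_l; lra).
    replace ((k + 1) * (v / (2 * (k + 1)))) with (v / 2) in E2 by (field; lra). lra. }
  assert (Uz : 0 <= Im zeta) by (left; apply (upper_open lam); lra).
  destruct (HUV zeta Uz) as [A1 A2].
  assert (B1 : Cmod (U zeta - U0 lam) <= (K + L1 * T) * r).
  { eapply Rle_trans; [apply (Cmod_le_via _ (U0 zeta))|].
    assert (X := P1 zeta ltac:(lra)). assert (L1 * Cmod (zeta - lam) <= L1 * (T * r)) by (apply Rmult_le_compat_l; lra). lra. }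
  assert (B2 : Cmod (V zeta - V0 lam) <= (K + L2 * T) * r).
  { eapply Rle_trans; [apply (Cmod_le_via _ (V0 zeta))|].
    assert (X := P2 zeta ltac:(lra)). assert (L2 * Cmod (zeta - lam) <= L2 * (T * r)) by (apply Rmult_le_compat_l; lra). lra. }
  assert (Rr : 0 <= (K + L2 * T) * r) by (apply Rmult_le_pos; lra).
  assert (B3 : Cmod (zeta * V zeta - lam * V0 lam) <= k * r).
  { replace (zeta * V zeta - lam * V0 lam)%C with (zeta * (V zeta - V0 lam) + (zeta - lam) * V0 lam)%C by ring.
    eapply Rle_trans; [apply Cmod_triangle|]; rewrite !Cmod_mult.
    assert (Zl : Cmod zeta <= Cmod lam + 1) by (generalize (Cmod_triangle_inv zeta lam); lra).
    assert (Cmod zeta * Cmod (V zeta - V0 lam) <= (Cmod lam + 1) * ((K + L2 * T) * r)).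
    { apply Rmult_le_compat; auto; apply Cmod_ge_0. }
    assert (Cmod (zeta - lam) * Cmod (V0 lam) <= T * r * Cmod (V0 lam)) by (apply Rmult_le_compat_r; lra).
    assert (0 <= (K + L1 * T) * r) by (apply Rmult_le_pos; lra). unfold k; lra. }
  assert (B4 : Cmod (U zeta - U0 lam) <= k * r).
  { eapply Rle_trans; [exact B1|]; apply Rmult_le_compat_r; [exact r0|unfold k; lra]. }
  destruct (quotient_lip (U zeta) (zeta * V zeta) (U0 lam) (lam * V0 lam) k r N0 Q2 B4 B3) as [W1 W2].
  split; [|exact W2].
  intros E; rewrite E, Cmult_0_r, Cmod_0 in W1; fold v in W1; lra.
Qed.

Theorem zero_perturbation q0 lam : H22 q0 -> simple_upper_zero q0 lam ->
  exists rho0, 0 < rho0 /\ rho0 <= Im lam / 2 /\ forall rho, 0 < rho -> rho <= rho0 ->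
  exists del K, 0 < del /\ 0 <= K /\ forall q, H22 q -> H22norm (fsub q q0) < del ->
    exists zeta, simple_upper_zero q zeta /\ Cmod (zeta - lam) < rho /\
      (forall z, upper_zero q z -> Cmod (z - lam) < rho -> z = zeta) /\
      Cmod (zeta - lam) <= K * H22norm (fsub q q0) /\
      Cmod (Bconst q zeta - Bconst q0 lam) <= K * H22norm (fsub q q0) /\
      Cmod (Cconst q zeta - Cconst q0 lam) <= K * H22norm (fsub q q0).
Proof.
  intros H0 [[Hl Hz0] Hs].
  destruct (jost_data_exists q0 H0) as [a0 [b0 [d0 [c0 J0]]]].
  destruct (jost_data_lip q0 a0 b0 d0 c0 H0 J0) as [K [K0 HK]].
  destruct (jost_data_regular q0 _ _ _ _ J0) as [_ [Hh [Ha [Hb [Hd Hc]]]]].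
  destruct (jost_data_breve q0 _ _ _ _ H0 J0) as [Br Bd].
  rewrite Br in Hz0 by lra; rewrite Bd in Hs by exact Hl.
  set (f0 := alpha0 a0 b0 d0 c0) in *.
  destruct (local_zero f0 lam Hh Hl Hz0 Hs) as [rho0 [R0 [R1 HR]]].
  exists rho0; split; [exact R0|split; [exact R1|]]; intros rho Hr Hr0.
  destruct (HR rho Hr Hr0) as [eta [K1 [Eta [K10 HE]]]].
  set (A := 4 * K * K).
  assert (A0 : 0 <= A) by (unfold A; repeat apply Rmult_le_pos; lra).
  assert (Alip : forall q a b d c, H22 q -> H22norm (fsub q q0) <= 1 -> jost_data q a b d c ->
     forall z, 0 <= Im z -> Cmod (alpha0 a b d c z - f0 z) <= A * H22norm (fsub q q0)).
  { intros q a b d c H HN J z Hz; destruct (HK q a b d c H HN J 0 z Hz) as [[X1 [X2 [X3 X4]]] [[_ [_ [X5 X6]]] [X7 [X8 _]]]].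
    apply alpha0_lip; assumption. }
  (* [A r] bounds the distance of the two Wronskians, and [K1] is the constant of [local_zero]; so
     [T r] bounds the displacement of the zero. *)
  set (T := K1 * A); assert (T0 : 0 <= T) by (unfold T; apply Rmult_le_pos; assumption).
  assert (BB : exists delB kB, 0 < delB /\ 0 <= kB /\ forall q a b d c zeta, H22 q -> H22norm (fsub q q0) <= 1 ->
     H22norm (fsub q q0) < delB -> jost_data q a b d c -> 0 < Im zeta -> alpha0 a b d c zeta = 0 ->
     Cmod (zeta - lam) <= T * H22norm (fsub q q0) ->
     Cmod (Bconst q zeta - Bconst q0 lam) <= kB * H22norm (fsub q q0)).
  (* The formula is chosen by a denominator that does not vanish for [q0] at [lam]; [ratio_lip]
     shows that it stays nonzero for nearby [q], so the same formula applies to both. *)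
  { destruct (Bconst_formula q0 a0 b0 d0 c0 lam H0 J0 Hl Hz0) as [F1 F2].
    destruct (right_nonzero q0 a0 b0 d0 c0 lam H0 J0 Hl) as [N|N].
    - destruct (ratio_lip (a0 0) (c0 0) lam K T Ha Hc Hl N K0 T0) as [del [k [Del [k0 P]]]].
      exists del, k; split; [exact Del|split; [exact k0|]]; intros q a b d c zeta H HN Hdel J Uz Zz Dz.
      destruct (P (a 0) (c 0) zeta (H22norm (fsub q q0)) ltac:(apply H22norm_pos, H22_fsub; assumption) Hdel) as [W1 W2]; [|exact Dz|].
      + intros z Hz; destruct (HK q a b d c H HN J 0 z Hz) as [[X1 [X2 [X3 X4]]] _]; split; assumption.
      + destruct (Bconst_formula q a b d c zeta H J Uz Zz) as [_ G2]; rewrite (G2 W1), (F2 N); exact W2.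
    - destruct (ratio_lip (b0 0) (d0 0) lam K T Hb Hd Hl N K0 T0) as [del [k [Del [k0 P]]]].
      exists del, k; split; [exact Del|split; [exact k0|]]; intros q a b d c zeta H HN Hdel J Uz Zz Dz.
      destruct (P (b 0) (d 0) zeta (H22norm (fsub q q0)) ltac:(apply H22norm_pos, H22_fsub; assumption) Hdel) as [W1 W2]; [|exact Dz|].
      + intros z Hz; destruct (HK q a b d c H HN J 0 z Hz) as [[X1 [X2 [X3 X4]]] _]; split; assumption.
      + destruct (Bconst_formula q a b d c zeta H J Uz Zz) as [G1 _]; rewrite (G1 W1), (F1 N); exact W2. }
  destruct BB as [delB [kB [DelB [kB0 HB]]]].
  set (m := C_derive f0 lam) in *.
  assert (M := proj1 (Cmod_gt_0 m) Hs).
  (* A common constant for the errors of numerator and denominator, as [quotient_lip] asks. *)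
  set (k := kB + T).
  set (kC := 2 / Cmod m * (1 + Cmod (Bconst q0 lam / m)) * k).
  assert (kC0 : 0 <= kC).
  { unfold kC, k; apply Rmult_le_pos; [|lra]; apply Rmult_le_pos; [left; apply Rdiv_lt_0_compat; lra|].
    generalize (Cmod_ge_0 (Bconst q0 lam / m)); lra. }
  set (del := Rmin (Rmin 1 (eta / (A + 1))) (Rmin delB (Cmod m / (2 * (k + 1))))).
  assert (k0 : 0 <= k) by (unfold k; lra).
  assert (Del : 0 < del) by (repeat apply Rmin_pos; try lra; apply Rdiv_lt_0_compat; lra).
  assert (De : del <= 1 /\ del <= eta / (A + 1) /\ del <= delB /\ del <= Cmod m / (2 * (k + 1))).
  { unfold del; generalize (Rmin_l (Rmin 1 (eta / (A + 1))) (Rmin delB (Cmod m / (2 * (k + 1)))))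
     (Rmin_r (Rmin 1 (eta / (A + 1))) (Rmin delB (Cmod m / (2 * (k + 1)))))
     (Rmin_l 1 (eta / (A + 1))) (Rmin_r 1 (eta / (A + 1)))
     (Rmin_l delB (Cmod m / (2 * (k + 1)))) (Rmin_r delB (Cmod m / (2 * (k + 1)))); lra. }
  exists del, (T + kB + kC); split; [exact Del|split; [lra|]].
  intros q H HN; set (r := H22norm (fsub q q0)) in *.
  assert (r0 : 0 <= r) by (apply H22norm_pos, H22_fsub; assumption).
  destruct (jost_data_exists q H) as [a [b [d [c J]]]].
  destruct (jost_data_breve q _ _ _ _ H J) as [Br' Bd'].
  destruct (jost_data_regular q _ _ _ _ J) as [_ [Hh' _]].
  assert (E1 : A * r <= eta).
  { assert (E2 : (A + 1) * r <= (A + 1) * (eta / (A + 1))) by (apply Rmult_le_compat_l; lra).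
    replace ((A + 1) * (eta / (A + 1))) with eta in E2 by (field; lra). lra. }
  destruct (HE (alpha0 a b d c) (A * r) Hh' E1) as [zeta [Q1 [Q2 [Q3 [Q4 [Q5 Q6]]]]]].
  { intros z Hz; apply (Alip q a b d c H ltac:(fold r; lra) J); lra. }
  assert (Q1' : Cmod (zeta - lam) <= T * r) by (unfold T; lra).
  assert (Uz : 0 < Im zeta) by (apply (upper_open lam); lra).
  assert (SZ : simple_upper_zero q zeta).
  { split; [split; [exact Uz|rewrite Br' by lra; exact Q3]|rewrite Bd' by exact Uz; exact Q4]. }
  assert (QB : Cmod (Bconst q zeta - Bconst q0 lam) <= kB * r).
  { apply (HB q a b d c); auto; fold r; lra. }
  assert (X1 : 0 <= T * r) by (apply Rmult_le_pos; assumption).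
  assert (X2 : 0 <= kB * r) by (apply Rmult_le_pos; assumption).
  assert (X3 : 0 <= kC * r) by (apply Rmult_le_pos; assumption).
  assert (QC : Cmod (Cconst q zeta - Cconst q0 lam) <= kC * r).
  { unfold Cconst; rewrite (Bd' zeta Uz), (Bd lam Hl); fold m.
    apply quotient_lip.
    - exact Hs.
    - assert (E2 : (k + 1) * r <= (k + 1) * (Cmod m / (2 * (k + 1)))) by (apply Rmult_le_compat_l; lra).
      replace ((k + 1) * (Cmod m / (2 * (k + 1)))) with (Cmod m / 2) in E2 by (field; lra). lra.
    - unfold k; lra.
    - unfold k, T in *; lra. }
  exists zeta; split; [exact SZ|split; [exact Q2|split; [|split; [|split]]]]; try lra.
  intros z [Hz Zz] Dz; apply Q6; [exact Dz|]; rewrite <- Br' by lra; exact Zz.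
Qed.

Lemma finite_min N (P : nat -> R -> Prop) : (forall j e e', 0 < e' -> e' <= e -> P j e -> P j e') ->
  (forall j, (j < N)%nat -> exists e, 0 < e /\ P j e) -> exists e, 0 < e /\ forall j, (j < N)%nat -> P j e.
Proof.
  intros Mono; induction N as [|N IH]; intros H.
  - exists 1; split; [lra|intros; lia].
  - destruct IH as [e1 [E1 P1]]; [intros; apply H; lia|]. destruct (H N ltac:(lia)) as [e2 [E2 P2]].
    assert (E0 := Rmin_pos _ _ E1 E2).
    exists (Rmin e1 e2); split; [exact E0|]; intros j Hj.
    destruct (Nat.eq_dec j N) as [E|E].
    + subst j; apply (Mono N e2); [exact E0|apply Rmin_r|exact P2].
    + apply (Mono j e1); [exact E0|apply Rmin_l|apply P1; lia].
Qed.

Lemma finite_max N (P : nat -> R -> Prop) : (forall j K K', K <= K' -> P j K -> P j K') ->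
  (forall j, (j < N)%nat -> exists K, P j K) -> exists K, forall j, (j < N)%nat -> P j K.
Proof.
  intros Mono; induction N as [|N IH]; intros H.
  - exists 0; intros; lia.
  - destruct IH as [e1 P1]; [intros; apply H; lia|]. destruct (H N ltac:(lia)) as [e2 P2].
    exists (Rmax e1 e2); intros j Hj.
    destruct (Nat.eq_dec j N) as [E|E].
    + subst j; apply (Mono N e2); [apply Rmax_r|exact P2].
    + apply (Mono j e1); [apply Rmax_l|apply P1; lia].
Qed.

(** Finitely many points have a positive minimal distance, and [lam 0] differs from its conjugate,
    so the infimum is over a nonempty set and is a real number. *)
Lemma d_Lambda_pos N lam : (0 < N)%nat -> (forall j, (j < N)%nat -> 0 < Im (lam j)) ->
  0 < d_Lambda N lam /\
  forall i j, (i < N)%nat -> (j < N)%nat -> lam i <> lam j -> d_Lambda N lam <= Cmod (lam i - lam j).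
Proof.
  intros HN Hlam; unfold d_Lambda.
  set (S := fun r => exists z w, in_Lambda N lam z /\ in_Lambda N lam w /\ z <> w /\ r = Cmod (z - w)%C).
  assert (Sep : exists e, 0 < e /\ forall r, S r -> e <= r).
  { assert (Far : forall z w : C, exists e, 0 < e /\ (z <> w -> e <= Cmod (z - w))).
    { intros z w; destruct (classic (z = w)) as [E|E]; [exists 1; split; [lra|tauto]|].
      exists (Cmod (z - w)); split; [|intros _; lra].
      apply Cmod_gt_0; intros Q; apply E; replace z with (z - w + w)%C by ring; rewrite Q; ring. }
    destruct (finite_min N (fun i e => forall j, (j < N)%nat -> forall z w, (z = lam i \/ z = Cconj (lam i)) ->
       (w = lam j \/ w = Cconj (lam j)) -> z <> w -> e <= Cmod (z - w))) as [e [He P]].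
    - intros i e e' _ Le Q j Hj z w Hz Hw Nzw; specialize (Q j Hj z w Hz Hw Nzw); lra.
    - intros i Hi.
      destruct (finite_min N (fun j e => forall z w, (z = lam i \/ z = Cconj (lam i)) ->
       (w = lam j \/ w = Cconj (lam j)) -> z <> w -> e <= Cmod (z - w))) as [e [He P]].
      + intros j e e' _ Le Q z w Hz Hw Nzw; specialize (Q z w Hz Hw Nzw); lra.
      + intros j Hj.
        destruct (Far (lam i) (lam j)) as [e1 [E1 P1]]; destruct (Far (lam i) (Cconj (lam j))) as [e2 [E2 P2]].
        destruct (Far (Cconj (lam i)) (lam j)) as [e3 [E3 P3]]; destruct (Far (Cconj (lam i)) (Cconj (lam j))) as [e4 [E4 P4]].
        exists (Rmin (Rmin e1 e2) (Rmin e3 e4)); split; [repeat apply Rmin_pos; assumption|].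
        generalize (Rmin_l (Rmin e1 e2) (Rmin e3 e4)) (Rmin_r (Rmin e1 e2) (Rmin e3 e4)) (Rmin_l e1 e2) (Rmin_r e1 e2)
          (Rmin_l e3 e4) (Rmin_r e3 e4); intros M1 M2 M3 M4 M5 M6.
        intros z w [Hz|Hz] [Hw|Hw] Nzw; subst z w.
        * specialize (P1 Nzw); lra.
        * specialize (P2 Nzw); lra.
        * specialize (P3 Nzw); lra.
        * specialize (P4 Nzw); lra.
      + exists e; split; [exact He|exact P].
    - exists e; split; [exact He|]; intros r [z [w [[i [Hi Hz]] [[j [Hj Hw]] [Nzw E]]]]]; subst r.
      apply (P i Hi j Hj); assumption. }
  destruct Sep as [e [He HS]].
  assert (Ne : S (Cmod (lam 0%nat - Cconj (lam 0%nat)))).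
  { exists (lam 0%nat), (Cconj (lam 0%nat)); split; [exists 0%nat; auto|split; [exists 0%nat; auto|split; [|reflexivity]]].
    intros E; apply (f_equal Im) in E; rewrite im_conj in E; specialize (Hlam 0%nat HN); lra. }
  destruct (Glb_Rbar_correct S) as [Lb Gb].
  assert (G1 := Gb (Finite e) ltac:(intros r Hr; apply HS, Hr)).
  assert (G2 := Lb _ Ne).
  destruct (Glb_Rbar S) as [g| |]; simpl in G1, G2; try contradiction.
  simpl; split; [lra|]; intros i j Hi Hj Nij.
  apply (Lb (Cmod (lam i - lam j))); exists (lam i), (lam j).
  split; [exists i; auto|split; [exists j; auto|split; [exact Nij|reflexivity]]].
Qed.

Theorem proposition3p11 :
  forall (q0 : R -> C) (N : nat) (lam0 : nat -> C),
  Uset q0 ->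
  lists_zeros q0 N lam0 ->
  ordered N lam0 ->
  exists (V : (R -> C) -> Prop) (lam : (R -> C) -> nat -> C),
    H22_neighborhood q0 V
    (* lam q is the ordered list of the zeros of q, except that the relative order
       of two zeros is left free when they come from zeros of q0 of equal modulus
       (an arbitrarily small change of q0 can reverse the order of those) *)
    /\ (forall q, V q -> lists_zeros q N (lam q) /\
          forall i j, (i < j)%nat -> (j < N)%nat ->
            Cmod (lam0 i) <> Cmod (lam0 j) -> precedes (lam q i) (lam q j))
    (* (i) *)
    /\ (forall q, V q ->
          (forall z, upper_zero q z -> simple_upper_zero q z)
          /\ no_real_zero q
          /\ forall j, (j < N)%nat ->
               Cmod (lam q j - lam0 j)%C <= / 4 * d_Lambda N lam0)
    (* (ii) *)
    /\ (exists K : R, forall q, V q -> forall j, (j < N)%nat ->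
          Cmod (lam q j - lam0 j)%C <= K * H22norm (fsub q q0))
    (* (iii) *)
    /\ (exists K : R, forall q, V q -> forall j, (j < N)%nat ->
          Cmod (Bconst q (lam q j) - Bconst q0 (lam0 j))%C
            <= K * H22norm (fsub q q0))
    (* (iv) *)
    /\ (exists K : R, forall q, V q -> forall j, (j < N)%nat ->
          Cmod (Cconst q (lam q j) - Cconst q0 (lam0 j))%C
            <= K * H22norm (fsub q q0)).

Proof.
  intros q0 N lam0 [H0 [NR [_ Simple]]] [L1 [L2 L3]] Ord.
  destruct (jost_data_exists q0 H0) as [a0 [b0 [d0 [c0 J0]]]].
  destruct (jost_data_lip q0 a0 b0 d0 c0 H0 J0) as [K [K0 HK]].
  destruct (jost_data_regular q0 _ _ _ _ J0) as [Cf [Hh _]].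
  destruct (jost_data_breve q0 _ _ _ _ H0 J0) as [Br _].
  set (f0 := alpha0 a0 b0 d0 c0) in *.
  (* A quarter of [d_Lambda] makes the discs about the zeros disjoint. For [N = 0], where [d_Lambda]
     is 0, any positive value will do. *)
  assert (Sep : exists r1, 0 < r1 /\ (forall i j, (i < N)%nat -> (j < N)%nat -> i <> j -> 2 * r1 <= Cmod (lam0 i - lam0 j)) /\
     (forall j, (j < N)%nat -> r1 <= / 4 * d_Lambda N lam0)).
  { destruct (Nat.eq_dec N 0) as [E|E].
    - exists 1; split; [lra|split; intros; lia].
    - destruct (d_Lambda_pos N lam0) as [D1 D2]; [lia|intros j Hj; apply (L1 j Hj)|].
      exists (/ 4 * d_Lambda N lam0); split; [lra|split; [|intros; lra]].
      intros i j Hi Hj Nij; assert (Q := D2 i j Hi Hj ltac:(intros E'; apply Nij, L2; assumption)); lra. }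
  destruct Sep as [r1 [R1 [Sep1 Sep2]]].
  (* [r2] is at most half of every positive gap between moduli, so that strict inequalities between
     them persist. *)
  destruct (finite_min N (fun j e => forall i, (i < N)%nat -> Cmod (lam0 i) < Cmod (lam0 j) -> 2 * e <= Cmod (lam0 j) - Cmod (lam0 i)))
    as [r2 [R2 Sep3]].
  { intros j e e' _ Le Q i Hi Hij; specialize (Q i Hi Hij); lra. }
  { intros j Hj; destruct (finite_min N (fun i e => Cmod (lam0 i) < Cmod (lam0 j) -> 2 * e <= Cmod (lam0 j) - Cmod (lam0 i))) as [e [He P]].
    - intros i e e' _ Le Q Hij; specialize (Q Hij); lra.
    - intros i Hi; destruct (Rlt_dec (Cmod (lam0 i)) (Cmod (lam0 j))) as [Q|Q].
      + exists ((Cmod (lam0 j) - Cmod (lam0 i)) / 2); split; [lra|intros; lra].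
      + exists 1; split; [lra|tauto].
    - exists e; split; [exact He|exact P]. }
  pose (Near := fun (j : nat) (rho K : R) (q : R -> C) (zeta : C) =>
      simple_upper_zero q zeta /\ Cmod (zeta - lam0 j) < rho /\
      (forall z, upper_zero q z -> Cmod (z - lam0 j) < rho -> z = zeta) /\
      Cmod (zeta - lam0 j) <= K * H22norm (fsub q q0) /\
      Cmod (Bconst q zeta - Bconst q0 (lam0 j)) <= K * H22norm (fsub q q0) /\
      Cmod (Cconst q zeta - Cconst q0 (lam0 j)) <= K * H22norm (fsub q q0)).
  (* The radius must be settled before the neighborhood and the constants, because these depend on
     it. *)
  destruct (finite_min N (fun j e => e <= Im (lam0 j) / 2 /\ forall rho, 0 < rho -> rho <= e ->
     exists del K, 0 < del /\ forall q, H22 q -> H22norm (fsub q q0) < del -> exists zeta, Near j rho K q zeta)) as [r3 [R3 Loc]].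
  { intros j e e' _ Le [Q1 Q2]; split; [lra|]; intros rho Hr Hle; apply Q2; lra. }
  { intros j Hj; destruct (zero_perturbation q0 (lam0 j) H0 (Simple _ (L1 j Hj))) as [e [He [Q1 Q2]]].
    exists e; split; [exact He|split; [exact Q1|]]; intros rho Hr Hle; destruct (Q2 rho Hr Hle) as [del [Kj [Del [_ P]]]].
    exists del, Kj; split; [exact Del|exact P]. }
  set (rho := Rmin r1 (Rmin r2 r3)).
  assert (Rho : 0 < rho) by (repeat apply Rmin_pos; assumption).
  assert (Rho1 : rho <= r1) by apply Rmin_l.
  assert (Rho2 : rho <= r2) by (eapply Rle_trans; [apply Rmin_r|apply Rmin_l]).
  assert (Rho3 : rho <= r3) by (eapply Rle_trans; [apply Rmin_r|apply Rmin_r]).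
  destruct (finite_min N (fun j del => exists K, forall q, H22 q -> H22norm (fsub q q0) < del -> exists zeta, Near j rho K q zeta))
    as [del1 [Del1 P1]].
  { intros j e e' _ Le [K1 Q]; exists K1; intros q H Hq; apply Q; [exact H|lra]. }
  { intros j Hj; destruct (Loc j Hj) as [_ Q]; destruct (Q rho Rho Rho3) as [del [K1 [Del P]]].
    exists del; split; [exact Del|exists K1; exact P]. }
  destruct (finite_max N (fun j K => forall q, H22 q -> H22norm (fsub q q0) < del1 -> exists zeta, Near j rho K q zeta)) as [KK P2].
  { intros j K1 K2 Le Q q H Hq; destruct (Q q H Hq) as [zeta [Z1 [Z2 [Z3 [Z4 [Z5 Z6]]]]]].
    assert (K1 * H22norm (fsub q q0) <= K2 * H22norm (fsub q q0)).
    { apply Rmult_le_compat_r; [apply H22norm_pos, H22_fsub; assumption|exact Le]. }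
    exists zeta; repeat split; try apply Z1; try assumption; lra. }
  { exact P1. }
  destruct (zero_free_bound f0 N lam0 rho Cf (alpha0_infinity _ _ _ _ _ J0)) as [m [Hm Free]]; [|exact Rho|].
  { intros z Hz E; rewrite <- Br in E by exact Hz.
    destruct Hz as [Hz|Hz]; [apply L3; split; assumption|].
    exfalso; apply (NR (Re z)); replace (RtoC (Re z)) with z; [exact E|apply C_ext; [reflexivity|rewrite <- Hz; reflexivity]]. }
  set (A := 4 * K * K).
  assert (A0 : 0 <= A) by (unfold A; repeat apply Rmult_le_pos; lra).
  set (del := Rmin del1 (Rmin 1 (m / (A + 1)))).
  assert (Del : 0 < del) by (repeat apply Rmin_pos; try lra; apply Rdiv_lt_0_compat; lra).
  assert (D1 : del <= del1) by apply Rmin_l.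
  assert (D2 : del <= 1) by (eapply Rle_trans; [apply Rmin_r|apply Rmin_l]).
  assert (D3 : del <= m / (A + 1)) by (eapply Rle_trans; [apply Rmin_r|apply Rmin_r]).
  pose (V := fun q => H22 q /\ H22norm (fsub q q0) < del).
  (* The label [j] goes to the zero of [q] in the disc about [lam0 j]; outside [V] and for [j >= N]
     the value does not matter. *)
  pose (lam := fun q j => epsilon (inhabits (RtoC 0)) (Near j rho KK q)).
  assert (HL : forall q, V q -> forall j, (j < N)%nat -> Near j rho KK q (lam q j)).
  { intros q [H Hq] j Hj; apply (epsilon_spec (inhabits (RtoC 0)) (Near j rho KK q)); apply P2; [exact Hj|exact H|lra]. }
  (* Outside the discs [|f0| >= m], while the perturbation is at most [A r < m]; this holds on the
     real axis too. *)
  assert (Zfree : forall q z, V q -> 0 <= Im z -> breve_alpha q z = 0 -> exists j, (j < N)%nat /\ Cmod (z - lam0 j) < rho).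
  { intros q z [H Hq] Hz E; apply NNPP; intros Nj.
    destruct (jost_data_exists q H) as [a [b [d [c J]]]].
    destruct (jost_data_breve q _ _ _ _ H J) as [Br' _]; rewrite Br' in E by exact Hz.
    destruct (HK q a b d c H ltac:(lra) J 0 z Hz) as [[X1 [X2 [X3 X4]]] [[_ [_ [X5 X6]]] [X7 [X8 _]]]].
    assert (Al := alpha0_lip a b d c a0 b0 d0 c0 z K _ K0 X1 X2 X3 X4 X5 X6 X7 X8); fold A f0 in Al.
    assert (F := Free z Hz ltac:(intros j Hj; apply Rnot_lt_le; intros Lj; apply Nj; exists j; auto)).
    rewrite E in Al; replace (0 - f0 z)%C with (- f0 z)%C in Al by ring; rewrite Cmod_opp in Al.
    set (r := H22norm (fsub q q0)) in *.
    assert (r0 : 0 <= r) by (apply H22norm_pos, H22_fsub; assumption).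
    assert (E2 : (A + 1) * r < (A + 1) * (m / (A + 1))) by (apply Rmult_lt_compat_l; lra).
    replace ((A + 1) * (m / (A + 1))) with m in E2 by (field; lra). lra. }
  exists V, lam.
  split; [|split; [|split; [|split; [|split]]]].
  - split; [intros q [H _]; exact H|]. exists del; split; [exact Del|]; intros q H Hq; split; assumption.
  - intros q Vq; split; [split; [|split]|].
    + intros j Hj; apply (HL q Vq j Hj).
    (* The discs about different zeros of [q0] are disjoint. *)
    + intros i j Hi Hj E; destruct (Nat.eq_dec i j) as [Q|Q]; [exact Q|exfalso].
      destruct (HL q Vq i Hi) as [_ [A1 _]]; destruct (HL q Vq j Hj) as [_ [A2 _]].
      generalize (Sep1 i j Hi Hj Q) (Cmod_le_via (lam0 i) (lam q i) (lam0 j)).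
      rewrite (Cmod_minus_sym (lam0 i) (lam q i)), E in *; lra.
    + intros z Hz; destruct (Zfree q z Vq ltac:(destruct Hz; lra) (proj2 Hz)) as [j [Hj Dj]].
      exists j; split; [exact Hj|]; destruct (HL q Vq j Hj) as [_ [_ [U _]]]; apply U; assumption.
    (* Each modulus changes by less than [rho], and [2 rho] does not exceed the gap between the
       two. *)
    + intros i j Hij Hj Ne.
      assert (Hi : (i < N)%nat) by lia.
      assert (Lt : Cmod (lam0 i) < Cmod (lam0 j)) by (destruct (Ord i j Hij Hj) as [Q|[Q _]]; [exact Q|contradiction]).
      left; generalize (Sep3 j Hj i Hi Lt).
      destruct (HL q Vq i Hi) as [_ [A1 _]]; destruct (HL q Vq j Hj) as [_ [A2 _]].
      generalize (Cmod_triangle_inv (lam q i) (lam0 i)) (Cmod_triangle_inv (lam0 j) (lam q j)).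
      rewrite (Cmod_minus_sym (lam0 j) (lam q j)); lra.
  - intros q Vq; split; [|split].
    + intros z Hz; destruct (Zfree q z Vq ltac:(destruct Hz; lra) (proj2 Hz)) as [j [Hj Dj]].
      destruct (HL q Vq j Hj) as [S [_ [U _]]]; rewrite (U z Hz Dj); exact S.
    (* The radius is at most half the height of every centre, so the discs miss the real axis. *)
    + intros l E; destruct (Zfree q (RtoC l) Vq ltac:(simpl; lra) E) as [j [Hj Dj]].
      destruct (Loc j Hj) as [Lj _]; generalize (im_le_Cmod (RtoC l - lam0 j)).
      rewrite Im_Cminus; simpl; rewrite Rminus_0_l, Rabs_Ropp; destruct (L1 j Hj) as [Pj _].
      rewrite Rabs_pos_eq by lra; lra.
    + intros j Hj; destruct (HL q Vq j Hj) as [_ [A1 _]]; specialize (Sep2 j Hj); lra.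
  - exists KK; intros q Vq j Hj; apply (HL q Vq j Hj).
  - exists KK; intros q Vq j Hj; apply (HL q Vq j Hj).
  - exists KK; intros q Vq j Hj; apply (HL q Vq j Hj).
Qed.
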